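(* Let $k$ be an algebraically closed field of characteristic $0$, let $p,q$ be prime numbers with $p^4<q$, and let $H$ be a semisimple Hopf algebra over $k$ of dimension $p^2q^2$. If $|G(H^* )|=p$ or $|G(H^* )|=pq$, then $H$ is upper semisolvable.
   Context: $G(H^* )$ is the group of group-like elements of the dual Hopf algebra $H^*$. A Hopf algebra is called trivial if it is isomorphic to a group algebra or to the dual of a group algebra (of a finite group). For a Hopf algebra map $\pi:H\to B$ put $H^{co\pi}=\{h\in H: (\mathrm{id}\otimes\pi)\Delta(h)=h\otimes 1\}$ and ${}^{co\pi}H=\{h\in H:(\pi\otimes \mathrm{id})\Delta(h)=1\otimes h\}$; $\pi$ is called normal if $H^{co\pi}={}^{co\pi}H$ (equivalently $H^{co\pi}$ is a Hopf subalgebra of $H$). A finite-dimensional Hopf algebra $H$ is upper semisolvable if there is a chain of quotient Hopf algebras $H_{(0)}=H\xrightarrow{\pi_1}H_{(1)}\xrightarrow{\pi_2}\cdots\xrightarrow{\pi_n}H_{(n)}=k$ with each $\pi_i$ normal and all $H_{(i-1)}^{co\pi_i}$ trivial. *)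

(* Defs.v *)
From HB Require Import structures.
From mathcomp Require Import all_boot all_fingroup all_algebra all_field.

Set Implicit Arguments.
Unset Strict Implicit.
Unset Printing Implicit Defensive.

Import GRing.Theory.
Local Open Scope ring_scope.

Reserved Notation "v \ox w" (at level 40, left associativity).

(* V (x) W in coordinates on (basis of V) x (basis of W); the bases are       *)
(* immaterial by the universal property [tlift_ox] and [tensor_eq].           *)
Definition tensor (k : fieldType) (V W : vectType k) : Type :=
  'M[k]_(\dim {:V}, \dim {:W}).

HB.instance Definition _ (k : fieldType) (V W : vectType k) :=
  Vector.copy (tensor V W) 'M[k]_(\dim {:V}, \dim {:W}).

HB.lock Definition ox (k : fieldType) (V W : vectType k) (v : V) (w : W) :
    tensor V W :=
  \matrix_(i, j) (coord (vbasis {:V}) i v * coord (vbasis {:W}) j w).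

(* The linear map on V (x) W induced by a bilinear map beta. *)
HB.lock Definition tlift (k : fieldType) (V W : vectType k) (X : lmodType k)
    (beta : V -> W -> X) (t : tensor V W) : X :=
  \sum_i \sum_j (t : 'M_(_, _)) i j *: beta (vbasis {:V})`_i (vbasis {:W})`_j.

Notation "v \ox w" := (ox v w) : ring_scope.

Definition bilinear_map (k : fieldType) (V W : vectType k) (X : lmodType k)
    (beta : V -> W -> X) : Prop :=
  (forall v, linear (beta v)) /\ (forall w, linear (beta^~ w)).

Section TensorTheory.
Variables (k : fieldType) (V W : vectType k).

Lemma ox_bilinear : bilinear_map (@ox k V W).
Proof.
split=> [v | w] a x y; apply/matrixP => i j; rewrite ox.unlock !mxE !linearD !linearZ /=.
  by rewrite mulrDr mulrCA.
by rewrite mulrDl mulrA.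
Qed.

Section Lift.
Variables (X : lmodType k) (beta : V -> W -> X).

Fact tlift_is_linear : linear (tlift beta).
Proof.
move=> a s t; rewrite !tlift.unlock scaler_sumr -big_split; apply: eq_bigr => i _ /=.
rewrite scaler_sumr -big_split; apply: eq_bigr => j _ /=.
by rewrite !mxE scalerDl scalerA.
Qed.
HB.instance Definition _ :=
  GRing.isLinear.Build k (tensor V W) X _ (tlift beta) tlift_is_linear.

Hypothesis beta_bilin : bilinear_map beta.

Lemma tlift_ox v w : tlift beta (v \ox w) = beta v w.
Proof.
have [beta_r beta_l] := beta_bilin.
pose br v' : {linear W -> X} := HB.pack (beta v')
  (GRing.isLinear.Build _ _ _ _ (beta v') (beta_r v')).
pose bl w' : {linear V -> X} := HB.pack (beta^~ w')
  (GRing.isLinear.Build _ _ _ _ (beta^~ w') (beta_l w')).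
have El : beta v w =
    \sum_i coord (vbasis {:V}) i v *: beta (vbasis {:V})`_i w.
  rewrite -[LHS]/(bl w v) {1}(coord_vbasis (memvf v)) linear_sum.
  by apply: eq_bigr => i _; rewrite linearZ_LR.
rewrite El tlift.unlock; apply: eq_bigr => i _.
have Er u : beta u w =
    \sum_j coord (vbasis {:W}) j w *: beta u (vbasis {:W})`_j.
  rewrite -[LHS]/(br u w) {1}(coord_vbasis (memvf w)) linear_sum.
  by apply: eq_bigr => j _; rewrite linearZ_LR.
rewrite Er scaler_sumr; apply: eq_bigr => j _.
by rewrite ox.unlock mxE scalerA.
Qed.

End Lift.

Lemma tensor_expand (t : tensor V W) : t = tlift (@ox k V W) t.
Proof.
apply/matrixP => i j; rewrite !tlift.unlock ox.unlock summxE.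
rewrite (bigD1 i) //= summxE (bigD1 j) //= !mxE.
rewrite !coord_free ?(basis_free (vbasisP _)) // !eqxx !mulr1.
rewrite big1 ?addr0 => [|j' /negPf j'j].
  rewrite big1 ?addr0 // => i' /negPf i'i.
  rewrite summxE big1 // => j' _; rewrite !mxE !coord_free ?(basis_free (vbasisP _)) //.
  by rewrite i'i mul0r mulr0.
rewrite !mxE !coord_free ?(basis_free (vbasisP _)) //.
by rewrite j'j !mulr0.
Qed.

Lemma tensor_ind (P : tensor V W -> Prop) :
    (forall a s t, P s -> P t -> P (a *: s + t)) ->
    (forall v w, P (v \ox w)) ->
  forall t, P t.
Proof.
move=> PD Pox t.
have P0 : P 0.
  by rewrite -(addNr (0 \ox 0)) -scaleN1r; apply: PD.
rewrite [t]tensor_expand !tlift.unlock.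
apply: (big_rec P) => // i x _ Px; rewrite -[\sum_j _]scale1r.
by apply: (PD) => //; apply: (big_rec P) => // j y _ Py; apply: PD.
Qed.

Lemma tensor_eq (X : lmodType k) (f g : {linear tensor V W -> X}) :
  (forall v w, f (v \ox w) = g (v \ox w)) -> f =1 g.
Proof.
by move=> fg; elim/tensor_ind => // a s t es et; rewrite !linearP es et.
Qed.

End TensorTheory.

Section TensorMaps.
Variable k : fieldType.

Definition tmap (V W V' W' : vectType k) (f : V -> V') (g : W -> W') :
    tensor V W -> tensor V' W' :=
  tlift (fun v w => f v \ox g w).

Definition tassoc (U V W : vectType k) :
    tensor (tensor U V) W -> tensor U (tensor V W) :=
  tlift (fun t w => tlift (fun u v => u \ox (v \ox w)) t).

HB.instance Definition _ (V W V' W' : vectType k) (f : V -> V') (g : W -> W') :=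
  GRing.Linear.on (tmap f g).
HB.instance Definition _ (U V W : vectType k) := GRing.Linear.on (@tassoc U V W).

Lemma oxPl (V W : vectType k) c (x y : V) (w : W) :
  (c *: x + y) \ox w = c *: (x \ox w) + y \ox w.
Proof. exact: (ox_bilinear V W).2. Qed.

Lemma oxPr (V W : vectType k) c (v : V) (x y : W) :
  v \ox (c *: x + y) = c *: (v \ox x) + v \ox y.
Proof. exact: (ox_bilinear V W).1. Qed.

Lemma tlift_param (V W : vectType k) (X : lmodType k)
    (b b1 b2 : V -> W -> X) c t :
    (forall v w, b v w = c *: b1 v w + b2 v w) ->
  tlift b t = c *: tlift b1 t + tlift b2 t.
Proof.
move=> bE; rewrite !tlift.unlock scaler_sumr -big_split; apply: eq_bigr => i _ /=.
rewrite scaler_sumr -big_split; apply: eq_bigr => j _ /=.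
by rewrite bE scalerDr !scalerA mulrC.
Qed.

Lemma eq_tlift (V W : vectType k) (X : lmodType k) (b1 b2 : V -> W -> X) :
  (forall v w, b1 v w = b2 v w) -> tlift b1 =1 tlift b2.
Proof.
move=> e t; rewrite !tlift.unlock.
by apply: eq_bigr => i _; apply: eq_bigr => j _; rewrite e.
Qed.

Lemma linear_tlift (V W : vectType k) (X Y : lmodType k)
    (h : {linear X -> Y}) (b : V -> W -> X) t :
  h (tlift b t) = tlift (fun v w => h (b v w)) t.
Proof.
rewrite !tlift.unlock linear_sum; apply: eq_bigr => i _.
by rewrite linear_sum; apply: eq_bigr => j _; rewrite linearZ_LR.
Qed.

Lemma tlift_tmap (V W V' W' : vectType k) (X : lmodType k)
    (f : {linear V -> V'}) (g : {linear W -> W'}) (b : V' -> W' -> X) t :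
    bilinear_map b ->
  tlift b (tmap f g t) = tlift (fun v w => b (f v) (g w)) t.
Proof.
move=> bb; rewrite (linear_tlift (tlift b)).
by apply: eq_tlift => v w; apply: tlift_ox.
Qed.

Lemma tmap_ox (V W V' W' : vectType k)
    (f : {linear V -> V'}) (g : {linear W -> W'}) v w :
  tmap f g (v \ox w) = f v \ox g w.
Proof.
by rewrite /tmap tlift_ox //; split=> ? ? ? ?; rewrite linearP ?oxPl ?oxPr.
Qed.

Lemma tassoc_bilin (U V W : vectType k) :
  bilinear_map (fun t (w : W) => tlift (fun (u : U) (v : V) => u \ox (v \ox w)) t).
Proof.
split=> [t c x y | w c x y]; last exact: linearP.
by apply: tlift_param => u v; rewrite !oxPr.
Qed.

Lemma tassoc_ox (U V W : vectType k) (u : U) (v : V) (w : W) :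
  tassoc ((u \ox v) \ox w) = u \ox (v \ox w).
Proof.
rewrite /tassoc tlift_ox; last exact: tassoc_bilin.
by rewrite tlift_ox //; split=> ? ? ? ?; rewrite ?oxPl ?oxPr ?oxPl.
Qed.

Lemma tlift_tassoc (U V W : vectType k) (X : lmodType k)
    (b : U -> tensor V W -> X) T :
    bilinear_map b ->
  tlift b (tassoc T) =
  tlift (fun t w => tlift (fun u v => b u (v \ox w)) t) T.
Proof.
move=> bb; rewrite (linear_tlift (tlift b)); apply: eq_tlift => t w.
rewrite (linear_tlift (tlift b)); apply: eq_tlift => u v.
exact: tlift_ox.
Qed.

Lemma ox_neq0 (V W : vectType k) (v : V) (w : W) :
  v != 0 -> w != 0 -> v \ox w != 0.
Proof.
move=> v0; apply: contraNneq => vw0; apply/eqP.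
have [i vi] : exists i, coord (vbasis {:V}) i v != 0.
  apply/existsP; apply: contraNT v0; rewrite negb_exists => /forallP v0.
  rewrite (coord_vbasis (memvf v)) big1 // => i _.
  by rewrite (eqP (negbNE (v0 i))) scale0r.
pose b (v' : V) (w' : W) := coord (vbasis {:V}) i v' *: w'.
have bb : bilinear_map b.
  split=> [v' c x y | w' c x y]; rewrite /b.
    by rewrite scalerDr !scalerA mulrC.
  by rewrite linearP /= scalerDl scalerA.
move: (tlift_ox bb v w); rewrite vw0 linear0 /b => /esym/eqP.
by rewrite scaler_eq0 (negPf vi) => /eqP.
Qed.

Section TensorAlgebra.
Variables A B : falgType k.

Definition tmul (s t : tensor A B) : tensor A B :=
  tlift (fun a b => tlift (fun c d => (a * c) \ox (b * d)) t) s.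

Fact tmulPr s c x y : tmul s (c *: x + y) = c *: tmul s x + tmul s y.
Proof. by apply: tlift_param => a b; rewrite linearP. Qed.

Fact tmulPl t c x y : tmul (c *: x + y) t = c *: tmul x t + tmul y t.
Proof. exact: linearP. Qed.

Fact tmul_ox a b c d : tmul (a \ox b) (c \ox d) = (a * c) \ox (b * d).
Proof.
rewrite /tmul tlift_ox; last first.
  by split=> ? ? ? ?; apply: tlift_param => ? ?;
    rewrite mulrDl -scalerAl ?oxPl ?oxPr.
by rewrite tlift_ox //; split=> ? ? ? ?; rewrite mulrDr -scalerAr ?oxPl ?oxPr.
Qed.

Fact tmulA : associative tmul.
Proof.
move=> s t u.
elim/tensor_ind: s => [c s1 s2 e1 e2|a b]; first by rewrite !tmulPl e1 e2.
elim/tensor_ind: t => [c s1 s2 e1 e2|a' b'].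
  by rewrite !(tmulPl, tmulPr) e1 e2.
elim/tensor_ind: u => [c s1 s2 e1 e2|a'' b'']; first by rewrite !tmulPr e1 e2.
by rewrite !tmul_ox !mulrA.
Qed.

Fact tmul1l : left_id (1 \ox 1) tmul.
Proof.
elim/tensor_ind => [c s1 s2 e1 e2|a b]; first by rewrite tmulPr e1 e2.
by rewrite tmul_ox !mul1r.
Qed.

Fact tmul1r : right_id (1 \ox 1) tmul.
Proof.
elim/tensor_ind => [c s1 s2 e1 e2|a b]; first by rewrite tmulPl e1 e2.
by rewrite tmul_ox !mulr1.
Qed.

Fact tmulDl : left_distributive tmul +%R.
Proof. by move=> x y t; rewrite -[x]scale1r tmulPl !scale1r. Qed.

Fact tmulDr : right_distributive tmul +%R.
Proof. by move=> t x y; rewrite -[x]scale1r tmulPr !scale1r. Qed.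

Fact tone_neq0 : 1 \ox 1 != 0 :> tensor A B.
Proof. by apply: ox_neq0; apply: oner_neq0. Qed.

HB.instance Definition _ := GRing.Zmodule_isNzRing.Build (tensor A B)
  tmulA tmul1l tmul1r tmulDl tmulDr tone_neq0.

Fact tscaleAl c (s t : tensor A B) : c *: (s * t) = (c *: s) * t.
Proof. by rewrite -[RHS]/(tmul _ _) -[c *: s]addr0 tmulPl [tmul 0 _]linear0 addr0. Qed.
HB.instance Definition _ :=
  GRing.Lmodule_isLalgebra.Build k (tensor A B) tscaleAl.

Fact tscaleAr c (s t : tensor A B) : c *: (s * t) = s * (c *: t).
Proof.
by rewrite -[RHS]/(tmul _ _) -[c *: t]addr0 tmulPr -[tmul s 0]/(s * 0) mulr0 addr0.
Qed.
HB.instance Definition _ :=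
  GRing.Lalgebra_isAlgebra.Build k (tensor A B) tscaleAr.
HB.instance Definition _ := Algebra_isFalgebra.Build k (tensor A B).

Lemma mul_ox (a c : A) (b d : B) :
  (a \ox b) * (c \ox d) = (a * c) \ox (b * d).
Proof. exact: tmul_ox. Qed.

Lemma tlift_mul (X : lmodType k) (b : A -> B -> X) s t : bilinear_map b ->
  tlift b (s * t) =
  tlift (fun x y => tlift (fun x' y' => b (x * x') (y * y')) t) s.
Proof.
move=> bb; rewrite (linear_tlift (tlift b)); apply: eq_tlift => x y.
rewrite (linear_tlift (tlift b)); apply: eq_tlift => x' y'.
exact: tlift_ox.
Qed.

End TensorAlgebra.
End TensorMaps.

HB.mixin Record Falgebra_isHopf (k : fieldType) H of Falgebra k H := {
  comul_subdef : {lrmorphism H -> tensor H H};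
  counit_subdef : {lrmorphism H -> k^o};
  antipode_subdef : {linear H -> H};
  comulA_subproof : forall h : H,
    tassoc (tmap comul_subdef idfun (comul_subdef h)) = tmap idfun comul_subdef (comul_subdef h);
  counitl_subproof : forall h : H, tlift (fun a b => counit_subdef a *: b) (comul_subdef h) = h;
  counitr_subproof : forall h : H, tlift (fun a b => counit_subdef b *: a) (comul_subdef h) = h;
  antipodel_subproof : forall h : H,
    tlift (fun a b => antipode_subdef a * b) (comul_subdef h) = (counit_subdef h)%:A;
  antipoder_subproof : forall h : H,
    tlift (fun a b => a * antipode_subdef b) (comul_subdef h) = (counit_subdef h)%:A
}.

#[short(type="hopfType")]
HB.structure Definition Hopf (k : fieldType) :=
  { H of Falgebra k H & Falgebra_isHopf k H }.

Section HopfOps.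
Variables (k : fieldType) (H : hopfType k).

(* The structure maps, with H (x) H seen through [hopfType]. *)
Definition comul : {lrmorphism H -> tensor H H} := comul_subdef.
Definition counit : {lrmorphism H -> k^o} := counit_subdef.
Definition antipode : {linear H -> H} := antipode_subdef.

Lemma comulA (h : H) :
  tassoc (tmap comul idfun (comul h)) = tmap idfun comul (comul h).
Proof. exact: comulA_subproof. Qed.

Lemma counitl (h : H) : tlift (fun a b => counit a *: b) (comul h) = h.
Proof. exact: counitl_subproof. Qed.

Lemma counitr (h : H) : tlift (fun a b => counit b *: a) (comul h) = h.
Proof. exact: counitr_subproof. Qed.

Lemma antipodel (h : H) :
  tlift (fun a b => antipode a * b) (comul h) = (counit h : k)%:A.
Proof. exact: antipodel_subproof. Qed.

Lemma antipoder (h : H) :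
  tlift (fun a b => a * antipode b) (comul h) = (counit h : k)%:A.
Proof. exact: antipoder_subproof. Qed.

End HopfOps.

Arguments comul {k H}.
Arguments counit {k H}.
Arguments antipode {k H}.

Section BaseField.
Variable k : fieldType.

Definition base_comul (a : k^o) : tensor k^o k^o := a *: @ox k k^o k^o 1 1.

Fact base_comul_linear : linear base_comul.
Proof. by move=> c x y; rewrite /base_comul scalerDl scalerA. Qed.
HB.instance Definition _ :=
  GRing.isLinear.Build k k^o (tensor k^o k^o) _ base_comul base_comul_linear.

Fact base_comul_monoid : monoid_morphism base_comul.
Proof.
rewrite /base_comul; split=> [|x y]; first by rewrite scale1r.
by rewrite -scalerAl -scalerAr scalerA mul_ox !mulr1.
Qed.
HB.instance Definition _ :=
  GRing.isMonoidMorphism.Build k^o (tensor k^o k^o) base_comul base_comul_monoid.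

Let comul11 (V W : vectType k) (f : {linear k^o -> V}) (g : {linear k^o -> W}) a :
  tmap f g (base_comul a) = a *: (f 1 \ox g 1).
Proof. rewrite /base_comul linearZ_LR /=. by rewrite tmap_ox. Qed.

Fact base_comulA a :
  tassoc (tmap base_comul idfun (base_comul a)) =
  tmap idfun base_comul (base_comul a).
Proof.
by rewrite !comul11 linearZ_LR /= /base_comul !scale1r tassoc_ox.
Qed.

Let bilin_mul (f g : {linear k^o -> k^o}) :
  bilinear_map (fun a b : k^o => f a * g b).
Proof.
split=> u c x y; first by rewrite linearP /= mulrDr -scalerAr.
by rewrite linearP /= mulrDl -scalerAl.
Qed.

Let lift11 a : tlift (fun x y : k^o => x * y) (base_comul a) = a.
Proof.
rewrite /base_comul linearZ_LR /= (tlift_ox (bilin_mul idfun idfun)) /= mul1r.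
exact: mulr1.
Qed.

Fact base_counitl (a : k^o) :
  tlift (fun x y : k^o => (idfun x : k^o) *: y) (base_comul a) = a.
Proof. exact: lift11. Qed.

Fact base_counitr (a : k^o) :
  tlift (fun x y : k^o => (idfun y : k^o) *: x) (base_comul a) = a.
Proof. by rewrite -[RHS]lift11; apply: eq_tlift => x y; exact: mulrC. Qed.

Fact base_antipode (a : k^o) :
  tlift (fun x y : k^o => idfun x * idfun y) (base_comul a) = (a : k)%:A.
Proof. by rewrite -[RHS]/(a * 1) mulr1; exact: lift11. Qed.

(* The base field as the one-dimensional Hopf algebra k. *)
HB.instance Definition _ := Falgebra_isHopf.Build k k^o
  base_comulA base_counitl base_counitr base_antipode base_antipode.

End BaseField.

Section HopfDual.
Variables (k : fieldType) (H : hopfType k).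

Definition hdual : Type := 'Hom(H, k^o).
HB.instance Definition _ := Vector.copy hdual 'Hom(H, k^o).

Implicit Types (f g : hdual) (a b c h : H).

(* Application, with its linearity in the functional. *)
Definition heval f : {linear H -> k^o} := fun_of_lfun (f : 'Hom(H, k^o)).
Local Notation "f $ a" := (heval f a) (at level 10).

Let hevalP x f g a : (x *: f + g : hdual) $ a = x * f $ a + g $ a.
Proof.
rewrite -[LHS]/((x *: (f : 'Hom(H, k^o)) + (g : 'Hom(H, k^o))) a).
by rewrite add_lfunE scale_lfunE.
Qed.

Let hevalZ x f a : (x *: f : hdual) $ a = x * f $ a.
Proof.
by rewrite -[LHS]/((x *: (f : 'Hom(H, k^o))) a) scale_lfunE.
Qed.

Let hevalX f g : (forall a, f $ a = g $ a) -> f = g.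
Proof. by move/lfunP. Qed.

Let convb f g a b : k^o := f $ a * g $ b.

Let convb_bilin f g : bilinear_map (convb f g).
Proof.
split=> u c x y; rewrite /convb linearP /=; first by rewrite mulrDr -scalerAr.
by rewrite mulrDl -scalerAl.
Qed.

Let conv f g h : k^o := tlift (convb f g) (comul h).

Let conv_linear f g : linear (conv f g).
Proof. by move=> c x y; rewrite /conv !linearP. Qed.
HB.instance Definition _ f g :=
  GRing.isLinear.Build k H k^o _ (conv f g) (conv_linear f g).

(* Convolution product. *)
Definition hdual_mul f g : hdual :=
  linfun (fun h => tlift (fun a b => f $ a * g $ b) (comul h)).
Definition hdual_one : hdual := linfun (@counit k H).

Let mulE f g h : hdual_mul f g $ h = tlift (convb f g) (comul h).
Proof. exact: (lfunE (conv f g)). Qed.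

Let oneE h : hdual_one $ h = counit h.
Proof. exact: lfunE. Qed.

Fact hdual_mulA : associative hdual_mul.
Proof.
move=> f g h; apply: hevalX => x; rewrite !mulE.
pose B a (t : tensor H H) : k^o := f $ a * tlift (convb g h) t.
have BB : bilinear_map B.
  split=> u c s t; rewrite /B linearP /=; first by rewrite mulrDr -scalerAr.
  by rewrite mulrDl -scalerAl.
transitivity (tlift B (tmap idfun comul (comul x))).
  rewrite (tlift_tmap idfun comul _ BB); apply: eq_tlift => a b.
  by rewrite /convb mulE.
rewrite -comulA (tlift_tassoc _ BB).
pose C (t : tensor H H) c : k^o := tlift (convb f g) t * h $ c.
have CB : bilinear_map C.
  split=> u c s t; rewrite /C linearP /=; first by rewrite mulrDr -scalerAr.
  by rewrite mulrDl -scalerAl.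
transitivity (tlift C (tmap comul idfun (comul x))).
  apply: eq_tlift => t c; rewrite /C.
  elim/tensor_ind: t => [y s1 s2 e1 e2|a b].
    by rewrite !linearP /= e1 e2 mulrDl -scalerAl.
  rewrite tlift_ox; last first.
    split=> ? ? ? ?; rewrite /B; first by rewrite oxPl linearP /= mulrDr -scalerAr.
    by rewrite linearP /= mulrDl -scalerAl.
  by rewrite /B !(tlift_ox (convb_bilin _ _)) /convb mulrA.
rewrite (tlift_tmap comul idfun _ CB); apply: eq_tlift => a b.
by rewrite /convb mulE.
Qed.

Fact hdual_mul1l : left_id hdual_one hdual_mul.
Proof.
move=> f; apply: hevalX => x; rewrite mulE -[x in RHS]counitl linear_tlift.
by apply: eq_tlift => a b; rewrite /convb oneE linearZ_LR.
Qed.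

Fact hdual_mul1r : right_id hdual_one hdual_mul.
Proof.
move=> f; apply: hevalX => x; rewrite mulE -[x in RHS]counitr linear_tlift.
by apply: eq_tlift => a b; rewrite /convb oneE linearZ_LR mulrC.
Qed.

Let mulPl (c : k) f f' g :
  hdual_mul (c *: f + f') g = c *: hdual_mul f g + hdual_mul f' g.
Proof.
apply: hevalX => x; rewrite hevalP !mulE; apply: tlift_param => a b.
by rewrite /convb hevalP mulrDl -mulrA.
Qed.

Let mulPr (c : k) f g g' :
  hdual_mul f (c *: g + g') = c *: hdual_mul f g + hdual_mul f g'.
Proof.
apply: hevalX => x; rewrite hevalP !mulE; apply: tlift_param => a b.
by rewrite /convb hevalP mulrDr mulrCA.
Qed.

Fact hdual_mulDl : left_distributive hdual_mul +%R.
Proof. by move=> x y t; rewrite -[x]scale1r mulPl !scale1r. Qed.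

Fact hdual_mulDr : right_distributive hdual_mul +%R.
Proof. by move=> t x y; rewrite -[x]scale1r mulPr !scale1r. Qed.

Fact hdual_one_neq0 : hdual_one != 0.
Proof.
apply: contraNneq (oner_neq0 k^o) => one0.
by have := oneE 1; rewrite one0 rmorph1 => <-; apply/eqP/zero_lfunE.
Qed.

HB.instance Definition _ := GRing.Zmodule_isNzRing.Build hdual
  hdual_mulA hdual_mul1l hdual_mul1r hdual_mulDl hdual_mulDr hdual_one_neq0.

Fact hdual_scaleAl x f g : x *: (f * g) = (x *: f) * g.
Proof.
apply: hevalX => y; rewrite -[x *: (f * g)]addr0 -[x *: f]addr0.
by rewrite -[(x *: f + 0) * g]/(hdual_mul _ _) mulPl -[hdual_mul 0 g]/(0 * g) mul0r.
Qed.
HB.instance Definition _ := GRing.Lmodule_isLalgebra.Build k hdual hdual_scaleAl.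

Fact hdual_scaleAr x f g : x *: (f * g) = f * (x *: g).
Proof.
apply: hevalX => y; rewrite -[x *: (f * g)]addr0 -[x *: g]addr0.
by rewrite -[f * (x *: g + 0)]/(hdual_mul _ _) mulPr -[hdual_mul f 0]/(f * 0) mulr0.
Qed.
HB.instance Definition _ := GRing.Lalgebra_isAlgebra.Build k hdual hdual_scaleAr.
HB.instance Definition _ := Algebra_isFalgebra.Build k hdual.

(* The i-th vector of the dual basis. *)
Definition dbasis (i : 'I_(\dim {:H})) : hdual := linfun (coord (vbasis {:H}) i : H -> k^o).

(* The transpose of the product of H: see [hdual_comulE]. *)
Definition hdual_comul f : tensor hdual hdual :=
  \sum_(i < \dim {:H}) \sum_(j < \dim {:H})
    f $ ((vbasis {:H})`_i * (vbasis {:H})`_j) *: (dbasis i \ox dbasis j).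

Let dbasisE i a : dbasis i $ a = coord (vbasis {:H}) i a.
Proof. exact: lfunE. Qed.

Section EvalLeft.
Variable Y : vectType k.
Implicit Types t : tensor hdual Y.

Definition evl t a : Y := tlift (fun f y => f $ a *: y) t.

Let evl_bilin a : bilinear_map (fun f (y : Y) => f $ a *: y).
Proof.
split=> [f c x y | y c f g]; first by rewrite scalerDr !scalerA mulrC.
by rewrite hevalP scalerDl scalerA.
Qed.

Lemma evl_ox f y a : evl (f \ox y) a = f $ a *: y.
Proof. exact: (tlift_ox (evl_bilin a)). Qed.

Lemma evlP (c : k) s t a : evl (c *: s + t) a = c *: evl s a + evl t a.
Proof. exact: linearP. Qed.

Lemma evl_expand t :
  t = \sum_(i < \dim {:H}) dbasis i \ox evl t (vbasis {:H})`_i.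
Proof.
elim/tensor_ind: t => [c s t es et | f y].
  rewrite {1}es {1}et scaler_sumr -big_split; apply: eq_bigr => i _.
  by rewrite evlP oxPr.
pose g : {linear hdual -> tensor hdual Y} := HB.pack (fun f => f \ox y)
  (GRing.isLinear.Build _ _ _ _ (fun f => f \ox y)
    (fun (c : k) x z => oxPl c x z y)).
have fE : f = \sum_(i < \dim {:H}) f $ (vbasis {:H})`_i *: dbasis i.
  apply: hevalX => x; rewrite {1}(coord_vbasis (memvf x)) linear_sum.
  pose ev : {linear hdual -> k^o} := HB.pack (fun f => f $ x)
    (GRing.isLinear.Build _ _ _ _ (fun f => f $ x)
      (fun (c : k) f g => hevalP c f g x)).
  rewrite -[RHS]/(ev _) linear_sum; apply: eq_bigr => i _.
  by rewrite !linearZ_LR /= dbasisE; exact: mulrC.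
rewrite -[LHS]/(g f) {1}fE linear_sum; apply: eq_bigr => i _.
rewrite linearZ_LR /= evl_ox.
pose g' : {linear Y -> tensor hdual Y} := HB.pack (fun y => dbasis i \ox y)
  (GRing.isLinear.Build _ _ _ _ (fun y => dbasis i \ox y)
    (fun (c : k) x z => oxPr c (dbasis i) x z)).
by rewrite -[RHS]/(g' _) linearZ_LR.
Qed.


Lemma evl_inj s t : (forall a, evl s a = evl t a) -> s = t.
Proof.
by move=> st; rewrite (evl_expand s) (evl_expand t); apply: eq_bigr => i _;
  rewrite st.
Qed.

End EvalLeft.

Lemma hdual_comulE f a b : evl (hdual_comul f) a $ b = f $ (a * b).
Proof.
pose ev : {linear tensor hdual hdual -> k^o} := HB.pack (fun t => evl t a $ b)
  (GRing.isLinear.Build _ _ _ _ (fun t => evl t a $ b)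
    (fun (c : k) s t => etrans (congr1 (fun f : hdual => f $ b) (evlP c s t a))
       (hevalP c (evl s a) (evl t a) b))).
rewrite -[LHS]/(ev _) linear_sum {1}(coord_vbasis (memvf a)) mulr_suml.
rewrite linear_sum; apply: eq_bigr => i _.
rewrite linear_sum {1}(coord_vbasis (memvf b)) mulr_sumr linear_sum.
apply: eq_bigr => j _; rewrite linearZ_LR /= evl_ox.
rewrite hevalZ !dbasisE.
have -> : f $ (coord (vbasis {:H}) i a *: (vbasis {:H})`_i * (coord (vbasis {:H}) j b *: (vbasis {:H})`_j)) = coord (vbasis {:H}) i a * (coord (vbasis {:H}) j b * f $ ((vbasis {:H})`_i * (vbasis {:H})`_j)).
  by rewrite -scalerAl linearZ_LR -scalerAr linearZ_LR.
by rewrite [RHS]mulrA; exact: mulrC.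
Qed.

Fact hdual_comul_linear : linear hdual_comul.
Proof.
move=> c f g; apply: evl_inj => a; apply: hevalX => b.
by rewrite evlP hevalP !hdual_comulE hevalP.
Qed.
HB.instance Definition _ := GRing.isLinear.Build k hdual (tensor hdual hdual) _
  hdual_comul hdual_comul_linear.

Let mul_tliftr (x : k^o) (B : H -> H -> k^o) t :
  x * tlift B t = tlift (fun a b => x * B a b) t.
Proof.
rewrite tlift.unlock mulr_sumr; apply: eq_bigr => i _; rewrite mulr_sumr.
by apply: eq_bigr => j _; rewrite -scalerAr.
Qed.

Let mul_tliftl (x : k^o) (B : H -> H -> k^o) t :
  tlift B t * x = tlift (fun a b => B a b * x) t.
Proof.
rewrite tlift.unlock mulr_suml; apply: eq_bigr => i _; rewrite mulr_suml.
by apply: eq_bigr => j _; rewrite -scalerAl.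
Qed.

Let evl_mul s t a b :
  evl (s * t) a $ b =
  tlift (fun a1 a2 => tlift (fun b1 b2 => evl s a1 $ b1 * evl t a2 $ b2) (comul b))
    (comul a).
Proof.
elim/tensor_ind: s => [c s1 s2 e1 e2|f f'].
  rewrite mulrDl -scalerAl evlP hevalP e1 e2; apply/esym.
  apply: tlift_param => a1 a2; apply: tlift_param => b1 b2.
  by rewrite evlP hevalP mulrDl -mulrA.
elim/tensor_ind: t => [c s1 s2 e1 e2|g g'].
  rewrite mulrDr -scalerAr evlP hevalP e1 e2; apply/esym.
  apply: tlift_param => a1 a2; apply: tlift_param => b1 b2.
  by rewrite evlP hevalP mulrDr mulrCA.
rewrite mul_ox evl_ox hevalZ -![_ * _ : hdual]/(hdual_mul _ _) !mulE.
rewrite mul_tliftl; apply: eq_tlift => a1 a2.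
rewrite mul_tliftr; apply: eq_tlift => b1 b2.
by rewrite !evl_ox !hevalZ /convb mulrACA.
Qed.

Fact hdual_comul_monoid : monoid_morphism hdual_comul.
Proof.
split=> [|f g]; apply: evl_inj => a; apply: hevalX => b; rewrite hdual_comulE.
  by rewrite evl_ox hevalZ !oneE rmorphM.
rewrite evl_mul mulE rmorphM (tlift_mul _ _ (convb_bilin f g)).
apply: eq_tlift => a1 a2; apply: eq_tlift => b1 b2.
by rewrite !hdual_comulE.
Qed.
HB.instance Definition _ :=
  GRing.isMonoidMorphism.Build hdual (tensor hdual hdual) hdual_comul
    hdual_comul_monoid.

Definition hdual_counit f : k^o := f $ 1.

Fact hdual_counit_linear : linear hdual_counit.
Proof. by move=> c f g; rewrite /hdual_counit hevalP. Qed.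
HB.instance Definition _ :=
  GRing.isLinear.Build k hdual k^o _ hdual_counit hdual_counit_linear.

Fact hdual_counit_monoid : monoid_morphism hdual_counit.
Proof.
rewrite /hdual_counit; split=> [|f g]; first by rewrite oneE rmorph1.
by rewrite mulE rmorph1 (tlift_ox (convb_bilin f g)).
Qed.
HB.instance Definition _ :=
  GRing.isMonoidMorphism.Build hdual k^o hdual_counit hdual_counit_monoid.

Definition hdual_antipode f : hdual := linfun (fun a => f $ (antipode a)).

Let antipodeE f a : hdual_antipode f $ a = f $ (antipode a).
Proof. exact: (lfunE (heval f \o @antipode k H)). Qed.

Fact hdual_antipode_linear : linear hdual_antipode.
Proof.
by move=> c f g; apply: hevalX => a; rewrite hevalP !antipodeE hevalP.
Qed.
HB.instance Definition _ :=
  GRing.isLinear.Build k hdual hdual _ hdual_antipode hdual_antipode_linear.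

Let evl_tmapr (Y Z : vectType k) (D : {linear Y -> Z}) (t : tensor hdual Y) a :
  evl (tmap idfun D t) a = D (evl t a).
Proof.
elim/tensor_ind: t => [c s t es et|f y]; first by rewrite linearP !evlP linearP es et.
by rewrite tmap_ox !evl_ox linearZ_LR.
Qed.

Let evl_tassoc (t : tensor (tensor hdual hdual) hdual) a b :
  evl (evl (tassoc t) a) b = tlift (fun s f => (evl s a $ b) *: f) t.
Proof.
have bb : bilinear_map (fun s (f : hdual) => (evl s a $ b) *: f).
  split=> [s c x y | f c s t']; first by rewrite scalerDr !scalerA mulrC.
  by rewrite evlP hevalP scalerDl scalerA.
elim/tensor_ind: t => [c s t es et|t f]; first by rewrite !linearP /= !evlP es et.
rewrite (tlift_ox bb).
elim/tensor_ind: t => [c s t es et|g h].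
  by rewrite oxPl linearP /= !evlP es et hevalP scalerDl scalerA.
by rewrite tassoc_ox !evl_ox hevalZ -[_ *: _ in LHS]addr0 evlP evl_ox scalerA [evl 0 b]linear0 addr0.
Qed.

Fact hdual_comulA f :
  tassoc (tmap hdual_comul idfun (hdual_comul f)) =
  tmap idfun hdual_comul (hdual_comul f).
Proof.
apply: evl_inj => a; apply: evl_inj => b; apply: hevalX => c.
rewrite evl_tmapr hdual_comulE evl_tassoc.
have bb : bilinear_map (fun s (f : hdual) => (evl s a $ b) *: f).
  split=> [s x u y | g x s t']; first by rewrite scalerDr !scalerA mulrC.
  by rewrite evlP hevalP scalerDl scalerA.
rewrite (tlift_tmap hdual_comul idfun _ bb).
rewrite (eq_tlift (b2 := fun g (h : hdual) => g $ (a * b) *: h)) => [|g h].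
  by rewrite -/(evl _ _) !hdual_comulE mulrA.
by rewrite hdual_comulE.
Qed.

Fact hdual_counitl f : tlift (fun g (h : hdual) => hdual_counit g *: h) (hdual_comul f) = f.
Proof.
by apply: hevalX => a; rewrite -/(evl _ 1) hdual_comulE mul1r.
Qed.

Fact hdual_counitr f : tlift (fun g (h : hdual) => hdual_counit h *: g) (hdual_comul f) = f.
Proof.
apply: hevalX => a; rewrite -[a in RHS]mulr1 -hdual_comulE.
have bb : bilinear_map (fun g (h : hdual) => hdual_counit h *: g).
  split=> [s x u y | g x s t']; last by rewrite scalerDr !scalerA mulrC.
  by rewrite linearP scalerDl scalerA.
elim/tensor_ind: (hdual_comul f) => [c s t es et|g h].
  by rewrite evlP linearP /= !hevalP es et.
by rewrite (tlift_ox bb) evl_ox !hevalZ mulrC.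
Qed.

Let conv_evl (S T : {linear H -> H}) (S' T' : {linear hdual -> hdual}) t x :
    (forall f a, S' f $ a = f $ (S a)) -> (forall f a, T' f $ a = f $ (T a)) ->
  tlift (fun f g => S' f * T' g) t $ x =
  tlift (fun a b => evl t (S a) $ (T b)) (comul x).
Proof.
move=> SE TE.
have bb : bilinear_map (fun f g => S' f * T' g).
  split=> ? ? ? ?; rewrite linearP /=; first by rewrite mulrDr -scalerAr.
  by rewrite mulrDl -scalerAl.
elim/tensor_ind: t => [c s t es et|f g].
  rewrite linearP hevalP es et; apply/esym; apply: tlift_param => a b.
  by rewrite evlP hevalP.
rewrite (tlift_ox bb) mulE; apply: eq_tlift => a b.
by rewrite evl_ox hevalZ /convb SE TE.
Qed.

Fact hdual_antipodel f :
  tlift (fun g (h : hdual) => hdual_antipode g * h) (hdual_comul f) = (hdual_counit f)%:A.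
Proof.
apply: hevalX => x.
rewrite (@conv_evl antipode idfun hdual_antipode idfun _ _ antipodeE (fun _ _ => erefl)).
under eq_tlift do rewrite hdual_comulE.
by rewrite -linear_tlift antipodel linearZ_LR hevalZ oneE; exact: mulrC.
Qed.

Fact hdual_antipoder f :
  tlift (fun g (h : hdual) => g * hdual_antipode h) (hdual_comul f) = (hdual_counit f)%:A.
Proof.
apply: hevalX => x.
rewrite (@conv_evl idfun antipode idfun hdual_antipode _ _ (fun _ _ => erefl) antipodeE).
under eq_tlift do rewrite hdual_comulE.
by rewrite -linear_tlift antipoder linearZ_LR hevalZ oneE; exact: mulrC.
Qed.

HB.instance Definition _ := Falgebra_isHopf.Build k hdual
  hdual_comulA hdual_counitl hdual_counitr hdual_antipodel hdual_antipoder.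

End HopfDual.

Section GroupAlgebra.
Variables (k : fieldType) (gT : finGroupType).

Definition group_algebra : Type := {ffun gT -> k^o}.
HB.instance Definition _ := Vector.copy group_algebra {ffun gT -> k^o}.

Implicit Types (f g : group_algebra) (x y : gT) (c : k).

Definition gelt x : group_algebra := [ffun y => (y == x)%:R].

(* The linear map on k[gT] extending phi : gT -> X. *)
Definition gext (X : lmodType k) (phi : gT -> X) f : X :=
  \sum_x (f : {ffun gT -> k^o}) x *: phi x.

Fact gext_linear (X : lmodType k) (phi : gT -> X) : linear (gext phi).
Proof.
move=> c f g; rewrite /gext scaler_sumr -big_split; apply: eq_bigr => x _ /=.
by rewrite !ffunE scalerDl scalerA.
Qed.
HB.instance Definition _ (X : lmodType k) (phi : gT -> X) :=
  GRing.isLinear.Build k group_algebra X _ (gext phi) (gext_linear phi).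

Lemma gext_gelt (X : lmodType k) (phi : gT -> X) x : gext phi (gelt x) = phi x.
Proof.
rewrite /gext (bigD1 x) //= ffunE eqxx scale1r big1 ?addr0 // => y /negPf yx.
by rewrite ffunE yx scale0r.
Qed.

Lemma eq_gext (X : lmodType k) (phi psi : gT -> X) :
  phi =1 psi -> gext phi =1 gext psi.
Proof. by move=> e f; apply: eq_bigr => x _; rewrite e. Qed.

Lemma gext_param (X : lmodType k) (p p1 p2 : gT -> X) c f :
  (forall x, p x = c *: p1 x + p2 x) -> gext p f = c *: gext p1 f + gext p2 f.
Proof.
move=> pE; rewrite /gext scaler_sumr -big_split; apply: eq_bigr => x _ /=.
by rewrite pE scalerDr !scalerA mulrC.
Qed.

Lemma group_algebra_ind (P : group_algebra -> Prop) :
    (forall c f g, P f -> P g -> P (c *: f + g)) -> (forall x, P (gelt x)) ->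
  forall f, P f.
Proof.
move=> PD Pg f.
have P0 : P 0 by rewrite -(addNr (gelt 1%g)) -scaleN1r; apply: (PD).
have -> : f = gext gelt f.
  apply/ffunP => x; rewrite /gext sum_ffunE (bigD1 x) //= !ffunE eqxx.
  rewrite big1 ?addr0 => [|y /negPf yx]; first by rewrite [RHS]mulr1.
  by rewrite !ffunE eq_sym yx; apply: mulr0.
by apply: (big_rec P) => // x g _ Pgg; apply: PD.
Qed.

Definition gmul f g : group_algebra := gext (fun x => gext (fun y => gelt (x * y)%g) g) f.

Let gmulPl g c f f' : gmul (c *: f + f') g = c *: gmul f g + gmul f' g.
Proof. exact: linearP. Qed.

Let gmulPr f c g g' : gmul f (c *: g + g') = c *: gmul f g + gmul f g'.
Proof. by apply: gext_param => x; rewrite linearP. Qed.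

Let gmul_gelt x y : gmul (gelt x) (gelt y) = gelt (x * y)%g.
Proof. by rewrite /gmul !gext_gelt. Qed.

Fact gmulA : associative gmul.
Proof.
move=> f g h.
elim/group_algebra_ind: f => [c f f' e e'|x]; first by rewrite !gmulPl e e'.
elim/group_algebra_ind: g => [c g g' e e'|y].
  by rewrite !(gmulPl, gmulPr) e e'.
elim/group_algebra_ind: h => [c h h' e e'|z]; first by rewrite !gmulPr e e'.
by rewrite !gmul_gelt mulgA.
Qed.

Fact gmul1l : left_id (gelt 1%g) gmul.
Proof.
elim/group_algebra_ind => [c f f' e e'|x]; first by rewrite gmulPr e e'.
by rewrite gmul_gelt mul1g.
Qed.

Fact gmul1r : right_id (gelt 1%g) gmul.
Proof.
elim/group_algebra_ind => [c f f' e e'|x]; first by rewrite gmulPl e e'.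
by rewrite gmul_gelt mulg1.
Qed.

Fact gmulDl : left_distributive gmul +%R.
Proof. by move=> f g h; rewrite -[f]scale1r gmulPl !scale1r. Qed.

Fact gmulDr : right_distributive gmul +%R.
Proof. by move=> h f g; rewrite -[f]scale1r gmulPr !scale1r. Qed.

Fact gelt1_neq0 : gelt 1%g != 0.
Proof.
apply/eqP => /ffunP/(_ 1%g); rewrite !ffunE eqxx => /eqP.
by rewrite oner_eq0.
Qed.

HB.instance Definition _ := GRing.Zmodule_isNzRing.Build group_algebra
  gmulA gmul1l gmul1r gmulDl gmulDr gelt1_neq0.

Fact group_algebra_scaleAl c f g : c *: (f * g) = (c *: f) * g.
Proof.
rewrite -[c *: (f * g)]addr0 -[c *: f]addr0.
by rewrite -[RHS]/(gmul _ _) gmulPl -[gmul 0 g]/(0 * g) mul0r.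
Qed.
HB.instance Definition _ :=
  GRing.Lmodule_isLalgebra.Build k group_algebra group_algebra_scaleAl.

Fact group_algebra_scaleAr c f g : c *: (f * g) = f * (c *: g).
Proof.
rewrite -[c *: (f * g)]addr0 -[c *: g]addr0.
by rewrite -[RHS]/(gmul _ _) gmulPr -[gmul f 0]/(f * 0) mulr0.
Qed.
HB.instance Definition _ :=
  GRing.Lalgebra_isAlgebra.Build k group_algebra group_algebra_scaleAr.
HB.instance Definition _ := Algebra_isFalgebra.Build k group_algebra.

Lemma geltM x y : gelt x * gelt y = gelt (x * y)%g.
Proof. exact: gmul_gelt. Qed.

Definition group_comul : group_algebra -> tensor group_algebra group_algebra :=
  gext (fun x => gelt x \ox gelt x).
Definition group_counit : group_algebra -> k^o := gext (fun=> 1 : k^o).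
Definition group_antipode : group_algebra -> group_algebra :=
  gext (fun x => gelt x^-1%g).

HB.instance Definition _ := GRing.Linear.on group_comul.
HB.instance Definition _ := GRing.Linear.on group_counit.
HB.instance Definition _ := GRing.Linear.on group_antipode.

Let comul_gelt x : group_comul (gelt x) = gelt x \ox gelt x.
Proof. exact: gext_gelt. Qed.
Let counit_gelt x : group_counit (gelt x) = 1.
Proof. exact: gext_gelt. Qed.
Let antipode_gelt x : group_antipode (gelt x) = gelt x^-1%g.
Proof. exact: gext_gelt. Qed.

Fact group_comul_monoid : monoid_morphism group_comul.
Proof.
split=> [|f g]; first exact: comul_gelt.
elim/group_algebra_ind: f => [c f f' e e'|x].
  by rewrite mulrDl -scalerAl !linearP /= e e' mulrDl -scalerAl.
elim/group_algebra_ind: g => [c f f' e e'|y].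
  by rewrite mulrDr -scalerAr !linearP /= e e' mulrDr -scalerAr.
by rewrite geltM !comul_gelt mul_ox !geltM.
Qed.
HB.instance Definition _ := GRing.isMonoidMorphism.Build
  group_algebra (tensor group_algebra group_algebra) group_comul group_comul_monoid.

Fact group_counit_monoid : monoid_morphism group_counit.
Proof.
split=> [|f g]; first exact: counit_gelt.
elim/group_algebra_ind: f => [c f f' e e'|x].
  by rewrite mulrDl -scalerAl !linearP /= e e' mulrDl -scalerAl.
elim/group_algebra_ind: g => [c f f' e e'|y].
  by rewrite mulrDr -scalerAr !linearP /= e e' mulrDr -scalerAr.
by rewrite geltM !counit_gelt mulr1.
Qed.
HB.instance Definition _ := GRing.isMonoidMorphism.Build
  group_algebra k^o group_counit group_counit_monoid.

Fact group_comulA f :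
  tassoc (tmap group_comul idfun (group_comul f)) =
  tmap idfun group_comul (group_comul f).
Proof.
elim/group_algebra_ind: f => [c f f' e e'|x]; first by rewrite !linearP /= e e'.
by rewrite !comul_gelt !tmap_ox /= !comul_gelt tassoc_ox.
Qed.

Fact group_counitl f :
  tlift (fun a b => group_counit a *: b) (group_comul f) = f.
Proof.
elim/group_algebra_ind: f => [c f f' e e'|x]; first by rewrite !linearP /= e e'.
rewrite comul_gelt tlift_ox ?counit_gelt ?scale1r //.
split=> [u c a b | u c a b]; first by rewrite scalerDr !scalerA mulrC.
by rewrite linearP scalerDl scalerA.
Qed.

Fact group_counitr f :
  tlift (fun a b => group_counit b *: a) (group_comul f) = f.
Proof.
elim/group_algebra_ind: f => [c f f' e e'|x]; first by rewrite !linearP /= e e'.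
rewrite comul_gelt tlift_ox ?counit_gelt ?scale1r //.
split=> [u c a b | u c a b]; last by rewrite scalerDr !scalerA mulrC.
by rewrite linearP scalerDl scalerA.
Qed.

Fact group_antipodel f :
  tlift (fun a b => group_antipode a * b) (group_comul f) = (group_counit f)%:A.
Proof.
elim/group_algebra_ind: f => [c f f' e e'|x].
  by rewrite !linearP /= e e' scalerDl scalerA.
rewrite comul_gelt counit_gelt tlift_ox ?antipode_gelt ?geltM ?mulVg ?scale1r //.
split=> [u c a b | u c a b]; first by rewrite mulrDr scalerAr.
by rewrite linearP mulrDl scalerAl.
Qed.

Fact group_antipoder f :
  tlift (fun a b => a * group_antipode b) (group_comul f) = (group_counit f)%:A.
Proof.
elim/group_algebra_ind: f => [c f f' e e'|x].
  by rewrite !linearP /= e e' scalerDl scalerA.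
rewrite comul_gelt counit_gelt tlift_ox ?antipode_gelt ?geltM ?mulgV ?scale1r //.
split=> [u c a b | u c a b]; first by rewrite linearP mulrDr scalerAr.
by rewrite mulrDl scalerAl.
Qed.

HB.instance Definition _ := Falgebra_isHopf.Build k group_algebra
  group_comulA group_counitl group_counitr group_antipodel group_antipoder.

End GroupAlgebra.

Section Notions.
Variable k : fieldType.

Definition left_ideal (A : falgType k) (U : {vspace A}) : Prop :=
  ({:A} * U <= U)%VS.

Definition simple_left_ideal (A : falgType k) (U : {vspace A}) : Prop :=
  [/\ left_ideal U, U != 0%VS
    & forall V : {vspace A}, left_ideal V -> (V <= U)%VS -> V = 0%VS \/ V = U].

(* The left regular module is a direct sum of simple submodules. *)
Definition semisimple (A : falgType k) : Prop :=
  exists (n : nat) (U : 'I_n -> {vspace A}),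
    [/\ forall i, simple_left_ideal (U i), directv (\sum_i U i)
      & (\sum_i U i)%VS = {:A}%VS].

Definition grouplike (H : hopfType k) : {pred H} :=
  [pred g : H | (g != 0) && (comul g == g \ox g)].

(* |G(H)| = n *)
Definition card_grouplikes (H : hopfType k) (n : nat) : Prop :=
  exists s : seq H, [/\ uniq s, s =i @grouplike H & size s = n].

Definition hopf_morphism (H B : hopfType k) (f : {lrmorphism H -> B}) : Prop :=
  [/\ forall h, comul (f h) = tmap f f (comul h),
      forall h, counit (f h) = counit h
    & forall h, antipode (f h) = f (antipode h)].

Definition hopf_iso (H B : hopfType k) : Prop :=
  exists2 f : {lrmorphism H -> B}, hopf_morphism f & bijective f.

Definition trivial_hopf (H : hopfType k) : Prop :=
  exists gT : finGroupType,
    hopf_iso H (group_algebra k gT) \/ hopf_iso H (hdual (group_algebra k gT)).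

Section Coinvariants.
Variables (H B : hopfType k) (pi : {lrmorphism H -> B}).

(* H^{co pi} and ^{co pi}H *)
Definition coinvr : {pred H} :=
  [pred h : H | tmap idfun pi (comul h) == h \ox 1].
Definition coinvl : {pred H} :=
  [pred h : H | tmap pi idfun (comul h) == 1 \ox h].

Definition normal_map : Prop := coinvr =i coinvl.

(* H^{co pi}, with the Hopf structure inherited from H, is trivial. *)
Definition trivial_coinv : Prop :=
  exists (K : hopfType k) (iota : {lrmorphism K -> H}),
    [/\ hopf_morphism iota, injective iota,
        forall h, h \in coinvr <-> exists x, iota x = h
      & trivial_hopf K].

End Coinvariants.

Inductive upper_semisolvable : hopfType k -> Prop :=
| UpperSemisolvableBase (H : hopfType k) of hopf_iso H k^o :
    upper_semisolvable H
| UpperSemisolvableStep (H B : hopfType k) (pi : {lrmorphism H -> B})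
    of hopf_morphism pi & (forall b, exists h, pi h = b)
     & normal_map pi & trivial_coinv pi & upper_semisolvable B :
    upper_semisolvable H.

End Notions.

(* Main.v *)
(* A semisimple Hopf algebra H in characteristic 0 has involutive antipode and semisimple Drinfeld double, whose
   irreducible modules have degrees dividing n = dim H.  Let T be the sum of the isotypic components of H, as a
   D(H)-module, of degree prime to q.  Those degrees are at most p^2 and the others exceed p^4, so T is closed under
   products: it is a normal coideal subalgebra, the quotient by it is dual to a Hopf subalgebra K of H^* of dimension
   n / dim T, and q divides dim T.

   If p divides dim T, then T contains one-dimensional submodules other than k, which gives a central group-like z of
   order p, and H/(z - 1) of dimension p q^2 is handled by descent: a Hopf algebra of dimension p q^b has either a
   nontrivial central group-like element or a central group-like element of order p in its dual.

   Otherwise dim K is p^2, and K is a group algebra, or p^2 q.  In the latter case apply the dichotomy to A = K^*: the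
   new case is that A is a central extension, by a group of order p, of a Hopf algebra of dimension pq, whose
   group-like elements x of order q act on each block of A by conjugation.  On a block of degree prime to p with
   nontrivial central character only scalars are fixed, so the block is one-dimensional, which together
   with the dual of the quotient gives p^2 as a divisor of |G(A^* )|.
   Either way p^2 divides the order of G(H^* ), a contradiction. *)
Require Import Defs.
From HB Require Import structures.
From mathcomp Require Import all_boot all_fingroup all_algebra all_solvable all_field.

From mathcomp Require Import zify ring.
From Stdlib Require Classical_Prop.

Set Implicit Arguments.
Unset Strict Implicit.
Unset Printing Implicit Defensive.

Import GRing.Theory.
Local Open Scope ring_scope.

(** Semisimplicity enters only to give S^2 = id. That identity passes to duals, Hopf subalgebras and
    the double, and [inv_semisimple] returns semisimplicity for each of them, so it is the
    hypothesis carried along ([hinv]). Dimensions are mostly obtained as traces of idempotent linear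
    maps, and divisibilities follow from trace identities in k through [natr_inj]. The quotient by T
    is not formed directly: the normalized integral of T is a central P with Delta(P)(1 (x) P) = P
    (x) P, and f |-> f(P -) projects the dual of H onto K. The bound p^4 < q separates degrees: a
    block whose degree is a multiple of q cannot occur in a product of two characters of degree at
    most p^2. The obstacle is the dimension p^2 q, where K need not be spanned by group-like
    elements. There only the divisibility of |G(K)| by p^2 is sought, and in the hardest case it
    comes from two characters of K^*: one of order p trivial on the central z, and one nontrivial on
    z. *)

(** * Linearity of unbundled functions *)

Section Linear.
Variable k : fieldType.
Implicit Types U V W : lmodType k.

(** Sweedler sums are fed anonymous functions, for which no bundled linear structure is inferred; as
    a predicate, linearity is proved by the syntax-directed tactic [lin]. *)
Definition lin U V (f : U -> V) : Prop := forall a x y, f (a *: x + y) = a *: f x + f y.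

Definition lpack U V (f : U -> V) (fl : lin f) : {linear U -> V} :=
  HB.pack f (GRing.isLinear.Build k U V _ f fl).

Lemma linD U V (f : U -> V) x y : lin f -> f (x + y) = f x + f y.
Proof. by move=> fl; have := linearD (lpack fl) x y. Qed.
Lemma linZ U V (f : U -> V) a x : lin f -> f (a *: x) = a *: f x.
Proof. by move=> fl; have := linearZ_LR (lpack fl) a x. Qed.
Lemma lin0 U V (f : U -> V) : lin f -> f 0 = 0.
Proof. by move=> fl; have := linear0 (lpack fl). Qed.
Lemma linN U V (f : U -> V) x : lin f -> f (- x) = - f x.
Proof. by move=> fl; have := linearN (lpack fl) x. Qed.
Lemma linB U V (f : U -> V) x y : lin f -> f (x - y) = f x - f y.
Proof. by move=> fl; rewrite linD // linN. Qed.
Lemma lin_sum U V (f : U -> V) (I : Type) r (P : pred I) (F : I -> U) : lin f ->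
  f (\sum_(i <- r | P i) F i) = \sum_(i <- r | P i) f (F i).
Proof. by move=> fl; have := linear_sum (lpack fl) r P F. Qed.

Lemma lin_linear U V (f : {linear U -> V}) : lin f.
Proof. exact: linearP. Qed.
Lemma lin_id U : lin (fun x : U => x).
Proof. by []. Qed.
Lemma lin_zero U V : lin (fun x : U => 0 : V).
Proof. by move=> a x y; rewrite scaler0 addr0. Qed.
Lemma lin_comp U V W (g : V -> W) (f : U -> V) : lin g -> lin f -> lin (fun x => g (f x)).
Proof. by move=> gl fl a x y; rewrite fl gl. Qed.
Lemma lin_scale U V c (f : U -> V) : lin f -> lin (fun x => c *: f x).
Proof. by move=> fl a x y; rewrite fl scalerDr !scalerA mulrC. Qed.
Lemma lin_scalel U V (c : U -> k^o) (v : V) : lin c -> lin (fun x => (c x : k) *: v).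
Proof. by move=> cl a x y; rewrite cl scalerDl scalerA. Qed.
Lemma lin_add U V (f g : U -> V) : lin f -> lin g -> lin (fun x => f x + g x).
Proof. by move=> fl gl a x y; rewrite fl gl scalerDr addrACA. Qed.
Lemma lin_opp U V (f : U -> V) : lin f -> lin (fun x => - f x).
Proof. by move=> fl a x y; rewrite fl opprD scalerN. Qed.
Lemma lin_big U V (I : Type) (r : seq I) P (F : U -> I -> V) :
  (forall i, lin (fun x => F x i)) -> lin (fun x => \sum_(i <- r | P i) F x i).
Proof.
by move=> Fl a x y; rewrite scaler_sumr -big_split; apply: eq_bigr => i _; apply: Fl.
Qed.
Lemma lin_mull U (A : algType k) (f : U -> A) b : lin f -> lin (fun x => f x * b).
Proof. by move=> fl a x y; rewrite fl mulrDl scalerAl. Qed.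
Lemma lin_mulr U (A : algType k) (f : U -> A) b : lin f -> lin (fun x => b * f x).
Proof. by move=> fl a x y; rewrite fl mulrDr scalerAr. Qed.
Lemma lin_mullk U (f : U -> k^o) (b : k) : lin f -> lin (fun x => f x * b : k^o).
Proof. by move=> fl a x y; rewrite fl mulrDl -mulrA. Qed.
Lemma lin_mulrk U (f : U -> k^o) (b : k) : lin f -> lin (fun x => b * f x : k^o).
Proof. by move=> fl a x y; rewrite fl mulrDr mulrCA. Qed.

Lemma lin_coord (V : vectType k) n (X : n.-tuple V) i : lin (coord X i : V -> k^o).
Proof. by move=> a x y; rewrite linearP. Qed.

Lemma lin_app U V (f : {linear U -> V}) W (g : W -> U) : lin g -> lin (fun x => f (g x)).
Proof. by move=> gl; apply: lin_comp => //; apply: lin_linear. Qed.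

End Linear.

Lemma lin2_bilinear (k : fieldType) (U V : vectType k) (X : lmodType k) (F : U -> V -> X) :
  (forall a, lin (fun b => F a b)) -> (forall b, lin (fun a => F a b)) -> bilinear_map F.
Proof. by []. Qed.

(** * Traces of linear maps *)

Section Trace.
Variable k : fieldType.
Implicit Types U V W : vectType k.

Definition bs V (i : 'I_(\dim {:V})) : V := (vbasis {:V})`_i.
Definition cb V (i : 'I_(\dim {:V})) : V -> k := coord (vbasis {:V}) i.

Lemma lin_cb V i : lin (@cb V i : V -> k^o).
Proof. exact: lin_coord. Qed.
Lemma lin_cbf V (Y : lmodType k) i (g : Y -> V) : lin g -> lin (fun y => cb i (g y) : k^o).
Proof. by move=> gl a x y; rewrite gl lin_cb. Qed.
Lemma cb_bs V i j : cb i (bs j : V) = (i == j)%:R.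
Proof. by rewrite /cb /bs coord_free ?(basis_free (vbasisP _)) // eq_sym. Qed.
Lemma bs_sum V (x : V) : x = \sum_i cb i x *: bs i.
Proof. exact: coord_vbasis (memvf x). Qed.

Definition ltr V (f : V -> V) : k := \sum_i cb i (f (bs i)).

Lemma eq_ltr V (f g : V -> V) : f =1 g -> ltr f = ltr g.
Proof. by move=> fg; apply: eq_bigr => i _; rewrite fg. Qed.

Lemma ltr_lin V a (f g : V -> V) : ltr (fun x => a *: f x + g x) = a * ltr f + ltr g.
Proof.
rewrite /ltr mulr_sumr -big_split; apply: eq_bigr => i _ /=.
exact: lin_cb.
Qed.
Lemma ltr_add V (f g : V -> V) : ltr (fun x => f x + g x) = ltr f + ltr g.
Proof. by rewrite -(mul1r (ltr f)) -ltr_lin; apply: eq_ltr => x; rewrite scale1r. Qed.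
Lemma ltr0 V : ltr (fun _ : V => 0) = 0.
Proof. by rewrite /ltr big1 // => i _; exact: (lin0 (lin_cb i)). Qed.
Lemma ltrZ V a (f : V -> V) : ltr (fun x => a *: f x) = a * ltr f.
Proof.
by rewrite -[RHS]addr0 -(ltr0 V) -ltr_lin; apply: eq_ltr => x; rewrite addr0.
Qed.
Lemma ltr_bigsum V (I : Type) (r : seq I) P (F : I -> V -> V) :
  ltr (fun x => \sum_(i <- r | P i) F i x) = \sum_(i <- r | P i) ltr (F i).
Proof.
rewrite /ltr exchange_big; apply: eq_bigr => i _.
by rewrite (lin_sum _ _ _ (lin_cb i)).
Qed.

(** The family e may be linearly dependent: a resolution of the identity by the pairs (phi_i, e_i)
    is all that a trace needs. Dual bases built from integrals or matrix units can so be inserted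
    without a basis proof. *)
Lemma ltr_dual V (f : V -> V) (I : finType) (e : I -> V) (phi : I -> V -> k^o) :
    lin f -> (forall i, lin (phi i)) -> (forall x, x = \sum_i phi i x *: e i) ->
  ltr f = \sum_i phi i (f (e i)).
Proof.
move=> fl pl xE; rewrite /ltr.
transitivity (\sum_i \sum_j phi i (f (bs j)) * cb j (e i)).
  rewrite exchange_big; apply: eq_bigr => j _.
  rewrite {1}(xE (f (bs j))) (lin_sum _ _ _ (lin_cb j)).
  by apply: eq_bigr => i _; rewrite (linZ _ _ (lin_cb j)).
apply: eq_bigr => i _; rewrite {2}(bs_sum (e i)) (lin_sum _ _ _ fl) lin_sum //.
by apply: eq_bigr => j _; rewrite (linZ _ _ fl) linZ // mulrC.
Qed.

Lemma ltr_comm U V (f : U -> V) (g : V -> U) : lin f -> lin g ->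
  ltr (fun x => f (g x)) = ltr (fun x => g (f x)).
Proof.
move=> fl gl; rewrite /ltr.
transitivity (\sum_i \sum_j cb i (f (bs j)) * cb j (g (bs i))).
  apply: eq_bigr => i _; rewrite {1}(bs_sum (g (bs i))) lin_sum // (lin_sum _ _ _ (lin_cb i)).
  by apply: eq_bigr => j _; rewrite linZ // (linZ _ _ (lin_cb i)); exact: mulrC.
rewrite exchange_big; apply: eq_bigr => j _.
rewrite {2}(bs_sum (f (bs j))) [in RHS]lin_sum // (lin_sum _ _ _ (lin_cb j)).
by apply: eq_bigr => i _; rewrite linZ // (linZ _ _ (lin_cb j)).
Qed.

Lemma ltr_id V : ltr (@id V) = (\dim {:V})%:R.
Proof.
rewrite /ltr (eq_bigr (fun=> 1)) => [|i _]; last by rewrite cb_bs eqxx.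
by rewrite sumr_const card_ord.
Qed.

Lemma lin_linfun V W (f : V -> W) : lin f -> linfun f =1 f.
Proof. by move=> fl x; rewrite -[f]/(lpack fl : V -> W) lfunE. Qed.

(** f is the inclusion of U after a projection to U; exchanging the two factors by [ltr_comm] leaves
    the identity of U. *)
Lemma ltr_proj V (f : V -> V) (U : {vspace V}) : lin f ->
  (forall x, f x \in U) -> (forall x, x \in U -> f x = x) -> ltr f = (\dim U)%:R.
Proof.
move=> fl fU fid.
have l1 : lin (@vsval k V U) by move=> a x y; rewrite linearP.
have l2 : lin (fun x => vsproj U (f x)) by move=> a x y; rewrite fl linearP.
rewrite (eq_ltr (g := fun x => vsval (vsproj U (f x)))) => [|x]; last by rewrite vsprojK.
rewrite (ltr_comm l1 l2) (eq_ltr (g := id)) ?ltr_id => [|x]; last first.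
  by rewrite fid ?subvsP // vsvalK.
by rewrite dimvf /dim.
Qed.

Lemma ltr_idem V (f : V -> V) : lin f -> (forall x, f (f x) = f x) ->
  ltr f = (\dim (limg (linfun f)))%:R.
Proof.
move=> fl ff; have fE := lin_linfun fl; apply: ltr_proj => // [x | x /memv_imgP[y _ ->]].
  by rewrite -[X in X \in _]fE memv_img ?memvf.
by rewrite fE ff.
Qed.
End Trace.

(** * Sweedler sums *)

Section Sweedler.
Variables (k : fieldType) (H : hopfType k).
Implicit Types (X Y : lmodType k) (a b h : H).

(* [sw h (fun a b => F a b)] is the Sweedler sum of F over comul h. *)
Definition sw X h (F : H -> H -> X) : X := tlift F (comul h).

Lemma swE X h (F : H -> H -> X) :
  sw h F = \sum_i \sum_j (comul h : 'M_(_, _)) i j *: F (bs i) (bs j).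
Proof. by rewrite /sw tlift.unlock. Qed.

Lemma eq_sw X h (F G : H -> H -> X) : (forall a b, F a b = G a b) -> sw h F = sw h G.
Proof. by move=> FG; apply: eq_tlift. Qed.

Lemma sw_lin X Y (f : X -> Y) h F : lin f -> f (sw h F) = sw h (fun a b => f (F a b)).
Proof. by move=> fl; have := linear_tlift (lpack fl) F (comul h). Qed.

Lemma lin_swh X Y (F : H -> H -> X) (f : Y -> H) : lin f -> lin (fun y => sw (f y) F).
Proof. by move=> fl a x y; rewrite /sw fl !linearP. Qed.

Lemma lin_sw X Y h (F : Y -> H -> H -> X) :
  (forall a b, lin (fun y => F y a b)) -> lin (fun y => sw h (F y)).
Proof. by move=> Fl a x y; apply: tlift_param => u v; apply: Fl. Qed.

Lemma sw_mull (A : algType k) h F (x : A) : x * sw h F = sw h (fun a b => x * F a b).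
Proof. by apply: (sw_lin (f := fun z => x * z)); apply: lin_mulr. Qed.
Lemma sw_mulr (A : algType k) h F (x : A) : sw h F * x = sw h (fun a b => F a b * x).
Proof. by apply: (sw_lin (f := fun z => z * x)); apply: lin_mull. Qed.
Lemma sw_scaler X h F (c : k) : c *: sw h F = sw h (fun a b => c *: F a b : X).
Proof. by apply: (sw_lin (f := fun z => c *: z)); apply: lin_scale. Qed.
Lemma sw_scalel X h (F : H -> H -> k^o) (v : X) : (sw h F : k) *: v = sw h (fun a b => (F a b : k) *: v).
Proof. by apply: (sw_lin (f := fun z : k^o => (z : k) *: v)); apply: lin_scalel. Qed.

Lemma sw_comm X (x y : H) (F : H -> H -> H -> H -> X) :
  sw x (fun a b => sw y (fun c d => F a b c d)) = sw y (fun c d => sw x (fun a b => F a b c d)).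
Proof.
rewrite !swE.
under eq_bigr => i _ do under eq_bigr => j _ do rewrite swE scaler_sumr.
under [RHS]eq_bigr => i _ do under eq_bigr => j _ do rewrite swE scaler_sumr.
under eq_bigr => i _ do rewrite exchange_big /=.
rewrite exchange_big /=; apply: eq_bigr => i' _.
under eq_bigr => i _ do under eq_bigr => j _ do rewrite scaler_sumr.
under [RHS]eq_bigr => i _ do under eq_bigr => j _ do rewrite scaler_sumr.
under eq_bigr => i _ do rewrite exchange_big /=.
rewrite exchange_big /=; apply: eq_bigr => j' _.
by apply: eq_bigr => i _; apply: eq_bigr => j _; rewrite !scalerA mulrC.
Qed.

Definition ev (f : hdual H) h : k := heval f h.
Definition eps h : k := counit h.

Notation "f $ a" := (ev f a) (at level 10).

Lemma ev_mul (f g : hdual H) h : (f * g) $ h = sw h (fun a b => f $ a * g $ b : k^o).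
Proof.
by apply: (lin_linfun (f := fun h => sw h (fun a b => f $ a * g $ b : k^o)) _ h); apply: lin_swh.
Qed.

Lemma evP c (f g : hdual H) h : (c *: f + g) $ h = c * f $ h + g $ h.
Proof. by rewrite -[LHS]/((c *: (f : 'Hom(H, k^o)) + (g : 'Hom(H, k^o))) h) add_lfunE scale_lfunE. Qed.

Lemma lin_ev Y (f : hdual H) (g : Y -> H) : lin g -> lin (fun y => f $ (g y) : k^o).
Proof. by move=> gl a x y; rewrite /ev gl linearP. Qed.
Lemma lin_evf Y (f : Y -> hdual H) h : lin f -> lin (fun y => f y $ h : k^o).
Proof. by move=> gl a x y; rewrite gl evP. Qed.

Lemma ev_inj (f g : hdual H) : (forall h, f $ h = g $ h) -> f = g.
Proof. by move=> fg; apply/lfunP => h; apply: fg. Qed.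

Lemma ev_linfun (f : H -> k^o) h : lin f -> ev (linfun f) h = f h.
Proof. by move=> fl; apply: (lin_linfun fl h). Qed.

Lemma ev1 h : (1 : hdual H) $ h = eps h.
Proof. by apply: (@ev_linfun eps); apply: (lin_linear counit). Qed.

Lemma ev_antipode (f : hdual H) h : antipode f $ h = f $ (antipode h).
Proof.
by apply: (@ev_linfun (fun h => f $ (antipode h))); apply: lin_ev; apply: lin_linear.
Qed.

Lemma ev_dbasis i h : @dbasis k H i $ h = cb i h.
Proof. by apply: (@ev_linfun (cb i)); apply: lin_coord. Qed.

Lemma comul_coef h i j : (comul h : 'M_(_, _)) i j = (@dbasis k H i * @dbasis k H j : hdual H) $ h.
Proof.
rewrite ev_mul swE (bigD1 i) //= (bigD1 j) //= !ev_dbasis !cb_bs !eqxx mulr1.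
rewrite !big1 ?addr0 => [|i' /negPf i'i|j' /negPf j'j]; first by rewrite [RHS]mulr1.
  by rewrite big1 // => j' _; rewrite !ev_dbasis !cb_bs eq_sym i'i mul0r scaler0.
by rewrite !ev_dbasis !cb_bs [j == _]eq_sym j'j mulr0 scaler0.
Qed.

(* Both sides are sums over triples of basis vectors with coefficients
   computed by the associative product of the dual, so F is arbitrary. *)
Lemma swA X h (F : H -> H -> H -> X) :
  sw h (fun a b => sw a (fun c d => F c d b)) = sw h (fun a b => sw b (fun c d => F a c d)).
Proof.
transitivity (\sum_i \sum_j \sum_l (@dbasis k H i * @dbasis k H j * @dbasis k H l) $ h *:
   F (bs i) (bs j) (bs l)).
  rewrite swE; under eq_bigr => i _ do under eq_bigr => j _ do rewrite swE scaler_sumr.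
  under eq_bigr => i _ do rewrite exchange_big /=.
  rewrite exchange_big /=; apply: eq_bigr => i _.
  under eq_bigr => j _ do under eq_bigr => l _ do rewrite scaler_sumr.
  under eq_bigr => j _ do rewrite exchange_big /=.
  rewrite exchange_big /=; apply: eq_bigr => j _.
  rewrite exchange_big; apply: eq_bigr => l _; rewrite -[LHS]/(\sum_u _).
  under eq_bigr => u _ do rewrite scalerA.
  rewrite -scaler_suml; congr (_ *: _); rewrite [RHS]ev_mul swE; apply: eq_bigr => u _.
  rewrite (bigD1 l) //= big1 ?addr0 => [|v /negPf vl].
    by rewrite comul_coef [in RHS]ev_dbasis cb_bs eqxx mulr1 comul_coef.
  by rewrite [@dbasis k H l $ _]ev_dbasis cb_bs eq_sym vl mulr0 scaler0.
rewrite swE; apply: eq_bigr => i _.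
under [RHS]eq_bigr => u _ do rewrite swE scaler_sumr.
rewrite [RHS]exchange_big; apply: eq_bigr => j _.
under [RHS]eq_bigr => u _ do rewrite scaler_sumr.
rewrite [RHS]exchange_big; apply: eq_bigr => l _.
under [RHS]eq_bigr => u _ do rewrite scalerA.
rewrite -scaler_suml -mulrA; congr (_ *: _); rewrite [LHS]ev_mul swE exchange_big.
apply: eq_bigr => u _.
rewrite (bigD1 i) //= big1 ?addr0 => [|v /negPf vl].
  by rewrite [in LHS]ev_dbasis cb_bs eqxx mul1r !comul_coef.
by rewrite [@dbasis k H i $ _]ev_dbasis cb_bs eq_sym vl mul0r scaler0.
Qed.

Lemma swM X (x y : H) (F : H -> H -> X) :
    (forall a, lin (fun b => F a b)) -> (forall b, lin (fun a => F a b)) ->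
  sw (x * y) F = sw x (fun a b => sw y (fun c d => F (a * c) (b * d))).
Proof. by move=> F1 F2; rewrite /sw rmorphM tlift_mul. Qed.

Lemma sw1 X (F : H -> H -> X) :
  (forall a, lin (fun b => F a b)) -> (forall b, lin (fun a => F a b)) -> sw 1 F = F 1 1.
Proof. by move=> F1 F2; rewrite /sw rmorph1 tlift_ox. Qed.

Lemma sw_counitl X h (F : H -> X) : lin F -> sw h (fun a b => eps a *: F b) = F h.
Proof.
move=> Fl; rewrite -{2}[h]counitl -/(sw h _) (sw_lin _ _ Fl).
by apply: eq_sw => a b; rewrite linZ.
Qed.
Lemma sw_counitr X h (F : H -> X) : lin F -> sw h (fun a b => eps b *: F a) = F h.
Proof.
move=> Fl; rewrite -{2}[h]counitr -/(sw h _) (sw_lin _ _ Fl).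
by apply: eq_sw => a b; rewrite linZ.
Qed.

Lemma sw_antipodel X h (F : H -> X) : lin F ->
  sw h (fun a b => F (antipode a * b)) = eps h *: F 1.
Proof. by move=> Fl; rewrite -(sw_lin h _ Fl) /sw antipodel linZ. Qed.
Lemma sw_antipoder X h (F : H -> X) : lin F ->
  sw h (fun a b => F (a * antipode b)) = eps h *: F 1.
Proof. by move=> Fl; rewrite -(sw_lin h _ Fl) /sw antipoder linZ. Qed.

Lemma epsM (x y : H) : eps (x * y) = eps x * eps y.
Proof. exact: rmorphM. Qed.
Lemma eps1 : eps 1 = 1.
Proof. exact: rmorph1. Qed.

Lemma lin_eps Y (g : Y -> H) : lin g -> lin (fun y => eps (g y) : k^o).
Proof. by move=> gl a x y; rewrite /eps gl linearP. Qed.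
Lemma evZ (f : hdual H) (c : k) h : f $ (c *: h) = c * f $ h.
Proof. exact: linZ (lin_ev f (@lin_id k H)). Qed.
Lemma evD (f : hdual H) (x y : H) : f $ (x + y) = f $ x + f $ y.
Proof. exact: linD (lin_ev f (@lin_id k H)). Qed.
Lemma ev0 (f : hdual H) : f $ 0 = 0.
Proof. exact: lin0 (lin_ev f (@lin_id k H)). Qed.
Lemma ev_sw (f : hdual H) h F : f $ (sw h F) = sw h (fun a b => f $ (F a b) : k^o).
Proof. exact: sw_lin h F (lin_ev f (@lin_id k H)). Qed.
Lemma ev_sum (f : hdual H) (I : Type) (r : seq I) P F :
  f $ (\sum_(i <- r | P i) F i) = \sum_(i <- r | P i) f $ (F i).
Proof. exact: lin_sum r P F (lin_ev f (@lin_id k H)). Qed.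
Lemma evfZ (f : hdual H) (c : k) h : (c *: f) $ h = c * f $ h.
Proof. exact: linZ (lin_evf h (@lin_id k (hdual H))). Qed.
Lemma evfD (f g : hdual H) h : (f + g) $ h = f $ h + g $ h.
Proof. exact: linD (lin_evf h (@lin_id k (hdual H))). Qed.
Lemma evf0 h : (0 : hdual H) $ h = 0.
Proof. exact: lin0 (lin_evf h (@lin_id k (hdual H))). Qed.
Lemma evf_sum h (I : Type) (r : seq I) P (F : I -> hdual H) :
  (\sum_(i <- r | P i) F i) $ h = \sum_(i <- r | P i) (F i) $ h.
Proof. exact: lin_sum r P F (lin_evf h (@lin_id k (hdual H))). Qed.
Lemma epsZ (c : k) h : eps (c *: h) = c * eps h.
Proof. exact: linZ (lin_eps (@lin_id k H)). Qed.
Lemma epsD (x y : H) : eps (x + y) = eps x + eps y.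
Proof. exact: linD (lin_eps (@lin_id k H)). Qed.
Lemma eps_sw h F : eps (sw h F) = sw h (fun a b => eps (F a b) : k^o).
Proof. exact: sw_lin h F (lin_eps (@lin_id k H)). Qed.
Lemma eps_sum (I : Type) (r : seq I) P (F : I -> H) :
  eps (\sum_(i <- r | P i) F i) = \sum_(i <- r | P i) eps (F i).
Proof. exact: lin_sum r P F (lin_eps (@lin_id k H)). Qed.
Lemma lin_antipode Y (g : Y -> H) : lin g -> lin (fun y => antipode (g y)).
Proof. by move=> gl; apply: lin_comp => //; apply: lin_linear. Qed.

Lemma lin_oxl (U V : vectType k) Y (f : Y -> U) (v : V) : lin f -> lin (fun y => f y \ox v).
Proof. by move=> fl a x y; rewrite fl oxPl. Qed.
Lemma lin_oxr (U V : vectType k) Y (f : Y -> V) (u : U) : lin f -> lin (fun y => u \ox f y).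
Proof. by move=> fl a x y; rewrite fl oxPr. Qed.

End Sweedler.

Notation "f $ a" := (ev f a) (at level 10).
Arguments ev {k H} f h : simpl never.
Arguments eps {k H} h : simpl never.

Ltac lin1 := intros; cbv beta; match goal with
 | |- lin (fun x => x) => exact (@lin_id _ _)
 | |- lin id => exact (@lin_id _ _)
 | |- lin (fun x => 0) => exact (@lin_zero _ _ _)
 | |- lin (fun x => - @?f x) => apply (@lin_opp _ _ _ f)
 | |- lin (fun x => @?f x + @?g x) => apply (@lin_add _ _ _ f g)
 | |- lin (fun x => ?c *: @?f x) => apply (@lin_scale _ _ _ c f)
 | |- lin (fun x => @?c x *: ?v) => apply (@lin_scalel _ _ _ c v)
 | |- lin (fun x => ev ?f (@?g x)) => apply (@lin_ev _ _ _ f g)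
 | |- lin (fun x => ev (@?f x) ?h) => apply (@lin_evf _ _ _ f h)
 | |- lin (fun x => eps (@?g x)) => apply (@lin_eps _ _ _ g)
 | |- lin (fun x => antipode (@?g x)) => apply (@lin_antipode _ _ _ g)
 | |- lin (fun x => cb ?i (@?g x)) => apply (@lin_cbf _ _ _ i g)
 | |- lin (fun x => @?f x * ?b) => first [apply (@lin_mullk _ _ f b) | apply (@lin_mull _ _ _ f b)]
 | |- lin (fun x => ?b * @?f x) => first [apply (@lin_mulrk _ _ f b) | apply (@lin_mulr _ _ _ f b)]
 | |- lin (fun x => sw (@?f x) ?F) => apply (@lin_swh _ _ _ _ F f)
 | |- lin (fun x => sw ?h (fun a b => @?F x a b)) => apply (@lin_sw _ _ _ _ h F)
 | |- @lin ?k ?U ?V (fun x => \sum_(i <- _ | _) @?F x i) => apply (@lin_big k U V _ _ _ F)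
 | |- lin (fun x => @?f x \ox ?v) => apply (@lin_oxl _ _ _ _ f v)
 | |- lin (fun x => ?u \ox @?f x) => apply (@lin_oxr _ _ _ _ f u)
 | |- lin (GRing.Linear.sort _) => apply lin_linear
 | |- lin (@eps _ _) => apply (@lin_eps _ _ _ (fun x => x) (@lin_id _ _))
 | |- lin (ev ?f) => apply (@lin_ev _ _ _ f (fun x => x) (@lin_id _ _))
 | |- lin (cb _) => apply lin_cb
 | |- lin (GRing.mul ?a) => apply (@lin_mulr _ _ _ (fun x => x) a (@lin_id _ _))
 | |- lin (fun x => GRing.Linear.sort ?f (@?g x)) => apply (@lin_app _ _ _ f _ g)
 | H : forall _, lin _ |- lin (fun x => ?F (@?g x) ?b) =>
     apply (@lin_comp _ _ _ _ _ g (H b))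
 | H : forall _, lin _ |- lin (fun x => ?F ?a (@?g x)) =>
     apply (@lin_comp _ _ _ _ _ g (H a))
 | H : forall _ _, lin _ |- lin (fun x => ?F (@?g x) ?b ?c) =>
     apply (@lin_comp _ _ _ _ _ g (H b c))
 | H : forall _ _, lin _ |- lin (fun x => ?F ?a (@?g x) ?c) =>
     apply (@lin_comp _ _ _ _ _ g (H a c))
 | H : forall _ _, lin _ |- lin (fun x => ?F ?a ?b (@?g x)) =>
     apply (@lin_comp _ _ _ _ _ g (H a b))
 | H : lin ?f |- lin (fun x => ?f x) => exact H
 | H : forall _, lin _ |- lin (fun x => ?f x) => apply H
 | H : lin ?f |- lin (fun x => ?f (@?g x)) => apply (@lin_comp _ _ _ _ _ g H)
 | H : lin ?f |- lin ?f => exact H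
 end; cbv beta.
Ltac lin := solve [repeat first [assumption | lin1 | progress (cbv beta)]].

Lemma sw_sum (k : fieldType) (H : hopfType k) (X : lmodType k) (h : H) (I : Type) (r : seq I)
    (P : pred I) (F : I -> H -> H -> X) :
  sw h (fun a b => \sum_(i <- r | P i) F i a b) = \sum_(i <- r | P i) sw h (F i).
Proof.
under [RHS]eq_bigr do rewrite swE.
rewrite swE [RHS]exchange_big; apply: eq_bigr => i _.
rewrite [RHS]exchange_big; apply: eq_bigr => j _.
by rewrite scaler_sumr.
Qed.

(** * The antipode *)

Section Antipode.
Variables (k : fieldType) (H : hopfType k).
Implicit Types (X Y : lmodType k) (a b h : H).
Local Notation S := antipode.

Lemma sw_antl X (F : H -> X) h (G : H -> H -> X) :
  (forall a b, G a b = F (S a * b)) -> lin F -> sw h G = eps h *: F 1.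
Proof. by move=> GF Fl; rewrite -sw_antipodel //; apply: eq_sw. Qed.
Lemma sw_antr X (F : H -> X) h (G : H -> H -> X) :
  (forall a b, G a b = F (a * S b)) -> lin F -> sw h G = eps h *: F 1.
Proof. by move=> GF Fl; rewrite -sw_antipoder //; apply: eq_sw. Qed.
Lemma sw_cul X (F : H -> X) h (G : H -> H -> X) :
  (forall a b, G a b = eps a *: F b) -> lin F -> sw h G = F h.
Proof. by move=> GF Fl; rewrite -(sw_counitl h Fl); apply: eq_sw. Qed.
Lemma sw_cur X (F : H -> X) h (G : H -> H -> X) :
  (forall a b, G a b = eps b *: F a) -> lin F -> sw h G = F h.
Proof. by move=> GF Fl; rewrite -(sw_counitr h Fl); apply: eq_sw. Qed.

Arguments sw_antl {X} F {h G}.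
Arguments sw_antr {X} F {h G}.
Arguments sw_cul {X} F {h G}.
Arguments sw_cur {X} F {h G}.

Lemma antipode1 : S (1 : H) = 1.
Proof.
have := antipodel (1 : H); rewrite -/(sw _ _) sw1; [|lin|lin].
by rewrite mulr1 rmorph1 scale1r.
Qed.

Lemma eps_antipode h : eps (S h) = eps h.
Proof.
have e : sw h (fun a b => (eps (S a * b) : k^o)) = eps h.
  rewrite (sw_antl (fun z : H => eps z : k^o)); [|by []|lin].
  by rewrite eps1; exact: mulr1.
rewrite -e; apply/esym; apply: (sw_cur (fun z => eps (S z) : k^o)); last by lin.
by move=> a b; rewrite epsM mulrC.
Qed.

(** Uniqueness of convolution inverses: S(xy) and S(y)S(x) both invert the product H (x) H -> H. The
    element E is the convolution of the three maps, contracted once from the right and once from the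
    left. *)
Lemma antipodeM (x y : H) : S (x * y) = S y * S x.
Proof.
pose E := sw x (fun x1 x' => sw y (fun y1 y' => sw x' (fun x2 x3 => sw y' (fun y2 y3 =>
  S (x1 * y1) * (x2 * y2) * (S y3 * S x3))))).
transitivity E; rewrite /E.
  apply/esym; transitivity (sw x (fun x1 x' => eps x' *: sw y (fun y1 y' =>
     eps y' *: S (x1 * y1)))).
    apply: eq_sw => x1 x'; rewrite sw_scaler; apply: eq_sw => y1 y'.
    rewrite (sw_antr (fun z => eps y' *: (S (x1 * y1) * z))); [|move=> x2 x3|lin].
      by rewrite mulr1 .
    rewrite (sw_antr (fun z => S (x1 * y1) * (x2 * z * S x3))); [|move=> y2 y3|lin].
      by rewrite mulr1.
    by rewrite !mulrA.
  rewrite (sw_cur (fun z => sw y (fun y1 y' => eps y' *: S (z * y1)))) //; last by lin.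
  by rewrite (sw_cur (fun z => S (x * z))) //; lin.
under eq_sw do rewrite sw_comm.
rewrite -(swA x (fun x1 x2 x3 => sw y (fun y1 y' => sw y' (fun y2 y3 =>
  S (x1 * y1) * (x2 * y2) * (S y3 * S x3))))).
rewrite (sw_cul (fun z => S y * S z)) //; last by lin.
move=> x' x3; under eq_sw do rewrite -(swA y (fun y1 y2 y3 => S (_ * y1) * (_ * y2) * (S y3 * S x3))).
rewrite sw_comm (sw_cul (fun z => eps x' *: (S z * S x3))) //; last by lin.
move=> y' y3; rewrite -(@swM _ _ _ x' y' (fun u v => S u * v * (S y3 * S x3))); [|lin|lin].
rewrite (sw_antl (fun z => z * (S y3 * S x3))) ?epsM; [|by []|lin].
by rewrite mul1r scalerA mulrC.
Qed.

End Antipode.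

Arguments sw_antl {k H X} F {h G}.
Arguments sw_antr {k H X} F {h G}.
Arguments sw_cul {k H X} F {h G}.
Arguments sw_cur {k H X} F {h G}.

Section AntipodeDual.
Variables (k : fieldType) (H : hopfType k).
Implicit Types (X Y : lmodType k) (a b h : H).
Local Notation S := antipode.

Lemma sw_fun2 X h (F : H -> H -> X) :
    (forall a, lin (fun b => F a b)) -> (forall b, lin (fun a => F a b)) ->
  sw h F = \sum_i \sum_j ((@dbasis k H i * @dbasis k H j) $ h : k) *: F (bs i) (bs j).
Proof. by move=> _ _; rewrite swE; under eq_bigr do under eq_bigr do rewrite comul_coef. Qed.

(** This is [antipodeM] for the dual Hopf algebra, read off on the coefficients of Delta. *)
Lemma sw_antipode X h (F : H -> H -> X) :
    (forall a, lin (fun b => F a b)) -> (forall b, lin (fun a => F a b)) ->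
  sw (S h) F = sw h (fun a b => F (S b) (S a)).
Proof.
move=> F1 F2; rewrite (sw_fun2 _ F1 F2).
transitivity (\sum_i \sum_j sw h (fun a b => (cb i (S b) * cb j (S a) : k) *: F (bs i) (bs j))).
  apply: eq_bigr => i _; apply: eq_bigr => j _.
  rewrite -ev_antipode antipodeM ev_mul sw_scalel; apply: eq_sw => a b.
  by rewrite !ev_antipode !ev_dbasis mulrC.
have Fs a b : F a b = \sum_i \sum_j (cb i a * cb j b : k) *: F (bs i) (bs j).
  rewrite {1}(bs_sum a) (lin_sum _ _ _ (F2 b)); apply: eq_bigr => i _.
  rewrite (linZ _ _ (F2 b)) {1}(bs_sum b) (lin_sum _ _ _ (F1 _)) scaler_sumr.
  by apply: eq_bigr => j _; rewrite (linZ _ _ (F1 _)) scalerA.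
under [RHS]eq_sw do rewrite Fs.
rewrite sw_sum; apply: eq_bigr => i _.
by rewrite sw_sum; apply: eq_bigr => j _.
Qed.

End AntipodeDual.

(* Matrix units of a split semisimple algebra: [wc] sends an index to the
   canonical index of its block, and [wE i j] is 0 across blocks. *)
Record wedd (k : fieldType) (A : falgType k) := Wedd {
  wN : nat;
  wc : 'I_wN -> 'I_wN;
  wE : 'I_wN -> 'I_wN -> A;
  wcc : forall i, wc (wc i) = wc i;
  wE0 : forall i j, wc i != wc j -> wE i j = 0;
  wEM : forall i j l m, wc i = wc j -> wE i j * wE l m = (j == l)%:R *: wE i m;
  wE1 : \sum_i wE i i = 1;
  wEn0 : forall i, wE i i != 0;
  wEs : forall x i j, exists a, wE i i * x * wE j j = a *: wE i j }.

(** * Matrix units of a semisimple algebra *)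

Section Wedderburn.
Variables (k : closedFieldType) (A : falgType k).

Lemma right_eigenvector (U : {vspace A}) (x : A) : U != 0%VS ->
  (forall u, u \in U -> u * x \in U) -> exists a, exists2 v, v \in U & v != 0 /\ v * x = a *: v.
Proof.
move=> U0 Ux; pose m := \dim U; have m0 : (0 < m)%N by rewrite lt0n dimv_eq0.
pose M : 'M[k]_m := \matrix_(i, j) coord (vbasis U) j ((vbasis U)`_i * x).
have : size (char_poly M) != 1%N by rewrite size_char_poly; case: (m) m0.
move/closed_rootP => [a]; rewrite -eigenvalue_root_char => /eigenvalueP[v vM v0].
exists a, (\sum_i v 0 i *: (vbasis U)`_i).
  by apply: memv_suml => i _; rewrite memvZ // vbasis_mem // mem_nth // size_tuple.
split.
  apply: contraNneq v0 => s0; apply/eqP/rowP => i; rewrite mxE.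
  have fr := basis_free (vbasisP U).
  by move/freeP: fr => /(_ (fun i => v 0 i) s0 i).
rewrite mulr_suml scaler_sumr.
transitivity (\sum_i \sum_j (v 0 i * M i j) *: (vbasis U)`_j).
  apply: eq_bigr => i _; rewrite -scalerAl {1}(coord_vbasis (Ux _ _)) ?vbasis_mem ?mem_nth ?size_tuple //.
  by rewrite scaler_sumr; apply: eq_bigr => j _; rewrite mxE scalerA.
rewrite exchange_big; apply: eq_bigr => j _; rewrite -scaler_suml scalerA; congr (_ *: _).
by have := congr1 (fun w : 'rV_m => w 0 j) vM; rewrite /= !mxE.
Qed.

(** The components u i of 1 are orthogonal idempotents. Schur's lemma makes each u i A u j at most
    one-dimensional, and i, j share a block when it is nonzero; transporters XY to a representative
    index of each block then multiply to matrix units. *)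
Lemma wedderburn : semisimple A -> exists w : wedd A, True.
Proof.
case=> n [U [Us Ud UA]].
have [u uU us] : exists2 u : 'I_n -> A, forall i, u i \in U i & 1 = \sum_i u i.
  have : 1 \in (\sum_i U i)%VS by rewrite UA memvf.
  by case/memv_sumP => u uU ->; exists u => // i; apply: uU.
have Ul i a x : x \in U i -> a * x \in U i.
  move=> xU; case: (Us i) => /subvP UU _ _; apply: UU; exact: memv_mul (memvf a) xU.
have xu i x j : x \in U i -> x * u j = (i == j)%:R *: x.
  move=> xU; pose w j := x * u j - (i == j)%:R *: x.
  have wU l : w l \in U l.
    rewrite memvB ?Ul //; case: (eqVneq i l) => [<-|_]; first by rewrite scale1r.
    by rewrite scale0r mem0v.
  have w0 : \sum_l w l = 0.
    rewrite sumrB -mulr_sumr -us mulr1 -scaler_suml (bigD1 i) //= eqxx big1 ?addr0 ?scale1r ?subrr //.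
    by move=> l /negPf li; rewrite eq_sym li.
  apply/eqP; rewrite -subr_eq0; apply/eqP.
  move/directv_sum_independent: Ud => /(_ w (fun i _ => wU i) w0 j isT); exact.
have uu i j : u i * u j = (i == j)%:R *: u i by apply: xu.
have uii i : u i * u i = u i by rewrite uu eqxx scale1r.
have u0 i : u i != 0.
  case: (Us i) => _ Ui0 _; apply: contraNneq Ui0 => ui0; rewrite -subv0; apply/subvP => x xU.
  by rewrite memv0 -[x]scale1r -[1]/(true%:R) -(eqxx i) -xu // ui0 mulr0.
(* A x is a nonzero left ideal inside the simple U j, hence contains u j. *)
have schur i j x : x != 0 -> u i * x = x -> x * u j = x ->
    exists2 y, y * x = u j & u j * y = y /\ y * u i = y.
  move=> x0 ux xuj.
  have xUj : x \in U j by rewrite -xuj Ul.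
  pose V := (amulr x @: {:A})%VS.
  have VP y : reflect (exists z, y = z * x) (y \in V).
    apply: (iffP memv_imgP) => [[z _ ->]|[z ->]]; first by exists z; rewrite lfunE.
    by exists z; rewrite ?memvf // lfunE.
  have [_ _ /(_ V)] := Us j; case.
  - apply/prodvP => a b _ /VP[z ->]; apply/VP; exists (a * z); exact: mulrA.
  - by apply/subvP => _ /VP[z ->]; apply: Ul.
  - move=> V0; have : x \in V by apply/VP; exists 1; rewrite mul1r.
    by rewrite V0 memv0 (negPf x0).
  move=> e; have : u j \in V by rewrite e.
  case/VP => y yx; exists (u j * y * u i); last by rewrite !mulrA uii -!mulrA uii.
  by rewrite -!mulrA ux -yx uii.
(* By [schur] the nonzero elements of u i A u i are invertible there; subtracting an eigenvalue of
   right multiplication by x gives an element with a nonzero left annihilator in U i, hence 0. *)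
have endo i x : u i * x = x -> x * u i = x -> exists a, x = a *: u i.
  move=> ux xui; have [Ul_i Ui0 _] := Us i.
  have xU : x \in U i by rewrite -xui Ul.
  have [|a [v vU [v0 va]]] := right_eigenvector (x := x) Ui0; first by move=> y _; apply: Ul.
  exists a; apply/eqP; rewrite -subr_eq0; apply: contraNT v0 => z0.
  set z := x - a *: u i in z0.
  have uz : u i * z = z by rewrite mulrBr ux -scalerAr uii.
  have zu : z * u i = z by rewrite mulrBl xui -scalerAl uii.
  have vu : v * u i = v by rewrite (xu i) // eqxx scale1r.
  have vz : v * z = 0 by rewrite mulrBr va -scalerAr vu subrr.
  have [y yz [uy yu]] := schur i i z z0 uz zu.
  have y0 : y != 0 by apply: contraNneq (u0 i) => y0; rewrite -yz y0 mul0r.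
  have [w wy [uw wu]] := schur i i y y0 uy yu.
  have wz : w = z by rewrite -wu -yz mulrA wy uz.
  by rewrite -vu -wy wz mulrA vz mul0r.
(* R i j says that U i and U j are isomorphic modules; its classes are the blocks. *)
pose R i j := [exists l : 'I_(\dim {:A}), u i * bs l * u j != 0].
have RP i j : reflect (exists x, u i * x * u j != 0) (R i j).
  apply: (iffP existsP) => [[l]|[x x0]]; first by exists (bs l).
  apply/existsP; apply: contraNT x0; rewrite negb_exists => /forallP nR.
  rewrite (bs_sum x) mulr_sumr mulr_suml big1 // => l _.
  by rewrite -scalerAr -scalerAl (eqP (negPn (nR l))) scaler0.
have Rsch i j : R i j -> exists x, exists2 y, [/\ u i * x = x, x * u j = x, u j * y = y & y * u i = y]
    & y * x = u j /\ x * y = u i.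
  case/RP => x x0; exists (u i * x * u j).
  have e1 : u i * (u i * x * u j) = u i * x * u j by rewrite !mulrA uii.
  have e2 : u i * x * u j * u j = u i * x * u j by rewrite -!mulrA uii.
  have [y yx [uy yu]] := schur i j _ x0 e1 e2; exists y => //; split=> //.
  have f1 : u i * (u i * x * u j * y) = u i * x * u j * y by rewrite !mulrA uii.
  have f2 : u i * x * u j * y * u i = u i * x * u j * y by rewrite -mulrA yu.
  have [a aE] := endo i _ f1 f2; rewrite aE.
  have : a *: (u i * x * u j) = u i * x * u j.
    by rewrite -{1}e1 scalerAl -aE -(mulrA (u i * x * u j) y) yx e2.
  move/eqP; rewrite -subr_eq0 -{2}[_ * _]scale1r -scalerBl scaler_eq0 (negPf x0) orbF subr_eq0.
  by move/eqP ->; rewrite scale1r.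
have Rxx i : R i i by apply/RP; exists 1; rewrite mulr1 uii.
have Rsym i j : R i j -> R j i.
  move=> /Rsch[x [y [_ _ uy yu] [yx _]]]; apply/RP; exists y.
  by rewrite uy yu; apply: contraNneq (u0 j) => y0; rewrite -yx y0 mul0r.
have Rtr i j l : R i j -> R j l -> R i l.
  move=> /Rsch[x [y [ux xuj _ _] [yx _]]] /Rsch[x' [y' [ux' xul _ _] [yx' _]]].
  apply/RP; exists (x * x'); rewrite !mulrA ux -mulrA xul.
  apply: contraNneq (u0 l) => e0; rewrite -yx' -ux' -yx -(mulrA y) e0.
  by rewrite !mulr0.
pose c i := odflt i [pick j | R i j].
have Rc i : R i (c i) by rewrite /c; case: pickP => [j|/(_ i)]; rewrite ?Rxx.
have cE i j : (c i == c j) = R i j.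
  apply/eqP/idP => [e|Rij]; first by apply: (Rtr _ (c i)) => //; rewrite e; apply: Rsym.
  have : R i =1 R j by move=> l; apply/idP/idP; apply: Rtr => //; apply: Rsym.
  by rewrite /c => /eq_pick ->; case: pickP => [//|/(_ j)]; rewrite Rxx.
have /fin_all_exists[XY XYP] : forall i, exists f : A * A, [/\ u i * f.1 = f.1,
   f.1 * u (c i) = f.1, u (c i) * f.2 = f.2 & f.2 * u i = f.2]
   /\ (f.2 * f.1 = u (c i) /\ f.1 * f.2 = u i).
  by move=> i; have [x [y a b]] := Rsch _ _ (Rc i); exists (x, y).
pose E i j := if c i == c j then (XY i).1 * (XY j).2 else 0.
have Eii i : E i i = u i by rewrite /E eqxx; have [_ []] := XYP i.
suff [w _] : exists w : wedd A, True by exists w.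
unshelve eexists (@Wedd _ A n c E _ _ _ _ _ _) => //.
- by move=> i; apply/eqP; rewrite cE Rsym.
- by move=> i j; rewrite /E => /negPf ->.
- move=> i j l m cij; rewrite /E cij eqxx.
  have [[a1 a2 a3 a4] [a5 a6]] := XYP j; have [[b1 b2 b3 b4] [b5 b6]] := XYP l.
  case: (eqVneq j l) => [jl|/negPf jl].
    rewrite -jl scale1r; case: (c j == c m); last by rewrite mulr0.
    have [[d1 d2 d3 d4] [d5 d6]] := XYP i.
    by rewrite jl in a5 *; rewrite !mulrA -(mulrA (XY i).1) a5 -jl -cij d2.
  rewrite scale0r; case: (c l == c m); last by rewrite mulr0.
  by rewrite -a4 -b1 -!mulrA (mulrA (u j)) uu jl scale0r mul0r !mulr0.
- by rewrite us; apply: eq_bigr => i _; rewrite Eii.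
- by move=> i; rewrite Eii.
move=> x i j; rewrite !Eii /E cE; case: ifP => [Rij|Rij].
  have [[a1 a2 a3 a4] [a5 a6]] := XYP j; have [[b1 b2 b3 b4] [b5 b6]] := XYP i.
  have cij : c i = c j by apply/eqP; rewrite cE.
  have [||a aE] := endo (c i) ((XY i).2 * x * (XY j).1).
  - by rewrite !mulrA b3.
  - by rewrite -mulrA cij a2.
  exists a; have -> : u i * x * u j = (XY i).1 * ((XY i).2 * x * (XY j).1) * (XY j).2.
    by rewrite -b6 -a6 !mulrA.
  by rewrite aE -scalerAr -scalerAl b2.
exists 0; rewrite scaler0; apply/eqP; apply: contraFT Rij => n0.
by apply/RP; exists x.
Qed.
End Wedderburn.

(** * Characters of the blocks *)

Section WedderburnTheory.
Variables (k : fieldType) (A : falgType k) (w : wedd A).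
Local Notation I := 'I_(wN w).
Local Notation c := (@wc _ _ w).
Local Notation E := (@wE _ _ w).
Implicit Types (i j l r : I) (x y z : A).

Lemma wEn i j : c i = c j -> E i j != 0.
Proof.
move=> cij; apply: contraNneq (wEn0 i) => e0.
by have := wEM j i cij; rewrite e0 mul0r eqxx scale1r => <-.
Qed.

Lemma wEid i j : c i = c j -> E i i * E i j = E i j.
Proof. by move=> cij; rewrite wEM // eqxx scale1r. Qed.
Lemma wEidr i j : E i j * E j j = E i j.
Proof.
case: (eqVneq (c i) (c j)) => cij; last by rewrite wE0 ?mul0r.
by rewrite wEM // eqxx scale1r.
Qed.

Fact wcf_ex i j x : exists a, E i i * x * E j j == a *: E i j.
Proof. by have [a ->] := wEs x i j; exists a. Qed.

(** Across blocks E i j = 0 determines no coefficient; the value 0 chosen there keeps [wcf]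
    linear. *)
Definition wcf i j x : k := if c i == c j then xchoose (wcf_ex i j x) else 0.

Lemma wcfP i j x : E i i * x * E j j = wcf i j x *: E i j.
Proof.
rewrite /wcf; case: eqVneq => cij; first exact/eqP/(xchooseP (wcf_ex i j x)).
by have [a ->] := wEs x i j; rewrite wE0 // !scaler0.
Qed.

Lemma wcf0 i j x : c i != c j -> wcf i j x = 0.
Proof. by rewrite /wcf => /negPf ->. Qed.

Lemma wcf_uniq i j x a : c i = c j -> E i i * x * E j j = a *: E i j -> wcf i j x = a.
Proof.
move=> cij; rewrite wcfP => /eqP; rewrite -subr_eq0 -scalerBl scaler_eq0 (negPf (wEn cij)) orbF.
by rewrite subr_eq0 => /eqP.
Qed.

Lemma lin_wcf i j : lin (wcf i j : A -> k^o).
Proof.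
move=> a x y; case: (eqVneq (c i) (c j)) => cij; last by rewrite !wcf0 // scaler0 addr0.
apply: wcf_uniq => //; rewrite mulrDr mulrDl -scalerAr -scalerAl !wcfP.
by rewrite scalerDl scalerA.
Qed.

Lemma wcf_expand x : x = \sum_i \sum_j wcf i j x *: E i j.
Proof.
rewrite -{1}[x]mul1r -{1}[1 * x]mulr1 -(wE1 w) !mulr_suml; apply: eq_bigr => i _.
by rewrite mulr_sumr; apply: eq_bigr => j _; rewrite wcfP.
Qed.

Lemma wcfE i j a b : c a = c b -> wcf i j (E a b) = ((i == a) && (j == b))%:R.
Proof.
move=> cab; case: (eqVneq (c i) (c j)) => cij; last first.
  rewrite wcf0 //; case: eqVneq => [ia|//]; case: eqVneq => [jb|//].
  by rewrite ia jb cab eqxx in cij.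
apply: wcf_uniq => //; rewrite wEM // -scalerAl.
case: (eqVneq i a) => [ia|]; last by rewrite !scale0r.
rewrite scale1r wEM ?ia // eq_sym; case: eqVneq => [->//|_].
by rewrite !scale0r.
Qed.

Lemma wcfM i j x y : wcf i j (x * y) = \sum_l wcf i l x * wcf l j y.
Proof.
case: (eqVneq (c i) (c j)) => cij; last first.
  rewrite wcf0 // big1 // => l _; case: (eqVneq (c i) (c l)) => cil; last by rewrite wcf0 ?mul0r.
  by rewrite (@wcf0 l) ?mulr0 // -cil.
apply: wcf_uniq => //; rewrite scaler_suml.
have -> : E i i * (x * y) * E j j = \sum_l E i i * (x * E l l * y) * E j j.
  by rewrite -{1}[x]mulr1 -(wE1 w) mulr_sumr mulr_suml mulr_sumr mulr_suml.
apply: eq_bigr => l _.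
case: (eqVneq (c i) (c l)) => cil; last first.
  rewrite wcf0 // mul0r scale0r.
  have := wcfP i l x; rewrite wcf0 // scale0r !mulrA => ->.
  by rewrite !mul0r.
have -> : E i i * (x * E l l * y) * E j j = (E i i * x * E l l) * (E l l * y * E j j).
  rewrite !mulrA; congr (_ * _ * _); rewrite -[in RHS]mulrA.
  by rewrite wEM // eqxx scale1r.
rewrite !wcfP -scalerAl -scalerAr wEM // eqxx scale1r scalerA. exact: erefl.
Qed.

Lemma wcf1 i : wcf i i 1 = 1.
Proof. by apply: wcf_uniq => //; rewrite mulr1 wEid // scale1r. Qed.

(** Characters are indexed by all diagonal matrix units. A sum over irreducible characters runs over
    the representatives, r with [c r == r]. *)
Definition chi r x : k := \sum_(j | c j == c r) wcf j j x.
Definition wdeg r : nat := #|[pred j | c j == c r]|.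

Lemma lin_chi r : lin (chi r : A -> k^o).
Proof. by apply: lin_big => j; apply: lin_wcf. Qed.

Lemma chi1 r : chi r 1 = (wdeg r)%:R.
Proof. by rewrite /chi (eq_bigr (fun=> 1)) ?sumr_const // => j _; apply: wcf1. Qed.

Lemma wdeg_gt0 r : (0 < wdeg r)%N.
Proof. by apply/card_gt0P; exists r; rewrite inE. Qed.

Lemma chiE r i j : c i = c j -> chi r (E i j) = ((i == j) && (c i == c r))%:R.
Proof.
move=> cij; rewrite /chi; under eq_bigr do rewrite wcfE //.
case: (eqVneq i j) => [<-|ij]; last first.
  rewrite big1 // => l _; case: (eqVneq l i) => [->|//].
  by rewrite (negPf ij).
case: (boolP (c i == c r)) => cir.
  rewrite (bigD1 i) //= !eqxx big1 ?addr0 // => l /andP[_ /negPf ->].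
  by [].
rewrite big1 // => l clr; case: (eqVneq l i) => [li|//].
by rewrite -li clr in cir.
Qed.

Lemma chiM_comm r x y : chi r (x * y) = chi r (y * x).
Proof.
rewrite /chi; under eq_bigr do rewrite wcfM; under [RHS]eq_bigr do rewrite wcfM.
rewrite (eq_bigr (fun j => \sum_(l | c l == c r) wcf j l x * wcf l j y)) => [|j cj].
  rewrite exchange_big; apply: eq_bigr => l cl.
  rewrite [RHS](bigID (fun j => c j == c r)) /= [X in _ = _ + X]big1 ?addr0.
    by apply: eq_bigr => j _; rewrite mulrC.
  by move=> j cj; rewrite wcf0 ?mul0r // (eqP cl) eq_sym.
rewrite (bigID (fun l => c l == c r)) /= [X in _ + X]big1 ?addr0 // => l cl.
by rewrite wcf0 ?mul0r // (eqP cj) eq_sym.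
Qed.

(** As a bimodule A is the sum over blocks of a simple module tensored with its dual; x acts on one
    factor and y on the other. *)
Lemma ltr_lr x y : ltr (fun z => x * z * y) = \sum_(r | c r == r) chi r x * chi r y.
Proof.
transitivity (\sum_(u : I * I | c u.1 == c u.2) wcf u.1 u.1 x * wcf u.2 u.2 y).
  rewrite (ltr_dual (I := (I * I)%type) (e := fun u => E u.1 u.2) (phi := fun u => wcf u.1 u.2)).
  - rewrite [LHS](bigID (fun u : I * I => c u.1 == c u.2)) /= [X in _ + X]big1 ?addr0.
      apply: eq_bigr => -[i j] /= /eqP cij; rewrite wcfM (bigD1 j) //= big1 ?addr0.
        rewrite wcfM (bigD1 i) //= big1 ?addr0 => [|l li]; first by rewrite wcfE // !eqxx mulr1.
        by rewrite wcfE // (negPf li) mulr0.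
      move=> l /negPf lj; rewrite wcfM big1 ?mul0r // => m _.
      by rewrite wcfE // lj andbF mulr0.
    by move=> u cu; rewrite wcf0.
  - by lin.
  - by move=> u; apply: lin_wcf.
  - by move=> z; rewrite {1}(wcf_expand z) pair_bigA.
rewrite (partition_big (fun u => c u.1) (fun r => c r == r)) /=; last by move=> u _; rewrite wcc.
apply: eq_bigr => r /eqP cr; rewrite /chi big_distrlr /= pair_big_dep /=.
apply: eq_bigl => -[i j] /=; rewrite cr andbC; case: eqVneq => [->|//] /=.
by rewrite eq_sym.
Qed.

Lemma ltr_mul x : ltr (fun z => x * z) = \sum_(r | c r == r) chi r x * (wdeg r)%:R.
Proof. by under eq_bigr do rewrite -chi1; rewrite -ltr_lr; apply: eq_ltr => z; rewrite mulr1. Qed.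

Lemma chi_root r x : chi (c r) x = chi r x.
Proof. by rewrite /chi wcc. Qed.
Lemma wdeg_root r : wdeg (c r) = wdeg r.
Proof. by rewrite /wdeg; apply: eq_card => j; rewrite !inE wcc. Qed.

Lemma chi_ltr r x : chi r x = ltr (fun z => x * z * E r r).
Proof.
rewrite ltr_lr (bigD1 (c r)) ?wcc //= big1 ?addr0 => [|s /andP[cs sr]].
  by rewrite chiE // eqxx wcc eqxx mulr1 chi_root.
rewrite chiE // eqxx /=; case: eqVneq => [e|]; last by rewrite mulr0.
by case/negP: sr; rewrite e (eqP cs).
Qed.

(** By [chi_ltr] the value is the trace of an idempotent map on A. *)
Lemma chi_idem r x : x * x = x -> exists n : nat, chi r x = n%:R.
Proof.
move=> xx; rewrite chi_ltr ltr_idem; first by eexists.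
  by lin.
by move=> z; rewrite !mulrA xx -mulrA wEidr.
Qed.

Definition we r : A := \sum_(j | c j == c r) E j j.

Lemma chi_we r s : chi r (we s) = (if c r == c s then wdeg r else 0)%:R.
Proof.
rewrite /we (lin_sum _ _ _ (lin_chi r)).
rewrite (eq_bigr (fun j => (c j == c r)%:R)); last by move=> j _; rewrite chiE // eqxx.
case: eqVneq => rs.
  rewrite (eq_bigr (fun=> 1)) => [|j /eqP ->]; last by rewrite rs eqxx.
  by rewrite sumr_const /wdeg; congr (_ *+ _); apply: eq_card => j; rewrite !inE rs.
by rewrite big1 // => j /eqP ->; rewrite eq_sym (negPf rs).
Qed.

Lemma trace_function_chi (f : A -> k^o) : lin f -> (forall x y, f (x * y) = f (y * x)) ->
  forall x, f x = \sum_(r | c r == r) f (E r r) * chi r x.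
Proof.
move=> fl fC x; have fE i j : f (E i j) = (i == j)%:R * f (E (c i) (c i)).
  case: (eqVneq (c i) (c j)) => cij; last first.
    rewrite wE0 // lin0 //; case: eqVneq => [ij|]; last by rewrite mul0r.
    by rewrite ij eqxx in cij.
  have -> : E i j = E i (c i) * E (c i) j by rewrite wEM ?wcc // eqxx scale1r.
  rewrite fC wEM ?wcc // (linZ _ _ fl) [j == i]eq_sym; case: eqVneq => [->|_]; rewrite ?scale0r ?mul0r //=.
rewrite {1}(wcf_expand x) lin_sum //.
transitivity (\sum_i wcf i i x * f (E (c i) (c i))).
  apply: eq_bigr => i _; rewrite lin_sum // (bigD1 i) //= big1 ?addr0.
    by rewrite linZ // fE eqxx mul1r.
  by move=> j /negPf ji; rewrite linZ // fE eq_sym ji mul0r scaler0.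
rewrite (partition_big c (fun r => c r == r)) /=; last by move=> i _; rewrite wcc.
apply: eq_bigr => r /eqP cr; rewrite /chi mulr_sumr; apply: eq_big => [i|i /eqP ->].
  by rewrite cr.
by rewrite mulrC.
Qed.

Lemma central_wE z i : (forall x, z * x = x * z) -> forall j, c i = c j ->
  wcf i i z = wcf j j z.
Proof.
move=> zC j cij; apply: wcf_uniq => //.
have : E i j * (E j j * z * E j j) * E j i = E i i * z * E i i.
  rewrite !mulrA wEidr -(mulrA _ (E j j)) wEid // -zC -[in RHS]zC -mulrA wEM //.
  by rewrite -[RHS]mulrA wEM // !eqxx !scale1r.
by rewrite wcfP -scalerAr -scalerAl wEidr wEM // eqxx scale1r => <-.
Qed.

End WedderburnTheory.

(** * Integrals and the trace functional *)

Section Integrals.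
Variables (k : fieldType) (H : hopfType k).
Implicit Types (X : lmodType k) (a b h : H).
Local Notation S := antipode.

Lemma ltr_rank1 (V : vectType k) (f : V -> k^o) (v : V) : lin f ->
  ltr (fun x => (f x : k) *: v) = f v.
Proof.
move=> fl; rewrite {2}(bs_sum v) lin_sum //; apply: eq_bigr => i _.
by rewrite (linZ _ _ (lin_cb i)) (linZ _ _ fl); exact: mulrC.
Qed.

(** The counit is a one-dimensional representation, so it is nonzero on exactly one diagonal
    idempotent, whose block has size one. That idempotent is the two-sided integral. *)
Lemma wedd_integral (w : wedd H) : exists2 i : 'I_(wN w), forall j, wc j = wc i -> j = i &
  [/\ eps (wE i i) = 1, forall h, h * wE i i = eps h *: wE i i
    & forall h, wE i i * h = eps h *: wE i i].
Proof.
pose E := @wE _ _ w; pose c := @wc _ _ w.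
have el : lin (eps : H -> k^o) by lin.
have [i ei] : exists i, eps (E i i) != 0.
  apply/existsP; apply: contraT; rewrite negb_exists => /forallP e0.
  rewrite -(oner_eq0 k) -(eps1 H) -(wE1 w) (lin_sum _ _ _ el) big1 // => i _.
  exact/eqP/negPn/e0.
have eE j : c j = c i -> j = i.
  move=> cj; apply/eqP/negPn/negP => ji.
  have e1 : eps (E i j) * eps (E j i) = eps (E i i).
    by rewrite -epsM wEM // eqxx scale1r.
  have e2 : eps (E j i) * eps (E i j) = eps (E j j).
    by rewrite -epsM wEM // eqxx scale1r.
  have : eps (E j j) * eps (E i i) = 0.
    by rewrite -epsM wEM // (negPf ji) scale0r; exact: (lin0 el).
  have -> : eps (E j j) = eps (E i i) by rewrite -e2 mulrC.
  move=> /eqP; rewrite mulf_eq0 orbb.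
  by rewrite (negPf ei).
have ei1 : eps (E i i) = 1.
  apply: (mulIf ei); rewrite mul1r -epsM wEM // eqxx scale1r.
  by [].
have sc (x : H) (u : k) : x = u *: E i i -> x = eps x *: E i i.
  by move=> ->; rewrite (linZ _ _ el) ei1 [_ *: 1]mulr1.
exists i => //; rewrite -/E; split=> // h.
- have -> : eps h = eps (h * E i i) by rewrite epsM ei1 mulr1.
  apply: (sc _ (wcf i i h)); rewrite -wcfP -[in LHS](mul1r h) -(wE1 w) !mulr_suml (bigD1 i) //=.
  rewrite big1 ?addr0 // => j ji; rewrite wcfP wcf0 ?scale0r //.
  by apply: contra ji => /eqP cji; apply/eqP/eE.
have -> : eps h = eps (E i i * h) by rewrite epsM ei1 mul1r.
apply: (sc _ (wcf i i h)); rewrite -wcfP -[in LHS](mulr1 h) -(wE1 w) !mulr_sumr (bigD1 i) //=.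
rewrite big1 ?addr0 // => [|j ji]; first by rewrite mulrA.
rewrite mulrA wcfP wcf0 ?scale0r //.
by apply: contra ji => /eqP cji; apply/eqP/eE.
Qed.

Section WithIntegral.
Variable L : H.
Hypotheses (epsL : eps L = 1) (Ll : forall h, h * L = eps h *: L)
  (Lr : forall h, L * h = eps h *: L).

(** Insert a counit as h2 S(h3), then absorb the pair h1, h2 into L through Delta(L h) = eps(h)
    Delta(L). *)
Lemma integral_mulr X (F : H -> H -> X) h :
    (forall a, lin (fun b => F a b)) -> (forall b, lin (fun a => F a b)) ->
  sw L (fun a b => F (a * h) b) = sw L (fun a b => F a (b * S h)).
Proof.
move=> F1 F2.
transitivity (sw h (fun t h3 => sw L (fun a b => sw t (fun h1 h2 => F (a * h1) (b * h2 * S h3))))).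
  under [RHS]eq_sw do rewrite sw_comm.
  rewrite (swA h (fun h1 h2 h3 => sw L (fun a b => F (a * h1) (b * h2 * S h3)))).
  apply/esym/(sw_cur (fun z => sw L (fun a b => F (a * z) b))); last by lin.
  move=> h1 t; rewrite sw_comm sw_scaler; apply: eq_sw => a b.
  rewrite (sw_antr (fun z => F (a * h1) (b * z))) ?mulr1 //; last by lin.
  by move=> h2 h3; rewrite mulrA.
apply: (sw_cul (fun z => sw L (fun a b => F a (b * S z)))); last by lin.
move=> t h3; rewrite -(@swM _ _ _ L t (fun u v => F u (v * S h3))); [|lin|lin].
by rewrite Lr (linZ (f := fun x => sw x _)) //; lin.
Qed.

Lemma integral_mull X (F : H -> H -> X) h :
    (forall a, lin (fun b => F a b)) -> (forall b, lin (fun a => F a b)) ->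
  sw L (fun a b => F (S h * a) b) = sw L (fun a b => F a (h * b)).
Proof.
move=> F1 F2.
transitivity (sw h (fun h1 t => sw L (fun a b => sw t (fun h2 h3 => F (S h1 * (h2 * a)) (h3 * b))))).
  apply/esym; apply: (sw_cur (fun z => sw L (fun a b => F (S z * a) b))); last by lin.
  move=> h1 t; rewrite sw_comm -(@swM _ _ _ t L (fun u v => F (S h1 * u) v)); [|lin|lin].
  by rewrite Ll (linZ (f := fun x => sw x _)) //; lin.
under eq_sw do rewrite sw_comm.
rewrite -(swA h (fun h1 h2 h3 => sw L (fun a b => F (S h1 * (h2 * a)) (h3 * b)))).
apply: (sw_cul (fun z => sw L (fun a b => F a (z * b)))); last by lin.
move=> t h3; rewrite sw_comm sw_scaler; apply: eq_sw => a b.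
rewrite (sw_antl (fun z => F (z * a) (h3 * b))) ?mul1r //; last by lin.
by move=> h1 h2; rewrite mulrA.
Qed.
End WithIntegral.

(** Radford's trace formula for a left integral of the dual; it is the regular character once S^2 =
    id. *)
Definition lam h : k := ltr (fun x => h * S (S x)).

Lemma lin_lam : lin (lam : H -> k^o).
Proof. by rewrite /lam /ltr; apply: (@lin_big _ _ k^o _ _ _ (fun h i => cb i (h * S (S (bs i))))); lin. Qed.

Lemma lamM (x y : H) : lam (x * y) = lam (y * S (S x)).
Proof.
rewrite /lam (eq_ltr (g := fun z => x * (y * S (S z)))) => [|z]; last by rewrite mulrA.
rewrite (ltr_comm (f := fun z => x * z) (g := fun z => y * S (S z))); [|lin|lin].
by apply: eq_ltr => z; rewrite !antipodeM mulrA.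
Qed.

Lemma sw_antipode2 X h (F : H -> H -> X) :
    (forall a, lin (fun b => F a b)) -> (forall b, lin (fun a => F a b)) ->
  sw (S (S h)) F = sw h (fun a b => F (S (S a)) (S (S b))).
Proof. by move=> F1 F2; rewrite !sw_antipode //; lin. Qed.

Lemma comul_sum v j l : (comul v : 'M_(_, _)) j l = \sum_i cb i v * (comul (bs i : H) : 'M_(_, _)) j l.
Proof.
rewrite comul_coef {1}(bs_sum v) (lin_sum (f := fun x => (@dbasis k H j * dbasis l) $ x : k^o)); last by lin.
apply: eq_bigr => i _; rewrite (linZ (f := fun x => (@dbasis k H j * dbasis l) $ x : k^o)); last by lin.
by rewrite comul_coef.
Qed.

(** [claim] moves S^2(y) inside the comultiplication at the price of a factor S(y1). Summing over a
    basis turns the legs of y into a second comultiplication of v, and the antipode cancels against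
    it. *)
Lemma lam_integral h : sw h (fun a b => lam b *: a) = lam h *: 1.
Proof.
have claim i y : sw h (fun a b => cb i (b * S (S y)) *: a) =
    sw y (fun y1 y2 => sw (h * S (S y2)) (fun u v => cb i v *: (u * S y1))).
  transitivity (sw y (fun y1 t => sw h (fun a b => sw t (fun p q => 
      cb i (b * S (S q)) *: (a * (S (S p) * S y1)))))).
    under [RHS]eq_sw do rewrite sw_comm.
    rewrite -(swA y (fun y1 p q => sw h (fun a b => cb i (b * S (S q)) *: (a * (S (S p) * S y1))))).
    apply/esym; apply: (sw_cul (fun z => sw h (fun a b => cb i (b * S (S z)) *: a))); last by lin.
    move=> t q; rewrite sw_comm sw_scaler; apply: eq_sw => a b.
    rewrite (sw_antr (fun z => cb i (b * S (S q)) *: (a * S z))) ?antipode1 ?mulr1 //; last by lin.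
    by move=> y1 p; rewrite antipodeM.
  apply: eq_sw => y1 y2; rewrite swM; [|lin|lin]; apply: eq_sw => a b.
  by rewrite sw_antipode2; [apply: eq_sw => p q; rewrite mulrA|lin|lin].
rewrite /lam; under eq_sw do rewrite scaler_suml.
rewrite sw_sum; under eq_bigr do rewrite claim swE.
rewrite scaler_suml exchange_big /=; under eq_bigr do rewrite exchange_big /=.
rewrite exchange_big /=; apply: eq_bigr => l _.
transitivity (sw (h * S (S (bs l))) (fun u v => sw v (fun p q => cb l q *: (u * S p)))); last first.
  rewrite -(swA _ (fun u p q => cb l q *: (u * S p))).
  apply: (sw_cul (fun z => cb l z *: 1)); last by lin.
  by move=> t q; rewrite (sw_antr (fun z => cb l q *: z)) //; lin.

under [RHS]eq_sw => u v do rewrite swE exchange_big /=.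
transitivity (\sum_j sw (h * S (S (bs l))) (fun u v => (comul v : 'M_(_, _)) j l *: (u * S (bs j)))).
  apply: eq_bigr => j _; under [RHS]eq_sw => u v do rewrite comul_sum scaler_suml.
  rewrite sw_sum; apply: eq_bigr => i _; rewrite sw_scaler; apply: eq_sw => u v.
  by rewrite scalerA mulrC.
rewrite -sw_sum; apply: eq_sw => u v; rewrite [RHS](bigD1 l) //= [X in _ = _ + X]big1 ?addr0 => [|m ml].
  by apply: eq_bigr => j _; rewrite cb_bs eqxx scale1r.
by rewrite big1 // => j _; rewrite cb_bs eq_sym (negPf ml) scale0r scaler0.
Qed.
End Integrals.

Lemma natr_inj (k : fieldType) (m n : nat) : [pchar k] =i pred0 -> m%:R = n%:R :> k -> m = n.
Proof.
move=> /pcharf0P ch.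
wlog mn : m n / (m <= n)%N => [th e|].
  by case: (leqP m n) => [|/ltnW] mn; [|apply/esym]; apply: th.
move/eqP; rewrite eq_sym -subr_eq0 -natrB // ch subn_eq0 => nm.
by apply/eqP; rewrite eqn_leq mn.
Qed.

Lemma lin_inj_surj (k : fieldType) (V : vectType k) (f : V -> V) : lin f ->
  (forall x, f x = 0 -> x = 0) -> forall y, exists x, f x = y.
Proof.
move=> fl f0 y; have fE := lin_linfun fl.
have k0 : lker (linfun f) == 0%VS.
  rewrite -subv0; apply/subvP => x; rewrite memv_ker memv0 fE => /eqP/f0 ->.
  exact: eqxx.
have : y \in limg (linfun f) by rewrite (lker0_limgf k0) memvf.
by case/memv_imgP => x _ ->; exists x; rewrite fE.
Qed.

Lemma ltr_rank_id (k : fieldType) (V : vectType k) (f : V -> V) : [pchar k] =i pred0 -> 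
  lin f -> (forall x, f (f x) = f x) -> ltr f = (\dim {:V})%:R -> f =1 id.
Proof.
move=> ch fl ff; rewrite ltr_idem // => /(natr_inj ch) d x.
have fE := lin_linfun fl.
have : x \in limg (linfun f).
  suff -> : limg (linfun f) = fullv by exact: memvf.
  by apply/eqP; rewrite -(dimv_leqif_eq (subvf _)) d.
by case/memv_imgP => y _ ->; rewrite fE.
Qed.

Lemma falg_unit (k : fieldType) (A : falgType k) (v : A) : (forall x, v * x = 0 -> x = 0) ->
  v \is a GRing.unit.
Proof.
move=> v0; have [|y vy] := lin_inj_surj (f := fun x => v * x) _ v0 1; first by lin.
apply/unitrP; exists y; split=> //; apply/eqP; rewrite -subr_eq0; apply/eqP/v0.
by rewrite mulrBr mulrA vy mul1r mulr1 subrr.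
Qed.

(** * Group-like elements *)

Section Grouplike.
Variables (k : fieldType) (H : hopfType k).
Local Notation S := antipode.
Implicit Types (g h x : H).

Lemma ev_sep x y : (forall f : hdual H, f $ x = f $ y) -> x = y.
Proof.
move=> xy; rewrite (bs_sum x) (bs_sum y); apply: eq_bigr => i _.
by rewrite -!ev_dbasis xy.
Qed.

Lemma comulM x y : comul (x * y) = comul x * comul y.
Proof. exact: rmorphM. Qed.

Lemma comul_sw h : comul h = sw h (fun a b => a \ox b).
Proof. exact: tensor_expand. Qed.

Lemma sw_ox (X : lmodType k) g (F : H -> H -> X) : comul g = g \ox g ->
  (forall a, lin (fun b => F a b)) -> (forall b, lin (fun a => F a b)) -> sw g F = F g g.
Proof. by move=> e F1 F2; rewrite /sw e tlift_ox. Qed.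

(** The condition eps g = 1 replaces g != 0 of [grouplike] because it is visibly stable under
    products; [isglP] identifies the two. *)
Definition isgl g := (eps g = 1) /\ comul g = g \ox g.

Lemma isglP g : reflect (isgl g) (g \in @grouplike k H).
Proof.
apply: (iffP andP) => [[g0 /eqP e]|[eg e]]; split=> //; last by apply/eqP.
  have : g = eps g *: g.
    rewrite -[LHS](sw_counitl g (@lin_id k H)) // sw_ox //; lin.
  move/eqP; rewrite -subr_eq0 -{1}[g]scale1r -scalerBl scaler_eq0 (negPf g0) orbF subr_eq0.
  by move/eqP.
apply: contraTneq isT => g0; have := oner_neq0 k; rewrite -eg g0.
by rewrite (lin0 (f := eps : H -> k^o)) ?eqxx //; lin.
Qed.

Lemma gl_sw (X : lmodType k) g (F : H -> H -> X) : isgl g ->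
  (forall a, lin (fun b => F a b)) -> (forall b, lin (fun a => F a b)) -> sw g F = F g g.
Proof. by case=> _; apply: sw_ox. Qed.

Lemma gl_one : isgl 1.
Proof. by split; rewrite ?eps1 // rmorph1. Qed.

Lemma gl_mul g h : isgl g -> isgl h -> isgl (g * h).
Proof. by move=> [e c] [e' c']; split; rewrite ?epsM ?e ?e' ?mulr1 // comulM c c' mul_ox. Qed.

Lemma gl_exp g n : isgl g -> isgl (g ^+ n).
Proof. by move=> gg; elim: n => [|n IH]; [exact: gl_one | rewrite exprS; apply: gl_mul]. Qed.

Lemma gl_mulS g : isgl g -> g * S g = 1.
Proof.
move=> gg; have := sw_antipoder g (@lin_id k H).
by rewrite gl_sw ?(proj1 gg) ?scale1r //; lin.
Qed.

Lemma gl_Smul g : isgl g -> S g * g = 1.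
Proof.
move=> gg; have := sw_antipodel g (@lin_id k H).
by rewrite gl_sw ?(proj1 gg) ?scale1r //; lin.
Qed.

Lemma gl_antipode g : isgl g -> isgl (S g).
Proof.
move=> gg; split; first by rewrite eps_antipode (proj1 gg).
by rewrite comul_sw sw_antipode; [rewrite gl_sw //; lin|lin|lin].
Qed.

(** If g is a combination of independent t_i with coefficients c_i, applying (f (x) id) Delta gives
    that the c_i (f(g) - f(t_i)) are the coefficients of 0. A nonzero c_i then makes every f agree
    on g and t_i. *)
Lemma gl_free (s : seq H) : uniq s -> (forall g, g \in s -> isgl g) -> free s.
Proof.
elim: s => [|g s IH] /=; first by rewrite nil_free.
case/andP=> gs us sg; have fs : free s by apply: IH => // h hs; apply: sg; rewrite inE hs orbT.
rewrite free_cons fs andbT; apply/negP => gspan.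
have gg : isgl g by apply: sg; rewrite mem_head.
pose t := in_tuple s; have gE : g = \sum_i coord t i g *: t`_i by apply: coord_span.
have ti (i : 'I_(size s)) : isgl t`_i by apply: sg; rewrite inE mem_nth ?orbT.
have c0 i : coord t i g = 0.
  apply/eqP; apply: contraNT gs => ci.
  suff -> : g = t`_i by rewrite mem_nth.
  apply: ev_sep => f; apply/eqP; rewrite -subr_eq0; apply/eqP; apply: (mulfI ci); rewrite mulr0.
  have e : \sum_j (coord t j g * (f $ g - f $ t`_j)) *: t`_j = 0.
    under eq_bigr do rewrite mulrBr scalerBl.
    rewrite sumrB; under eq_bigr do rewrite mulrC -scalerA.
    rewrite -scaler_sumr -gE.
    rewrite -(gl_sw (F := fun a b => f $ a *: b) gg); [|lin|lin].
    rewrite {1}gE (lin_sum (f := fun x => sw x (fun a b => f $ a *: b))); last by lin.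
    rewrite -sumrB big1 // => j _; rewrite (linZ (f := fun x => sw x (fun a b => f $ a *: b))); last by lin.
    by rewrite gl_sw; [rewrite scalerA subrr| | lin | lin].
  have ft : free t by [].
  by move/freeP: ft => /(_ (fun j => coord t j g * (f $ g - f $ t`_j)) e i).
have : g = 0 by rewrite gE big1 // => i _; rewrite c0 scale0r.
move=> g0; have := oner_neq0 k; rewrite -(proj1 gg) g0.
by rewrite (lin0 (f := eps : H -> k^o)) ?eqxx //; lin.
Qed.

(** More powers than dim H cannot be distinct, by linear independence of group-like elements. *)
Lemma gl_order g : isgl g -> exists2 n, (0 < n)%N & g ^+ n = 1.
Proof.
move=> gg; pose m := (\dim {:H}).+1; pose s := [seq g ^+ i | i <- iota 0 m].
have : ~~ uniq s.
  apply/negP => us; have : free s.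
    by apply: gl_free => // h /mapP[i _ ->]; apply: gl_exp.
  move/eqP => fs; have := dimvS (subvf <<s>>); rewrite fs size_map size_iota.
  by rewrite ltnn.
have U := gl_mulS gg.
move/(uniqPn 0) => [i [j [ij js]]]; rewrite size_map size_iota in js.
rewrite !(nth_map 0%N) ?size_iota ?(ltn_trans ij) // !nth_iota ?(ltn_trans ij) // !add0n => e.
exists (j - i)%N; first by rewrite subn_gt0.
have gi n : g ^+ n * S g ^+ n = 1.
  by elim: n => [|n IH]; rewrite ?mulr1 // exprS exprSr mulrA -(mulrA g) IH mulr1.
have := congr1 (fun x => x * S g ^+ i) e; rewrite gi.
by rewrite -{1}(subnK (ltnW ij)) exprD -mulrA gi mulr1 => <-.
Qed.
End Grouplike.

(** * Radford's formula for S^4 *)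

Section Modular.
Variables (k : fieldType) (H : hopfType k) (L : H).
Hypotheses (epsL : eps L = 1) (Ll : forall h, h * L = eps h *: L)
  (Lr : forall h, L * h = eps h *: L).
Local Notation S := antipode.
Implicit Types (g h x : H).

Let llam : lin (@lam k H : H -> k^o) := @lin_lam k H.

Lemma lam_L : lam L = 1.
Proof.
rewrite /lam (eq_ltr (g := fun x => eps x *: L)) => [|x]; last by rewrite Lr !eps_antipode.
by rewrite (ltr_rank1 (f := eps : H -> k^o)) ?epsL //; lin.
Qed.

(** The two legs of L are dual bases for the trace form; injectivity of S and nondegeneracy of [lam]
    are read off from this. *)
Lemma lam_dual h : sw L (fun a b => lam (b * S h) *: a) = h.
Proof.
rewrite -(integral_mulr Lr (F := fun a b => lam b *: a)); [|lin|lin].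
under eq_sw do rewrite scalerAl.
by rewrite -sw_mulr lam_integral lam_L scale1r mul1r.
Qed.

Lemma antipode_inj h : S h = 0 -> h = 0.
Proof.
move=> Sh; rewrite -(lam_dual h) Sh swE big1 // => i _; rewrite big1 // => j _.
by rewrite mulr0 (lin0 llam) scale0r scaler0.
Qed.

Lemma antipode_surj h : exists x, S x = h.
Proof. by apply: lin_inj_surj (@antipode_inj) _; lin. Qed.

Lemma lam_nondeg h : (forall x, lam (x * h) = 0) -> h = 0.
Proof.
have [y <-] := antipode_surj h => l0; rewrite -(lam_dual y).
suff -> : sw L (fun a b => lam (b * S y) *: a) = 0 by rewrite -[RHS](lin0 (f := S)) //; lin.
by rewrite swE big1 // => i _; rewrite big1 // => j _; rewrite l0 scale0r scaler0.
Qed.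

(** The distinguished group-like element of H. *)
Definition dist : H := sw L (fun a b => lam a *: b).

Lemma lam_dist (mu : H -> k^o) : lin mu -> (forall h, sw h (fun a b => (mu b : k) *: a) = (mu h : k) *: 1) ->
  forall h, mu (h * dist) = mu L * lam (S h).
Proof.
move=> ml mi h; rewrite /dist sw_mull (sw_lin _ _ ml).
transitivity (sw L (fun a b => lam (S h * a) * mu b : k^o)).
  rewrite (integral_mull Ll (F := fun a b => lam a * mu b : k^o)); [|lin|lin].
  by apply: eq_sw => a b; rewrite -scalerAr linZ.
transitivity (lam (S h * sw L (fun a b => (mu b : k) *: a)) : k^o).
  rewrite sw_mull (sw_lin _ _ llam); apply: eq_sw => a b.
  by rewrite -scalerAr (linZ _ _ llam) mulrC.
by rewrite mi -scalerAr mulr1 (linZ _ _ llam).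
Qed.

Lemma lam_antipode h : lam (S h) = lam (h * dist).
Proof. by rewrite (lam_dist llam) ?lam_L ?mul1r // => x; apply: lam_integral. Qed.

(** [lamM] says that [lam] is a trace twisted by S^2. Applying it before and after S, through
    [lam_antipode], doubles the twist. As L is two-sided, the only modular element left in Radford's
    formula is [dist]. *)
Lemma antipode4 h : h * dist = dist * S (S (S (S h))).
Proof.
apply/eqP; rewrite -subr_eq0; apply/eqP/lam_nondeg => x.
rewrite mulrBr (linB _ _ llam) !mulrA -lam_antipode antipodeM lamM -antipodeM lam_antipode.
by rewrite -mulrA lamM subrr.
Qed.

Lemma left_integral_uniq (mu : H -> k^o) : lin mu ->
  (forall h, sw h (fun a b => (mu b : k) *: a) = (mu h : k) *: 1) ->
  forall h, mu h = mu L * lam h.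
Proof.
move=> ml mi h.
have [|x0|y <-] := @lin_inj_surj _ _ (fun x => x * dist) _ _ h; first by lin.
  move=> xd; apply/antipode_inj/antipode_inj/antipode_inj/lam_nondeg => z.
  have [y <-] := antipode_surj z.
  by rewrite -(lamM (S x0)) -antipodeM lam_antipode -mulrA xd mulr0 (lin0 llam).
by rewrite lam_dist // lam_antipode.
Qed.

Lemma lam_right h : sw h (fun a b => lam a *: b) = lam h *: dist.
Proof.
apply: ev_sep => f; pose mu x : k^o := f $ (sw x (fun a b => lam a *: b)).
have ml : lin mu by rewrite /mu; lin.
rewrite -[LHS]/(mu h) (@left_integral_uniq mu) //.
  by rewrite evZ; exact: mulrC.
move=> x; rewrite /mu.
under eq_sw => a b do rewrite ev_sw sw_scalel.
rewrite -(swA x (fun a c d => f $ (lam c *: d) *: a)).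
rewrite ev_sw sw_scalel; apply: eq_sw => t d.
under eq_sw => a c do rewrite evZ mulrC -scalerA.
by rewrite -sw_scaler lam_integral scalerA evZ mulrC.
Qed.

Lemma dist_gl : isgl dist.
Proof.
split.
  rewrite /dist eps_sw -lam_L.
  by apply: (sw_cur (fun x => lam x : k^o)) => // a b; rewrite epsZ mulrC.
rewrite comul_sw {1}/dist (sw_lin (f := fun x => sw x (fun a b => a \ox b)) L _ ltac:(lin)).
under eq_sw => a b do rewrite (linZ (f := fun x => sw x (fun a b => a \ox b)) _ _ ltac:(lin)) sw_scaler.
rewrite -(swA L (fun a c d => lam a *: (c \ox d))).
under eq_sw => t d do under eq_sw => a c do rewrite -(linZ (f := fun x => x \ox d) _ _ ltac:(lin)).
under eq_sw => t d do rewrite -(sw_lin (f := fun x => x \ox d) t _ ltac:(lin)) lam_right (linZ (f := fun x => x \ox d) _ _ ltac:(lin)).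
by rewrite {2}/dist (sw_lin (f := fun x => dist \ox x) L _ ltac:(lin)); apply: eq_sw => a b; rewrite (linZ (f := fun x => dist \ox x) _ _ ltac:(lin)).
Qed.

Lemma antipode_finite_order : exists2 M, (0 < M)%N & forall h, iter M (fun x => S (S (S (S x)))) h = h.
Proof.
have [M M0 dM] := gl_order dist_gl; exists M => // h.
suff : forall m, h * dist ^+ m = dist ^+ m * iter m (fun x => S (S (S (S x)))) h.
  by move/(_ M); rewrite dM mulr1 mul1r.
elim=> [|m IH]; first by rewrite mulr1 mul1r.
by rewrite exprSr mulrA IH -mulrA antipode4 mulrA -exprSr.
Qed.
End Modular.

(** * Roots of unity and eigenvalue multiplicities *)

Section RootsOfUnity.

Lemma closed_prim_root (k : closedFieldType) (N : nat) : [pchar k] =i pred0 -> (0 < N)%N ->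
  exists z : k, N.-primitive_root z.
Proof.
move=> /pcharf0P ch N0; pose p : {poly k} := 'X^N - 1.
have [r Dp] := closed_field_poly_normal p.
move: Dp; rewrite (monicP (monicXnsubC 1 N0)) scale1r => Dp.
have rn1 : all N.-unity_root r by apply/allP => z; rewrite -root_prod_XsubC -Dp.
have sz_r : (N < (size r).+1)%N.
  by rewrite -(size_prod_XsubC r id) -Dp size_XnsubC.
have [|z] := hasP (has_prim_root N0 rn1 _ sz_r); last by exists z.
rewrite -separable_prod_XsubC -Dp separable_Xn_sub_1 //.
by rewrite ch -lt0n.
Qed.

Lemma intr_eq0_pchar0 (k : fieldType) (m : int) : [pchar k] =i pred0 ->
  (m%:~R == 0 :> k) = (m == 0).
Proof. by move/pcharf0P => ch; case: m => n; rewrite ?NegzE ?rmorphN ?oppr_eq0 /= ?ch. Qed.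

(* The gcd with X^N - 1 transfers a vanishing sum of roots of unity from k to
   the algebraic numbers, where each summand below is a squared modulus. *)
Lemma int_poly_root_unity (k : closedFieldType) (N : nat) (w : k) (P : {poly int}) :
    [pchar k] =i pred0 -> (0 < N)%N -> w ^+ N = 1 -> (map_poly intr P).[w] = 0 ->
  exists2 z : algC, z ^+ N = 1 & (map_poly intr P).[z] = 0.
Proof.
have mapM (R : nzRingType) (p q : {poly int}) :
  map_poly intr (p * q) = map_poly intr p * map_poly intr q :> {poly R} by exact: rmorphM.
have mapD (R : nzRingType) (p q : {poly int}) :
  map_poly intr (p + q) = map_poly intr p + map_poly intr q :> {poly R} by exact: rmorphD.
have mapZ (R : nzRingType) a (p : {poly int}) :
  map_poly intr (a *: p) = a%:~R *: map_poly intr p :> {poly R} by exact: map_polyZ.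
have mapC (R : nzRingType) a : map_poly intr a%:P = (a%:~R)%:P :> {poly R} by exact: map_polyC.
move=> ch N0 wN Pw; pose Q : {poly int} := 'X^N - 1.
have Qmap (R : nzRingType) : map_poly intr Q = 'X^N - 1 :> {poly R}.
  by rewrite rmorphB rmorph1 /= map_polyXn.
pose P' : {poly rat} := map_poly intr P; pose Q' : {poly rat} := map_poly intr Q.
have [cop|ncop] := boolP (coprimep P' Q').
  have [[u v] /= uv] := Bezout_eq1_coprimepP _ _ cop.
  have [u' [a a0 ua]] := rat_poly_scale u; have [v' [b b0 vb]] := rat_poly_scale v.
  have e : b *: (u' * P) + a *: (v' * Q) = (a * b)%:P.
    apply: (map_inj_poly (f := intr : int -> rat)) => //; first exact: intr_inj.
    rewrite mapD !mapZ !mapM mapC rmorphM /=.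
    have a0' : a%:~R != 0 :> rat by rewrite intr_eq0.
    have b0' : b%:~R != 0 :> rat by rewrite intr_eq0.
    have : (a%:~R * b%:~R) *: (u * P' + v * Q') = (a%:~R * b%:~R)%:P :> {poly rat}.
      by rewrite uv -mul_polyC mulr1.
    rewrite ua vb scalerDr -!scalerAl !scalerA mulfK // => <-.
    by rewrite [a%:~R * b%:~R]mulrC mulfK.
  have := congr1 (fun p : {poly int} => (map_poly intr p).[w] : k) e.
  rewrite /= mapD !mapZ !mapM Qmap mapC !hornerE Pw wN /=.
  rewrite subrr !mulr0 addr0 => /esym/eqP.
  by rewrite intr_eq0_pchar0 // mulf_eq0 (negPf a0) (negPf b0).
pose g := map_poly (ratr : rat -> algC) (gcdp P' Q').
have sg : size g != 1%N by rewrite size_map_poly.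
have [z /rootP gz] := closed_rootP g sg.
have dz (R : {poly rat}) : gcdp P' Q' %| R -> (map_poly (ratr : rat -> algC) R).[z] = 0.
  by move=> /dvdpP[T ->]; rewrite rmorphM /= hornerM gz mulr0.
have ratint (R : {poly int}) : map_poly (ratr : rat -> algC) (map_poly intr R) = map_poly intr R.
  by rewrite -map_poly_comp; apply: eq_map_poly => m /=; rewrite ratr_int.
exists z; last by rewrite -ratint dz // dvdp_gcdl.
have := dz _ (dvdp_gcdr P' Q'); rewrite ratint Qmap !hornerE.
by move/eqP; rewrite subr_eq0 => /eqP.
Qed.
End RootsOfUnity.

Section Fourier.
Variables (k : fieldType) (A : algType k) (N : nat) (w : k) (e b : A).
Hypotheses (N0 : N%:R != 0 :> k) (wN : N.-primitive_root w) (ee : e * e = e) (eb : e * b = b)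
  (be : b * e = b) (bN : b ^+ N = e).

Let wj (j : nat) := (w ^+ j)^-1.
(** Discrete Fourier transform: the projection onto the eigenvalue w^j of b inside the corner of
    e. *)
Definition fproj (j : nat) : A := N%:R^-1 *: \sum_(i < N) (w ^+ (i * j))^-1 *: (e * b ^+ i).

Let Npos : (0 < N)%N := prim_order_gt0 wN.
Let w0 j : w ^+ j != 0.
Proof. by rewrite expf_eq0 (prim_root_eq0 wN) (gtn_eqF Npos) andbF. Qed.

Lemma fproj_mul j : b * fproj j = w ^+ j *: fproj j.
Proof.
rewrite /fproj -scalerAr scalerA mulrC -scalerA; congr (_ *: _).
rewrite mulr_sumr scaler_sumr.
pose F i := w ^+ j *: ((w ^+ (i * j))^-1 *: (e * b ^+ i)).
transitivity (\sum_(i < N) F i.+1).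
  apply: eq_bigr => i _; rewrite /F -scalerAr !scalerA mulrA be -{1}eb -mulrA -exprS.
  by rewrite mulSn exprD invfM mulVKf.
have FN : F N = F 0.
  by rewrite /F bN mul0n exprM (prim_expr_order wN) expr1n ee mulr1.
have e1 := @big_ord_recr _ 0 +%R N (fun i : 'I_N.+1 => F i).
have e2 := @big_ord_recl _ 0 +%R N (fun i : 'I_N.+1 => F i).
rewrite e1 in e2; apply: (@addrI _ (F 0)).
transitivity (\sum_(i < N) F i + F N); first exact: esym e2.
by rewrite FN addrC.
Qed.

Lemma fproj_e j : e * fproj j = fproj j.
Proof.
rewrite /fproj -scalerAr mulr_sumr; congr (_ *: _); apply: eq_bigr => i _.
by rewrite -scalerAr mulrA ee.
Qed.

Lemma fproj_exp i j : b ^+ i * fproj j = w ^+ (i * j) *: fproj j.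
Proof.
elim: i => [|i IH]; first by rewrite mul1r mul0n scale1r.
by rewrite exprSr -mulrA fproj_mul -scalerAr IH scalerA mulSn exprD.
Qed.

Lemma fproj_idem j : fproj j * fproj j = fproj j.
Proof.
rewrite {1}/fproj -scalerAl mulr_suml (eq_bigr (fun=> fproj j)) => [|i _]; last first.
  by rewrite -scalerAl -mulrA fproj_exp -scalerAr fproj_e scalerA mulVf ?scale1r.
by rewrite sumr_const card_ord -scaler_nat scalerA mulVf ?scale1r.
Qed.

Lemma fproj_sum (m : 'I_N) : e * b ^+ m = \sum_(j < N) w ^+ (m * j) *: fproj j.
Proof.
transitivity (\sum_(i < N) (N%:R^-1 * \sum_(j < N) w ^+ (m * j) * (w ^+ (i * j))^-1) *: (e * b ^+ i)).
  rewrite (bigD1 m) //= [X in _ = _ + X]big1 ?addr0 => [|i im].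
    have -> : \sum_(j < N) w ^+ (m * j) * (w ^+ (m * j))^-1 = N%:R.
      by rewrite (eq_bigr (fun=> 1)) ?sumr_const ?card_ord // => j _; rewrite mulfV.
    by rewrite mulVf ?scale1r.
  pose z := w ^+ m / w ^+ i.
  have zE (j : nat) : w ^+ (m * j) * (w ^+ (i * j))^-1 = z ^+ j.
    by rewrite exprMn exprVn -!exprM.
  rewrite (eq_bigr (fun j : 'I_N => z ^+ j)) => [|j _]; last exact: zE.
  have z1 : z != 1.
    rewrite /z -(inj_eq (mulIf (w0 i))) mulfVK // mul1r (eq_prim_root_expr wN) !modn_small //.
    by rewrite eq_sym.
  have : (z - 1) * \sum_(j < N) z ^+ j = 0.
    by rewrite -subrX1 -zE mulnC exprM (prim_expr_order wN) expr1n mulnC exprM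
       (prim_expr_order wN) expr1n invr1 mulr1 subrr.
  move/eqP; rewrite mulf_eq0 subr_eq0 (negPf z1) /= => /eqP ->.
  by rewrite mulr0 scale0r.
rewrite /fproj; under [RHS]eq_bigr => j _ do rewrite scalerA scaler_sumr.
rewrite exchange_big; apply: eq_bigr => i _; rewrite mulr_sumr scaler_suml.
by apply: eq_bigr => j _; rewrite scalerA mulrA [N%:R^-1 * _]mulrC.
Qed.
End Fourier.

Section Positivity.
Variables (k : closedFieldType) (A : falgType k) (w : wedd A).
Hypothesis ch0 : [pchar k] =i pred0.
Local Notation E := (@wE _ _ w).
Implicit Types (x y z : A) (r i j : 'I_(wN w)).

Lemma we_E r i j : we r * E i j = (wc i == wc r)%:R *: E i j.
Proof.
rewrite /we mulr_suml; case: (boolP (wc i == wc r)) => ir.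
  rewrite (bigD1 i) //= big1 ?addr0 => [|l /andP[_ li]].
    by case: (eqVneq (wc i) (wc j)) => ij; [rewrite wEid ?scale1r | rewrite (wE0 ij) mulr0 scaler0].
  by rewrite wEM // (negPf li) scale0r.
rewrite scale0r big1 // => l lr; rewrite wEM //; case: eqVneq => [li|]; last by rewrite scale0r.
by rewrite -li lr in ir.
Qed.

Lemma E_we r i j : E i j * we r = (wc j == wc r)%:R *: E i j.
Proof.
rewrite /we mulr_sumr; case: (boolP (wc j == wc r)) => jr.
  rewrite (bigD1 j) //= big1 ?addr0 => [|l /andP[_ lj]].
    by rewrite wEidr scale1r.
  case: (eqVneq (wc i) (wc j)) => ij; last by rewrite wE0 ?mul0r.
  by rewrite wEM // eq_sym (negPf lj) scale0r.
rewrite scale0r big1 // => l lr.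
case: (eqVneq (wc i) (wc j)) => ij; last by rewrite wE0 ?mul0r.
by rewrite wEM //; case: eqVneq => [jl|]; [rewrite jl lr in jr | rewrite scale0r].
Qed.

Lemma we_central r x : we r * x = x * we r.
Proof.
rewrite (wcf_expand w x) mulr_sumr mulr_suml; apply: eq_bigr => i _.
rewrite mulr_sumr mulr_suml; apply: eq_bigr => j _; rewrite -scalerAr -scalerAl we_E E_we.
case: (eqVneq (wc i) (wc j)) => [->//|ij].
by rewrite wE0 // !scaler0.
Qed.

Lemma we_idem r : we r * we r = we r.
Proof.
rewrite {2 3}/we mulr_sumr; apply: eq_bigr => j jr.
by rewrite we_E jr scale1r.
Qed.

Lemma chi_mul_we r x : chi r (x * we r) = chi r x.
Proof.
apply: eq_bigr => j jr; rewrite wcfM (bigD1 j) //= big1 ?addr0 => [|l lj].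
  have -> : wcf j j (we r) = 1; last by rewrite mulr1.
  by apply: wcf_uniq => //; rewrite -mulrA we_E jr !scale1r wEidr.
rewrite (_ : wcf l j (we r) = 0) ?mulr0 //.
case: (eqVneq (wc l) (wc j)) => llj; last by rewrite wcf0.
apply: wcf_uniq => //; rewrite -mulrA we_E -scalerAr wEM // (negPf lj).
by rewrite !scale0r scaler0.
Qed.

(** On block r the central element b^N is a scalar s. Multiplying b by an N-th root t of 1/s gives
    eigenvalues z^j with multiplicities n j, and z^((N-1)j) for the inverse; t cancels in the
    product of the two characters. *)
Lemma chi_finite_order (b : A) (N : nat) (z : k) r : b \is a GRing.unit ->
    (forall x, b ^+ N * x = x * b ^+ N) -> N.-primitive_root z ->
  exists2 n : 'I_N -> nat, (\sum_j n j = wdeg r)%N &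
    chi r b * chi r b^-1 =
    (\sum_j (n j)%:R * z ^+ j) * (\sum_j (n j)%:R * z ^+ (N.-1 * j)).
Proof.
move=> ub bC zN; have N0 := prim_order_gt0 zN; have NR := prim_root_natf_neq0 zN.
pose e : A := we r; pose s := wcf r r (b ^+ N).
have be : b ^+ N * e = s *: e.
  rewrite /e /we mulr_sumr scaler_sumr; apply: eq_bigr => j /eqP jr.
  rewrite -(wEidr j j) mulrA bC wcfP (central_wE bC jr).
  by rewrite wEidr.
have s0 : s != 0.
  apply/eqP => s0; have : b ^- N * (b ^+ N * e) = 0 by rewrite be s0 scale0r mulr0.
  rewrite mulrA mulVr ?unitrX // mul1r => e0.
  have := chi_we r r; rewrite -/e e0 eqxx (lin0 (lin_chi r)) => /esym/eqP.
  by rewrite (proj1 (pcharf0P _) ch0) (gtn_eqF (wdeg_gt0 r)).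
have [t tN] : exists t, t ^+ N = s^-1.
  have [|t] := closed_rootP ('X^N - (s^-1)%:P) _; first by rewrite size_XnsubC // eqSS -lt0n.
  by rewrite rootE !hornerE subr_eq0 => /eqP; exists t.
have t0 : t != 0.
  apply/eqP => t0; move: tN; rewrite t0 expr0n (gtn_eqF N0) => /eqP.
  by rewrite eq_sym invr_eq0 (negPf s0).
pose B := t *: (b * e).
have eC x : e * x = x * e by apply: we_central.
have ee : e * e = e by apply: we_idem.
have eB : e * B = B by rewrite /B -scalerAr eC -mulrA ee.
have Be : B * e = B by rewrite -eC.
have Bn n : (0 < n)%N -> B ^+ n = t ^+ n *: (b ^+ n * e).
  case: n => // n _; elim: n => [|n IH]; first by rewrite !expr1.
  rewrite exprS IH /B -scalerAl -scalerAr scalerA -exprS; congr (_ *: _).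
  by rewrite -mulrA (mulrA e) eC -!mulrA ee mulrA -exprS.
have BN : B ^+ N = e by rewrite Bn // be scalerA tN mulVf ?scale1r.
have fp := fproj_sum e B NR zN.
have nj (j : 'I_N) : exists m : nat, chi r (fproj N z e B j) = m%:R.
  by apply: chi_idem; apply: (fproj_idem NR zN ee eB Be BN).
have /fin_all_exists[n nE] := nj; exists n.
  apply: (natr_inj ch0); rewrite -chi1 -chi_mul_we mul1r -/e.
  have := fp (Ordinal N0); rewrite mulr1 => ->; rewrite (lin_sum _ _ _ (lin_chi r)) natr_sum.
  by apply: eq_bigr => j _; rewrite mul0n scale1r nE.
have chs (m : 'I_N) : chi r (e * B ^+ m) = \sum_j (n j)%:R * z ^+ (m * j).
  rewrite fp (lin_sum _ _ _ (lin_chi r)); apply: eq_bigr => j _.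
  by rewrite (linZ _ _ (lin_chi r)) nE; apply: mulrC.
have eB1 : e * B ^+ (1 %% N) = B.
  have [N1|N1] := eqVneq N 1%N; last first.
    by rewrite modn_small ?expr1 // ltn_neqAle eq_sym N1.
  by move: BN; rewrite N1 modn1 mulr1 expr1.
have h1 : chi r b = t^-1 * \sum_j (n j)%:R * z ^+ j.
  have mN : (1 %% N < N)%N by rewrite ltn_mod.
  have := chs (Ordinal mN); rewrite /= eB1 => e1.
  rewrite (eq_bigr (fun j : 'I_N => (n j)%:R * z ^+ j)) in e1; last first.
    by move=> j _; rewrite exprM (prim_expr_mod zN).
  rewrite -e1 -chi_mul_we -/e (linZ _ _ (lin_chi r)).
  by rewrite [RHS]mulrA mulVf // mul1r.
have h2 : chi r b^-1 = t * \sum_j (n j)%:R * z ^+ (N.-1 * j).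
  have N2 : (N.-1 < N)%N by rewrite prednK.
  rewrite -(chs (Ordinal N2)) /= -chi_mul_we -/e.
  have -> : e * B ^+ N.-1 = t^-1 *: (b^-1 * e).
    have BB : B * (t^-1 *: (b^-1 * e)) = e.
      rewrite /B -scalerAl -scalerAr scalerA mulfV // scale1r -mulrA (mulrA e) eC.
      by rewrite -!mulrA ee mulrA mulrV // mul1r.
    rewrite -{1}BB -[RHS]mul1r; have comm : e * B ^+ N.-1 = B ^+ N.-1 * e by rewrite eC.
    rewrite BB comm -{1}BB mulrA -exprSr prednK // BN mul1r.
    by rewrite -scalerAr mulrA eC -mulrA ee.
  rewrite (linZ _ _ (lin_chi r)).
  by rewrite [RHS]mulrA mulfV // mul1r.
by rewrite h1 h2 mulrACA mulVf // mul1r.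
Qed.
End Positivity.

(** * The regular character *)

Section TensorTrace.
Variable k : fieldType.

Lemma ltr_tmap (U V : vectType k) (f : U -> U) (g : V -> V) : lin f -> lin g ->
  ltr (tlift (fun u v => f u \ox g v)) = ltr f * ltr g.
Proof.
move=> fl gl; pose phi (ij : _ * _) (t : tensor U V) : k^o := (t : 'M_(_, _)) ij.1 ij.2.
have bb : bilinear_map (fun u v => f u \ox g v) by apply: lin2_bilinear; lin.
rewrite (@ltr_dual _ _ _ _ (fun ij => bs ij.1 \ox bs ij.2) phi).
- rewrite /ltr big_distrlr /= pair_bigA; apply: eq_bigr => -[i j] _ /=.
  by rewrite tlift_ox // /phi ox.unlock mxE.
- by move=> a x y; rewrite linearP.
- by move=> [i j] a x y; rewrite /phi !mxE.
by move=> x; rewrite {1}(tensor_expand x) tlift.unlock pair_bigA.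
Qed.

Lemma lin_tensor_eq (U V : vectType k) (X : lmodType k) (f g : tensor U V -> X) : lin f -> lin g ->
  (forall u v, f (u \ox v) = g (u \ox v)) -> f =1 g.
Proof. by move=> fl gl; apply: (tensor_eq (f := lpack fl) (g := lpack gl)). Qed.

Lemma lin_tlift (U V : vectType k) (X : lmodType k) (b : U -> V -> X) : lin (tlift b).
Proof. by move=> a x y; rewrite linearP. Qed.
End TensorTrace.

Section RegularCharacter.
Variables (k : fieldType) (H : hopfType k).
Implicit Types (h x y : H).
Local Notation S := antipode.

Definition rho h : k := ltr (fun x => h * x).

Lemma lin_rho : lin (rho : H -> k^o).
Proof. by rewrite /rho /ltr; apply: (@lin_big _ _ k^o _ _ _ (fun h i => cb i (h * bs i))); lin. Qed.

Lemma rhoC x y : rho (x * y) = rho (y * x).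
Proof.
rewrite /rho (eq_ltr (g := fun z => x * (y * z))) => [|z]; last by rewrite mulrA.
rewrite (ltr_comm (f := fun z => x * z) (g := fun z => y * z)); [|lin|lin].
by apply: eq_ltr => z; rewrite mulrA.
Qed.

Lemma rho1 : rho 1 = (\dim {:H})%:R.
Proof. by rewrite -ltr_id; apply: eq_ltr => x; rewrite mul1r. Qed.

(** Phi is an isomorphism from H (x) H, with H acting on the left factor only, to H (x) H with the
    diagonal action; compare traces. *)
Lemma rho_conv h : sw h (fun a b => rho a * rho b : k^o) = (\dim {:H})%:R * rho h.
Proof.
pose Phi := tlift (fun x y : H => sw x (fun a b => a \ox (b * y))).
pose Psi := tlift (fun x y : H => sw x (fun a b => a \ox (S b * y))).
have bP : bilinear_map (fun x y : H => sw x (fun a b => a \ox (b * y))) by apply: lin2_bilinear; lin.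
have bQ : bilinear_map (fun x y : H => sw x (fun a b => a \ox (S b * y))) by apply: lin2_bilinear; lin.
have bM : bilinear_map (fun x y : H => (h * x) \ox y) by apply: lin2_bilinear; lin.
have lP : lin Phi by exact: lin_tlift.
have lQ : lin Psi by exact: lin_tlift.
have PQ : forall t, Phi (Psi t) = t.
  apply: lin_tensor_eq => [||x y]; [by apply: lin_comp; apply: lin_tlift | by [] |].
  rewrite /Psi tlift_ox // (sw_lin x _ lP).
  under eq_sw => a b do rewrite /Phi tlift_ox //.
  rewrite (swA x (fun a b c => a \ox (b * (S c * y)))).
  apply: (sw_cur (fun z => z \ox y)) => [a b|]; last by lin.
  rewrite (sw_antr (fun z => a \ox (z * y))) ?mul1r //; last by lin.
  by move=> c d; rewrite mulrA.
have QP : forall t, Psi (Phi t) = t.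
  apply: lin_tensor_eq => [||x y]; [by apply: lin_comp; apply: lin_tlift | by [] |].
  rewrite /Phi tlift_ox // (sw_lin x _ lQ).
  under eq_sw => a b do rewrite /Psi tlift_ox //.
  rewrite (swA x (fun a b c => a \ox (S b * (c * y)))).
  apply: (sw_cur (fun z => z \ox y)) => [a b|]; last by lin.
  rewrite (sw_antl (fun z => a \ox (z * y))) ?mul1r //; last by lin.
  by move=> c d; rewrite mulrA.
pose D t := sw h (fun a b => tlift (fun x y : H => (a * x) \ox (b * y)) t).
have DP : forall t, D (Phi t) = Phi (tlift (fun x y => (h * x) \ox y) t).
  apply: lin_tensor_eq => [||x y].
  - by apply: lin_sw => a b; apply: lin_comp; apply: lin_tlift.
  - by apply: lin_comp; apply: lin_tlift.
  rewrite /Phi !tlift_ox // swM; [|lin|lin]; rewrite /D; apply: eq_sw => a b.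
  rewrite (sw_lin x _ (lin_tlift _)); apply: eq_sw => c d.
  by rewrite tlift_ox; [rewrite mulrA | apply: lin2_bilinear; lin].
transitivity (ltr D).
  rewrite /D.
  under [RHS]eq_ltr => t do rewrite swE.
  rewrite swE ltr_bigsum; apply: eq_bigr => i _; rewrite ltr_bigsum; apply: eq_bigr => j _.
  by rewrite ltrZ ltr_tmap; [exact: erefl|lin|lin].
rewrite -(eq_ltr (f := fun t => D (Phi (Psi t)))) => [|t]; last by rewrite PQ.
rewrite (eq_ltr (g := fun t => Phi (tlift (fun x y => (h * x) \ox y) (Psi t)))) => [|t]; last by rewrite DP.
rewrite (ltr_comm (f := Phi)); [|exact: lin_tlift|by apply: lin_comp; apply: lin_tlift].
rewrite (eq_ltr (g := tlift (fun x y => (h * x) \ox y))) => [|t]; last by rewrite QP.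
by rewrite (ltr_tmap (g := id)) //; [rewrite ltr_id mulrC | lin].
Qed.

Lemma sw_hdual (f : hdual H) x y : sw f (fun a b => a $ x * b $ y : k^o) = f $ (x * y).
Proof.
rewrite /ev -hdual_comulE /evl -[RHS]/(ev _ _) (sw_lin (f := fun g => g $ y : k^o) f (fun a b => a $ x *: b)); last by lin.
by apply: eq_sw => a b; rewrite evfZ.
Qed.

Lemma ltr_hdual (G : hdual H -> hdual H) (F : H -> H) : lin G ->
  (forall g h, G g $ h = g $ (F h)) -> ltr G = ltr F.
Proof.
move=> Gl GF; rewrite (@ltr_dual _ _ _ _ (@dbasis k H) (fun i g => g $ (bs i))) //.
- by apply: eq_bigr => i _; rewrite GF ev_dbasis.
- by move=> i; lin.
move=> g; apply: ev_inj => h; rewrite evf_sum {1}(bs_sum h) ev_sum.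
by apply: eq_bigr => i _; rewrite evZ evfZ ev_dbasis mulrC.
Qed.

End RegularCharacter.

(** * The antipode of a semisimple Hopf algebra is involutive (Larson and Radford) *)

Section LarsonRadford.
Import order.Order.TTheory Num.Theory.
Variables (k : closedFieldType) (H : hopfType k) (w : wedd H).
Hypothesis ch0 : [pchar k] =i pred0.
Implicit Types (h x y : H).
Local Notation S := antipode.
Local Notation E := (@wE _ _ w).

Lemma rho_wcf x : rho x = \sum_i wcf (w := w) i i x * (wdeg i)%:R.
Proof.
rewrite /rho (ltr_mul w) [RHS](partition_big (@wc _ _ w) (fun r => wc r == r)) /=; last by move=> i _; rewrite wcc.
apply: eq_bigr => r /eqP cr; rewrite /chi mulr_suml; apply: eq_big => [i|i /eqP ir].
  by rewrite cr.
by rewrite -[in RHS]wdeg_root ir cr.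
Qed.

Lemma rho_E x i j : rho (x * E j i) = wcf i j x * (wdeg i)%:R.
Proof.
case: (eqVneq (wc j) (wc i)) => ji; last first.
  by rewrite wE0 // mulr0 (lin0 (@lin_rho k H)) wcf0 ?mul0r // eq_sym.
rewrite rho_wcf (bigD1 i) //= [X in _ + X]big1 ?addr0 => [|l li].
  rewrite wcfM (bigD1 j) //= big1 ?addr0 => [|m mj]; first by rewrite wcfE // !eqxx mulr1.
  by rewrite wcfE // (negPf mj) mulr0.
by rewrite wcfM big1 ?mul0r // => m _; rewrite wcfE // (negPf li) andbF mulr0.
Qed.

Lemma wdeg_neq0 i : (wdeg (w := w) i)%:R != 0 :> k.
Proof. by rewrite (proj1 (pcharf0P _) ch0) -lt0n wdeg_gt0. Qed.

Lemma rho_nondeg x : (forall y, rho (x * y) = 0) -> x = 0.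
Proof.
move=> x0; rewrite (wcf_expand w x) big1 // => i _; rewrite big1 // => j _.
have /eqP := x0 (E j i); rewrite rho_E mulf_eq0 (negPf (wdeg_neq0 i)) orbF => /eqP ->.
by rewrite scale0r.
Qed.

Lemma rho_rep (f : H -> k^o) : lin f -> exists v, forall x, f x = rho (v * x).
Proof.
move=> fl; exists (\sum_i \sum_j (f (E j i) / (wdeg i)%:R) *: E i j) => x.
rewrite rhoC mulr_sumr (lin_sum _ _ _ (@lin_rho k H)) {1}(wcf_expand w x) lin_sum //.
under [LHS]eq_bigr do rewrite lin_sum //.
rewrite [LHS]exchange_big /=.
apply: eq_bigr => i _; rewrite mulr_sumr (lin_sum _ _ _ (@lin_rho k H)); apply: eq_bigr => j _.
rewrite -scalerAr (linZ _ _ (@lin_rho k H)) rho_E linZ //.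
case: (eqVneq (wc j) (wc i)) => ji; last by rewrite wcf0 // mul0r scale0r [RHS]mulr0.
rewrite -(wdeg_root i) -ji wdeg_root; set d := (wdeg j)%:R.
transitivity (f (E j i) / d * (wcf j i x * d)); last by [].
rewrite mulrACA mulVf ?mulr1; last exact: wdeg_neq0.
exact: mulrC.
Qed.

(** The S^2-twisted trace [lam] equals rho(v -) for some v, and [rho] is an ordinary trace;
    comparing the two symmetries shows that S^2 is conjugation by v. *)
Lemma antipode2_inner : exists2 v : H, v \is a GRing.unit & forall x, S (S x) * v = v * x.
Proof.
have [i0 _ [eL Ll Lr]] := wedd_integral w.
have [v vE] := rho_rep (@lin_lam k H); exists v.
  apply: falg_unit => x vx; apply/(antipode_inj eL Lr)/(antipode_inj eL Lr)/(lam_nondeg eL Lr) => y.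
  by rewrite -lamM vE mulrA vx mul0r (lin0 (@lin_rho k H)).
move=> x; apply/eqP; rewrite -subr_eq0; apply/eqP/rho_nondeg => y.
have e : rho (v * x * y) = rho (S (S x) * v * y) by rewrite -mulrA -vE lamM vE mulrA rhoC mulrA.
by rewrite mulrBl (linB _ _ (@lin_rho k H)) e subrr.
Qed.

(** Tr(S^2) is the sum over blocks of chi(v) chi(v^-1), and a power of v is central because S^4 has
    finite order. Were it zero, the corresponding sum of squared moduli in [algC] would vanish,
    although its term at the trivial block does not. *)
Lemma trace_antipode2_neq0 : ltr (fun x : H => S (S x)) != 0.
Proof.
have [i0 i0c [eL Ll Lr]] := wedd_integral w.
have [v uv vS] := antipode2_inner.
have [M M0 SM] := antipode_finite_order eL Ll Lr.
have vM m x : iter m (fun x => S (S (S (S x)))) x * v ^+ (m * 2) = v ^+ (m * 2) * x.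
  elim: m x => [|m IH] x; first by rewrite mul0n mulr1 mul1r.
  rewrite iterSr mulSn addnC exprD mulrA IH -!mulrA; congr (_ * _).
  by rewrite [v ^+ 2]expr2 mulrA vS -mulrA vS mulrA.
pose N := (M * 2)%N; have N0 : (0 < N)%N by rewrite muln_gt0 M0.
have [z zN] := closed_prim_root ch0 N0.
have vC x : v ^+ N * x = x * v ^+ N by rewrite /N -vM SM.
have np r := chi_finite_order (w := w) ch0 r uv vC zN.
have /fin_all_exists2[n nd nE] : forall r, exists2 m : 'I_N -> nat, (\sum_j m j = wdeg (w := w) r)%N &
    chi (w := w) r v * chi (w := w) r v^-1 =
    (\sum_j (m j)%:R * z ^+ j) * (\sum_j (m j)%:R * z ^+ (N.-1 * j)) by [].
(* P evaluates at z to Tr(S^2). At a root of unity in [algC] the value of P2 is the conjugate of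
   that of P1. *)
pose P1 r : {poly int} := \sum_j (n r j)%:R *: 'X^j.
pose P2 r : {poly int} := \sum_j (n r j)%:R *: 'X^(N.-1 * j).
pose P : {poly int} := \sum_(r | wc r == r) P1 r * P2 r.
have mapsum (R : nzRingType) (I : finType) (Q : pred I) (F : I -> {poly int}) :
  map_poly intr (\sum_(i | Q i) F i) = \sum_(i | Q i) map_poly intr (F i) :> {poly R}.
  exact: rmorph_sum.
have mapM (R : nzRingType) (a b : {poly int}) :
  map_poly intr (a * b) = map_poly intr a * map_poly intr b :> {poly R} by exact: rmorphM.
have mapZX (R : nzRingType) (a j : nat) :
  map_poly intr ((a%:R : int) *: 'X^j) = a%:R *: 'X^j :> {poly R}.
  by have := map_polyZ (intr : int -> R) a%:R 'X^j; rewrite map_polyXn rmorph_nat.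
have mapS (R : nzRingType) (f : 'I_N -> nat) (g : 'I_N -> nat) (y : R) :
    (map_poly intr (\sum_j (f j)%:R *: 'X^(g j) : {poly int})).[y] = \sum_j (f j)%:R * y ^+ (g j).
  rewrite mapsum horner_sum; apply: eq_bigr => j _.
  by rewrite mapZX hornerZ hornerXn.
have PE (R : comNzRingType) (y : R) : (map_poly intr P).[y] =
    \sum_(r | wc r == r) (\sum_j (n r j)%:R * y ^+ j) * (\sum_j (n r j)%:R * y ^+ (N.-1 * j)).
  rewrite mapsum horner_sum; apply: eq_bigr => r _.
  by rewrite mapM hornerM !mapS.
apply/eqP => tr0.
have Pz : (map_poly intr P).[z] = 0.
  rewrite PE -[RHS]tr0 (eq_ltr (g := fun x => v * x * v^-1)) => [|x].
    by rewrite (ltr_lr w); apply: eq_bigr => r _; rewrite nE.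
  by rewrite -vS mulrK.
have [y yN Py] := int_poly_root_unity ch0 N0 (prim_expr_order zN) Pz.
have yy j : y ^+ (N.-1 * j) = (y ^+ j)^*.
  have ny : `|y| = 1 by apply/eqP; rewrite -(@pexpr_eq1 _ _ N) // -normrX yN normr1.
  rewrite exprM rmorphXn /=; congr (_ ^+ _); have y0 : y != 0 by rewrite -normr_eq0 ny oner_eq0.
  apply: (mulfI y0); rewrite -exprS prednK // yN -normCK ny expr1n.
  by [].
have P2c r : \sum_j (n r j)%:R * y ^+ (N.-1 * j) = (\sum_j (n r j)%:R * y ^+ j)^*.
  by rewrite rmorph_sum; apply: eq_bigr => j _; rewrite rmorphM /= rmorph_nat yy.
move: Py; rewrite PE => /eqP; rewrite psumr_eq0 => [|r _]; last first.
  by rewrite P2c -normCK exprn_ge0.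
move/allP/(_ i0); rewrite mem_index_enum => /(_ isT).
have -> : wc i0 == i0 by apply/eqP/i0c; rewrite wcc.
rewrite /= P2c -normCK expf_eq0 /= normr_eq0 => /eqP s0.
(* The block of the integral has degree 1, so its factor is a single root of unity. *)
have : wdeg (w := w) i0 = 1%N.
  by rewrite -(card1 i0); apply: eq_card => j; rewrite !inE; apply/eqP/eqP => [/i0c|->].
rewrite -nd => n1; have [j nj] : exists j, n i0 j != 0%N.
  apply/existsP; apply: contraT; rewrite negb_exists => /forallP n0.
  by rewrite big1 // in n1 => l _; apply/eqP/negPn/n0.
move: n1; rewrite (bigD1 j) //= => n1.
have nj1 : n i0 j = 1%N by case: (n i0 j) nj n1 => // -[|a].
rewrite nj1 in n1; case: n1 => /eqP; rewrite sum_nat_eq0 => /forallP n0.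
move: s0; rewrite (bigD1 j) //= big1 ?addr0 => [|l lj]; last first.
  by have := n0 l; rewrite lj => /eqP ->; rewrite mul0r.
rewrite nj1 mul1r => /eqP; rewrite expf_eq0 => /andP[_ /eqP y0].
by move: yN; rewrite y0 expr0n (gtn_eqF N0) => /eqP; rewrite eq_sym oner_eq0.
Qed.

(** As lam(1) = Tr(S^2) is nonzero, [dist] is 1 and T = S^2 satisfies T^2 = id. With the idempotents
    P = (1 + T)/2 and E1, convolution by the normalized regular character, the relation n Tr(T E1) =
    Tr(T) between integers leaves only T = id. *)
Lemma antipode_involutive_wedd x : S (S x) = x.
Proof.
have [i0 _ [eL Ll Lr]] := wedd_integral w; set L := E i0 i0 in eL Ll Lr.
pose T (x : H) := S (S x); have Tl : lin T by rewrite /T; lin.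
have l1 : lam (1 : H) = ltr T by rewrite /lam; apply: eq_ltr => z; rewrite mul1r.
have l1n : lam (1 : H) != 0 by rewrite l1; apply: trace_antipode2_neq0.
have d1 : dist L = 1.
  have ll := @lin_lam k H.
  have := lam_right eL Ll Lr 1; rewrite sw1; [|lin|lin].
  by move/(scalerI l1n).
have TT y : T (T y) = y by have := antipode4 eL Ll Lr y; rewrite d1 mulr1 mul1r {2}/T /T => <-.
pose n := \dim {:H}; have nR : n%:R != 0 :> k.
  rewrite (proj1 (pcharf0P _) ch0) dimv_eq0; apply/eqP => f0.
  by have := memvf (1 : H); rewrite f0 memv0 oner_eq0.
have two : 2%:R != 0 :> k by rewrite (proj1 (pcharf0P _) ch0).
pose P (y : H) := 2%:R^-1 *: (y + T y).
have Pl : lin P by rewrite /P; lin.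
have PP y : P (P y) = P y.
  rewrite /P (linZ _ _ Tl) (linD _ _ Tl) TT [T y + y]addrC -scalerDr -mulr2n -scaler_nat !scalerA.
  by rewrite mulVf // mulr1.
pose E1 h := n%:R^-1 *: sw h (fun a b => rho a *: b).
have lr := @lin_rho k H.
have E1l : lin E1 by rewrite /E1; lin.
have EE h : E1 (E1 h) = E1 h.
  rewrite /E1 (linZ (f := fun h => sw h (fun a b => rho a *: b))) ?(sw_lin (f := fun h => sw h (fun a b => rho a *: b))); [|lin|lin].
  under eq_sw do rewrite (linZ (f := fun h => sw h (fun a b => rho a *: b)) _ _ ltac:(lin)) sw_scaler.
  rewrite -(swA h (fun a c d => rho a *: (rho c *: d))).
  under eq_sw => t d do under eq_sw => a c do rewrite scalerA.
  under eq_sw => t d do rewrite -(sw_scalel t (fun a c => rho a * rho c : k^o)) rho_conv -scalerA.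
  by rewrite -sw_scaler -/n [n%:R^-1 *: (n%:R *: _)]scalerA mulVf // scale1r.
have Ph (y : H) : P y = 2%:R^-1 *: y + 2%:R^-1 *: T y by rewrite /P scalerDr.
(* This trace is [lam] of the dual at f, a left integral of the bidual, hence evaluation at a
   multiple of L. *)
have trE (f : hdual H) : ltr (fun h => sw h (fun a b => f $ a *: T b)) = lam (1 : H) * f $ L.
  have lamE (g : hdual H) : lam g = ltr (fun h => sw h (fun a b => g $ a *: T b)).
    apply: ltr_hdual => [|u y]; first by lin.
    rewrite ev_mul ev_sw; apply: (@eq_sw _ _ k^o) => a b.
    by rewrite !ev_antipode evZ.
  have ll := @lin_lam k (hdual H).
  pose La := \sum_i lam (@dbasis k H i) *: bs i.
  have LaE (g : hdual H) : lam g = g $ La.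
    have gE : g = \sum_i g $ (bs i) *: dbasis i.
      apply: ev_inj => h; rewrite evf_sum {1}(bs_sum h) ev_sum.
      by apply: eq_bigr => i _; rewrite evZ evfZ ev_dbasis mulrC.
    rewrite {1}gE (lin_sum _ _ _ ll) ev_sum; apply: eq_bigr => i _.
    by rewrite (linZ _ _ ll) evZ mulrC.
  have Lal y : y * La = eps y *: La.
    apply: ev_sep => g; rewrite evZ -sw_hdual.
    have := congr1 (fun u : hdual H => u $ y) (lam_integral g).
    rewrite evfZ ev1 mulrC -LaE => <-; rewrite (sw_lin (f := fun u : hdual H => u $ y : k^o)); last by lin.
    by apply: (@eq_sw _ _ k^o) => a b; rewrite evfZ LaE mulrC.
  rewrite -lamE LaE; have -> : La = eps La *: L by rewrite -Lr Lal eL scale1r.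
  rewrite evZ; congr (_ * _); rewrite -ev1 -LaE lamE l1; apply: eq_ltr => y.
  by apply: (sw_cul T) => // a b; rewrite ev1.
pose rh : hdual H := linfun (@rho k H : H -> k^o).
have rhE y : rh $ y = rho y by apply: ev_linfun.
have trTE : ltr (fun h => T (E1 h)) = n%:R^-1 * lam (1 : H).
  have := trE rh; rewrite rhE.
  have -> : rho L = 1.
    rewrite /rho (eq_ltr (g := fun y => eps y *: L)) // (ltr_rank1 (f := eps : H -> k^o)) //.
    by lin.
  rewrite mulr1 => <-; rewrite -ltrZ; apply: eq_ltr => h.
  rewrite /E1 (linZ _ _ Tl) (sw_lin _ _ Tl); congr (_ *: _); apply: eq_sw => a b.
  by rewrite (linZ _ _ Tl) rhE.
have rhoT y : rho (T y) = rho y.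
  rewrite /rho (eq_ltr (g := fun z => T (y * T z))) => [|z]; last by rewrite /T !antipodeM -!/(T _) TT.
  rewrite (ltr_comm (f := T) (g := fun z => y * T z)); [|lin|lin].
  by apply: eq_ltr => z; rewrite TT.
have E1T h : E1 (T h) = T (E1 h).
  rewrite /E1 (linZ _ _ Tl) (sw_lin _ _ Tl) sw_antipode2; [|lin|lin].
  congr (_ *: _); apply: eq_sw => a b.
  by rewrite (linZ _ _ Tl) -[rho (S (S a))]/(rho (T a)) rhoT.
have trP : ltr T = 2%:R * ltr P - n%:R.
  rewrite (eq_ltr (f := P) Ph) ltr_add ltrZ ltrZ ltr_id -/n mulrDr !mulrA mulfV // !mul1r.
  by rewrite addrAC subrr add0r.
have trPE : ltr (fun h => T (E1 h)) = 2%:R * ltr (fun h => P (E1 h)) - ltr E1.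
  rewrite (eq_ltr (f := fun h => P (E1 h)) (fun h => Ph (E1 h))) ltr_add (ltrZ _ (fun h => E1 h)) (ltrZ _ (fun h => T (E1 h))) mulrDr !mulrA mulfV // !mul1r.
  by rewrite addrAC subrr add0r.
have E1P h : E1 (P h) = P (E1 h) by rewrite /P (linZ _ _ E1l) (linD _ _ E1l) E1T.
pose a := \dim (limg (linfun P)); have aE : ltr P = a%:R by apply: ltr_idem.
have a0 : (0 < a)%N.
  rewrite lt0n dimv_eq0; apply/eqP => l0.
  have : P 1 \in limg (linfun P) by rewrite -(lin_linfun Pl) memv_img ?memvf.
  rewrite l0 memv0 /P /T !antipode1 -mulr2n -scaler_nat scalerA mulVf // scale1r.
  by rewrite oner_eq0.
have an : (a <= n)%N by apply/dimvS/subvf.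
have [b bE] : exists b : nat, ltr (fun h => P (E1 h)) = b%:R.
  rewrite ltr_idem; [by eexists | lin | move=> h].
  by rewrite E1P EE PP.
have [c cE] : exists c : nat, ltr E1 = c%:R by rewrite ltr_idem //; eexists.
(* The relation Tr(T) = n Tr(T E1), i.e. 2a - n = n (2b - c), without subtraction. *)
have e1 : (2 * a + n * c = n + 2 * n * b)%N.
  apply: (natr_inj ch0); apply/eqP; rewrite -subr_eq0; apply/eqP.
  have : n%:R * ltr (fun h => T (E1 h)) = ltr T by rewrite trTE l1 mulrA mulfV // mul1r.
  rewrite trPE trP bE cE aE => e2; rewrite !natrD !natrM.
  transitivity ((2%:R * a%:R - n%:R) - n%:R * (2%:R * b%:R - c%:R) : k); last by rewrite e2 subrr.
  by ring.
have bc : c != (2 * b)%N.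
  apply: contraNneq l1n => cb; rewrite l1 -(mulr1 (ltr T)) -(mulfV nR) mulrA mulrC mulrA.
  by rewrite -l1 -trTE trPE bE cE cb natrM subrr mul0r.
(* 2a - n is a nonzero multiple of n, at most n, and greater than -n since a > 0. *)
have {an} an : a = n.
  have cb : (c < 2 * b)%N.
    case: ltngtP bc => // bc _.
    have : (n * (2 * b).+1 <= n * c)%N by rewrite leq_mul2l bc orbT.
    by move: e1 a0; lia.
  have : (n * c <= n * (2 * b).-1)%N by rewrite leq_mul2l -ltnS prednK ?cb ?orbT //; case: (2 * b)%N cb.
  have n0 : (0 < n)%N by apply: leq_trans a0 an.
  have : (n * (2 * b) = n * (2 * b).-1 + n)%N by rewrite -mulnSr prednK //; case: (2 * b)%N cb.
  by move: e1 a0 an; lia.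
have Pid y : P y = y by apply: (ltr_rank_id ch0 Pl PP); rewrite aE an.
have := Pid x; move/(congr1 (fun y => 2%:R *: y)).
rewrite /P scalerA mulfV // scale1r scaler_nat mulr2n => /addrI.
by [].
Qed.

End LarsonRadford.

Lemma antipode_involutive (k : closedFieldType) (H : hopfType k) : [pchar k] =i pred0 ->
  semisimple H -> forall x : H, antipode (antipode x) = x.
Proof. by move=> ch0 /wedderburn[w _]; apply: (antipode_involutive_wedd w ch0). Qed.

(** * Complete reducibility *)

Section CompleteReducibility.
Variables (k : fieldType) (A : falgType k).

Lemma simple_ideal_in (V : {vspace A}) : left_ideal V -> V != 0%VS ->
  exists2 U, simple_left_ideal U & (U <= V)%VS.
Proof.
have [m] := ubnP (\dim V); elim: m V => // m IH V dV Vl V0.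
have [[W [Wl WV W0 WnV]]|nW] := Classical_Prop.classic (exists W : {vspace A},
   [/\ left_ideal W, (W <= V)%VS, W != 0%VS & W != V]); last first.
  exists V => //; split=> // W Wl WV; case: (eqVneq W 0%VS) => [|W0]; first by left.
  by right; apply/eqP/negPn/negP => WnV; apply: nW; exists W; split.
have dW : (\dim W < \dim V)%N.
  by rewrite ltn_neqAle dimvS // andbT (dimv_leqif_eq WV).
have [|U Us UW] := IH W _ Wl W0; first exact: leq_trans dW _.
by exists U => //; apply: subv_trans UW WV.
Qed.

Lemma complements_semisimple :
  (forall U : {vspace A}, left_ideal U -> exists V : {vspace A}, [/\ left_ideal V,
     (U :&: V = 0)%VS & (U + V = fullv)%VS]) -> semisimple A.
Proof.
move=> compl.
suff step m : exists n (U : 'I_n -> {vspace A}), [/\ forall i, simple_left_ideal (U i),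
    directv (\sum_i U i) & (\sum_i U i = fullv)%VS \/ (m <= \dim (\sum_i U i))%N].
  have [n [U [Us Ud [UA|]]]] := step (\dim {:A}).+1; first by exists n, U.
  by move=> lt; have := leq_trans lt (dimvS (subvf _)); rewrite ltnn.
elim: m => [|m [n [U [Us Ud UA]]]].
  exists 0%N, (fun=> 0%VS); split; [by case | | by right].
  by rewrite directvE /= !big_ord0 dimv0.
case: UA => [UA|mU]; first by exists n, U; split=> //; left.
have Wl : left_ideal (\sum_i U i)%VS.
  apply/prodvP => a b _ /memv_sumP[u uU ->]; rewrite mulr_sumr; apply: memv_sumr => i _.
  by have [Ul _ _] := Us i; apply: (subvP Ul); apply: memv_mul; rewrite ?memvf ?uU.
have [V [Vl WV0 WV]] := compl _ Wl.
case: (eqVneq V 0%VS) => [V0|V0].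
  by exists n, U; split=> //; left; rewrite -WV V0 addv0.
have [S Ss SV] := simple_ideal_in Vl V0.
exists n.+1, (fun i => oapp U S (unlift ord0 i)).
have SW0 : (S :&: (\sum_i U i) = 0)%VS.
  apply/eqP; rewrite -subv0; apply: subv_trans (capvS SV (subvv _)) _.
  by rewrite capvC WV0 subvv.
have e : (\sum_i oapp U S (unlift ord0 i) = S + \sum_i U i)%VS.
  rewrite big_ord_recl unlift_none /=; congr (_ + _)%VS.
  by apply: eq_bigr => i _; rewrite liftK.
have dS : (0 < \dim S)%N by rewrite lt0n dimv_eq0; case: Ss.
split.
- by move=> i; case: unliftP => [j _|_] /=.
- rewrite directvE /= e dimv_disjoint_sum // big_ord_recl unlift_none /=.
  move/directvP: Ud => /= ->; rewrite eqn_add2l; apply/eqP.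
  by apply: eq_bigr => i _; rewrite liftK.
by right; rewrite e dimv_disjoint_sum // -add1n leq_add.
Qed.
End CompleteReducibility.

Lemma lin_limg (k : fieldType) (V : vectType k) (f : V -> V) y : lin f ->
  reflect (exists x, y = f x) (y \in limg (linfun f)).
Proof.
move=> fl; apply: (iffP memv_imgP) => [[x _ ->]|[x ->]]; exists x; rewrite ?memvf //.
  exact: lin_linfun.
by rewrite (lin_linfun fl).
Qed.

Lemma lin_lker (k : fieldType) (V : vectType k) (f : V -> V) x : lin f ->
  (x \in lker (linfun f)) = (f x == 0).
Proof. by move=> fl; rewrite memv_ker (lin_linfun fl). Qed.

(** * Hopf algebras with involutive antipode *)

Section Involutive.
Variables (k : fieldType) (H : hopfType k).
Hypotheses (ch0 : [pchar k] =i pred0) (SS : forall x : H, antipode (antipode x) = x).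
Implicit Types (h x y : H) (f g : hdual H).
Local Notation S := antipode.
Local Notation n := (\dim {:H}).

Lemma dim_neq0 : n%:R != 0 :> k.
Proof.
rewrite (proj1 (pcharf0P _) ch0) dimv_eq0; apply/eqP => f0.
by have := memvf (1 : H); rewrite f0 memv0 oner_eq0.
Qed.

Lemma hdual_inv f : S (S f) = f.
Proof. by apply: ev_inj => h; rewrite !ev_antipode SS. Qed.

Lemma lam_rho h : lam h = rho h.
Proof. by apply: eq_ltr => x; rewrite SS. Qed.

(** The Haar functional: the integral of the dual normalized by [lmn1]. *)
Definition lmn h : k := n%:R^-1 * rho h.
Lemma lin_lmn : lin (lmn : H -> k^o).
Proof. by have lr := @lin_rho k H; rewrite /lmn; lin. Qed.
Lemma lmn1 : lmn 1 = 1.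
Proof. by rewrite /lmn rho1 mulVf // dim_neq0. Qed.
Lemma lmnC x y : lmn (x * y) = lmn (y * x).
Proof. by rewrite /lmn rhoC. Qed.
Lemma rho_lmn h : rho h = n%:R * lmn h.
Proof. by rewrite /lmn mulrA mulfV ?mul1r // dim_neq0. Qed.

Lemma lmn_l h : sw h (fun a b => lmn b *: a) = lmn h *: 1.
Proof.
rewrite /lmn -[in RHS]scalerA -lam_rho -lam_integral sw_scaler.
by apply: eq_sw => a b; rewrite scalerA lam_rho.
Qed.

(* The normalized integral: f $ L = Tr(left multiplication by f on the dual) / n. *)
Definition haar : H := \sum_i (n%:R^-1 * rho (@dbasis k H i)) *: bs i.
Local Notation L := haar.

Lemma ev_haar_rho f : f $ L = n%:R^-1 * rho f.
Proof.
have fE : f = \sum_i f $ (bs i) *: dbasis i.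
  apply: ev_inj => h; rewrite evf_sum {1}(bs_sum h) ev_sum.
  by apply: eq_bigr => i _; rewrite evZ evfZ ev_dbasis mulrC.
rewrite {2}fE (lin_sum _ _ _ (@lin_rho k (hdual H))) ev_sum mulr_sumr; apply: eq_bigr => i _.
by rewrite evZ (linZ _ _ (@lin_rho k (hdual H))) -mulrA [rho _ * _]mulrC.
Qed.

Lemma ev_haar f : f $ L = n%:R^-1 * ltr (fun h => sw h (fun a b => f $ a *: b)).
Proof.
rewrite ev_haar_rho; congr (_ * _); apply: ltr_hdual => [|u y]; first by lin.
by rewrite ev_mul ev_sw; apply: (@eq_sw _ _ k^o) => a b; rewrite evZ.
Qed.

Lemma haar_eps : eps L = 1.
Proof.
rewrite -ev1 ev_haar (eq_ltr (g := id)) ?ltr_id ?mulVf ?dim_neq0 // => h.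
by apply: (sw_cul (fun x => x)) => // a b; rewrite ev1.
Qed.

Let haar_l0 h : h * L = eps h *: L.
Proof.
apply: ev_sep => g; rewrite evZ -sw_hdual.
have := congr1 (fun u : hdual H => u $ h) (lam_integral g).
rewrite evfZ ev1 => e.
have lE u : u $ L = n%:R^-1 * lam u.
  by rewrite ev_haar_rho; congr (_ * _); apply: eq_ltr => x; rewrite hdual_inv.
rewrite [in RHS]lE mulrCA [eps h * _]mulrC -e (sw_lin (f := fun u : hdual H => u $ h : k^o)); last by lin.
rewrite -[RHS]/(n%:R^-1 *: _) sw_scaler; apply: (@eq_sw _ _ k^o) => a b.
by rewrite evfZ lE -[RHS]/(n%:R^-1 * _) [LHS]mulrC -mulrA.
Qed.

Let haarSr h : S L * h = eps h *: S L.
Proof.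
rewrite -{1}(SS h) -antipodeM haar_l0 eps_antipode.
by rewrite (linZ (f := @antipode k H)) //; lin.
Qed.

Lemma haar_antipode : S L = L.
Proof. by have := haarSr L; rewrite haar_l0 haar_eps eps_antipode haar_eps !scale1r => <-. Qed.

Lemma haar_l h : h * L = eps h *: L. Proof. exact: haar_l0. Qed.
Lemma haar_r h : L * h = eps h *: L. Proof. by have := haarSr h; rewrite haar_antipode. Qed.

Let eL := haar_eps. Let Ll := haar_l. Let Lr := haar_r.

Lemma dist1 : dist L = 1.
Proof.
have := lam_right eL Ll Lr 1; have ll := @lin_lam k H; rewrite sw1; [|lin|lin].
by rewrite lam_rho rho1; move/(scalerI dim_neq0).
Qed.

Lemma lmn_r h : sw h (fun a b => lmn a *: b) = lmn h *: 1.
Proof.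
rewrite /lmn -[in RHS]scalerA -lam_rho -dist1 -(lam_right eL Ll Lr) sw_scaler.
by apply: eq_sw => a b; rewrite scalerA lam_rho.
Qed.

Lemma lmn_antipode h : lmn (S h) = lmn h.
Proof. by rewrite /lmn -!lam_rho (lam_antipode eL Ll Lr) dist1 mulr1. Qed.

Lemma lmn_haar : lmn L = n%:R^-1.
Proof. by rewrite /lmn -lam_rho (lam_L eL Lr) mulr1. Qed.

Lemma lmn_dual h : sw L (fun a b => lmn (b * S h) *: a) = n%:R^-1 *: h.
Proof.
rewrite -{2}(lam_dual eL Lr h) sw_scaler; apply: eq_sw => a b.
by rewrite scalerA lam_rho.
Qed.

Lemma lmn_nondeg h : (forall x, lmn (x * h) = 0) -> h = 0.
Proof.
move=> h0; apply: (lam_nondeg eL Lr) => x; rewrite lam_rho rho_lmn h0 mulr0.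
by [].
Qed.

(** Evaluation at L is a multiple of the regular trace of the dual, hence symmetric in products. *)
Lemma haar_cocomm (X : lmodType k) (F : H -> H -> X) :
  (forall a, lin (fun b => F a b)) -> (forall b, lin (fun a => F a b)) ->
  sw L F = sw L (fun a b => F b a).
Proof.
move=> F1 F2; rewrite (sw_fun2 _ F1 F2) (@sw_fun2 _ _ _ _ (fun a b => F b a)) // exchange_big.
by apply: eq_bigr => i _; apply: eq_bigr => j _; rewrite !ev_haar_rho rhoC.
Qed.

Lemma haar_swS (X : lmodType k) (F : H -> H -> X) :
  (forall a, lin (fun b => F a b)) -> (forall b, lin (fun a => F a b)) ->
  sw L F = sw L (fun a b => F (S a) (S b)).
Proof. by move=> F1 F2; rewrite -{1}haar_antipode sw_antipode // haar_cocomm //; lin. Qed.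

Lemma ltr_haar (F : H -> H) : lin F -> ltr F = n%:R * sw L (fun a b => lmn (b * S (F a)) : k^o).
Proof.
move=> Fl; have ll := lin_lmn.
pose phi (i : 'I_n) (x : H) : k^o := n%:R * \sum_j (comul L : 'M_(_, _)) i j * lmn (bs j * S x).
rewrite (@ltr_dual _ _ _ _ (@bs k H) phi) //.
- rewrite swE mulr_sumr; apply: eq_bigr => i _; congr (_ * _); apply: eq_bigr => j _.
- by move=> i; rewrite /phi; lin.
move=> x; rewrite -[LHS]scale1r -(mulfV dim_neq0) -scalerA -lmn_dual swE scaler_sumr.
apply: eq_bigr => i _; rewrite /phi -scalerA scaler_suml; congr (_ *: _); apply: eq_bigr => j _.
by rewrite scalerA.
Qed.

Lemma sw_antipodel_op (X : lmodType k) (F : H -> X) h (G : H -> H -> X) :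
  (forall a b, G a b = F (b * S a)) -> lin F -> sw h G = eps h *: F 1.
Proof.
move=> GF Fl; rewrite -{1}(SS h) (eq_sw _ GF) sw_antipode; [|lin|lin].
by rewrite -eps_antipode; apply: sw_antl => // a b; rewrite SS.
Qed.

Lemma sw_antipoder_op (X : lmodType k) (F : H -> X) h (G : H -> H -> X) :
  (forall a b, G a b = F (S b * a)) -> lin F -> sw h G = eps h *: F 1.
Proof.
move=> GF Fl; rewrite -{1}(SS h) (eq_sw _ GF) sw_antipode; [|lin|lin].
by rewrite -eps_antipode; apply: sw_antr => // a b; rewrite SS.
Qed.

(** Maschke's argument: averaging a linear projection onto U over L, with eps L = 1, makes it
    H-linear, and its kernel is a complement. *)
Lemma inv_semisimple : semisimple H.
Proof.
apply: complements_semisimple => U Ul.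
have UlP a u : u \in U -> a * u \in U by move=> uU; apply: (subvP Ul); rewrite memv_mul ?memvf.
pose p x := projv U x; have pl : lin p by move=> a x y; rewrite /p linearP.
pose P x := sw L (fun a b => a * p (S b * x)).
have Pl : lin P by rewrite /P; lin.
have PU x : P x \in U.
  by rewrite /P swE; apply: memv_suml => i _; apply: memv_suml => j _; rewrite memvZ ?UlP ?memv_proj.
have Pid u : u \in U -> P u = u.
  move=> uU; rewrite /P (sw_antr (fun x => x * u)) ?haar_eps ?scale1r ?mul1r //; last by lin.
  by move=> a b; rewrite /p projv_id ?UlP // mulrA.
have PH h x : P (h * x) = h * P x.
  have := @integral_mull _ _ L Ll _ (fun a b => a * p (S b * x)) (S h).
  rewrite SS => e; rewrite /P sw_mull.
  under [RHS]eq_sw do rewrite mulrA.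
  rewrite e; [|lin|lin]; apply: eq_sw => a b.
  by rewrite antipodeM SS mulrA.
have PP x : P (P x) = P x by apply: Pid.
exists (lker (linfun P)); split.
- apply/prodvP => a b _; rewrite !(lin_lker _ Pl) PH => /eqP ->; by rewrite mulr0.
- apply/eqP; rewrite -subv0; apply/subvP => x; rewrite memv_cap (lin_lker _ Pl) memv0.
  by case/andP => /Pid -> /eqP ->.
apply/eqP; rewrite eqEsubv subvf; apply/subvP => x _.
rewrite -[x](subrK (P x)) addrC memv_add //.
by rewrite (lin_lker _ Pl) (linB _ _ Pl) PP subrr.
Qed.
End Involutive.

Arguments sw_antipodel_op {k H} SS {X} F {h G}.
Arguments sw_antipoder_op {k H} SS {X} F {h G}.

(** z is a root of a monic integer polynomial and equals a/b; the rational root theorem makes it an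
    integer. *)
Lemma nat_matrix_eigenvalue (k : fieldType) (N : nat) (M : 'I_N -> 'I_N -> nat) (v : 'I_N -> k) (z : k)
    (a b : nat) : [pchar k] =i pred0 -> (exists i, v i != 0) ->
    (forall i, v i * z = \sum_j v j * (M j i)%:R) -> (0 < b)%N -> z * b%:R = a%:R ->
  (b %| a)%N.
Proof.
move=> ch0 [i0 vi0] vz b0 zb.
pose g := gcdn a b; have g0 : (0 < g)%N by rewrite gcdn_gt0 b0 orbT.
pose a' := (a %/ g)%N; pose b' := (b %/ g)%N.
have aE : a = (a' * g)%N by rewrite divnK // dvdn_gcdl.
have bE : b = (b' * g)%N by rewrite divnK // dvdn_gcdr.
have cop : coprime b' a'.
  by rewrite /coprime -(eqn_pmul2r g0) mul1n muln_gcdl -aE -bE gcdnC.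
have zb' : z * b'%:R = a'%:R.
  have gk : g%:R != 0 :> k by rewrite (proj1 (pcharf0P _) ch0) -lt0n.
  by apply: (mulIf gk); rewrite -mulrA -!natrM -aE -bE.
pose Mi : 'M[int]_N := \matrix_(i, j) (M i j)%:R.
pose P := char_poly Mi.
have Pz : (map_poly intr P).[z] = 0.
  rewrite map_char_poly; apply/rootP; rewrite -eigenvalue_root_char.
  apply/eigenvalueP; exists (\row_i v i).
    by apply/rowP => i; rewrite !mxE mulrC vz; apply: eq_bigr => j _; rewrite !mxE rmorph_nat.
  by apply: contraNneq vi0 => /rowP/(_ i0); rewrite !mxE => ->.
have sP : size P = N.+1 by apply: size_char_poly.
have e : \sum_(i < N.+1) P`_i * a'%:R ^+ i * b'%:R ^+ (N - i) = 0 :> int.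
  apply/eqP; rewrite -(intr_eq0_pchar0 _ ch0) rmorph_sum /=.
  have : b'%:R ^+ N * (map_poly intr P).[z] = 0 by rewrite Pz mulr0.
  rewrite (@horner_coef_wide _ N.+1) ?(leq_trans (size_poly _ _)) ?sP // mulr_sumr => e0.
  apply/eqP; rewrite -[RHS]e0; apply: eq_bigr => i _.
  rewrite !rmorphM /= !rmorphXn /= !rmorph_nat -zb' exprMn coef_map /=.
  have -> : (b'%:R : k) ^+ N = b'%:R ^+ i * b'%:R ^+ (N - i) by rewrite -exprD subnKC // -ltnS.
  by ring.
have PN : P`_N = 1 by have := char_poly_monic Mi; rewrite monicE lead_coefE sP => /eqP.
have : (b' %| a' ^ N)%N.
  have : ((b'%:R : int) %| (a'%:R : int) ^+ N)%Z.
    rewrite big_ord_recr /= PN mul1r subnn expr0 mulr1 in e.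
    have -> : (a'%:R : int) ^+ N = - \sum_(i < N) P`_i * a'%:R ^+ i * b'%:R ^+ (N - i).
      by apply/eqP; rewrite -addr_eq0 addrC e.
    rewrite rpredN; apply: rpred_sum => i _.
    by rewrite dvdz_mull // -[(N - i)%N]prednK ?subn_gt0 // exprS dvdz_mulr.
  by rewrite dvdzE abszX !natz.
rewrite -[X in (_ %| X)%N]mul1n Gauss_dvdl ?coprimeXr // dvdn1 => /eqP b1.
by rewrite bE b1 mul1n aE dvdn_mull.
Qed.

(** * The character ring *)

Section Characters.
Variables (k : closedFieldType) (H : hopfType k) (w : wedd H).
Hypotheses (ch0 : [pchar k] =i pred0) (SS : forall x : H, antipode (antipode x) = x).
Local Notation S := antipode.
Local Notation E := (@wE _ _ w).
Local Notation n := (\dim {:H}).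
Local Notation L := (haar H).
Implicit Types (f g : hdual H) (x y : H) (r s t : 'I_(wN w)).

Definition tracial f := forall x y, f $ (x * y) = f $ (y * x).

Lemma tracialM f g : tracial f -> tracial g -> tracial (f * g).
Proof.
move=> fC gC x y; rewrite !ev_mul !swM; try lin.
by rewrite sw_comm; apply: (@eq_sw _ _ k^o) => a b; apply: (@eq_sw _ _ k^o) => c d; rewrite fC gC.
Qed.

Lemma tracial_antipode f : tracial f -> tracial (S f).
Proof. by move=> fC x y; rewrite !ev_antipode !antipodeM fC. Qed.

Definition Chi r : hdual H := linfun (chi r : H -> k^o).

Lemma ChiE r x : Chi r $ x = chi r x.
Proof. by apply: (ev_linfun (f := chi r : H -> k^o)); apply: lin_chi. Qed.

Lemma Chi_tracial r : tracial (Chi r).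
Proof. by move=> x y; rewrite !ChiE chiM_comm. Qed.

Lemma tracial_expand f : tracial f -> f = \sum_(r | wc r == r) f $ (E r r) *: Chi r.
Proof.
move=> fC; apply: ev_inj => x; rewrite evf_sum.
rewrite (@trace_function_chi _ _ w (ev f) (lin_ev f (@lin_id k H)) fC).
by apply: eq_bigr => r _; rewrite evfZ ChiE.
Qed.

Lemma tracial_E f r j : tracial f -> wc j = wc r -> f $ (E j j) = f $ (E r r).
Proof.
move=> fC jr; have -> : E j j = E j r * E r j by rewrite wEM // eqxx scale1r.
by rewrite fC wEM // eqxx scale1r.
Qed.

(** Orthogonality of characters. The regular character reads the coefficient at E j j, so [lmn_dual]
    evaluates the average over L of f against each diagonal coefficient of Chi r. *)
Lemma Chi_orthogonal f r : tracial f -> (f * S (Chi r)) $ L = f $ (E r r).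
Proof.
move=> fC; have ll := @lin_lmn k H; have cl := lin_chi (w := w) r.
have wl j := @lin_wcf _ _ w j j.
rewrite ev_mul; under eq_sw do rewrite ev_antipode ChiE.
rewrite (haar_swS ch0 SS (F := fun a b => f $ a * chi r (S b) : k^o)); [|lin|lin].
under eq_sw do rewrite SS /chi mulr_sumr.
rewrite sw_sum (eq_bigr (fun=> (wdeg r)%:R^-1 * f $ (E r r))) => [|j /eqP jr].
  rewrite sumr_const; transitivity ((wdeg r)%:R * ((wdeg r)%:R^-1 * f $ (E r r))).
    by rewrite mulr_natl.
  by rewrite mulVKf // (wdeg_neq0 ch0 r).
rewrite -(tracial_E fC jr) -(wdeg_root r) -jr wdeg_root.
have e : sw L (fun a b => lmn (b * E j j) * f $ (S a) : k^o) = n%:R^-1 * f $ (E j j).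
  have := congr1 (fun x => f $ (S x)) (lmn_dual ch0 SS (S (E j j))).
  rewrite !SS (linZ (f := @antipode k H)) ?SS; last by lin.
  rewrite evZ => <-; rewrite (sw_lin (f := @antipode k H)); last by lin.
  rewrite ev_sw; apply: (@eq_sw _ _ k^o) => a b.
  by rewrite (linZ (f := @antipode k H)) ?evZ //; lin.
have nn := dim_neq0 H ch0; have dn := wdeg_neq0 (w := w) ch0 j.
transitivity (((wdeg j)%:R^-1 * n%:R) * sw L (fun a b => lmn (b * E j j) * f $ (S a) : k^o)).
  rewrite -[RHS]/(_ *: (_ : k^o)) sw_scaler; apply: (@eq_sw _ _ k^o) => a b.
  rewrite -[RHS]/(_ * (_ * _)) mulrA -(mulrA _^-1) -(rho_lmn ch0) (rho_E (w := w) b j j) [_^-1 * _]mulrC.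
  by rewrite mulfK // mulrC.
by rewrite e -mulrA mulVKf.
Qed.

(** Characters of modules, zero included; [naturalP] recognizes them by natural values at the
    primitive idempotents. *)
Definition natural f := exists m : 'I_(wN w) -> nat, f = \sum_(r | wc r == r) (m r)%:R *: Chi r.

Lemma naturalP f : tracial f -> (forall r, exists m : nat, f $ (E r r) = m%:R) -> natural f.
Proof.
move=> fC /fin_all_exists[m mE]; exists m; rewrite {1}(tracial_expand fC).
by apply: eq_bigr => r _; rewrite mE.
Qed.

Lemma natural_Chi r : natural (Chi r).
Proof.
apply: naturalP => [|s]; first exact: Chi_tracial.
by rewrite ChiE chiE // eqxx; eexists.
Qed.

Lemma natural_SChi r : natural (S (Chi r)).
Proof.
apply: naturalP => [|s]; first exact/tracial_antipode/Chi_tracial.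
rewrite ev_antipode ChiE; apply: chi_idem.
by rewrite -antipodeM wEM // eqxx scale1r.
Qed.

Lemma natural_tracial f : natural f -> tracial f.
Proof.
case=> m -> x y; rewrite !evf_sum; apply: eq_bigr => r _.
by rewrite !evfZ Chi_tracial.
Qed.

Lemma natural_E f r : natural f -> exists m : nat, f $ (E r r) = m%:R.
Proof.
case=> m ->; exists (m (wc r)); rewrite evf_sum (bigD1 (wc r)) ?wcc //= big1 ?addr0.
  by rewrite evfZ ChiE chiE // eqxx wcc eqxx mulr1.
move=> s /andP[/eqP ss sr]; rewrite evfZ ChiE chiE // eqxx /=.
by rewrite ss eq_sym (negPf sr) mulr0.
Qed.

Lemma ltr_comul_ChiM r s x : ltr (fun u => comul x * u * (E r r \ox E s s)) = (Chi r * Chi s) $ x.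
Proof.
set e : tensor H H := E r r \ox E s s; rewrite ev_mul comul_sw.
rewrite (eq_ltr (g := fun u => sw x (fun a b => (a \ox b) * u * e))) => [|u]; last by rewrite !sw_mulr.
under [LHS]eq_ltr => u do rewrite swE.
rewrite swE ltr_bigsum; apply: eq_bigr => i _; rewrite ltr_bigsum; apply: eq_bigr => j _.
rewrite ltrZ; congr (_ * _); rewrite !ChiE !chi_ltr -ltr_tmap; [|lin|lin].
apply: eq_ltr; apply: lin_tensor_eq => [||y z]; [lin | exact: lin_tlift |].
by rewrite tlift_ox; [rewrite /e !mul_ox | apply: lin2_bilinear; lin].
Qed.

Lemma comul_idem_ltr r s t : lin (fun u => comul (E t t) * u * (E r r \ox E s s)) /\
  forall u, comul (E t t) * (comul (E t t) * u * (E r r \ox E s s)) * (E r r \ox E s s) =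
            comul (E t t) * u * (E r r \ox E s s).
Proof.
split=> [|u]; first by lin.
by rewrite !mulrA -comulM wEM // eqxx scale1r -!mulrA mul_ox !wEM // !eqxx !scale1r.
Qed.

(* The value at an idempotent of a product of characters is the trace of an idempotent on H (x) H. *)
Lemma natural_ChiM r s : natural (Chi r * Chi s).
Proof.
apply: naturalP => [|t]; first exact/tracialM/Chi_tracial/Chi_tracial.
have [fl ff] := comul_idem_ltr r s t.
by rewrite -ltr_comul_ChiM ltr_idem //; eexists.
Qed.

Lemma natural_sum (I : finType) (Q : pred I) (c : I -> nat) (F : I -> hdual H) :
  (forall i, Q i -> natural (F i)) -> natural (\sum_(i | Q i) (c i)%:R *: F i).
Proof.
move=> Fn; apply: naturalP => [x y|r].
  by rewrite !evf_sum; apply: eq_bigr => i /Fn/natural_tracial Fi; rewrite !evfZ Fi.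
have : exists m : I -> nat, forall i, Q i -> F i $ (E r r) = (m i)%:R.
  have /fin_all_exists[m mE] : forall i, exists mi : nat, Q i -> F i $ (E r r) = mi%:R.
    move=> i; have [Qi|] := boolP (Q i); last by exists 0%N.
    by have [m mE] := natural_E r (Fn i Qi); exists m.
  by exists m.
case=> m mE; exists (\sum_(i | Q i) c i * m i)%N; rewrite evf_sum natr_sum.
by apply: eq_bigr => i Qi; rewrite evfZ natrM mE.
Qed.

Lemma naturalM f g : natural f -> natural g -> natural (f * g).
Proof.
case=> m -> [l ->]; rewrite mulr_suml.
under eq_bigr => r _ do rewrite -scalerAl.
apply: natural_sum => r _; rewrite mulr_sumr.
under eq_bigr => s _ do rewrite -scalerAr.
by apply: natural_sum => s _; apply: natural_ChiM.
Qed.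

(* A linear character [om] of the character ring, given by its idempotent [eta]:
   the Casimir element acts on it by the inverse of [eta $ L], an integer matrix eigenvalue. *)
Lemma casimir_dvd (eta : hdual H) (om : hdual H -> k) (a b : nat) :
    tracial eta -> eta != 0 -> (forall f, tracial f -> eta * f = om f *: eta) ->
    eta * eta = eta -> (0 < b)%N -> (eta $ L) * a%:R = b%:R -> (b %| a)%N.
Proof.
move=> etaC eta0 omE etaI b0 ab.
have om_uniq f c : tracial f -> eta * f = c *: eta -> om f = c.
  move=> fC e; apply/eqP; rewrite -subr_eq0.
  have := omE _ fC; rewrite e => /eqP; rewrite eq_sym -subr_eq0 -scalerBl scaler_eq0 (negPf eta0) orbF.
  by [].
have omZ c f : tracial f -> om (c *: f) = c * om f.
  move=> fC; apply: om_uniq; last by rewrite -scalerAr omE // scalerA.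
  by move=> x y; rewrite !evfZ fC.
have omS (I : finType) (Q : pred I) (F : I -> hdual H) : (forall i, tracial (F i)) ->
    om (\sum_(i | Q i) F i) = \sum_(i | Q i) om (F i).
  move=> FC; apply: om_uniq => [x y|].
    by rewrite !evf_sum; apply: eq_bigr => i _; rewrite FC.
  by rewrite mulr_sumr scaler_suml; apply: eq_bigr => i _; rewrite omE.
have omM f g : tracial f -> tracial g -> om (f * g) = om f * om g.
  move=> fC gC; apply: om_uniq; first exact: tracialM.
  by rewrite mulrA omE // -scalerAl omE // scalerA.
have SC r : tracial (S (Chi r)) by apply/tracial_antipode/Chi_tracial.
pose z := \sum_(r | wc r == r) om (Chi r * S (Chi r)).
have etaz : (eta $ L) * z = 1.
  have <- : om eta = 1 by apply: om_uniq; rewrite ?etaI ?scale1r.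
  rewrite {2}(tracial_expand etaC) omS => [|r x y]; last by rewrite !evfZ Chi_tracial.
  rewrite mulr_sumr; apply: eq_bigr => r _; rewrite omZ ?omM //; try exact: Chi_tracial.
  rewrite -Chi_orthogonal // omE // evfZ.
  by rewrite [RHS]mulrC mulrCA [_ * om (S _)]mulrC.
have L0 : eta $ L != 0 by apply/eqP => e0; have := oner_neq0 k; rewrite -etaz e0 mul0r eqxx.
(* Multiplication by the Casimir element F has a matrix of natural numbers on the Chi r; the values
   of [om] form an eigenvector with eigenvalue z. *)
pose F := \sum_(r | wc r == r) Chi r * S (Chi r).
have Fn : natural F.
  rewrite /F (eq_bigr (fun r => 1%:R *: (Chi r * S (Chi r)))) => [|r _]; last by rewrite scale1r.
  by apply: natural_sum => r _; apply: naturalM; [apply: natural_Chi | apply: natural_SChi].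
have zE : om F = z by rewrite /F omS // => r; apply: tracialM => //; apply: Chi_tracial.
have /fin_all_exists[M ME] : forall r, exists m : 'I_(wN w) -> nat,
    Chi r * F = \sum_(s | wc s == s) (m s)%:R *: Chi s.
  by move=> r; apply: naturalM => //; apply: natural_Chi.
apply: (@nat_matrix_eigenvalue k (wN w) (fun s r => if wc s == s then M r s else 0%N)
   (fun r => om (Chi r)) z a b ch0) => //.
- have : exists r, om (Chi r) != 0.
    apply/existsP; apply: contraT; rewrite negb_exists => /forallP v0.
    have := oner_neq0 k; rewrite -etaz /z big1 ?mulr0 ?eqxx // => r _.
    by rewrite omM ?(eqP (negPn (v0 r))) ?mul0r //; apply: Chi_tracial.
  by [].
- move=> r; rewrite -zE -omM; [|exact: Chi_tracial|exact: natural_tracial].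
  rewrite ME omS => [|s x y]; last by rewrite !evfZ Chi_tracial.
  rewrite [RHS](bigID (fun s => wc s == s)) /= [X in _ + X]big1 ?addr0 => [|s /negPf ->]; last by rewrite mulr0.
  apply: eq_bigr => s ss; rewrite omZ; last exact: Chi_tracial.
  by rewrite ss [RHS]mulrC.
by apply: (mulfI L0); rewrite mulrA etaz mul1r ab.
Qed.
End Characters.

(** * Iterated Sweedler sums *)

Section MultiSweedler.
Variables (k : fieldType) (H : hopfType k) (X : lmodType k).
Implicit Types (g h : H).
Local Notation S := antipode.

Definition sw3 g (F : H -> H -> H -> X) : X := sw g (fun a t => sw t (fun b c => F a b c)).

Lemma eq_sw3 g (F G : H -> H -> H -> X) : (forall a b c, F a b c = G a b c) -> sw3 g F = sw3 g G.
Proof. by move=> FG; apply: eq_sw => a t; apply: eq_sw. Qed.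

Lemma sw5A g (F : H -> H -> H -> H -> H -> X) :
  sw3 g (fun a b c => sw a (fun a1 a2 => sw c (fun c1 c2 => F a1 a2 b c1 c2))) =
  sw3 g (fun a b c => sw3 b (fun b1 b2 b3 => F a b1 b2 b3 c)).
Proof.
rewrite /sw3; transitivity (sw g (fun a t => sw t (fun b t => sw t (fun c t => sw t (fun d e => F a b c d e))))).
  under eq_sw => a t do rewrite sw_comm.
  rewrite (swA g (fun a1 a2 t => sw t (fun b c => sw c (fun c1 c2 => F a1 a2 b c1 c2)))).
  by [].
apply: eq_sw => a t.
rewrite (swA t (fun b1 b' c => sw b' (fun b2 b3 => F a b1 b2 b3 c))).
by apply: eq_sw => b1 t'; rewrite (swA t' (fun b2 b3 c => F a b1 b2 b3 c)).
Qed.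
End MultiSweedler.

Section MultiSweedlerLin.
Variables (k : fieldType) (H : hopfType k).
Implicit Types (g h : H).
Local Notation S := antipode.

Lemma lin_sw3g (X Y : lmodType k) (F : H -> H -> H -> X) (f : Y -> H) : lin f -> lin (fun y => sw3 (f y) F).
Proof. by move=> fl; rewrite /sw3; lin. Qed.
Lemma lin_sw3F (X Y : lmodType k) g (F : Y -> H -> H -> H -> X) :
  (forall a b c, lin (fun y => F y a b c)) -> lin (fun y => sw3 g (F y)).
Proof. by move=> Fl; rewrite /sw3; apply: lin_sw => a t; apply: lin_sw => b c; apply: Fl. Qed.

Lemma sw3_comm (X : lmodType k) g h (F : H -> H -> H -> H -> H -> X) :
  sw3 g (fun a b c => sw h (fun u v => F a b c u v)) = sw h (fun u v => sw3 g (fun a b c => F a b c u v)).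
Proof. by rewrite /sw3; under eq_sw do rewrite sw_comm; rewrite sw_comm. Qed.

Lemma sw33_comm (X : lmodType k) g h (F : H -> H -> H -> H -> H -> H -> X) :
  sw3 g (fun a b c => sw3 h (fun u v w => F a b c u v w)) = sw3 h (fun u v w => sw3 g (fun a b c => F a b c u v w)).
Proof. by rewrite {2}/sw3 sw3_comm /sw3; apply: eq_sw => u t; rewrite -!/(sw3 _ _) sw3_comm. Qed.

Lemma sw3M (X : lmodType k) (x y : H) (F : H -> H -> H -> X) :
    (forall a b, lin (fun c => F a b c)) -> (forall a c, lin (fun b => F a b c)) ->
    (forall b c, lin (fun a => F a b c)) ->
  sw3 (x * y) F = sw3 x (fun a b c => sw3 y (fun a' b' c' => F (a * a') (b * b') (c * c'))).
Proof.
move=> F1 F2 F3; rewrite /sw3 swM; last first.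
- by move=> b; lin.
- by move=> a; lin.
have e a a' t t' : sw (t * t') (fun b c => F (a * a') b c) =
    sw t (fun b c => sw t' (fun b' c' => F (a * a') (b * b') (c * c'))).
  by apply: swM => u; [apply: F1 | apply: F2].
apply: eq_sw => a t; under eq_sw => a' t' do rewrite e.
by rewrite sw_comm; apply: eq_sw => b c.
Qed.

Lemma sw3_lin (X Y : lmodType k) (f : X -> Y) g (F : H -> H -> H -> X) : lin f ->
  f (sw3 g F) = sw3 g (fun a b c => f (F a b c)).
Proof. by move=> fl; rewrite /sw3 (sw_lin _ _ fl); apply: eq_sw => a t; rewrite (sw_lin _ _ fl). Qed.

Lemma sw3_antipode (X : lmodType k) g (F : H -> H -> H -> X) :
    (forall a b, lin (fun c => F a b c)) -> (forall a c, lin (fun b => F a b c)) ->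
    (forall b c, lin (fun a => F a b c)) ->
  sw3 (S g) F = sw3 g (fun a b c => F (S c) (S b) (S a)).
Proof.
move=> F1 F2 F3; rewrite /sw3 sw_antipode; [|lin|lin].
have e a b : sw (S a) (fun u v => F (S b) u v) = sw a (fun u v => F (S b) (S v) (S u)).
  by apply: sw_antipode => u; [apply: F1 | apply: F2].
under eq_sw => a b do rewrite e.
by rewrite (swA g (fun a b c => F (S c) (S b) (S a))).
Qed.
End MultiSweedlerLin.

(** * The Drinfeld double *)

(** The proof that S^2 = id is a parameter of the type, so that a Hopf structure whose axioms rely
    on it can be attached canonically. *)
Definition dbl (k : fieldType) (H : hopfType k)
  (SS : forall x : H, antipode (antipode x) = x) : Type := 'Hom(H, H).
HB.instance Definition _ (k : fieldType) (H : hopfType k)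
  (SS : forall x : H, antipode (antipode x) = x) := Vector.copy (dbl SS) 'Hom(H, H).

(* The Drinfeld double, realized on Hom(H, H) = H^* (x) H: F acts on a left-left
   Yetter-Drinfeld module by v |-> F(v_(-1)) v_(0). *)
Section Double.
Variables (k : fieldType) (H : hopfType k) (SS : forall x : H, antipode (antipode x) = x).
Local Notation S := antipode.
Local Notation D := (dbl SS).
Implicit Types (F G K : D) (g h x y : H).

Definition dv F h : H := (F : 'Hom(H, H)) h.
Definition dmk (f : H -> H) : D := linfun f.

Lemma dvP c F G h : dv (c *: F + G) h = c *: dv F h + dv G h.
Proof. by rewrite -[LHS]/((c *: (F : 'Hom(H, H)) + (G : 'Hom(H, H))) h) add_lfunE scale_lfunE. Qed.
Lemma lin_dv F : lin (dv F).
Proof. by move=> a x y; rewrite /dv linearP. Qed.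
Lemma lin_dvf h : lin (fun F => dv F h).
Proof. by move=> a x y; rewrite dvP. Qed.
Lemma dv_inj F G : (forall h, dv F h = dv G h) -> F = G.
Proof. by move=> e; apply/lfunP => h; apply: e. Qed.
Lemma dv_mk (f : H -> H) h : lin f -> dv (dmk f) h = f h.
Proof. by move=> fl; apply: (lin_linfun fl h). Qed.

Let dl := lin_dv.
Let dlf := lin_dvf.

(** In a Yetter-Drinfeld module the coaction of g v is g1 v_(-1) S(g3) (x) g2 v_(0). The product is
    what acting by G and then by F requires. *)
Definition dmulf F G h := sw h (fun h1 h2 => sw3 (dv G h1) (fun a b c => dv F (a * h2 * S c) * b)).
Definition dmul F G : D := dmk (dmulf F G).

Lemma dmulE F G h : dv (dmul F G) h = dmulf F G h.
Proof. by apply: dv_mk; rewrite /dmulf; lin. Qed.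

Definition done1 : D := dmk (fun h => eps h *: 1).
Lemma done1E h : dv done1 h = eps h *: 1.
Proof. by apply: dv_mk; lin. Qed.

Fact dmulA : associative dmul.
Proof.
move=> F G K; apply: dv_inj => h; rewrite !dmulE /dmulf.
pose Psi (p q r a2 b c1 v : H) := dv F (p * (a2 * v * S c1) * S r) * q * b.
transitivity (sw h (fun h1 h2 => sw h2 (fun u v => sw3 (dv K h1) (fun a b c => sw a (fun a1 a2 => sw c (fun c1 c2 =>
   sw3 (dv G (a1 * u * S c2)) (fun p q r => Psi p q r a2 b c1 v))))))); last first.
  apply: eq_sw => h1 h2; rewrite -sw3_comm; apply: eq_sw3 => a b c.
  rewrite dmulE /dmulf sw_mulr -mulrA swM; [|rewrite /sw3; lin|rewrite /sw3; lin].
  rewrite sw_comm; apply: eq_sw => a1 a2.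
  rewrite swM; [|rewrite /sw3; lin|rewrite /sw3; lin]; apply: eq_sw => u v.
  rewrite sw_antipode; [|rewrite /sw3; lin|rewrite /sw3; lin]; apply: eq_sw => c1 c2.
  rewrite (sw3_lin (f := fun z => z * b)); last by lin.
  by rewrite !mulrA; apply: eq_sw3 => p q r; rewrite /Psi !mulrA.
under [RHS]eq_sw => h1 h2 do under eq_sw => u v do rewrite sw5A.
rewrite -[RHS](swA h (fun h1 u v => sw3 (dv K h1) (fun a b c => sw3 b (fun b1 b2 b3 =>
   sw3 (dv G (a * u * S c)) (fun p q r => Psi p q r b1 b2 b3 v))))).
apply: eq_sw => z h2; rewrite dmulE /dmulf.
have l3 : lin (fun g => sw3 g (fun a b c => dv F (a * h2 * S c) * b)) by apply: lin_sw3g; lin.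
rewrite (sw_lin _ _ l3); apply: eq_sw => h1 u; rewrite (sw3_lin _ _ l3); apply: eq_sw3 => a b c.
rewrite sw3M; [|lin|lin|lin]; rewrite sw33_comm; apply: eq_sw3 => b1 b2 b3; apply: eq_sw3 => p q r.
by rewrite /Psi antipodeM !mulrA.
Qed.

Fact dmul1l : left_id done1 dmul.
Proof.
move=> G; apply: dv_inj => h; rewrite dmulE /dmulf.
apply: (sw_cur (dv G)) => // h1 h2.
have e a b c : dv done1 (a * h2 * S c) * b = eps h2 *: (eps a *: (eps c *: b)).
  by rewrite done1E -scalerAl mul1r !epsM eps_antipode !scalerA; congr (_ *: _); rewrite mulrAC mulrC mulrA.
have -> : sw3 (dv G h1) (fun a b c => dv done1 (a * h2 * S c) * b) =
    sw3 (dv G h1) (fun a b c => eps h2 *: (eps a *: (eps c *: b))) by apply: eq_sw3.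
rewrite -(sw3_lin _ _ (f := fun z => eps h2 *: z)); last by lin.
congr (_ *: _); rewrite /sw3; apply: (sw_cul (fun z => z)) => // a t.
by rewrite -sw_scaler; congr (_ *: _); apply: (sw_cur (fun z => z)).
Qed.

Fact dmul1r : right_id done1 dmul.
Proof.
move=> F; apply: dv_inj => h; rewrite dmulE /dmulf.
apply: (sw_cul (dv F)) => // h1 h2.
have l3 : lin (fun g => sw3 g (fun a b c => dv F (a * h2 * S c) * b)) by apply: lin_sw3g; lin.
rewrite done1E (linZ _ _ l3); congr (_ *: _).
rewrite /sw3 sw1; [|rewrite /=; lin|rewrite /=; lin]; rewrite sw1; [|lin|lin].
by rewrite antipode1 mul1r !mulr1.
Qed.

Fact dmulPl c F G K : dmul (c *: F + G) K = c *: dmul F K + dmul G K.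
Proof.
apply: dv_inj => h; rewrite dvP !dmulE.
have l : lin (fun F => dmulf F K h) by rewrite /dmulf /sw3; lin.
exact: l.
Qed.

Fact dmulPr c F G K : dmul K (c *: F + G) = c *: dmul K F + dmul K G.
Proof.
apply: dv_inj => h; rewrite dvP !dmulE.
have l : lin (fun F => dmulf K F h) by rewrite /dmulf /sw3; lin.
exact: l.
Qed.

Fact dmulDl : left_distributive dmul +%R.
Proof. by move=> F G K; rewrite -[F]scale1r dmulPl !scale1r. Qed.
Fact dmulDr : right_distributive dmul +%R.
Proof. by move=> F G K; rewrite -[G]scale1r dmulPr !scale1r. Qed.

Fact done1_neq0 : done1 != 0.
Proof.
apply/eqP => /(congr1 (fun F => dv F 1)); rewrite done1E eps1 scale1r (lin0 (dlf 1)).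
by apply/eqP/oner_neq0.
Qed.

HB.instance Definition _ := GRing.Zmodule_isNzRing.Build D dmulA dmul1l dmul1r dmulDl dmulDr done1_neq0.

Fact dscaleAl c F G : c *: (F * G) = (c *: F) * G.
Proof.
rewrite -[LHS]addr0 -[c *: F]addr0 -[RHS]/(dmul _ _) dmulPl; congr (_ + _).
by rewrite -[RHS]/(0 * G) mul0r.
Qed.
HB.instance Definition _ := GRing.Lmodule_isLalgebra.Build k D dscaleAl.
Fact dscaleAr c F G : c *: (F * G) = F * (c *: G).
Proof.
rewrite -[LHS]addr0 -[c *: G]addr0 -[RHS]/(dmul _ _) dmulPr; congr (_ + _).
by rewrite -[RHS]/(F * 0) mulr0.
Qed.
HB.instance Definition _ := GRing.Lalgebra_isAlgebra.Build k D dscaleAr.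
HB.instance Definition _ := Algebra_isFalgebra.Build k D.

Lemma dvM F G h : dv (F * G) h = sw h (fun h1 h2 => sw3 (dv G h1) (fun a b c => dv F (a * h2 * S c) * b)).
Proof. exact: dmulE. Qed.
Lemma dv1 h : dv 1 h = eps h *: 1.
Proof. exact: done1E. Qed.

Definition dd (i : 'I_(\dim {:H})) (a : H) : D := dmk (fun h => cb i h *: a).
Lemma ddE i a h : dv (dd i a) h = cb i h *: a.
Proof. by apply: dv_mk; lin. Qed.
Lemma lin_dd i : lin (dd i).
Proof. by move=> c x y; apply: dv_inj => h; rewrite dvP !ddE scalerDr !scalerA mulrC. Qed.
Lemma dd_sum F : F = \sum_i dd i (dv F (bs i)).
Proof.
apply: dv_inj => h; rewrite (lin_sum _ _ _ (dlf h)) {1}(bs_sum h) (lin_sum _ _ _ (dl F)).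
by apply: eq_bigr => i _; rewrite ddE (linZ _ _ (dl F)).
Qed.

Definition dth i j : tensor H H -> tensor D D := tlift (fun a b => dd i a \ox dd j b).
Lemma lin_dth i j : lin (dth i j).
Proof. exact: lin_tlift. Qed.
Lemma dth_ox i j a b : dth i j (a \ox b) = dd i a \ox dd j b.
Proof. by have ld := lin_dd; rewrite /dth tlift_ox //; apply: lin2_bilinear; lin. Qed.

Definition dev2 (t : tensor D D) h l : tensor H H := tlift (fun F G => dv F h \ox dv G l) t.
Lemma lin_dev2 h l : lin (fun t => dev2 t h l).
Proof. exact: lin_tlift. Qed.
Lemma dev2_ox F G h l : dev2 (F \ox G) h l = dv F h \ox dv G l.
Proof. by rewrite /dev2 tlift_ox //; apply: lin2_bilinear; lin. Qed.

Lemma dev2_expand t : t = \sum_i \sum_j dth i j (dev2 t (bs i) (bs j)).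
Proof.
move: t; apply: lin_tensor_eq => [||F G]; first by lin.
  apply: lin_big => i; apply: lin_big => j; exact: lin_comp (lin_dth i j) (lin_dev2 _ _).
under [RHS]eq_bigr => i _ do under eq_bigr => j _ do rewrite dev2_ox dth_ox.
rewrite {1}(dd_sum F) (lin_sum (f := fun F => F \ox G)); last by lin.
apply: eq_bigr => i _; rewrite {1}(dd_sum G) (lin_sum (f := fun G => _ \ox G)) //; lin.
Qed.

Lemma dev2_inj s t : (forall h l, dev2 s h l = dev2 t h l) -> s = t.
Proof.
by move=> st; rewrite (dev2_expand s) (dev2_expand t); apply: eq_bigr => i _; apply: eq_bigr => j _; rewrite st.
Qed.

(** The coproduct is pinned down by [dev2_comul]: evaluated at h and l it is Delta(F(h l)). *)
Definition dcomul F : tensor D D := \sum_i \sum_j dth i j (comul (dv F (bs i * bs j))).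

Lemma dev2_dth i j u h l : dev2 (dth i j u) h l = (cb i h * cb j l) *: u.
Proof.
move: u; apply: lin_tensor_eq => [||a b].
- exact: lin_comp (lin_dev2 _ _) (lin_dth i j).
- exact: lin_scale (@lin_id _ _).
rewrite dth_ox dev2_ox !ddE -scalerA.
by rewrite (linZ (f := fun x => x \ox _)) ?(linZ (f := fun x => _ \ox x)); [|lin|lin].
Qed.

Lemma dev2_comul F h l : dev2 (dcomul F) h l = comul (dv F (h * l)).
Proof.
have cl : lin (@comul k H) by apply: lin_linear.
rewrite /dcomul (lin_sum _ _ _ (lin_dev2 h l)) {2}(bs_sum h) mulr_suml (lin_sum _ _ _ (dl F)) (lin_sum _ _ _ cl).
apply: eq_bigr => i _; rewrite (lin_sum _ _ _ (lin_dev2 h l)) {2}(bs_sum l) mulr_sumr (lin_sum _ _ _ (dl F)) (lin_sum _ _ _ cl).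
apply: eq_bigr => j _; rewrite dev2_dth -scalerAl -scalerAr scalerA (linZ _ _ (dl F)).
by rewrite (linZ _ _ cl).
Qed.

Fact dcomul_linear : linear dcomul.
Proof.
move=> c F G; apply: dev2_inj => h l.
by rewrite (lin_dev2 h l) !dev2_comul dvP linearP.
Qed.
HB.instance Definition _ := GRing.isLinear.Build k D (tensor D D) _ dcomul dcomul_linear.

Lemma dev2M (s t : tensor D D) h l : dev2 (s * t) h l = sw h (fun h1 h2 => sw l (fun l1 l2 =>
  tlift (fun x y => sw3 x (fun a b c => sw3 y (fun a' b' c' =>
    dev2 s (a * h2 * S c) (a' * l2 * S c') * (b \ox b')))) (dev2 t h1 l1))).
Proof.
have bl (s' : tensor D D) h2 l2 : bilinear_map (fun x y => sw3 x (fun a b c => sw3 y (fun a' b' c' =>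
    dev2 s' (a * h2 * S c) (a' * l2 * S c') * (b \ox b')))).
  apply: lin2_bilinear => a; first by apply: lin_sw3F => *; apply: lin_sw3g; lin.
  by apply: lin_sw3g; lin.
move: s; apply: lin_tensor_eq => [||F F'].
- by apply: lin_comp (lin_dev2 h l) _; lin.
- apply: lin_sw => h1 h2; apply: lin_sw => l1 l2 c x y; apply: tlift_param => u v.
  have lm : lin (fun s => sw3 u (fun a b c => sw3 v (fun a' b' c' =>
    dev2 s (a * h2 * S c) (a' * l2 * S c') * (b \ox b')))).
    by do 2 apply: lin_sw3F => ? ? ?; apply: lin_mull; apply: lin_dev2.
  exact: lm.
move: t; apply: lin_tensor_eq => [||G G'].
- by apply: lin_comp (lin_dev2 h l) _; lin.
- by apply: lin_sw => h1 h2; apply: lin_sw => l1 l2; apply: lin_comp (lin_tlift _) (lin_dev2 _ _).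
rewrite mul_ox dev2_ox !dvM (sw_lin (f := fun x => x \ox _)); last by lin.
apply: eq_sw => h1 h2; rewrite (sw_lin (f := fun x => _ \ox x)); last by lin.
apply: eq_sw => l1 l2; rewrite dev2_ox tlift_ox // (sw3_lin (f := fun x => x \ox _)); last by lin.
apply: eq_sw3 => a b c; rewrite (sw3_lin (f := fun x => _ \ox x)); last by lin.
by apply: eq_sw3 => a' b' c'; rewrite dev2_ox mul_ox.
Qed.

Lemma sw_contract (X : lmodType k) g (Phi : H -> H -> H -> H -> H -> X) :
    (forall a b b' c', lin (fun z => Phi a b z b' c')) ->
  sw g (fun x y => sw3 x (fun a b c => sw3 y (fun a' b' c' => Phi a b (S c * a') b' c'))) =
  sw g (fun a t => sw t (fun b t => sw t (fun b' c' => Phi a b 1 b' c'))).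
Proof.
move=> Pl; rewrite /sw3.
rewrite (swA g (fun a t y => sw t (fun b c => sw y (fun a' t' => sw t' (fun b' c' => Phi a b (S c * a') b' c'))))).
apply: eq_sw => a u.
rewrite (swA u (fun b c y => sw y (fun a' t' => sw t' (fun b' c' => Phi a b (S c * a') b' c')))).
apply: eq_sw => b v.
rewrite -(swA v (fun c a' t' => sw t' (fun b' c' => Phi a b (S c * a') b' c'))).
apply: (sw_cul (fun t' => sw t' (fun b' c' => Phi a b 1 b' c'))) => [z t'|]; last by lin.
by apply: (sw_antl (fun z => sw t' (fun b' c' => Phi a b z b' c'))) => //; apply: lin_sw.
Qed.

Fact dcomul_monoid : monoid_morphism dcomul.
Proof.
have cl : lin (@comul k H) by apply: lin_linear.
split=> [|F G]; apply: dev2_inj => h l; rewrite dev2_comul.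
  rewrite dv1 dev2_ox !dv1 epsM -scalerA !(linZ _ _ cl) rmorph1.
  by rewrite (linZ (f := fun x => x \ox _)) ?(linZ (f := fun x => _ \ox x)); [|lin|lin].
rewrite dev2M dvM (sw_lin _ _ cl) swM; first last.
- by move=> b; apply: lin_comp => //; rewrite /sw3; lin.
- by move=> b; apply: lin_comp => //; apply: lin_sw3F => *; lin.
apply: eq_sw => h1 h2; apply: eq_sw => l1 l2; rewrite dev2_comul -/(sw _ _).
rewrite (sw3_lin _ _ cl); set g := dv G _.
transitivity (sw g (fun x y => sw3 x (fun a b c => sw3 y (fun a' b' c' =>
   comul (dv F (a * h2 * (S c * a') * l2 * S c')) * (b \ox b'))))); last first.
  apply: eq_sw => x y; apply: eq_sw3 => a b c; apply: eq_sw3 => a' b' c'.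
  by rewrite dev2_comul !mulrA.
rewrite (sw_contract g (Phi := fun a b z b' c' => comul (dv F (a * h2 * z * l2 * S c')) * (b \ox b'))); last first.
  by move=> a b b' c'; apply: lin_mull; apply: lin_comp => //; lin.
apply: eq_sw => a t; rewrite -(swA t (fun b b' c' => comul (dv F (a * h2 * 1 * l2 * S c')) * (b \ox b'))).
by apply: eq_sw => b c; rewrite comulM (comul_sw b) sw_mull mulr1 mulrA.
Qed.
HB.instance Definition _ := GRing.isMonoidMorphism.Build D (tensor D D) dcomul dcomul_monoid.

Definition dcounit F : k^o := eps (dv F 1).
Fact dcounit_linear : linear dcounit.
Proof. by move=> c F G; rewrite /dcounit dvP epsD epsZ. Qed.
HB.instance Definition _ := GRing.isLinear.Build k D k^o _ dcounit dcounit_linear.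

Fact dcounit_monoid : monoid_morphism dcounit.
Proof.
rewrite /dcounit; split=> [|F G]; first by rewrite dv1 epsZ !eps1 mulr1.
rewrite dvM sw1; [|rewrite /sw3; lin|rewrite /sw3; lin].
rewrite (sw3_lin (f := eps : H -> k^o)); last by lin.
rewrite /sw3; transitivity (eps (dv F (sw (dv G 1) (fun a t => a * S t)))); last first.
  by rewrite (sw_antipoder _ (@lin_id k H)) (linZ _ _ (dl F)) epsZ mulrC.
rewrite (sw_lin _ _ (dl F)) eps_sw; apply: (@eq_sw _ _ k^o) => a t.
apply: (sw_cul (fun c => eps (dv F (a * S c)) : k^o)); last by lin.
by move=> b c; rewrite epsM mulr1 mulrC.
Qed.
HB.instance Definition _ := GRing.isMonoidMorphism.Build D k^o dcounit dcounit_monoid.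

Definition dev3 (t : tensor D (tensor D D)) h l m : tensor H (tensor H H) :=
  tlift (fun F u => dv F h \ox dev2 u l m) t.
Lemma lin_dev3 h l m : lin (fun t => dev3 t h l m).
Proof. exact: lin_tlift. Qed.
Lemma dev3_ox F u h l m : dev3 (F \ox u) h l m = dv F h \ox dev2 u l m.
Proof.
have ld := lin_dev2; rewrite /dev3 tlift_ox //; apply: lin2_bilinear => a.
  by apply: lin_oxr; apply: lin_dev2.
by lin.
Qed.

Lemma dev3_inj s t : (forall h l m, dev3 s h l m = dev3 t h l m) -> s = t.
Proof.
have ld := lin_dd; have bb i j m : bilinear_map (fun a v => dd i a \ox dth j m v).
  by apply: lin2_bilinear => a; [apply: lin_oxr; apply: lin_dth | lin].
have e u : u = \sum_i \sum_j \sum_m tlift (fun a v => dd i a \ox dth j m v) (dev3 u (bs i) (bs j) (bs m)).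
  move: u; apply: lin_tensor_eq => [||F u]; first by lin.
    do 3 apply: lin_big => ?; apply: lin_comp (lin_tlift _) (lin_dev3 _ _ _).
  under [RHS]eq_bigr => i _ do under eq_bigr => j _ do under eq_bigr => m _ do rewrite dev3_ox tlift_ox //.
  rewrite {1}(dd_sum F) (lin_sum (f := fun F => F \ox u)); last by lin.
  apply: eq_bigr => i _; rewrite {1}(dev2_expand u) (lin_sum (f := fun v => _ \ox v)); last by lin.
  by apply: eq_bigr => j _; rewrite (lin_sum (f := fun v => _ \ox v)) //; lin.
move=> st; rewrite (e s) (e t).
by do 3 apply: eq_bigr => ? _; rewrite st.
Qed.

Fact dcomulA F : tassoc (tmap dcomul idfun (dcomul F)) = tmap idfun dcomul (dcomul F).
Proof.
have cl : lin (@comul k H) by apply: lin_linear.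
apply: dev3_inj => h l m.
have e1 t : dev3 (tassoc (tmap dcomul idfun t)) h l m = tassoc (tmap comul idfun (dev2 t (h * l) m)).
  move: t; apply: lin_tensor_eq => [||F' G].
  - exact: lin_comp (lin_dev3 h l m) (lin_comp (lin_linear _) (lin_linear _)).
  - exact: lin_comp (lin_comp (lin_linear _) (lin_linear _)) (lin_dev2 _ _).
  rewrite dev2_ox !tmap_ox /= -dev2_comul; move: (dcomul F'); apply: lin_tensor_eq => [||P Q].
  - by apply: lin_comp (lin_dev3 h l m) (lin_comp (lin_linear _) _); lin.
  - exact: lin_comp (lin_linear _) (lin_oxl _ (lin_dev2 _ _)).
  by rewrite dev2_ox !tassoc_ox dev3_ox dev2_ox.
have e2 t : dev3 (tmap idfun dcomul t) h l m = tmap idfun comul (dev2 t h (l * m)).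
  move: t; apply: lin_tensor_eq => [||F' G].
  - exact: lin_comp (lin_dev3 h l m) (lin_linear _).
  - exact: lin_comp (lin_linear _) (lin_dev2 _ _).
  by rewrite dev2_ox !tmap_ox /= dev3_ox dev2_comul.
by rewrite e1 e2 !dev2_comul mulrA comulA.
Qed.

Fact dcounitl F : tlift (fun G K => dcounit G *: K) (dcomul F) = F.
Proof.
apply: dv_inj => h; have bb : bilinear_map (fun x y : H => eps x *: y) by apply: lin2_bilinear; lin.
have e t : dv (tlift (fun G K => dcounit G *: K) t) h = tlift (fun x y => eps x *: y) (dev2 t 1 h).
  move: t; apply: lin_tensor_eq => [||G K].
  - exact: lin_comp (dlf h) (lin_tlift _).
  - exact: lin_comp (lin_tlift _) (lin_dev2 _ _).
  rewrite dev2_ox !tlift_ox //; first by rewrite (linZ _ _ (dlf h)).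
  by apply: lin2_bilinear => a; [lin | apply: lin_scalel; apply: lin_linear].
by rewrite e dev2_comul mul1r; apply: (sw_cul (fun x => x)).
Qed.

Fact dcounitr F : tlift (fun G K => dcounit K *: G) (dcomul F) = F.
Proof.
apply: dv_inj => h; have bb : bilinear_map (fun x y : H => eps y *: x) by apply: lin2_bilinear; lin.
have e t : dv (tlift (fun G K => dcounit K *: G) t) h = tlift (fun x y => eps y *: x) (dev2 t h 1).
  move: t; apply: lin_tensor_eq => [||G K].
  - exact: lin_comp (dlf h) (lin_tlift _).
  - exact: lin_comp (lin_tlift _) (lin_dev2 _ _).
  rewrite dev2_ox !tlift_ox //; first by rewrite (linZ _ _ (dlf h)).
  by apply: lin2_bilinear => a; [apply: lin_scalel; apply: lin_linear | lin].
by rewrite e dev2_comul mulr1; apply: (sw_cur (fun x => x)).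
Qed.
End Double.

(** In finite dimension a left convolution inverse of the identity is a right one: convolving with
    the identity is injective, hence surjective. For the double this saves the second antipode
    computation. *)
Lemma antipode_right (k : fieldType) (A : falgType k) (De : {linear A -> tensor A A}) (e : {linear A -> k^o})
    (T : {linear A -> A}) :
    (forall h, tassoc (tmap De idfun (De h)) = tmap idfun De (De h)) ->
    (forall h, tlift (fun a b => e a *: b) (De h) = h) ->
    (forall h, tlift (fun a b => e b *: a) (De h) = h) ->
    (forall h, tlift (fun a b => T a * b) (De h) = (e h : k)%:A) ->
  forall h, tlift (fun a b => a * T b) (De h) = (e h : k)%:A.
Proof.
move=> DA el er Tl.
pose cv (f g : 'Hom(A, A)) : 'Hom(A, A) := linfun (fun h => tlift (fun a b => f a * g b) (De h)).
have fl (f : 'Hom(A, A)) : lin f by move=> a x y; rewrite linearP.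
have flh (h : A) : lin (fun f : 'Hom(A, A) => f h) by move=> a f g; rewrite add_lfunE scale_lfunE.
have Dl : lin De by apply: lin_linear.
have bb (f g : 'Hom(A, A)) : bilinear_map (fun a b => f a * g b) by apply: lin2_bilinear; lin.
have cvE f g h : cv f g h = tlift (fun a b => f a * g b) (De h).
  by apply: (lin_linfun (f := fun h => tlift (fun a b => f a * g b) (De h))); apply: lin_comp (lin_tlift _) Dl.
pose u : 'Hom(A, A) := linfun (fun h => (e h : k)%:A).
have uE h : u h = (e h : k)%:A.
  by apply: (lin_linfun (f := fun h => (e h : k)%:A)); apply: lin_scalel; apply: lin_linear.
have cvA f g h : cv f (cv g h) = cv (cv f g) h.
  apply/lfunP => x; rewrite !cvE.
  pose B (a : A) (t : tensor A A) : A := f a * tlift (fun b c => g b * h c) t.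
  have tl := @lin_tlift k A A A.
  have BB : bilinear_map B by apply: lin2_bilinear => y; rewrite /B; [apply: lin_mulr; apply: tl | lin].
  transitivity (tlift B (tmap idfun De (De x))).
    by rewrite (tlift_tmap idfun De _ BB); apply: eq_tlift => a b; rewrite /B cvE.
  rewrite -DA (tlift_tassoc _ BB).
  pose C (t : tensor A A) c : A := tlift (fun a b => f a * g b) t * h c.
  have CB : bilinear_map C by apply: lin2_bilinear => y; rewrite /C; [lin | apply: lin_mull; apply: tl].
  transitivity (tlift C (tmap De idfun (De x))).
    apply: eq_tlift => t c; rewrite /C; move: t; apply: lin_tensor_eq => [||a b]; first exact: tl.
      by apply: lin_mull; apply: tl.
    rewrite !tlift_ox //; first by rewrite /B tlift_ox // mulrA.
    apply: lin2_bilinear => y; rewrite /B; first by apply: lin_mulr; apply: lin_comp (tl _) _; lin.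
    by lin.
  by rewrite (tlift_tmap De idfun _ CB); apply: eq_tlift => a b; rewrite /C cvE.
pose I : 'Hom(A, A) := linfun idfun; pose T' : 'Hom(A, A) := linfun T.
have IE h : I h = h by rewrite /I lfunE.
have TE h : T' h = T h by rewrite /T' lfunE.
have ulE f : cv u f = f.
  apply/lfunP => h; rewrite cvE -{2}[h]el (linear_tlift (lpack (fl f))); apply: eq_tlift => a b.
  by rewrite uE -scalerAl mul1r linearZ.
have urE f : cv f u = f.
  apply/lfunP => h; rewrite cvE -{2}[h]er (linear_tlift (lpack (fl f))); apply: eq_tlift => a b.
  by rewrite uE -scalerAr mulr1 linearZ.
have TI : cv T' I = u.
  by apply/lfunP => h; rewrite cvE uE -Tl; apply: eq_tlift => a b; rewrite IE TE.
have [|f f0|g gu] := @lin_inj_surj _ _ (cv I) _ _ u.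
- move=> a f g; apply/lfunP => h; rewrite cvE add_lfunE scale_lfunE !cvE; apply: tlift_param => x y.
  by rewrite add_lfunE scale_lfunE mulrDr scalerAr.
- rewrite -(ulE f) -TI -cvA f0; apply/lfunP => h; rewrite cvE.
  rewrite (eq_tlift (b2 := fun _ _ => 0)) => [|a b]; last by rewrite zero_lfunE mulr0.
  rewrite zero_lfunE tlift.unlock big1 // => i _; rewrite big1 // => j _.
  by rewrite scaler0.
have gT : g = T' by rewrite -(ulE g) -TI -cvA gu urE.
move=> h; rewrite -uE -gu gT cvE; apply: eq_tlift => a b.
by rewrite IE TE.
Qed.

Section DoubleAntipode.
Variables (k : fieldType) (H : hopfType k) (SS : forall x : H, antipode (antipode x) = x).
Local Notation S := antipode.
Local Notation D := (dbl SS).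
Implicit Types (F G K : D) (g h x y : H).
Let dl := @lin_dv k H SS.
Let dlf := @lin_dvf k H SS.

(** For F = phi (x) x this is the product of S(phi) and S(x) in that order, brought to the form h
    |-> phi(S(x1) S(h) x3) S(x2). *)
Definition dSf F h := \sum_i sw3 (dv F (bs i)) (fun a b c => cb i (S a * S h * c) *: S b).
Definition dS F : D := dmk SS (dSf F).
Lemma dSE F h : dv (dS F) h = dSf F h.
Proof. by apply: dv_mk; rewrite /dSf /sw3; lin. Qed.

Fact dS_linear : linear dS.
Proof.
move=> c F G; apply: dv_inj => h; rewrite dvP !dSE.
have l : lin (fun F => dSf F h) by rewrite /dSf /sw3; lin.
exact: l.
Qed.
HB.instance Definition _ := GRing.isLinear.Build k D D _ dS dS_linear.

Fact dantipodel F : tlift (fun G K => dS G * K) (dcomul F) = (dcounit F : k)%:A.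
Proof.
apply: dv_inj => h.
have dSl : lin dS by apply: lin_linear.
have b1 : bilinear_map (fun G K : D => dS G * K) by apply: lin2_bilinear; lin.
pose Phi i h2 (x y : H) : H := sw3 x (fun a b c => sw3 y (fun p q r =>
   cb i (S a * S (p * h2 * S r) * c) *: (S b * q))).
have bP i h2 : bilinear_map (Phi i h2).
  apply: lin2_bilinear => a; rewrite /Phi; last by apply: lin_sw3g; lin.
  by apply: lin_sw3F => ? ? ?; apply: lin_sw3g; lin.
have e t : dv (tlift (fun G K => dS G * K) t) h =
    \sum_i sw h (fun h1 h2 => tlift (Phi i h2) (dev2 t (bs i) h1)).
  move: t; apply: lin_tensor_eq => [||G K].
  - exact: lin_comp (dlf h) (lin_tlift _).
  - apply: lin_big => i; apply: lin_sw => h1 h2; exact: lin_comp (lin_tlift _) (lin_dev2 _ _).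
  rewrite tlift_ox // dvM -sw_sum; apply: eq_sw => h1 h2.
  under [RHS]eq_bigr => i _ do rewrite dev2_ox tlift_ox // /Phi sw33_comm.
  rewrite /sw3 -sw_sum; apply: eq_sw => p t; rewrite -sw_sum; apply: eq_sw => q r.
  rewrite dSE /dSf mulr_suml; apply: eq_bigr => i _.
  rewrite -/(sw3 _ (fun a b c => _)) (sw3_lin (f := fun z => z * q)); last by lin.
  by apply: eq_sw3 => a b c; rewrite scalerAl.
rewrite e.
have con i h2 g : tlift (Phi i h2) (comul g) = eps g *: (cb i (S h2) *: 1).
  rewrite -/(sw g _) /Phi.
  transitivity (sw g (fun x y => sw x (fun a t => sw t (fun b c => sw y (fun p t' => sw t' (fun q r =>
      cb i (S a * (r * S h2 * S p) * c) *: (S b * q))))))).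
    apply: eq_sw => x y; apply: eq_sw3 => a b c; apply: eq_sw3 => p q r.
    by rewrite !antipodeM SS !mulrA.
  rewrite (swA g (fun a t y => sw t (fun b c => sw y (fun p t' => sw t' (fun q r =>
      cb i (S a * (r * S h2 * S p) * c) *: (S b * q)))))).
  rewrite -{2}[S h2]mul1r; apply: (sw_antl (fun z => cb i (z * S h2) *: 1)) => [a u|]; last by lin.
  rewrite (swA u (fun b c y => sw y (fun p t' => sw t' (fun q r =>
      cb i (S a * (r * S h2 * S p) * c) *: (S b * q))))).
  transitivity (sw u (fun b v => sw v (fun q r => cb i (S a * (r * S h2)) *: (S b * q)))).
    apply: eq_sw => b v; rewrite -(swA v (fun c p t' => sw t' (fun q r =>
      cb i (S a * (r * S h2 * S p) * c) *: (S b * q)))).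
    apply: (sw_cul (fun t' => sw t' (fun q r => cb i (S a * (r * S h2)) *: (S b * q)))) => [z t'|]; last by lin.
    rewrite (sw_antipoder_op SS (fun z => sw t' (fun q r => cb i (S a * (r * S h2 * z)) *: (S b * q)))) //.
    - by congr (_ *: _); apply: eq_sw => q r; rewrite mulr1.
    - by move=> c p; apply: eq_sw => q r; rewrite !mulrA.
    by lin.
  rewrite -(swA u (fun b q r => cb i (S a * (r * S h2)) *: (S b * q))).
  apply: (sw_cul (fun r => cb i (S a * r * S h2) *: 1)) => [z r|]; last by lin.
  rewrite (sw_antl (fun z => cb i (S a * (r * S h2)) *: z)) ?mulrA //; lin.
under eq_bigr => i _ do under eq_sw => h1 h2 do rewrite dev2_comul con.
rewrite -sw_sum [1 in RHS]/1 (linZ _ _ (dlf h)) dv1.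
rewrite (sw_antipoder_op SS (fun z => eps (dv F z) *: 1)); last by lin.
  by rewrite !scalerA mulrC.
move=> h1 h2; rewrite {2}(bs_sum (S h2)) mulr_suml (lin_sum _ _ _ (dl F)) eps_sum scaler_suml.
apply: eq_bigr => i _; rewrite -scalerAl (linZ _ _ (dl F)) epsZ scalerA mulrC.
by [].
Qed.

Fact dantipoder F : tlift (fun G K => G * dS K) (dcomul F) = (dcounit F : k)%:A.
Proof.
apply: (antipode_right (De := @dcomul k H SS) (e := @dcounit k H SS) (T := dS)).
- exact: dcomulA.
- exact: dcounitl.
- exact: dcounitr.
exact: dantipodel.
Qed.

HB.instance Definition _ := Falgebra_isHopf.Build k D
  (@dcomulA k H SS) (@dcounitl k H SS) (@dcounitr k H SS) dantipodel dantipoder.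

(** This opens to the double everything proved for involutive antipodes, semisimplicity included. *)
Lemma double_inv F : antipode (antipode F) = F.
Proof.
rewrite -[antipode F]/(dS F) -[LHS]/(dS (dS F)); apply: dv_inj => h; rewrite dSE /dSf.
rewrite {2}(dd_sum F) (lin_sum _ _ _ (dlf h)).
pose Q i (a b c : H) j : H := cb i (S a * S (bs j) * c) *: sw3 b (fun p q r => cb j (r * S h * S p) *: q).
transitivity (\sum_i \sum_j sw3 (dv F (bs i)) (fun a b c => Q i a b c j)).
  rewrite exchange_big; apply: eq_bigr => j _; rewrite dSE /dSf.
  have l3 : lin (fun g => sw3 g (fun a b c => cb j (S a * S h * c) *: S b)) by apply: lin_sw3g; lin.
  rewrite (lin_sum _ _ _ l3); apply: eq_bigr => i _; rewrite (sw3_lin _ _ l3); apply: eq_sw3 => a b c.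
  rewrite (linZ _ _ l3) /Q; congr (_ *: _); rewrite sw3_antipode; [|lin|lin|lin].
  by apply: eq_sw3 => p q r; rewrite !SS.
apply: eq_bigr => i _; rewrite ddE.
transitivity (sw3 (dv F (bs i)) (fun a b c => sw3 b (fun p q r => cb i (S a * (p * h * S r) * c) *: q))).
  rewrite /sw3 -sw_sum; apply: eq_sw => a t; rewrite -sw_sum; apply: eq_sw => b c; rewrite /Q /sw3.
  under eq_bigr => j _ do rewrite sw_scaler.
  rewrite -sw_sum; apply: eq_sw => p t'; under eq_bigr => j _ do rewrite sw_scaler.
  rewrite -sw_sum; apply: eq_sw => q r.
  have lc : lin (fun z => cb i (S a * S z * c) : k^o) by lin.
  have -> : p * h * S r = S (r * S h * S p) by rewrite !antipodeM !SS mulrA.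
  have lcE Y : cb i (S a * S Y * c) = \sum_j cb j Y * cb i (S a * S (bs j) * c).
    rewrite {1}(bs_sum Y); have := lin_sum _ xpredT (fun j => cb j Y *: bs j) lc => /= ->.
    by apply: eq_bigr => j _; have := linZ (cb j Y) (bs j) lc => /= ->.
  rewrite lcE scaler_suml.
  by apply: eq_bigr => j _; rewrite scalerA mulrC.
rewrite -sw5A.
transitivity (sw3 (dv F (bs i)) (fun a b c => eps a *: (eps c *: (cb i h *: b)))); last first.
  by rewrite /sw3; apply: (sw_cul (fun z => cb i h *: z)) => [a t|]; [rewrite -sw_scaler; congr (_ *: _); apply: (sw_cur (fun z => cb i h *: z)); [|lin] | lin].
apply: eq_sw3 => a b c.
rewrite (sw_antl (fun z => sw c (fun c1 c2 => cb i (z * h * (S c1 * c2)) *: b))).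
- congr (_ *: _); rewrite (sw_antl (fun z => cb i (1 * h * z) *: b)) ?mul1r ?mulr1 //; lin.
- by move=> a1 a2; apply: eq_sw => c1 c2; rewrite !mulrA.
by lin.
Qed.
End DoubleAntipode.

(** * Class functions and central elements of the double *)

Section DoubleCenter.
Variables (k : closedFieldType) (H : hopfType k).
Hypotheses (ch0 : [pchar k] =i pred0) (SS : forall x : H, antipode (antipode x) = x).
Local Notation S := antipode.
Local Notation D := (dbl SS).
Local Notation n := (\dim {:H}).
Local Notation L := (haar H).
Implicit Types (C F G K : D) (a b g h x y : H) (f : hdual D) (phi psi : hdual H).
Let dl := @lin_dv k H SS.
Let dlf := @lin_dvf k H SS.

Definition rk1 phi a : D := dmk SS (fun h => phi $ h *: a).
Lemma rk1E phi a h : dv (rk1 phi a) h = phi $ h *: a.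
Proof. by apply: dv_mk; lin. Qed.
Lemma lin_rk1 phi : lin (rk1 phi).
Proof. by move=> c x y; apply: dv_inj => h; rewrite dvP !rk1E scalerDr !scalerA mulrC. Qed.
Lemma lin_rk1f a : lin (rk1^~ a).
Proof. by move=> c f g; apply: dv_inj => h; rewrite dvP !rk1E evfD evfZ scalerDl scalerA. Qed.
(** [gi] embeds H, and [gj] embeds the dual with the opposite product ([gjM]); together they
    generate D by [gi_gj]. *)
Definition gi a : D := rk1 1 a.
Lemma giE a h : dv (gi a) h = eps h *: a.
Proof. by rewrite rk1E ev1. Qed.
Definition gj psi : D := rk1 psi 1.

Lemma gi_mul a G h : dv (gi a * G) h = a * dv G h.
Proof.
rewrite dvM; apply: (sw_cur (fun z => a * dv G z)) => [h1 h2|]; last by lin.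
transitivity (sw3 (dv G h1) (fun x y z => eps h2 *: (eps x *: (eps z *: (a * y))))).
  apply: eq_sw3 => x y z; rewrite giE !epsM eps_antipode !scalerA -scalerAl.
  by congr (_ *: _); rewrite [eps x * _]mulrC.
rewrite /sw3 -[in RHS](sw_counitl (dv G h1) (F := fun z => a * z)); last by lin.
rewrite sw_scaler; apply: eq_sw => x t; rewrite -!sw_scaler; congr (_ *: (_ *: _)).
by apply: (sw_cur (fun y => a * y)) => //; lin.
Qed.

Lemma mul_gi a F h : dv (F * gi a) h = sw3 a (fun x y z => dv F (x * h * S z) * y).
Proof.
have l3 : lin (fun g => sw h (fun h1 h2 => eps h1 *: sw3 g (fun x y z => dv F (x * h2 * S z) * y))).
  by apply: lin_sw => ? ?; apply: lin_scale; apply: lin_sw3g; lin.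
rewrite dvM; apply: (sw_cul (fun z => sw3 a (fun x y t => dv F (x * z * S t) * y))) => [h1 h2|].
  rewrite giE (linZ (f := fun g => sw3 g (fun x y z => dv F (x * h2 * S z) * y))) //.
  by apply: lin_sw3g; lin.
by rewrite /sw3; lin.
Qed.

Lemma gi_gj a psi : gi a * gj psi = rk1 psi a.
Proof. by apply: dv_inj => h; rewrite gi_mul !rk1E -scalerAr mulr1. Qed.

Lemma gj_mul psi G h : dv (gj psi * G) h = sw h (fun h1 h2 => sw3 (dv G h1) (fun x y z => psi $ (x * h2 * S z) *: y)).
Proof.
rewrite dvM; apply: eq_sw => h1 h2; apply: eq_sw3 => x y z.
by rewrite rk1E -scalerAl mul1r.
Qed.

Lemma mul_gj psi F h : dv (F * gj psi) h = sw h (fun h1 h2 => psi $ h1 *: dv F h2).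
Proof.
rewrite dvM; apply: eq_sw => h1 h2.
have l3 : lin (fun g => sw3 g (fun x y z => dv F (x * h2 * S z) * y)) by apply: lin_sw3g; lin.
rewrite rk1E (linZ _ _ l3); congr (_ *: _); rewrite /sw3 !sw1; try by lin.
by rewrite antipode1 mul1r !mulr1.
Qed.

Lemma central_gen C : (forall a, C * gi a = gi a * C) -> (forall psi, C * gj psi = gj psi * C) ->
  forall F, C * F = F * C.
Proof.
move=> Ci Cj F; rewrite (dd_sum F) mulr_sumr mulr_suml; apply: eq_bigr => i _.
have -> : dd SS i (dv F (bs i)) = gi (dv F (bs i)) * gj (@dbasis k H i).
  by rewrite gi_gj; apply: dv_inj => h; rewrite ddE rk1E ev_dbasis.
by rewrite mulrA Ci -mulrA Cj mulrA.
Qed.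

(** The trace pairing of Hom(H, H) identifies D with its dual. It plays the role of the Drinfeld
    map: class functions correspond to central elements, and products correspond by [trf_mul]. *)
Definition trf C : hdual D := linfun (fun F => ltr (fun h => dv C (dv F h)) : k^o).
Lemma trfE C F : trf C $ F = ltr (fun h => dv C (dv F h)).
Proof.
apply: (ev_linfun (f := fun F => ltr (fun h => dv C (dv F h)) : k^o)).
by rewrite /ltr; lin.
Qed.

Lemma trf_rk1 C phi a : trf C $ (rk1 phi a) = phi $ (dv C a).
Proof.
rewrite trfE (eq_ltr (g := fun h => phi $ h *: dv C a)) => [|h]; last by rewrite rk1E (linZ _ _ (dl C)).
by rewrite (ltr_rank1 (f := fun h => phi $ h : k^o)) //; lin.
Qed.

Definition ctr f : D := dmk SS (fun a => \sum_i f $ (rk1 (@dbasis k H i) a) *: bs i).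
Lemma trf_ctr f : trf (ctr f) = f.
Proof.
have lr := lin_rk1.
apply: ev_inj => F; rewrite (dd_sum F) !ev_sum; apply: eq_bigr => i _.
have -> : dd SS i (dv F (bs i)) = rk1 (@dbasis k H i) (dv F (bs i)).
  by apply: dv_inj => h; rewrite ddE rk1E ev_dbasis.
rewrite trf_rk1 dv_mk; last by lin.
rewrite ev_sum (bigD1 i) //= big1 ?addr0 => [|j ji]; first by rewrite evZ ev_dbasis cb_bs eqxx mulr1.
by rewrite evZ ev_dbasis cb_bs eq_sym (negPf ji) mulr0.
Qed.

Lemma trf_inj C C' : trf C = trf C' -> C = C'.
Proof.
move=> e; apply: dv_inj => a; apply: ev_sep => phi.
by rewrite -!trf_rk1 e.
Qed.

Section TracialCentral.
Variable C : D.
Hypothesis Ctr : tracial (trf C).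

Lemma tracial_gi a b : dv C (a * b) = sw3 a (fun x y z => x * dv C (b * y) * S z).
Proof.
apply: ev_sep => phi.
have := Ctr (gi a) (rk1 phi b).
have -> : gi a * rk1 phi b = rk1 phi (a * b).
  by apply: dv_inj => h; rewrite gi_mul !rk1E scalerAr.
rewrite trf_rk1 => ->.
pose ph x z : hdual H := linfun (fun h => phi $ (x * h * S z) : k^o).
have phE x z h : ph x z $ h = phi $ (x * h * S z).
  by apply: (ev_linfun (f := fun h => phi $ (x * h * S z) : k^o)); lin.
have -> : rk1 phi b * gi a = sw3 a (fun x y z => rk1 (ph x z) (b * y)).
  apply: dv_inj => h; rewrite mul_gi (sw3_lin _ _ (dlf h)); apply: eq_sw3 => x y z.
  by rewrite !rk1E phE scalerAl.
rewrite (sw3_lin (f := fun F => trf C $ F : k^o)); last by lin.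
rewrite (sw3_lin (f := fun u : H => phi $ u : k^o)); last by lin.
by apply: (@eq_sw3 _ _ k^o) => x y z; rewrite trf_rk1 phE.
Qed.

Lemma tracial_gj0 b psi phi : sw (dv C b) (fun u v => psi $ u * phi $ v : k^o) =
  sw3 b (fun x y z => sw (dv C y) (fun u v => psi $ (x * v * S z) * phi $ u : k^o)).
Proof.
have := Ctr (rk1 phi b) (gj psi).
have -> : rk1 phi b * gj psi = rk1 (psi * phi) b.
  apply: dv_inj => h; rewrite mul_gj rk1E ev_mul sw_scalel; apply: eq_sw => h1 h2.
  by rewrite rk1E scalerA.
rewrite trf_rk1 ev_mul => ->.
pose ph x z : hdual H := linfun (fun h => psi $ (x * h * S z) : k^o).
have phE x z h : ph x z $ h = psi $ (x * h * S z).
  by apply: (ev_linfun (f := fun h => psi $ (x * h * S z) : k^o)); lin.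
have -> : gj psi * rk1 phi b = sw3 b (fun x y z => rk1 (phi * ph x z) y).
  apply: dv_inj => h; rewrite gj_mul (sw3_lin _ _ (dlf h)).
  under eq_sw => h1 h2 do rewrite rk1E (linZ (f := fun g => sw3 g (fun x y z => psi $ (x * h2 * S z) *: y)) _ _ (lin_sw3g _ (@lin_id _ _))).
  under eq_sw => h1 h2 do rewrite (sw3_lin b _ (lin_scale (phi $ h1) (@lin_id _ H))).
  rewrite -sw3_comm; apply: eq_sw3 => x y z.
  by rewrite rk1E ev_mul sw_scalel; apply: eq_sw => h1 h2; rewrite phE scalerA.
rewrite (sw3_lin (f := fun F => trf C $ F : k^o)); last by lin.
apply: (@eq_sw3 _ _ k^o) => x y z; rewrite trf_rk1 ev_mul; apply: (@eq_sw _ _ k^o) => u v.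
by rewrite phE mulrC.
Qed.

Lemma tracial_gj (X : lmodType k) b (F : H -> H -> X) :
    (forall a, lin (fun b => F a b)) -> (forall b, lin (fun a => F a b)) ->
  sw (dv C b) F = sw3 b (fun x y z => sw (dv C y) (fun u v => F (x * v * S z) u)).
Proof.
move=> F1 F2; rewrite (sw_fun2 _ F1 F2).
have Fs x y : F x y = \sum_i \sum_j (@dbasis k H i $ x * @dbasis k H j $ y) *: F (bs i) (bs j).
  rewrite {1}(bs_sum x) (lin_sum _ _ _ (F2 y)); apply: eq_bigr => i _.
  rewrite (linZ _ _ (F2 y)) {1}(bs_sum y) (lin_sum _ _ _ (F1 _)) scaler_sumr.
  by apply: eq_bigr => j _; rewrite (linZ _ _ (F1 _)) scalerA !ev_dbasis.
transitivity (\sum_i \sum_j (sw3 b (fun x y z => sw (dv C y) (fun u v =>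
   @dbasis k H i $ (x * v * S z) * @dbasis k H j $ u : k^o)) : k) *: F (bs i) (bs j)).
  by apply: eq_bigr => i _; apply: eq_bigr => j _; rewrite -tracial_gj0 ev_mul.
under [RHS]eq_sw3 => x y z do under eq_sw => u v do rewrite Fs.
rewrite /sw3; under eq_bigr => i _ do under eq_bigr => j _ do rewrite sw_scalel.
under eq_bigr => i _ do rewrite -sw_sum.
rewrite -sw_sum; apply: eq_sw => x t.
under eq_bigr => i _ do under eq_bigr => j _ do rewrite sw_scalel.
under eq_bigr => i _ do rewrite -sw_sum.
rewrite -sw_sum; apply: eq_sw => y z.
under eq_bigr => i _ do under eq_bigr => j _ do rewrite sw_scalel.
under eq_bigr => i _ do rewrite -sw_sum.
by rewrite -sw_sum.
Qed.

(** Commutation is checked on the generators. [tracial_gi] and [tracial_gj] express the class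
    function property against them; what remains is cancellation of antipodes. *)
Lemma tracial_central F : C * F = F * C.
Proof.
move: F; apply: central_gen => [a|psi]; apply: dv_inj => h.
  rewrite gi_mul mul_gi.
  transitivity (sw3 a (fun x y z => sw x (fun x1 t => sw t (fun x2 x3 =>
      x1 * dv C (h * (S z * x2)) * (S x3 * y))))).
    apply: eq_sw3 => x y z; rewrite -mulrA tracial_gi (sw3_lin (f := fun u => u * y)); last by lin.
    by apply: eq_sw3 => x1 x2 x3; rewrite !mulrA.
  rewrite /sw3; under eq_sw => x t do rewrite sw_comm.
  rewrite (swA a (fun x1 s t => sw t (fun y z => sw s (fun x2 x3 =>
      x1 * dv C (h * (S z * x2)) * (S x3 * y))))).
  transitivity (sw a (fun x1 u => sw u (fun x2 z => x1 * dv C (h * (S z * x2))))).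
    apply: eq_sw => x1 u; under eq_sw => s t do rewrite sw_comm.
    rewrite (swA u (fun x2 x3 t => sw t (fun y z => x1 * dv C (h * (S z * x2)) * (S x3 * y)))).
    apply: eq_sw => x2 v.
    rewrite -(swA v (fun x3 y z => x1 * dv C (h * (S z * x2)) * (S x3 * y))).
    apply: (sw_cul (fun z => x1 * dv C (h * (S z * x2)))) => [w z|]; last by lin.
    by rewrite (sw_antl (fun t => x1 * dv C (h * (S z * x2)) * t)) ?mulr1 //; lin.
  apply: (sw_cur (fun x1 => x1 * dv C h)) => [x1 u|]; last by lin.
  by rewrite (sw_antipoder_op SS (fun t => x1 * dv C (h * t))) ?mulr1 //; lin.
apply: esym; rewrite gj_mul mul_gj.
transitivity (sw h (fun h1 h2 => sw h1 (fun p t => sw t (fun q r => sw (dv C q) (fun u v =>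
   sw u (fun y z => psi $ (p * v * (S r * h2) * S z) *: y)))))).
  apply: eq_sw => h1 h2.
  rewrite -[LHS]/(sw (dv C h1) (fun x t => sw t (fun y z => psi $ (x * h2 * S z) *: y))).
  rewrite tracial_gj; [|lin|lin].
  apply: eq_sw3 => p q r; apply: eq_sw => u v; apply: eq_sw => y z.
  by rewrite !mulrA.
rewrite (swA h (fun p t h2 => sw t (fun q r => sw (dv C q) (fun u v =>
   sw u (fun y z => psi $ (p * v * (S r * h2) * S z) *: y))))).
apply: eq_sw => p h'.
rewrite (swA h' (fun q r h2 => sw (dv C q) (fun u v =>
   sw u (fun y z => psi $ (p * v * (S r * h2) * S z) *: y)))).
apply: (sw_cur (fun q => psi $ p *: dv C q)) => [q t|]; last by lin.
rewrite (sw_antl (fun s => sw (dv C q) (fun u v => sw u (fun y z => psi $ (p * v * s * S z) *: y)))) //; last by lin.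
congr (_ *: _); rewrite (swA (dv C q) (fun y z v => psi $ (p * v * 1 * S z) *: y)).
apply: (sw_cur (fun y => psi $ p *: y)) => [y w|]; last by lin.
rewrite -[p in RHS]mulr1 (sw_antipodel_op SS (fun s => psi $ (p * s) *: y)) //; last by lin.
by move=> z v; rewrite mulr1 !mulrA.
Qed.
End TracialCentral.

End DoubleCenter.

(** * Degrees of the double divide dim H *)

Section DoubleDivides.
Variables (k : closedFieldType) (H : hopfType k).
Hypotheses (ch0 : [pchar k] =i pred0) (SS : forall x : H, antipode (antipode x) = x).
Local Notation S := antipode.
Local Notation D := (dbl SS).
Local Notation n := (\dim {:H}).
Local Notation L := (haar H).
Implicit Types (C F G K : D) (a b g h x y : H) (f : hdual D) (phi psi : hdual H).
Let dl := @lin_dv k H SS.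
Let dlf := @lin_dvf k H SS.
Let dinv := @double_inv k H SS.

Lemma sw_dv (X : lmodType k) F h l (B : H -> H -> X) :
    (forall a, lin (fun b => B a b)) -> (forall b, lin (fun a => B a b)) ->
  sw F (fun F1 F2 => B (dv F1 h) (dv F2 l)) = sw (dv F (h * l)) B.
Proof.
move=> B1 B2; rewrite /sw -dev2_comul -[comul F]/(dcomul F).
have bb : bilinear_map B by apply: lin2_bilinear.
move: (dcomul F); apply: lin_tensor_eq => [||G K]; first exact: lin_tlift.
  exact: lin_comp (lin_tlift _) (lin_dev2 _ _).
by rewrite dev2_ox !tlift_ox //; apply: lin2_bilinear => a; [apply: lin_comp (B1 _) _; lin | apply: lin_comp (B2 _) _; lin].
Qed.

Lemma dim_double : \dim {:D} = (n * n)%N.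
Proof. by rewrite !dimvf. Qed.

Lemma eq_rk1 f f' : (forall phi a, f $ (rk1 SS phi a) = f' $ (rk1 SS phi a)) -> f = f'.
Proof.
move=> e; apply: ev_inj => F; rewrite (dd_sum F) !ev_sum; apply: eq_bigr => i _.
have -> : dd SS i (dv F (bs i)) = rk1 SS (@dbasis k H i) (dv F (bs i)).
  by apply: dv_inj => h; rewrite ddE rk1E ev_dbasis.
exact: e.
Qed.

Lemma trf_mul C C' : (forall F, C * F = F * C) -> trf C' * trf C = trf (C * C').
Proof.
(* Against a central C the product of D collapses to a convolution of linear maps. *)
move=> CC; have cE h : dv (C * C') h = sw h (fun a b => dv C' a * dv C b).
  rewrite dvM; apply: eq_sw => h1 h2; have := congr1 (fun G => dv G h2) (CC (gi SS (dv C' h1))).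
  by rewrite mul_gi gi_mul.
apply: eq_rk1 => phi a; rewrite trf_rk1 cE ev_mul.
under eq_sw => F1 F2 do rewrite !trfE /ltr big_distrlr /=.
rewrite sw_sum; under eq_bigr => i _ do rewrite sw_sum.
transitivity (\sum_i \sum_j phi $ (bs i * bs j) * sw a (fun x y => cb i (dv C' x) * cb j (dv C y) : k^o)).
  apply: eq_bigr => i _; apply: eq_bigr => j _.
  rewrite (sw_dv _ _ _ (B := fun x y => cb i (dv C' x) * cb j (dv C y) : k^o)); [|lin|lin].
  rewrite rk1E (linZ (f := fun g => sw g (fun x y => cb i (dv C' x) * cb j (dv C y) : k^o))) //.
  exact: lin_swh (@lin_id _ _).
transitivity (sw a (fun x y => \sum_i \sum_j phi $ (bs i * bs j) *: (cb i (dv C' x) * cb j (dv C y) : k^o))).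
  rewrite sw_sum; apply: eq_bigr => i _; rewrite sw_sum; apply: eq_bigr => j _.
  by rewrite -sw_scaler.
rewrite ev_sw; apply: (@eq_sw _ _ k^o) => x y; apply: esym.
rewrite {1}(bs_sum (dv C' x)) mulr_suml ev_sum; apply: eq_bigr => i _.
rewrite {1}(bs_sum (dv C y)) mulr_sumr ev_sum; apply: eq_bigr => j _.
by rewrite -scalerAl -scalerAr !evZ -[RHS]/(_ * _) [RHS]mulrC mulrA.
Qed.

Lemma trfZ c C : trf (c *: C) = c *: trf C.
Proof.
apply: ev_inj => F; rewrite evfZ !trfE /ltr mulr_sumr; apply: eq_bigr => i _.
by rewrite (linZ _ _ (dlf _)) (linZ _ _ (lin_cb i)).
Qed.
Lemma trf0 : trf (0 : D) = 0.
Proof. by rewrite -(scale0r (0 : D)) trfZ scale0r. Qed.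

Lemma haar_double : haar D = rk1 SS (linfun (@lmn k H : H -> k^o)) L.
Proof.
have ll := @lin_lmn k H; set Lam := rk1 SS _ L.
have LE h : dv Lam h = lmn h *: L by rewrite rk1E (ev_linfun (f := @lmn k H : H -> k^o)).
have Le : eps Lam = 1.
  by rewrite -[LHS]/(eps (dv Lam 1)) LE epsZ lmn1 // haar_eps // mulr1.
have Ll F : F * Lam = eps F *: Lam.
  apply: dv_inj => h; rewrite (linZ _ _ (dlf h)) LE dvM.
  transitivity (sw3 L (fun x y z => dv F (x * sw h (fun h1 h2 => lmn h1 *: h2) * S z) * y)).
    transitivity (sw3 L (fun x y z => sw h (fun h1 h2 => lmn h1 *: (dv F (x * h2 * S z) * y)))).
      rewrite sw3_comm; apply: eq_sw => h1 h2.
      rewrite LE (linZ (f := fun g => sw3 g (fun x y z => dv F (x * h2 * S z) * y))); last by apply: lin_sw3g; lin.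
      by rewrite (sw3_lin _ _ (lin_scale (lmn h1) (@lin_id _ H))).
    apply: eq_sw3 => x y z; rewrite (sw_lin (f := fun t => dv F (x * t * S z) * y)); last by lin.
    by apply: eq_sw => h1 h2; rewrite -scalerAr -!scalerAl (linZ _ _ (dl F)) -scalerAl.
  rewrite lmn_r // /sw3 haar_cocomm //; [|lin|lin].
  rewrite (swA L (fun y z x => dv F (x * (lmn h *: 1) * S z) * y)).
  have -> : eps F *: (lmn h *: L) = lmn h *: (dv F 1 * L) by rewrite haar_l // scalerA mulrC -scalerA.
  apply: (sw_cur (fun y => lmn h *: (dv F 1 * y))) => [y u|]; last by lin.
  rewrite (sw_antipodel_op SS (fun t => lmn h *: (dv F t * y))) //; last by lin.
  by move=> z x; rewrite -scalerAr mulr1 -scalerAl (linZ _ _ (dl F)) -scalerAl.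
by rewrite -[haar D]scale1r -Le -(haar_r ch0 dinv) Ll haar_eps ?scale1r.
Qed.

(** F |-> lmn (F L) satisfies the integral identity on D, and left integrals are unique up to a
    scalar. *)
Lemma lmn_double F : lmn F = lmn (dv F L).
Proof.
have ll := @lin_lmn k H.
pose mu F : k^o := lmn (dv F L).
have ml : lin mu by rewrite /mu; lin.
have mi G : sw G (fun u v => (mu v : k) *: u) = (mu G : k) *: 1.
  apply: dv_inj => h; rewrite (linZ _ _ (dlf h)) dv1 (sw_lin _ _ (dlf h)).
  under eq_sw => F1 F2 do rewrite (linZ _ _ (dlf h)).
  rewrite (sw_dv _ _ _ (B := fun x y => lmn y *: x)); [|lin|lin].
  rewrite lmn_l // haar_l // (linZ _ _ (dl G)) (linZ _ _ ll) [in RHS]scalerA /mu; congr (_ *: _); exact: mulrC.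
have e := left_integral_uniq (haar_eps D ch0) (haar_l dinv) (haar_r ch0 dinv) ml mi.
have := e 1; rewrite {1}/mu dv1 haar_eps // scale1r lmn1 // lam_rho // rho1 => e1.
rewrite -[RHS]/(mu F) e /lmn lam_rho //; congr (_ * _).
by apply: (mulIf (dim_neq0 D ch0)); rewrite mulVf ?dim_neq0.
Qed.

Variable w : wedd D.
Local Notation E := (@wE _ _ w).

Lemma we_we (r s : 'I_(wN w)) : wc r = r -> wc s = s -> we s * we r = (s == r)%:R *: we r.
Proof.
move=> rr ss; rewrite {2 3}/we mulr_sumr scaler_sumr; apply: eq_bigr => j /eqP jr.
by rewrite we_E jr rr ss eq_sym.
Qed.

Lemma central_expand C : (forall F, C * F = F * C) ->
  C = \sum_(r | wc r == r) wcf r r C *: we (w := w) r.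
Proof.
move=> CC; rewrite {1}(wcf_expand w C).
transitivity (\sum_i wcf i i C *: E i i).
  apply: eq_bigr => i _; rewrite (bigD1 i) //= big1 ?addr0 // => j ji.
  by rewrite -wcfP -mulrA CC mulrA wEM // eq_sym (negPf ji) scale0r mul0r.
rewrite (partition_big (@wc _ _ w) (fun r => wc r == r)) /=; last by move=> i _; rewrite wcc.
apply: eq_bigr => r /eqP rr; rewrite /we scaler_sumr rr; apply: eq_bigr => i /eqP ir.
by rewrite (central_wE CC (i := i) (j := r)) // ir rr.
Qed.

Lemma wcf_we (r s : 'I_(wN w)) : wc r = r -> wc s = s -> wcf s s (we (w := w) r) = (s == r)%:R.
Proof.
move=> rr ss; apply: wcf_uniq => //; rewrite -mulrA we_E ss rr -scalerAr.
by rewrite wEM // eqxx scale1r.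
Qed.

Let cn f := ctr f.
Let lin_cn : lin cn.
Proof.
have lr := @lin_rk1 k H SS; move=> c f g; apply: dv_inj => h; rewrite dvP !dv_mk; [|lin|lin|lin].
by rewrite scaler_sumr -big_split; apply: eq_bigr => i _; rewrite evfD evfZ scalerDl scalerA.
Qed.

(** Class functions and the centre both have the number of blocks as dimension. The injective map f
    |-> [ctr f] between them is therefore onto and reaches [we r]. *)
Lemma trf_we_tracial r : tracial (trf (we (w := w) r)).
Proof.
wlog rr : r / wc r = r => [th|].
  have -> : we (w := w) r = we (w := w) (wc r) by rewrite /we wcc.
  by apply: th; rewrite wcc.
pose cf (v : {ffun 'I_(wN w) -> k^o}) : hdual D := \sum_(s | wc s == s) (v s : k) *: Chi s.
have cft v : tracial (cf v).
  by move=> x y; rewrite !evf_sum; apply: eq_bigr => s _; rewrite !evfZ Chi_tracial.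
have lcf : lin cf.
  move=> c u v; rewrite /cf scaler_sumr -big_split; apply: eq_bigr => s _.
  by rewrite !ffunE scalerDl scalerA.
have cfE v s : wc s = s -> cf v $ (E s s) = v s.
  move=> ss; rewrite evf_sum (bigD1 s) ?ss //= big1 ?addr0 => [|t /andP[/eqP tt ts]].
    by rewrite evfZ ChiE chiE // !eqxx mulr1.
  by rewrite evfZ ChiE chiE // eqxx ss tt eq_sym (negPf ts) mulr0.
have cc v F : cn (cf v) * F = F * cn (cf v) by apply: tracial_central => //; rewrite trf_ctr.
(* Coordinates at indices that represent no block are carried along unchanged, which makes phi an
   endomorphism of one space. *)
pose phi (v : {ffun 'I_(wN w) -> k^o}) : {ffun 'I_(wN w) -> k^o} :=
  [ffun s => if wc s == s then wcf s s (cn (cf v)) : k^o else v s].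
have lw s := @lin_wcf _ _ w s s.
have [||v ve] := lin_inj_surj (f := phi) _ _ [ffun s => (s == r)%:R : k^o].
- move=> c u v; apply/ffunP => s; rewrite !ffunE; case: eqP => _ //.
  by rewrite lcf lin_cn lw.
- move=> v v0; have c0 : cn (cf v) = 0.
    rewrite (central_expand (cc v)) big1 // => s /eqP ss.
    by have /ffunP/(_ s) := v0; rewrite !ffunE ss eqxx => ->; rewrite scale0r.
  have f0 : cf v = 0.
    by rewrite -(trf_ctr (cf v)) -/(cn _) c0 trf0.
  apply/ffunP => s; rewrite [RHS]ffunE; case: (eqVneq (wc s) s) => [ss|ss].
    by rewrite -(cfE v s ss) f0 evf0.
  by have /ffunP/(_ s) := v0; rewrite !ffunE (negPf ss).
suff -> : we (w := w) r = cn (cf v) by rewrite trf_ctr.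
rewrite (central_expand (cc v)) (bigD1 r) ?rr //= big1 ?addr0 => [|s /andP[/eqP ss sr]].
  by have /ffunP/(_ r) := ve; rewrite !ffunE rr !eqxx => ->; rewrite scale1r.
by have /ffunP/(_ s) := ve; rewrite !ffunE ss eqxx (negPf sr) => ->; rewrite scale0r.
Qed.

(* Etingof-Gelaki *)
Lemma double_wdeg_dvd r : (wdeg (w := w) r %| n)%N.
Proof.
wlog rr : r / wc r = r => [th|].
  by rewrite -(wdeg_root r); apply: th; rewrite wcc.
have e0 : trf (we (w := w) r) != 0.
  apply/eqP; rewrite -trf0 => /trf_inj.
  move=> w0; have := wcf_we rr rr; rewrite w0 (lin0 (@lin_wcf _ _ w r r)) eqxx.
  by move/esym/eqP; rewrite oner_eq0.
have wc_ := @we_central _ _ w r.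
have : (wdeg (w := w) r ^ 2 %| n ^ 2)%N.
  (* [om] sends f to the scalar by which the central element [ctr f] acts on block r. The value of
     the idempotent at the integral of D is deg^2 / n^2, so deg^2 divides n^2. *)
  apply: (@casimir_dvd _ _ w ch0 dinv (trf (we (w := w) r)) (fun f => wcf r r (cn f))) => //.
  - exact: trf_we_tracial.
  - move=> f ft; have cc F : cn f * F = F * cn f by apply: tracial_central => //; rewrite trf_ctr.
    have e : cn f * we (w := w) r = wcf r r (cn f) *: we (w := w) r.
      rewrite {1}(central_expand cc) mulr_suml (bigD1 r) ?rr //= big1 ?addr0 => [|s /andP[/eqP ss /negPf sr]].
        by rewrite -scalerAl we_idem.
      by rewrite -scalerAl we_we // sr scale0r scaler0.
    by rewrite -{1}(trf_ctr f) trf_mul // -/(cn f) e trfZ.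
  - by rewrite trf_mul ?we_idem // => F; rewrite we_central.
  - by rewrite expn_gt0 wdeg_gt0.
  rewrite haar_double trf_rk1 (ev_linfun (f := @lmn k H : H -> k^o)); last exact: lin_lmn.
  rewrite -lmn_double /lmn dim_double mulnn mulrC mulrA mulfV ?mul1r; last first.
    by rewrite natrX expf_neq0 ?dim_neq0.
  rewrite /rho (ltr_mul w) (bigD1 r) ?rr //= big1 ?addr0 => [|s /andP[/eqP ss /negPf sr]].
    by rewrite chi_we eqxx -natrM mulnn.
  by rewrite chi_we ss rr sr mul0r.
by rewrite dvdn_pexp2r.
Qed.
End DoubleDivides.

(** * Finite groups of group-like elements *)

Section GrouplikeGroup.
Variables (k : fieldType) (H : hopfType k).
Implicit Types (g h x y : H) (Q : H -> Prop) (s : seq H).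
Local Notation S := antipode.

(** Independence bounds the length of a list of group-like elements by dim H, so a list extended
    while possible exhausts those satisfying Q. The case split is classical, Q being arbitrary. *)
Lemma gl_finite Q : exists2 s, uniq s & forall g, g \in s <-> isgl g /\ Q g.
Proof.
suff step m : exists s, [/\ uniq s, forall g, g \in s -> isgl g /\ Q g &
    (forall g, isgl g -> Q g -> g \in s) \/ (m <= size s)%N].
  have [s [us sg [sm|]]] := step (\dim {:H}).+1.
    by exists s => // g; split; [exact: sg | case; exact: sm].
  have /eqnP fs := gl_free us (fun g gs => proj1 (sg g gs)).
  by move=> lt; have := leq_trans lt (eq_leq (esym fs)); move/leq_trans/(_ (dimvS (subvf _))); rewrite ltnn.
elim: m => [|m [s [us sg sm]]]; first by exists [::]; split=> //; right.
case: sm => [sm|ms]; first by exists s; split=> //; left.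
have [[g [gg Qg gs]]|no] := Classical_Prop.classic (exists g, [/\ isgl g, Q g & g \notin s]).
  exists (g :: s); split=> /=; [by rewrite gs | | by right].
  by move=> h; rewrite inE => /predU1P[->|/sg].
exists s; split=> //; left => g gg Qg; apply/negPn/negP => gs.
by apply: no; exists g.
Qed.
End GrouplikeGroup.

Section GrouplikeType.
Variables (k : fieldType) (H : hopfType k) (s : seq H).
Hypotheses (sgl : forall g, g \in s -> isgl g) (s1 : 1 \in s)
  (sM : forall g h, g \in s -> h \in s -> g * h \in s) (sS : forall g, g \in s -> antipode g \in s).

Definition glt of (forall g, g \in s -> isgl g) & 1 \in s &
  (forall g h, g \in s -> h \in s -> g * h \in s) & (forall g, g \in s -> antipode g \in s) := seq_sub s.
Local Notation G := (glt sgl s1 sM sS).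
HB.instance Definition _ := Finite.copy G (seq_sub s).

Definition glt_val (x : G) : H := ssval x.
Definition glt_mul (x y : G) : G := SeqSub (sM (ssvalP x) (ssvalP y)).
Definition glt_one : G := SeqSub s1.
Definition glt_inv (x : G) : G := SeqSub (sS (ssvalP x)).
Lemma glt_inj : injective glt_val.
Proof. exact: val_inj. Qed.
Fact glt_mulA : associative glt_mul.
Proof. by move=> x y z; apply: glt_inj; rewrite /glt_val /= mulrA. Qed.
Fact glt_mul1 : left_id glt_one glt_mul.
Proof. by move=> x; apply: glt_inj; rewrite /glt_val /= mul1r. Qed.
Fact glt_mulV : left_inverse glt_one glt_inv glt_mul.
Proof. by move=> x; apply: glt_inj; rewrite /glt_val /= gl_Smul //; apply/sgl/ssvalP. Qed.
HB.instance Definition _ := Finite_isGroup.Build G glt_mulA glt_mul1 glt_mulV.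
End GrouplikeType.

(** The predicate Q serves central elements, powers of one element, and stabilizers of characters
    alike. *)
Lemma gl_group (k : fieldType) (H : hopfType k) (Q : H -> Prop) : Q 1 ->
    (forall g h, Q g -> Q h -> Q (g * h)) -> (forall g, isgl g -> Q g -> Q (antipode g)) ->
  exists (gT : finGroupType) (phi : gT -> H), [/\ injective phi,
    {morph phi : x y / (x * y)%g >-> x * y}, phi 1%g = 1, forall x, isgl (phi x) /\ Q (phi x)
    & forall g, isgl g -> Q g -> exists x, phi x = g].
Proof.
move=> Q1 QM QS; have [s us sE] := gl_finite Q.
have sgl g : g \in s -> isgl g by move/sE => [].
have s1 : 1 \in s by apply/sE; split=> //; apply: gl_one.
have sM g h : g \in s -> h \in s -> g * h \in s.
  by move=> /sE[? ?] /sE[? ?]; apply/sE; split; [apply: gl_mul | apply: QM].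
have sS g : g \in s -> antipode g \in s.
  by move=> /sE[? ?]; apply/sE; split; [apply: gl_antipode | apply: QS].
exists (glt sgl s1 sM sS), (@glt_val _ _ _ sgl s1 sM sS); split=> //.
- exact: glt_inj.
- by move=> x; apply/sE; apply: ssvalP.
move=> g gg Qg; have gs : g \in s by apply/sE.
by exists (SeqSub gs).
Qed.

Lemma card_gl_group (k : fieldType) (H : hopfType k) (gT : finGroupType) (phi : gT -> H) m : injective phi ->
  (forall x, isgl (phi x)) -> (forall g, isgl g -> exists x, phi x = g) -> card_grouplikes H m -> #|gT| = m.
Proof.
move=> pi pg ps [s [us sE <-]]; rewrite cardE -(size_map phi).
apply/perm_size/uniq_perm => //; first by rewrite (map_inj_uniq pi) enum_uniq.
move=> g; rewrite sE.
apply/mapP/isglP => [[x _ ->]|/ps[x <-]]; [exact: pg | exists x => //; exact: mem_enum].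
Qed.

Lemma dvdn_inj_morph (gT hT : finGroupType) (f : hT -> gT) : injective f ->
  {morph f : x y / (x * y)%g >-> (x * y)%g} -> (#|hT| %| #|gT|)%N.
Proof.
move=> fi fM; have fM' : {in [set: hT]%G &, {morph f : x y / (x * y)%g}} by move=> x y _ _; apply: fM.
pose F := Morphism fM'; have := cardSg (subsetT (F @* [set: hT])%G).
rewrite card_injm ?cardsT //; apply/injmP => x y _ _; exact: fi.
Qed.

Lemma gl_expr_morph (k : fieldType) (H : hopfType k) (gT : finGroupType) (phi : gT -> H) :
  {morph phi : x y / (x * y)%g >-> x * y} -> phi 1%g = 1 -> forall x i, phi (x ^+ i)%g = phi x ^+ i.
Proof. by move=> pM p1 x; elim=> [|i IH]; rewrite ?expg0 ?expgS ?exprS ?pM ?IH. Qed.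

Lemma gl_cauchy (k : fieldType) (H : hopfType k) (gT : finGroupType) (phi : gT -> H) p : prime p ->
    injective phi -> {morph phi : x y / (x * y)%g >-> x * y} -> phi 1%g = 1 -> (p %| #|gT|)%N ->
  exists x, phi x ^+ p = 1 /\ phi x != 1.
Proof.
move=> pp pi pM p1; rewrite -cardsT => /(Cauchy pp)[x _ xp]; exists x.
split; first by rewrite -(gl_expr_morph pM p1) -xp expg_order.
apply/eqP => e; have x1 : x = 1%g by apply: pi; rewrite e p1.
by move: pp; rewrite -xp x1 order1.
Qed.

Section PrimeOrder.
Variables (k : fieldType) (H : hopfType k) (p : nat) (z : H).
Hypotheses (pp : prime p) (zg : isgl z) (zp : z ^+ p = 1) (z1 : z != 1).
Lemma gl_expr_eq1 i : (z ^+ i == 1) = (p %| i)%N.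
Proof.
apply/eqP/idP => [zi|/dvdnP[m ->]]; last by rewrite mulnC exprM zp expr1n.
apply: contraNT z1; rewrite -prime_coprime // => cop.
have p0 := prime_gt0 pp; have [u _] := Bezoutl i p0; rewrite (eqP cop) => /dvdnP[v e].
have e2 : (1 + u * i)%N = (v * p)%N by [].
have : z ^+ (v * p) = 1 by rewrite mulnC exprM zp expr1n.
rewrite -e2 exprD expr1 mulnC exprM zi expr1n mulr1 => ->.
by rewrite eqxx.
Qed.
Lemma gl_exp_inj (i j : 'I_p) : z ^+ i = z ^+ j -> i = j.
Proof.
wlog ij : i j / (i <= j)%N => [th|] e.
  by case: (leqP i j) => [|/ltnW] ij; [|apply/esym]; apply: th.
have zi : z ^+ i * antipode (z ^+ i) = 1 by apply: gl_mulS; apply: gl_exp.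
have : z ^+ (j - i) == 1.
  by apply/eqP; rewrite -[LHS]mulr1 -[X in _ * X]zi mulrA -exprD subnK // -e.
rewrite gl_expr_eq1 => /dvdnP[[|m] ji]; apply/val_inj/eqP; rewrite eqn_leq ij /= -subn_eq0 ji //.
by have := leq_ltn_trans (leq_subr i j) (ltn_ord j); rewrite ji mulSn ltnNge leq_addr.
Qed.
End PrimeOrder.

(** * Hopf subalgebras as images of projections *)

Section TensorFunctor.
Variables k : fieldType.

Lemma tmap_comp (V W V' W' V2 W2 : vectType k) (f : {linear V -> V'}) (g : {linear W -> W'})
    (f' : {linear V' -> V2}) (g' : {linear W' -> W2}) (f2 : {linear V -> V2}) (g2 : {linear W -> W2}) t :
  (forall x, f2 x = f' (f x)) -> (forall x, g2 x = g' (g x)) -> tmap f' g' (tmap f g t) = tmap f2 g2 t.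
Proof.
move=> ff gg; move: t; apply: lin_tensor_eq => [||x y].
- exact: lin_comp (lin_linear _) (lin_linear _).
- exact: lin_linear.
by rewrite !tmap_ox ff gg.
Qed.

Lemma tmapK (V W V' W' : vectType k) (f : {linear V -> V'}) (g : {linear W -> W'})
    (f' : {linear V' -> V}) (g' : {linear W' -> W}) : cancel f f' -> cancel g g' -> cancel (tmap f g) (tmap f' g').
Proof.
move=> fK gK t.
rewrite (tmap_comp (f2 := idfun) (g2 := idfun)) => [|x|x]; rewrite ?fK ?gK //.
by move: t; apply: lin_tensor_eq => [||x y]; [exact: lin_linear | exact: lin_id | rewrite tmap_ox].
Qed.

Lemma tmapM (A B A' B' : falgType k) (f : {lrmorphism A -> A'}) (g : {lrmorphism B -> B'}) s t :
  tmap f g (s * t) = tmap f g s * tmap f g t.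
Proof.
move: s; apply: lin_tensor_eq => [||x y].
- by apply: lin_comp (lin_linear _) _; lin.
- by apply: lin_mull; apply: lin_linear.
move: t; apply: lin_tensor_eq => [||u v].
- by apply: lin_comp (lin_linear _) _; lin.
- by apply: lin_mulr; apply: lin_linear.
by rewrite mul_ox !tmap_ox !rmorphM mul_ox.
Qed.

Lemma tassoc_tmap (U V W U' V' W' : vectType k) (f : {linear U -> U'}) (g : {linear V -> V'})
    (h : {linear W -> W'}) t :
  tmap f (tmap g h) (tassoc t) = tassoc (tmap (tmap f g) h t).
Proof.
move: t; apply: lin_tensor_eq => [||t w].
- exact: lin_comp (lin_linear _) (lin_linear _).
- exact: lin_comp (lin_linear _) (lin_linear _).
move: t; apply: lin_tensor_eq => [||u v].
- exact: lin_comp (lin_linear _) (lin_comp (lin_linear _) (lin_oxl _ (@lin_id _ _))).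
- exact: lin_comp (lin_linear _) (lin_comp (lin_linear _) (lin_oxl _ (@lin_id _ _))).
by rewrite tassoc_ox tmap_ox /= tmap_ox tmap_ox /= tmap_ox tassoc_ox.
Qed.
End TensorFunctor.

Section SubHopfType.
Variables (k : fieldType) (H : hopfType k) (U : {aspace H}).
Hypotheses (U1 : 1 \in U) (UD : forall u, u \in U -> comul u = tmap (projv U) (projv U) (comul u))
  (US : forall u, u \in U -> antipode u \in U).

Definition subhopf of (1 \in U) & (forall u, u \in U -> comul u = tmap (projv U) (projv U) (comul u))
  & (forall u, u \in U -> antipode u \in U) := subvs_of U.
Local Notation K := (subhopf U1 UD US).
HB.instance Definition _ := Falgebra.copy K (subvs_of U).
Implicit Types (x y : K).

Definition shval (x : K) : H := vsval x.
Fact shval_linear : linear shval. Proof. by []. Qed.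
HB.instance Definition _ := GRing.isLinear.Build k K H _ shval shval_linear.
Fact shval_monoid : monoid_morphism shval.
Proof.
by split=> [|x y] //; rewrite /shval /= ; apply/eqP; rewrite algid_eq1.
Qed.
HB.instance Definition _ := GRing.isMonoidMorphism.Build K H shval shval_monoid.
Definition shproj (h : H) : K := vsproj U h.
Fact shproj_linear : linear shproj. Proof. exact: vsproj_is_linear. Qed.
HB.instance Definition _ := GRing.isLinear.Build k H K _ shproj shproj_linear.

Lemma shvalK : cancel shval shproj. Proof. exact: vsvalK. Qed.
Lemma shprojK u : u \in U -> shval (shproj u) = u. Proof. exact: vsprojK. Qed.
Lemma shvalP x : shval x \in U. Proof. exact: subvsP. Qed.
Lemma shval_proj h : shval (shproj h) = projv U h.
Proof. by rewrite /shproj /vsproj unlock. Qed.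

Definition shcomul x : tensor K K := tmap shproj shproj (comul (shval x)).
Fact shcomul_linear : linear shcomul.
Proof. by move=> c x y; rewrite /shcomul !linearP. Qed.
HB.instance Definition _ := GRing.isLinear.Build k K (tensor K K) _ shcomul shcomul_linear.

Lemma shcomulE x : tmap shval shval (shcomul x) = comul (shval x).
Proof.
have pE h : projv U h = shval (shproj h) by rewrite shval_proj.
by rewrite /shcomul (tmap_comp _ pE pE) -UD ?shvalP.
Qed.

Let inj2 := can_inj (tmapK shvalK shvalK).

Fact shcomul_monoid : monoid_morphism shcomul.
Proof.
split=> [|x y]; apply: inj2; rewrite ?tmapM !shcomulE ?rmorphM ?rmorph1 //.
by rewrite tmap_ox rmorph1.
Qed.
HB.instance Definition _ := GRing.isMonoidMorphism.Build K (tensor K K) shcomul shcomul_monoid.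

Definition shcounit x : k^o := counit (shval x).
Fact shcounit_linear : linear shcounit. Proof. by move=> c x y; rewrite /shcounit !linearP. Qed.
HB.instance Definition _ := GRing.isLinear.Build k K k^o _ shcounit shcounit_linear.
Fact shcounit_monoid : monoid_morphism shcounit.
Proof. by split=> [|x y]; rewrite /shcounit ?rmorph1 ?rmorphM. Qed.
HB.instance Definition _ := GRing.isMonoidMorphism.Build K k^o shcounit shcounit_monoid.

Definition shantipode x : K := shproj (antipode (shval x)).
Fact shantipode_linear : linear shantipode. Proof. by move=> c x y; rewrite /shantipode !linearP. Qed.
HB.instance Definition _ := GRing.isLinear.Build k K K _ shantipode shantipode_linear.
Lemma shantipodeE x : shval (shantipode x) = antipode (shval x).
Proof. by rewrite shprojK // US // shvalP. Qed.

Lemma sh_tlift (X : lmodType k) (F : H -> H -> X) x : bilinear_map F ->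
  tlift (fun a b => F (shval a) (shval b)) (shcomul x) = sw (shval x) F.
Proof. by move=> bF; rewrite /sw -shcomulE (tlift_tmap shval shval _ bF). Qed.

Fact shcomulA x : tassoc (tmap shcomul idfun (shcomul x)) = tmap idfun shcomul (shcomul x).
Proof.
apply: (can_inj (tmapK shvalK (tmapK shvalK shvalK))).
rewrite tassoc_tmap.
have -> : tmap (tmap shval shval) shval (tmap shcomul idfun (shcomul x)) =
    tmap comul idfun (tmap shval shval (shcomul x)).
  move: (shcomul x); apply: lin_tensor_eq => [||y z]; try exact: lin_comp (lin_linear _) (lin_linear _).
  by rewrite !tmap_ox /= shcomulE.
have -> : tmap shval (tmap shval shval) (tmap idfun shcomul (shcomul x)) =
    tmap idfun comul (tmap shval shval (shcomul x)).
  move: (shcomul x); apply: lin_tensor_eq => [||y z]; try exact: lin_comp (lin_linear _) (lin_linear _).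
  by rewrite !tmap_ox /= shcomulE.
by rewrite shcomulE comulA.
Qed.

Fact shcounitl x : tlift (fun a b => shcounit a *: b) (shcomul x) = x.
Proof.
apply: (can_inj shvalK); rewrite (linear_tlift shval) -[RHS](counitl (shval x)) -/(sw _ _) -sh_tlift.
  by apply: eq_tlift => a b; rewrite linearZ.
by apply: lin2_bilinear => a; [lin | apply: lin_scalel; apply: lin_linear].
Qed.
Fact shcounitr x : tlift (fun a b => shcounit b *: a) (shcomul x) = x.
Proof.
apply: (can_inj shvalK); rewrite (linear_tlift shval) -[RHS](counitr (shval x)) -/(sw _ _) -sh_tlift.
  by apply: eq_tlift => a b; rewrite linearZ.
by apply: lin2_bilinear => a; [apply: lin_scalel; apply: lin_linear | lin].
Qed.
Lemma shval_counit x : shval ((shcounit x : k)%:A) = (counit (shval x) : k)%:A.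
Proof. by rewrite linearZ_LR rmorph1. Qed.
Fact shantipodel x : tlift (fun a b => shantipode a * b) (shcomul x) = (shcounit x : k)%:A.
Proof.
apply: (can_inj shvalK); rewrite (linear_tlift shval) shval_counit -antipodel -/(sw _ _) -sh_tlift.
  by apply: eq_tlift => a b; rewrite -shantipodeE; exact: rmorphM.
by apply: lin2_bilinear => a; lin.
Qed.
Fact shantipoder x : tlift (fun a b => a * shantipode b) (shcomul x) = (shcounit x : k)%:A.
Proof.
apply: (can_inj shvalK); rewrite (linear_tlift shval) shval_counit -antipoder -/(sw _ _) -sh_tlift.
  by apply: eq_tlift => a b; rewrite -shantipodeE; exact: rmorphM.
by apply: lin2_bilinear => a; lin.
Qed.
HB.instance Definition _ := Falgebra_isHopf.Build k K shcomulA shcounitl shcounitr shantipodel shantipoder.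

Lemma shval_hopf : hopf_morphism (shval : {lrmorphism K -> H}).
Proof. by split=> [x|x|x] //; [exact: esym (shcomulE x) | exact: esym (shantipodeE x)]. Qed.
End SubHopfType.

(** The dimension is delivered as the trace of E, since the later projections have computable traces
    and no visible bases. *)
Lemma subhopf_ex (k : fieldType) (H : hopfType k) (E : H -> H) : lin E -> E 1 = 1 ->
    (forall x, E (E x) = E x) -> (forall x y, E (E x * E y) = E x * E y) ->
    (forall x, E (antipode (E x)) = antipode (E x)) ->
    (forall x, comul (E x) = sw (E x) (fun a b => E a \ox E b)) ->
  exists (K : hopfType k) (iota : {lrmorphism K -> H}), [/\ hopf_morphism iota, injective iota,
     forall h, E h = h <-> exists x, iota x = h & (\dim {:K})%:R = ltr E].
Proof.
move=> El E1 EE EM ES ED; pose V := limg (linfun E).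
have VP h : reflect (E h = h) (h \in V).
  apply: (iffP (lin_limg h El)) => [[x ->]|e]; first exact: EE.
  by exists h.
have V1 : 1 \in V by apply/VP.
have Vs : is_aspace V.
  rewrite /is_aspace has_algid1 //=; apply/prodvP => x y /VP <- /VP <-; apply/VP.
  exact: EM.
pose U : {aspace H} := ASpace Vs.
have UD u : u \in U -> comul u = tmap (projv U) (projv U) (comul u).
  move/VP => e; have pE a : projv U (E a) = E a by apply: projv_id; apply/VP.
  rewrite -e ED /sw (linear_tlift (tmap (projv U) (projv U))); apply: eq_tlift => a b.
  by rewrite /= tmap_ox /= !pE.
have US u : u \in U -> antipode u \in U by move=> /VP <-; apply/VP.
have U1 : 1 \in U by [].
exists (subhopf U1 UD US), (@shval _ _ _ U1 UD US); split.
- exact: shval_hopf.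
- exact/can_inj/shvalK.
- move=> h; split=> [/VP hU|[x <-]]; last exact/VP/shvalP.
  by exists (shproj U1 UD US h); apply: shprojK.
rewrite (ltr_proj El (U := V)); last by move=> x /VP.
  by rewrite dimvf.
by move=> x; apply/VP; apply: EE.
Qed.

(** * Quotients dual to Hopf subalgebras of the dual *)

Section EvalTensor.
Variables (k : fieldType) (H : hopfType k) (V : vectType k).

Lemma lin_evl (a : H) : lin (fun t : tensor (hdual H) V => evl t a).
Proof. exact: lin_tlift. Qed.

Definition evr (t : tensor V (hdual H)) (a : H) : V := tlift (fun v f => f $ a *: v) t.
Lemma lin_evr a : lin (fun t => evr t a).
Proof. exact: lin_tlift. Qed.
Lemma evr_ox v f a : evr (v \ox f) a = f $ a *: v.
Proof. by rewrite /evr tlift_ox //; apply: lin2_bilinear => u; lin. Qed.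
Lemma evr_inj s t : (forall a, evr s a = evr t a) -> s = t.
Proof.
have e u : u = \sum_i evr u (bs i) \ox dbasis i.
  move: u; apply: lin_tensor_eq => [||v f]; first exact: lin_id.
    by apply: lin_big => i; apply: lin_oxl; apply: lin_evr.
  under eq_bigr => i _ do rewrite evr_ox.
  have {1}-> : f = \sum_i f $ (bs i) *: dbasis i.
    apply: ev_inj => h; rewrite evf_sum {1}(bs_sum h) ev_sum.
    by apply: eq_bigr => i _; rewrite evZ evfZ ev_dbasis mulrC.
  rewrite (lin_sum (f := fun f => v \ox f)); last by lin.
  apply: eq_bigr => i _; rewrite (linZ (f := fun f => v \ox f)); last by lin.
  by rewrite (linZ (f := fun v => v \ox _)) //; lin.
by move=> st; rewrite (e s) (e t); apply: eq_bigr => i _; rewrite st.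
Qed.
End EvalTensor.

Section DualQuotient.
Variables (k : fieldType) (H K : hopfType k) (iota : {lrmorphism K -> hdual H}).
Hypotheses (ih : hopf_morphism iota) (ii : injective iota).
Implicit Types (h a b : H) (x y : K).
Let il : lin iota. Proof. exact: lin_linear. Qed.

(** The transpose of iota, on H seen as its own bidual: the quotient of H whose dual is K. *)
Definition dquot h : hdual K := linfun (fun x => iota x $ h : k^o).
Lemma dquotE h x : dquot h $ x = iota x $ h.
Proof. by apply: (ev_linfun (f := fun x => iota x $ h : k^o)); lin. Qed.
Fact dquot_linear : linear dquot.
Proof. by move=> c a b; apply: ev_inj => x; rewrite evP !dquotE evD evZ. Qed.
HB.instance Definition _ := GRing.isLinear.Build k H (hdual K) _ dquot dquot_linear.

Lemma sw_iota (X : lmodType k) (F : hdual H -> hdual H -> X) x :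
    (forall u, lin (fun v => F u v)) -> (forall v, lin (fun u => F u v)) ->
  sw (iota x) F = sw x (fun u v => F (iota u) (iota v)).
Proof.
case: ih => ic _ _ F1 F2; rewrite /sw ic.
by rewrite (tlift_tmap iota iota _ (lin2_bilinear F1 F2)).
Qed.

Fact dquot_monoid : monoid_morphism dquot.
Proof.
case: ih => ic ie ia; split=> [|a b]; apply: ev_inj => x; rewrite dquotE.
  by rewrite ev1 -[LHS]/(eps (iota x)) -[RHS]/(eps x) /eps ie.
rewrite ev_mul -sw_hdual sw_iota; [|lin|lin].
by apply: (@eq_sw _ _ k^o) => u v; rewrite !dquotE.
Qed.
HB.instance Definition _ := GRing.isMonoidMorphism.Build H (hdual K) dquot dquot_monoid.

Lemma dquot_hopf : hopf_morphism (dquot : {lrmorphism H -> hdual K}).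
Proof.
case: ih => ic ie ia; split=> h.
- apply: evl_inj => x; apply: ev_inj => y.
  rewrite -[LHS]/(heval (evl (hdual_comul _) x) y) hdual_comulE -[LHS]/(dquot h $ (x * y)) dquotE rmorphM ev_mul.
  rewrite /sw; move: (comul h); apply: (@lin_tensor_eq _ _ _ k^o) => [||a b].
  + exact: lin_tlift.
  + by apply: lin_comp (@lin_ev _ _ _ _ _) _ || (move=> c s t; rewrite linearP /= (lin_evl x) evP).
  rewrite tlift_ox; last by apply: lin2_bilinear => u; lin.
  by rewrite tmap_ox evl_ox evfZ dquotE; congr (_ * _); exact: esym (dquotE a x).
- by rewrite -[LHS]/(dquot h $ 1) dquotE rmorph1 ev1.
by apply: ev_inj => x; rewrite ev_antipode !dquotE -ev_antipode ia.
Qed.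

Lemma dquot_surj (F : hdual K) : exists h, dquot h = F.
Proof.
have k0 : lker (linfun iota) == 0%VS.
  by apply/lker0P => x y; rewrite !(lin_linfun il) => /ii.
(* The generalized inverse is a left inverse of iota, so G extends F from the image of iota to the
   whole dual. *)
pose G f : k^o := F $ ((linfun iota)^-1%VF f).
have Gl : lin G by move=> c f g; rewrite /G linearP /= evD evZ.
exists (\sum_i G (@dbasis k H i) *: bs i); apply: ev_inj => x; rewrite dquotE.
have <- : G (iota x) = F $ x by rewrite /G -[iota x](lin_linfun il) lker0_lfunK.
have {2}-> : iota x = \sum_i iota x $ (bs i) *: dbasis i.
  apply: ev_inj => h; rewrite evf_sum {1}(bs_sum h) ev_sum.
  by apply: eq_bigr => i _; rewrite evZ evfZ ev_dbasis mulrC.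
rewrite ev_sum; have := lin_sum _ xpredT (fun i => iota x $ (bs i) *: dbasis i) Gl => /= ->.
by apply: eq_bigr => i _; rewrite evZ (linZ _ _ Gl) mulrC.
Qed.

Lemma dquot_coinvr h : h \in coinvr (dquot : {lrmorphism H -> hdual K}) <->
  forall x, sw h (fun a b => iota x $ b *: a) = iota x $ 1 *: h.
Proof.
have e x : evr (tmap idfun dquot (comul h)) x = sw h (fun a b => iota x $ b *: a).
  rewrite /sw; move: (comul h); apply: lin_tensor_eq => [||a b]; [|exact: lin_tlift|].
    exact: lin_comp (lin_evr x) (lin_linear _).
  rewrite tlift_ox; last by apply: lin2_bilinear => u; lin.
  by rewrite tmap_ox evr_ox dquotE.
split=> [/eqP t x|t]; first by rewrite -e t evr_ox -(rmorph1 (dquot : {lrmorphism _ -> _})) dquotE.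
apply/eqP/evr_inj => x; rewrite e t evr_ox -(rmorph1 (dquot : {lrmorphism _ -> _})) dquotE.
by [].
Qed.

Lemma dquot_coinvl h : h \in coinvl (dquot : {lrmorphism H -> hdual K}) <->
  forall x, sw h (fun a b => iota x $ a *: b) = iota x $ 1 *: h.
Proof.
have e x : evl (tmap dquot idfun (comul h)) x = sw h (fun a b => iota x $ a *: b).
  rewrite /sw; move: (comul h); apply: lin_tensor_eq => [||a b]; [|exact: lin_tlift|].
    exact: lin_comp (lin_evl x) (lin_linear _).
  rewrite tlift_ox; last by apply: lin2_bilinear => u; lin.
  by rewrite tmap_ox evl_ox; congr (_ *: _); apply: dquotE.
have e1 x : heval (1 : hdual K) x = iota x $ 1.
  by rewrite -(rmorph1 (dquot : {lrmorphism _ -> _})); apply: dquotE.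
split=> [/eqP t x|t]; first by rewrite -e t evl_ox e1.
by apply/eqP/evl_inj => x; rewrite e t evl_ox e1.
Qed.
End DualQuotient.

(** * Group-like projections *)

Section GrouplikeProjection.
Variables (k : fieldType) (H : hopfType k) (P : H).
Hypotheses (SS : forall x : H, antipode (antipode x) = x).
Hypotheses (eP : eps P = 1) (PC : forall h, h * P = P * h)
  (PD : sw P (fun a b => a \ox (b * P)) = P \ox P).
Local Notation S := antipode.

Lemma glproj_sw (X : lmodType k) (F : H -> H -> X) :
    (forall a, lin (fun b => F a b)) -> (forall b, lin (fun a => F a b)) ->
  sw P (fun a b => F a (b * P)) = F P P.
Proof.
move=> F1 F2; have bb := lin2_bilinear F1 F2.
rewrite -[RHS](tlift_ox bb) -PD (sw_lin _ _ (@lin_tlift _ _ _ _ F)).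
by apply: eq_sw => a b; rewrite tlift_ox.
Qed.

Lemma glproj_idem : P * P = P.
Proof.
have := @glproj_sw H (fun a b => eps a *: b); rewrite eP scale1r => e.
rewrite -[RHS]e; [|lin|lin]; apply: esym.
by apply: (sw_cul (fun b => b * P)) => //; lin.
Qed.

Lemma glproj_antipode : S P = P.
Proof.
have e : S P * P = P.
  rewrite -(@glproj_sw H (fun a b => S a * b)); [|lin|lin].
  rewrite (sw_antl (fun z => z * P)) => [|a b|]; [|by rewrite mulrA|by lin].
  by rewrite eP scale1r mul1r.
by rewrite -{1}e antipodeM SS.
Qed.

(** [PD] reads Delta(P)(1 (x) P) = P (x) P, which makes f |-> f(P -) a projection of the dual onto a
    Hopf subalgebra. It is applied to the average of a central group-like element and to the
    normalized integral of T. *)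
Lemma glproj_subhopf : [pchar k] =i pred0 ->
  exists (K : hopfType k) (iota : {lrmorphism K -> hdual H}), [/\ hopf_morphism iota, injective iota,
    forall f, (forall h, f $ (P * h) = f $ h) <-> exists x, iota x = f & (\dim {:K})%:R = (\dim {:H})%:R * lmn P].
Proof.
move=> ch0; pose E f : hdual H := linfun (fun h => f $ (P * h) : k^o).
have EE f h : E f $ h = f $ (P * h) by apply: (ev_linfun (f := fun h => f $ (P * h) : k^o)); lin.
have El : lin E by move=> c f g; apply: ev_inj => h; rewrite evP !EE evP.
have PP := glproj_idem; have PPA h : P * (P * h) = P * h by rewrite mulrA PP.
have [|||||K [iota [ih ii iE dK]]] := subhopf_ex El.
- by apply: ev_inj => h; rewrite EE !ev1 epsM eP mul1r.
- by move=> f; apply: ev_inj => h; rewrite !EE PPA.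
- move=> f g; apply: ev_inj => h; rewrite EE !ev_mul swM; [|lin|lin].
  pose F a b : k^o := sw h (fun u v => f $ (P * (a * u)) * g $ (b * v) : k^o).
  transitivity (F P P).
    have F1 a : lin (F a) by rewrite /F; apply: lin_sw => u v; lin.
    have F2 b : lin (F^~ b) by rewrite /F; apply: lin_sw => u v; lin.
    apply: etrans (glproj_sw F1 F2).
    apply: (@eq_sw _ _ k^o) => a b; apply: (@eq_sw _ _ k^o) => u v.
    by rewrite !EE PC !mulrA.
  by apply: (@eq_sw _ _ k^o) => u v; rewrite !EE PPA.
- move=> f; apply: ev_inj => h; rewrite EE !ev_antipode !EE antipodeM glproj_antipode.
  by rewrite -PC mulrA PP || rewrite PC PPA.
- move=> f; rewrite comul_sw; apply: evl_inj => a; apply: ev_inj => b.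
  have l (G : hdual H -> hdual H -> tensor (hdual H) (hdual H)) : (evl (sw (E f) G) a) $ b = sw (E f) (fun u v => (evl (G u v) a) $ b : k^o).
    rewrite (sw_lin _ _ (@lin_evl _ _ _ a)) (sw_lin (f := fun u : hdual H => u $ b : k^o)) //; lin.
  rewrite !l; under [LHS]eq_sw do rewrite evl_ox evfZ; under [RHS]eq_sw => u v do rewrite evl_ox evfZ -[heval (E u) a]/(E u $ a) !EE.
  rewrite !sw_hdual !EE; congr (f $ _).
  by rewrite -!mulrA ?PPA (mulrA a) PC -mulrA PPA.
exists K, iota; split=> //.
  move=> f; rewrite -iE; split=> [e|<- h]; first by apply: ev_inj => h; rewrite EE.
  by rewrite !EE PPA.
rewrite dK (ltr_hdual (F := fun h => P * h)) // -[LHS]/(rho P).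
by rewrite rho_lmn.
Qed.
End GrouplikeProjection.

(** * Trivial Hopf algebras are upper semisolvable *)

Section Packing.
Variables (k : fieldType).

Definition lrpack (A B : falgType k) (f : A -> B) (fl : linear f) (fm : monoid_morphism f) :
  {lrmorphism A -> B} := HB.pack f (GRing.isLinear.Build k A B _ f fl) (GRing.isMonoidMorphism.Build A B f fm).

Lemma hopf_iso_inv (H K : hopfType k) (f : {lrmorphism K -> H}) :
  hopf_morphism f -> bijective f -> hopf_iso H K.
Proof.
case=> fc fe fa [g gK fK].
have gl : linear g by move=> c x y; apply: (can_inj gK); rewrite fK linearP /= !fK.
have gm : monoid_morphism g.
  by split=> [|x y]; apply: (can_inj gK); rewrite ?rmorph1 ?rmorphM /= !fK.
pose G := lrpack gl gm; exists G; last by exists f.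
have GK x : G (f x) = x by apply: gK.
split=> h; have [x ->] : exists x, h = f x by exists (g h); rewrite fK.
- rewrite GK fc (@tmap_comp _ _ _ _ _ _ _ f f G G idfun idfun _ (fun x => esym (GK x)) (fun x => esym (GK x))).
  by move: (comul x); apply: lin_tensor_eq => [||y z]; [exact: lin_id | exact: lin_linear | rewrite tmap_ox].
- by rewrite GK fe.
by rewrite GK fa GK.
Qed.

Lemma hopf_iso_refl (H : hopfType k) : hopf_iso H H.
Proof.
exists idfun; last by exists idfun.
split=> // h; move: (comul h); apply: lin_tensor_eq => [||y z]; [exact: lin_id | exact: lin_linear |].
by rewrite tmap_ox.
Qed.

(** The counit alone is the chain: all of H is coinvariant for it. *)
Lemma us_trivial (H : hopfType k) : trivial_hopf H -> upper_semisolvable H.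
Proof.
move=> tH; pose pi := (counit : {lrmorphism H -> k^o}).
have c1 (h : H) : tmap idfun pi (comul h) == h \ox 1.
  rewrite -[tmap _ _ _]/(tlift _ _) -/(sw _ _); apply/eqP.
  apply: (sw_cur (fun a => a \ox (1 : k^o))) => [a b|]; last by lin.
  by rewrite -(linZ (f := fun y => a \ox y) _ (1 : k^o)); [congr (_ \ox _); rewrite -[RHS]/(_ * _) mulr1 | lin].
have c2 (h : H) : tmap pi idfun (comul h) == 1 \ox h.
  rewrite -[tmap _ _ _]/(tlift _ _) -/(sw _ _); apply/eqP.
  apply: (sw_cul (fun a => (1 : k^o) \ox a)) => [a b|]; last by lin.
  by rewrite -(linZ (f := fun y => y \ox b) _ (1 : k^o)); [congr (_ \ox _); rewrite -[RHS]/(_ * _) mulr1 | lin].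
apply: (UpperSemisolvableStep (B := k^o) (pi := pi)).
- split=> h //; last by rewrite -[RHS]/(eps (antipode h)) eps_antipode.
  rewrite -[RHS]/(tlift _ _) -/(sw _ _) -[LHS]/(eps h *: ((1 : k^o) \ox (1 : k^o))).
  apply: esym; apply: (sw_cul (fun b => eps b *: ((1 : k^o) \ox (1 : k^o)))) => [a b|]; last by lin.
  have t (x y : k^o) : x \ox y = (x : k) *: ((y : k) *: ((1 : k^o) \ox (1 : k^o))).
    have e (z : k^o) : z = (z : k) *: (1 : k^o) by rewrite -[RHS]/(_ * _) mulr1.
    rewrite {1}(e x) {1}(e y) (linZ (f := fun u => u \ox _)); last by lin.
    by rewrite (linZ (f := fun u => _ \ox u)); last by lin.
  exact: t.
- by move=> b; exists (b *: 1); rewrite linearZ rmorph1 -[LHS]/(_ * _) mulr1.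
- by move=> h; rewrite !inE c1 c2.
- exists H, idfun; split=> //; first by have [f fh _] := hopf_iso_refl H; split=> // h; move: (comul h); apply: lin_tensor_eq => [||y z]; [exact: lin_id | exact: lin_linear | rewrite tmap_ox].
  by move=> h; split=> [_|_]; [exists h | rewrite inE c1].
exact/UpperSemisolvableBase/hopf_iso_refl.
Qed.
End Packing.

(** * Group algebras spanned by group-like elements *)

Section GrouplikeSpan.
Variables (k : fieldType) (H : hopfType k) (gT : finGroupType) (phi : gT -> H).
Hypotheses (pi : injective phi) (pM : {morph phi : x y / (x * y)%g >-> x * y}) (p1 : phi 1%g = 1)
  (pg : forall x, isgl (phi x)).

Lemma gext_monoid : monoid_morphism (gext phi : group_algebra k gT -> H).
Proof.
split=> [|f g]; first by rewrite -[1 in LHS]/(gelt k 1%g) gext_gelt.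
elim/group_algebra_ind: f => [c f f' e e'|x]; first by rewrite mulrDl -scalerAl !linearP /= e e' mulrDl -scalerAl.
elim/group_algebra_ind: g => [c f f' e e'|y]; first by rewrite mulrDr -scalerAr !linearP /= e e' mulrDr -scalerAr.
by rewrite geltM !gext_gelt pM.
Qed.

Definition gextlr : {lrmorphism group_algebra k gT -> H} := lrpack (@gext_linear _ _ _ phi) gext_monoid.
Lemma gextlrE x : gextlr (gelt k x) = phi x.
Proof. exact: gext_gelt. Qed.

Lemma gextlr_hopf : hopf_morphism gextlr.
Proof.
split=> f.
- elim/group_algebra_ind: f => [c f f' e e'|x]; first by rewrite !linearP /= e e'.
  rewrite gextlrE (proj2 (pg x)) -[comul (gelt k x)]/(gext _ _) gext_gelt tmap_ox.
  by congr (_ \ox _); rewrite -gextlrE.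
- elim/group_algebra_ind: f => [c f f' e e'|x]; first by rewrite !linearP /= e e'.
  by rewrite gextlrE -[counit (gelt k x)]/(gext _ _) gext_gelt -[LHS]/(eps _) (proj1 (pg x)).
elim/group_algebra_ind: f => [c f f' e e'|x]; first by rewrite !linearP /= e e'.
rewrite gextlrE -[antipode (gelt k x)]/(gext _ _) gext_gelt gextlrE.
by rewrite -[LHS]mul1r -p1 -(mulVg x) pM -mulrA gl_mulS // mulr1.
Qed.

Let s := [seq phi x | x : gT].
Let us : uniq s. Proof. by rewrite map_inj_uniq // enum_uniq. Qed.
Let fs : free s. Proof. by apply: gl_free => // g /mapP[x _ ->]. Qed.

Lemma gextlr_inj : injective gextlr.
Proof.
have z f : gextlr f = 0 -> f = 0.
  move=> f0; apply/ffunP => x; rewrite ffunE.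
  have sz : size s = #|gT| by rewrite size_map -cardE.
  have /freeP/(_ (fun i : 'I_(size s) => (f : {ffun gT -> k^o}) (enum_val (cast_ord sz i)) : k)) : free (in_tuple s) by [].
  have e : \sum_(i < size s) ((f : {ffun gT -> k^o}) (enum_val (cast_ord sz i)) : k) *: (s`_i : H) = 0.
    rewrite -[RHS]f0 -[RHS]/(gext phi f) /gext.
    rewrite [RHS](reindex (fun i : 'I_(size s) => enum_val (cast_ord sz i))) /=; last first.
      exists (fun y => cast_ord (esym sz) (enum_rank y)) => [i _|y _]; first by rewrite enum_valK cast_ordK.
      by rewrite cast_ordKV enum_rankK.
    apply: eq_bigr => i _; congr (_ *: _).
    rewrite (nth_map 1%g); last by rewrite -cardE -sz.
    by congr phi; rewrite (enum_val_nth 1%g).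
  move/(_ e (cast_ord (esym sz) (enum_rank x))).
  by rewrite cast_ordKV enum_rankK.
by move=> f g /eqP; rewrite -subr_eq0 -linearB => /eqP/z/eqP; rewrite subr_eq0 => /eqP.
Qed.

Lemma gl_card_le : (#|gT| <= \dim {:H})%N.
Proof.
have <- : size s = #|gT| by rewrite size_map -cardE.
by have /eqnP <- := fs; rewrite dimvS ?subvf.
Qed.

Lemma gextlr_surj : #|gT| = \dim {:H} -> forall h, exists f, gextlr f = h.
Proof.
move=> e h; have sz : size s = #|gT| by rewrite size_map -cardE.
have sH : (<<s>> = {:H})%VS.
  by apply/eqP; rewrite -(dimv_leqif_eq (subvf _)) -e -sz; apply/eqP; apply/eqnP.
have : h \in <<s>>%VS by rewrite sH memvf.
rewrite -[s]/(tval (in_tuple s)) => /coord_span ->.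
exists (\sum_(i < size s) coord (in_tuple s) i h *: gelt k (enum_val (cast_ord sz i))).
rewrite linear_sum; apply: eq_bigr => i _; rewrite linearZ_LR; congr (_ *: _); apply: etrans (gextlrE _) _.
rewrite [RHS](nth_map 1%g); last by rewrite -cardE -sz.
by congr phi; rewrite (enum_val_nth 1%g).
Qed.

Lemma gl_span_trivial : #|gT| = \dim {:H} -> trivial_hopf H.
Proof.
move=> e; exists gT; left; apply: (hopf_iso_inv gextlr_hopf).
have inj := gextlr_inj; have surj' h : exists f, gextlr f == h by have [f <-] := gextlr_surj e h; exists f.
by exists (fun h => xchoose (surj' h)) => [f|h]; [apply: inj; apply/eqP/(xchooseP (surj' _)) | apply/eqP/(xchooseP (surj' _))].
Qed.
End GrouplikeSpan.

Lemma hopf_inj_inv (k : fieldType) (H K : hopfType k) (iota : {lrmorphism K -> H}) :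
    hopf_morphism iota -> injective iota -> (forall h : H, antipode (antipode h) = h) ->
  forall x : K, antipode (antipode x) = x.
Proof. by case=> _ _ ia ii SS x; apply: ii; rewrite -!ia SS. Qed.

(** * Translations by functionals *)

Section Translations.
Variables (k : fieldType) (H : hopfType k).
Implicit Types (f g : hdual H) (h x y z : H).
Local Notation S := antipode.

(** The two hit actions of the dual on H: [rt] is a left action ([rt_rt]) and [lt] a right one
    ([lt_lt]). *)
Definition rt f h : H := sw h (fun a b => f $ b *: a).
Definition lt f h : H := sw h (fun a b => f $ a *: b).
Lemma lin_rt f : lin (rt f). Proof. by rewrite /rt; lin. Qed.
Lemma lin_lt f : lin (lt f). Proof. by rewrite /lt; lin. Qed.
Lemma lin_rtf h : lin (rt^~ h). Proof. by rewrite /rt; lin. Qed.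
Lemma lin_ltf h : lin (lt^~ h). Proof. by rewrite /lt; lin. Qed.

Lemma rt_rt f g h : rt f (rt g h) = rt (f * g) h.
Proof.
have lr := lin_rt; rewrite {2}/rt (sw_lin _ _ (lr f)); under eq_sw => a b do rewrite (linZ _ _ (lr f)) /rt sw_scaler.
rewrite (swA h (fun u v b => g $ b *: (f $ v *: u))) /rt; apply: eq_sw => u t.
by rewrite ev_mul sw_scalel; apply: eq_sw => v b; rewrite scalerA mulrC.
Qed.

Lemma lt_lt f g h : lt f (lt g h) = lt (g * f) h.
Proof.
have ll := lin_lt; rewrite {2}/lt (sw_lin _ _ (ll f)); under eq_sw => a b do rewrite (linZ _ _ (ll f)) /lt sw_scaler.
rewrite -(swA h (fun a u v => g $ a *: (f $ u *: v))) /lt; apply: eq_sw => t v.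
by rewrite ev_mul sw_scalel; apply: eq_sw => a u; rewrite scalerA.
Qed.

Lemma rt1 h : rt 1 h = h.
Proof. by apply: (sw_cur (fun a => a)) => [a b|]; [rewrite ev1 | lin]. Qed.

Lemma comul_rt f h : comul (rt f h) = sw h (fun a b => a \ox rt f b).
Proof.
have cl : lin (@comul k H) by apply: lin_linear.
rewrite /rt (sw_lin _ _ cl); transitivity (sw h (fun a b => sw a (fun u v => f $ b *: (u \ox v)))).
  by apply: eq_sw => a b; rewrite (linZ _ _ cl) comul_sw sw_scaler.
rewrite (swA h (fun u v b => f $ b *: (u \ox v))); apply: eq_sw => u t.
rewrite (sw_lin (f := fun x => u \ox x)); last by lin.
by apply: eq_sw => v b; rewrite (linZ (f := fun x => u \ox x)) //; lin.
Qed.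

Lemma gl_ev f x y : isgl f -> f $ (x * y) = f $ x * f $ y.
Proof. by move=> fg; rewrite -sw_hdual gl_sw //; lin. Qed.
Lemma gl_ev1 f : isgl f -> f $ 1 = 1.
Proof. by case=> e _; rewrite -[LHS]/(eps f). Qed.

Lemma rtM f x y : isgl f -> rt f (x * y) = rt f x * rt f y.
Proof.
move=> fg; rewrite /rt swM; [|lin|lin]; rewrite sw_mulr; apply: eq_sw => a b.
rewrite sw_mull; apply: eq_sw => c d.
by rewrite gl_ev // -scalerAl -scalerAr scalerA mulrC.
Qed.
Lemma rt_1 f : isgl f -> rt f 1 = 1.
Proof. by move=> fg; rewrite /rt sw1; [rewrite gl_ev1 // scale1r | lin | lin]. Qed.

Lemma eps_rt f h : eps (rt f h) = f $ h.
Proof.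
rewrite /rt eps_sw -{2}(sw_counitl h (@lin_id k H)) ev_sw; apply: (@eq_sw _ _ k^o) => a b.
by rewrite epsZ evZ mulrC.
Qed.

Lemma lmn_gl : [pchar k] =i pred0 -> (forall x : H, S (S x) = x) -> forall z, isgl z -> z != 1 -> lmn z = 0.
Proof.
move=> ch0 SS z zg; apply: contraNeq => l0; have ll := @lin_lmn k H.
have := lmn_l SS z; rewrite gl_sw //; [|lin|lin].
by move=> e; apply/eqP/(scalerI l0).
Qed.
End Translations.

(** * The two reduction steps *)

Section AverageGrouplike.
Variables (k : fieldType) (H : hopfType k) (p : nat) (z : H).
Hypotheses (ch0 : [pchar k] =i pred0) (pp : prime p) (zg : isgl z) (zp : z ^+ p = 1) (z1 : z != 1).
Local Notation S := antipode.

Definition glavg : H := p%:R^-1 *: \sum_(i < p) z ^+ i.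
Let pk : p%:R != 0 :> k.
Proof. by rewrite (proj1 (pcharf0P _) ch0) -lt0n prime_gt0. Qed.

Lemma glavg_l : z * glavg = glavg.
Proof.
rewrite /glavg -scalerAr mulr_sumr; congr (_ *: _).
case: p pp zp => // m _ zm; rewrite big_ord_recr [RHS]big_ord_recl /= addrC expr0 -exprS zm.
by congr (_ + _); apply: eq_bigr => i _; rewrite -exprS.
Qed.
Lemma glavg_li i : z ^+ i * glavg = glavg.
Proof. by elim: i => [|i IH]; rewrite ?mul1r // exprSr -mulrA glavg_l. Qed.
Lemma glavg_idem : glavg * glavg = glavg.
Proof.
rewrite {1}/glavg -scalerAl mulr_suml (eq_bigr (fun=> glavg)) => [|i _]; last exact: glavg_li.
by rewrite sumr_const card_ord -scaler_nat scalerA mulVf // scale1r.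
Qed.
Lemma glavg_eps : eps glavg = 1.
Proof.
rewrite /glavg epsZ eps_sum (eq_bigr (fun=> 1)) => [|i _]; last by rewrite (proj1 (gl_exp i zg)).
by rewrite sumr_const card_ord mulVf.
Qed.
Lemma glavg_sw : sw glavg (fun a b => a \ox (b * glavg)) = glavg \ox glavg.
Proof.
rewrite {1}/glavg (linZ (f := fun g => sw g (fun a b => a \ox (b * glavg)))); last exact: lin_swh (@lin_id _ _).
rewrite (lin_sum (f := fun g => sw g (fun a b => a \ox (b * glavg)))); last exact: lin_swh (@lin_id _ _).
rewrite {3}/glavg (linZ (f := fun g => g \ox glavg)) ?(lin_sum (f := fun g => g \ox glavg)); [|lin|lin].
congr (_ *: _); apply: eq_bigr => i _; rewrite gl_sw ?glavg_li //; try exact: gl_exp; lin.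
Qed.
Lemma glavg_fun (V : lmodType k) (F : H -> V) : lin F -> (forall i, (0 < i < p)%N -> F (z ^+ i) = 0) ->
  F glavg = p%:R^-1 *: F 1.
Proof.
move=> Fl F0; rewrite /glavg (linZ _ _ Fl) (lin_sum _ _ _ Fl); congr (_ *: _).
case: p pp F0 => // m _ F0; rewrite big_ord_recl /= expr0 big1 ?addr0 // => i _.
by apply: F0; rewrite /= ltnS ltn_ord.
Qed.
Lemma gl_exp_neq1 i : (0 < i < p)%N -> z ^+ i != 1.
Proof.
by case/andP=> i0 ip; rewrite (gl_expr_eq1 pp zp z1); apply/negP => /dvdn_leq -/(_ i0); rewrite leqNgt ip.
Qed.
Lemma gl_exp_antipode i : S (z ^+ i) = z ^+ (i * p.-1).
Proof.
have zi : isgl (z ^+ i) by apply: gl_exp.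
rewrite -[RHS]mul1r -(gl_Smul zi) -mulrA -exprD -mulnS prednK ?prime_gt0 //.
by rewrite mulnC exprM zp expr1n mulr1.
Qed.

Lemma gl_powers : exists (gT : finGroupType) (phi : gT -> H), [/\ injective phi,
   {morph phi : x y / (x * y)%g >-> x * y}, phi 1%g = 1, forall x, isgl (phi x) /\ exists i, phi x = z ^+ i
   & forall i, exists x, phi x = z ^+ i].
Proof.
have [|g h [i ->] [j ->]|g gg [i ->]|gT [phi [pi pM p1 pg ps]]] := @gl_group _ H (fun g => exists i, g = z ^+ i).
- by exists 0%N.
- by exists (i + j)%N; rewrite exprD.
- by exists (i * p.-1)%N; rewrite gl_exp_antipode.
by exists gT, phi; split=> // i; apply: ps; [exact: gl_exp | exists i].
Qed.
End AverageGrouplike.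

Section CentralQuotient.
Variables (k : fieldType) (H : hopfType k) (p : nat) (z : H).
Hypotheses (ch0 : [pchar k] =i pred0) (SS : forall x : H, antipode (antipode x) = x).
Hypotheses (pp : prime p) (zg : isgl z) (zp : z ^+ p = 1) (z1 : z != 1) (zC : forall h, z * h = h * z).
Local Notation S := antipode.
Local Notation n := (\dim {:H}).
Local Notation P := (glavg p z).
Let pk : p%:R != 0 :> k.
Proof. by rewrite (proj1 (pcharf0P _) ch0) -lt0n prime_gt0. Qed.

Lemma lmn_glavg : lmn P = p%:R^-1.
Proof.
have ll := @lin_lmn k H; rewrite (glavg_fun pp ll) => [|i i0p]; first by rewrite lmn1 // -[LHS]/(_ * _) mulr1.
have zi1 : z ^+ i != 1 by apply: (gl_exp_neq1 pp).
exact: (lmn_gl ch0 SS (gl_exp i zg) zi1).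
Qed.

(** Coinvariance is tested on the single functional lmn (P -). Since [lmn] is an integral, each lmn
    (z^i h2) h1 equals lmn (z^i h) z^(-i); the exponent i (p - 1) stands for -i. *)
Lemma span_powers_coinv h : sw h (fun a b => lmn (P * b) *: a) = lmn P *: h \/
    sw h (fun a b => lmn (P * a) *: b) = lmn P *: h ->
  h = \sum_(i < p) lmn (z ^+ i * h) *: z ^+ (i * p.-1).
Proof.
have ll := @lin_lmn k H; have lP b : lmn (P * b) = p%:R^-1 * \sum_(i < p) lmn (z ^+ i * b).
  rewrite /glavg -scalerAl (linZ _ _ ll) mulr_suml; congr (_ * _).
  by have := lin_sum _ xpredT (fun i : 'I_p => z ^+ i * b) ll => /= ->.
have mv (i : 'I_p) : isgl (z ^+ i) by apply: gl_exp.
have zCi i x : z ^+ i * x = x * z ^+ i by elim: i => [|i IH]; rewrite ?mul1r ?mulr1 // exprS -mulrA IH mulrA zC -mulrA.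
have key (i : 'I_p) : sw h (fun a b => lmn (z ^+ i * b) *: a) = lmn (z ^+ i * h) *: z ^+ (i * p.-1) /\
    sw h (fun a b => lmn (z ^+ i * a) *: b) = lmn (z ^+ i * h) *: z ^+ (i * p.-1).
  have swz (F : H -> H -> H) : (forall a, lin (F a)) -> (forall b, lin (F^~ b)) ->
      sw (z ^+ i * h) F = sw h (fun a b => F (z ^+ i * a) (z ^+ i * b)).
    move=> F1 F2; rewrite swM // gl_sw // => a; apply: lin_sw => c d.
      by apply: lin_comp (F1 _) _; lin.
    by apply: lin_comp (F2 _) _; lin.
  have -> : z ^+ (i * p.-1) = S (z ^+ i) by rewrite (gl_exp_antipode pp).
  split; rewrite -[X in _ = _ *: X]mulr1 scalerAr.
    rewrite -lmn_l // swz; [|lin|lin].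
    rewrite sw_mull; apply: eq_sw => a b.
    by rewrite -scalerAr mulrA gl_Smul // mul1r.
  rewrite -lmn_r // swz; [|lin|lin].
  rewrite sw_mull; apply: eq_sw => a b.
  by rewrite -scalerAr mulrA gl_Smul // mul1r.
rewrite lmn_glavg; case=> e; apply: (scalerI (invr_neq0 pk)); rewrite -e scaler_sumr.
  under eq_sw => a b do rewrite lP -scalerA scaler_suml.
  rewrite -sw_scaler; rewrite sw_sum scaler_sumr; apply: eq_bigr => i _.
  by rewrite (proj1 (key i)).
under eq_sw => a b do rewrite lP -scalerA scaler_suml.
rewrite -sw_scaler; rewrite sw_sum scaler_sumr; apply: eq_bigr => i _.
by rewrite (proj2 (key i)).
Qed.

(** The functionals invariant under z form K, so the dual of K is H/(z - 1). Its left and right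
    coinvariants both equal the group algebra of the powers of z, which makes this one step of a
    chain. *)
Lemma central_quotient : exists (K : hopfType k) (iota : {lrmorphism K -> hdual H}), [/\ hopf_morphism iota,
  injective iota, forall f, (forall h, f $ (z * h) = f $ h) <-> exists x, iota x = f, (\dim {:K} * p = n)%N &
  upper_semisolvable (hdual K) -> upper_semisolvable H].
Proof.
have ll := @lin_lmn k H.
have PC h : h * P = P * h.
  rewrite /glavg -scalerAl -scalerAr mulr_suml mulr_sumr; congr (_ *: _); apply: eq_bigr => i _.
  by elim: (i : nat) => [|j IH]; rewrite ?mul1r ?mulr1 // exprS mulrA -zC -!mulrA IH.
have eP : eps P = 1 by apply: glavg_eps.
have Psw : sw P (fun a b => a \ox (b * P)) = P \ox P by apply: glavg_sw.
have [K [iota [ih ii iE dK]]] := glproj_subhopf SS eP PC Psw ch0.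
have iz f : (forall h, f $ (z * h) = f $ h) <-> exists x, iota x = f.
  rewrite -iE; split=> e h.
    rewrite /glavg -scalerAl evZ mulr_suml ev_sum (eq_bigr (fun=> f $ h)) => [|i _].
      by rewrite sumr_const card_ord -[f $ h *+ _]mulr_natl mulrA mulVf // mul1r.
    by elim: (i : nat) => [|j IH]; rewrite ?mul1r // exprS -mulrA e.
  by rewrite -[RHS]e -e mulrA -PC glavg_l.
have dp : (\dim {:K} * p = n)%N by apply: (natr_inj ch0); rewrite natrM dK lmn_glavg mulfVK.
exists K, iota; split=> // usK.
have [|||gT [phi [phi_i phiM phi1 phig phis]]] := @gl_powers _ H p z => //.
pose J := gextlr phiM phi1.
pose D : {lrmorphism H -> hdual K} := lrpack (dquot_linear iota) (dquot_monoid ih).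
have phg x : isgl (phi x) by case: (phig x).
have fz x i : iota x $ (z ^+ i) = iota x $ 1.
  have /iz e : exists y, iota y = iota x by exists x.
  by elim: i => [//|i IH]; rewrite exprS e.
have Jr f : J f \in coinvr D /\ J f \in coinvl D.
  suff e x : sw (J f) (fun a b => iota x $ b *: a) = iota x $ 1 *: J f /\
      sw (J f) (fun a b => iota x $ a *: b) = iota x $ 1 *: J f.
    by split; [apply/dquot_coinvr => x; case: (e x) | apply/dquot_coinvl => x; case: (e x)].
  rewrite -!/(rt _ _) -!/(lt _ _).
  elim/group_algebra_ind: f => [c f f' [e1 e2] [e1' e2']|y].
    by rewrite linearP (@lin_rt _ _ _ c (J f)) (@lin_lt _ _ _ c (J f)) e1 e2 e1' e2' scalerDr !scalerA mulrC.
  rewrite /J gextlrE; have [yg [i yE]] := phig y.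
  by rewrite /rt /lt !gl_sw //; [rewrite yE fz | lin..].
have rJ h : h \in coinvr D \/ h \in coinvl D -> exists f, J f = h.
  move=> hc; have -> : h = \sum_(i < p) lmn (z ^+ i * h) *: z ^+ (i * p.-1).
    apply: span_powers_coinv; pose u : hdual H := linfun (fun h => lmn (P * h) : k^o).
    have uE x : u $ x = lmn (P * x) by apply: (ev_linfun (f := fun h => lmn (P * h) : k^o)); lin.
    have /iE[x xu] : forall x, u $ (P * x) = u $ x by move=> x; rewrite !uE mulrA glavg_idem.
    case: hc => [/dquot_coinvr/(_ x)|/dquot_coinvl/(_ x)]; rewrite xu uE mulr1 => <-; [left | right];
      by apply: eq_sw => a b; rewrite uE.
  have /fin_all_exists[t tE] : forall i : 'I_p, exists t, phi t = z ^+ (i * p.-1) by move=> i; apply: phis.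
  exists (\sum_(i < p) lmn (z ^+ i * h) *: gelt k (t i)); rewrite linear_sum; apply: eq_bigr => i _.
  by rewrite linearZ_LR -tE; congr (_ *: _); apply: gextlrE.
apply: (UpperSemisolvableStep (pi := D) (dquot_hopf ih) (dquot_surj ii)) usK.
  by move=> h; apply/idP/idP => hc; have [|f <-] := rJ h; [by left| by case: (Jr f)|by right|by case: (Jr f)].
exists (group_algebra k gT), J; split.
- exact: gextlr_hopf.
- exact: gextlr_inj.
- by move=> h; split=> [hc|[f <-]]; [apply: rJ; left | case: (Jr f)].
by exists gT; left; apply: hopf_iso_refl.
Qed.
End CentralQuotient.

Section CentralCharacter.
Variables (k : fieldType) (H : hopfType k) (p : nat) (g : hdual H).
Hypotheses (ch0 : [pchar k] =i pred0) (SS : forall x : H, antipode (antipode x) = x).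
Hypotheses (pp : prime p) (gg : isgl g) (gp : g ^+ p = 1) (g1 : g != 1) (gC : forall f, f * g = g * f).
Local Notation S := antipode.
Local Notation n := (\dim {:H}).
Local Notation P := (glavg p g).
Let pk : p%:R != 0 :> k.
Proof. by rewrite (proj1 (pcharf0P _) ch0) -lt0n prime_gt0. Qed.

Lemma gl_haar (f : hdual H) : isgl f -> f != 1 -> f $ (haar H) = 0.
Proof.
move=> fg; apply: contraNeq => l0; apply/eqP/ev_inj => h; rewrite ev1.
by apply: (mulIf l0); rewrite -(gl_ev _ _ fg) haar_l // evZ.
Qed.

Lemma ev_rt (f u : hdual H) h : f $ (rt u h) = (f * u) $ h.
Proof. by rewrite /rt ev_sw ev_mul; apply: (@eq_sw _ _ k^o) => a b; rewrite evZ mulrC. Qed.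
Lemma ev_lt (f u : hdual H) h : f $ (lt u h) = (u * f) $ h.
Proof. by rewrite /lt ev_sw ev_mul; apply: (@eq_sw _ _ k^o) => a b; rewrite evZ. Qed.

Lemma rt_lt_central h : rt g h = lt g h.
Proof. by apply: ev_sep => f; rewrite ev_rt ev_lt gC. Qed.

Let E := rt P.
Let Pl : g * P = P. Proof. exact: glavg_l. Qed.
Let PP : P * P = P. Proof. exact: glavg_idem. Qed.
Let EP h : E h = h <-> rt g h = h.
Proof.
split=> e; first by rewrite -e /E rt_rt Pl.
have ei i : rt (g ^+ i) h = h by elim: i => [|i IH]; rewrite ?rt1 // exprS -rt_rt IH.
have lr := lin_rtf h; rewrite /E /glavg (linZ _ _ lr) (lin_sum _ _ _ lr) (eq_bigr (fun=> h)) => [|i _ //].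
by rewrite sumr_const card_ord -scaler_nat scalerA mulVf // scale1r.
Qed.
Let gE x : rt g (E x) = E x. Proof. by rewrite /E rt_rt Pl. Qed.

Lemma rt_powers i h : rt g h = h -> rt (g ^+ i) h = h.
Proof. by move=> e; elim: i => [|i IH]; rewrite ?rt1 // exprS -rt_rt IH. Qed.

(** Dually, H maps onto the dual of the group algebra of the powers of g. Centrality of g gives
    [rt g] = [lt g], hence normality; N is the fixed space, cut out by averaging over g, and the
    target is itself trivial. *)
Lemma central_character : exists (N : hopfType k) (iota : {lrmorphism N -> H}), [/\ hopf_morphism iota,
  injective iota, forall h, rt g h = h <-> exists x, iota x = h, (\dim {:N} * p = n)%N &
  trivial_hopf N -> upper_semisolvable H].
Proof.
have lr := @lin_rt k H.
have eE x : rt g x = x -> E x = x by move/EP.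
have el h : E h = lt P h.
  by apply: ev_sep => f; rewrite ev_rt ev_lt /glavg -scalerAl -scalerAr mulr_sumr mulr_suml; congr (_ $ _); congr (_ *: _); apply: eq_bigr => i _; elim: (i : nat) => [|j IH]; rewrite ?mulr1 ?mul1r // exprS mulrA gC -!mulrA IH.
have [|||||N [iota [ih ii iE dN]]] := @subhopf_ex _ H E (lr P).
- by apply/EP; apply: rt_1.
- by move=> x; rewrite /E rt_rt PP.
- by move=> x y; apply/EP; rewrite rtM // !gE.
- move=> x; apply/EP; rewrite -{2}(gE x) rt_lt_central /lt.
  have gS a : g $ a = (S g) $ (S a) by rewrite ev_antipode SS.
  have -> : sw (S (E x)) (fun a b => g $ a *: b) = S (sw (E x) (fun a b => S g $ b *: a)).
    rewrite sw_antipode; [|lin|lin]; rewrite (sw_lin (f := S)); last by lin.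
    by apply: eq_sw => a b; rewrite ev_antipode (linZ (f := S)) //; lin.
  congr (antipode _); rewrite -/(rt _ _) -{1}(gE x) rt_rt gl_Smul // rt1 gE.
  by [].
- move=> x.
  have e1 h : comul (E h) = sw h (fun a b => a \ox E b) by rewrite comul_rt.
  have e2 h : comul (E h) = sw h (fun a b => E a \ox b).
    rewrite el /lt (sw_lin (f := @comul k H)); last by apply: lin_linear.
    transitivity (sw h (fun a b => sw b (fun u v => P $ a *: (u \ox v)))).
      by apply: eq_sw => a b; rewrite (linZ (f := @comul k H)) ?comul_sw ?sw_scaler //; apply: lin_linear.
    rewrite -(swA h (fun a u v => P $ a *: (u \ox v))); apply: eq_sw => u t.
    rewrite el /lt (sw_lin (f := fun y => y \ox t)); last by lin.
    by apply: eq_sw => a b; rewrite (linZ (f := fun y => y \ox t)) //; lin.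
  have EEx : E (E x) = E x by rewrite /E rt_rt PP.
  rewrite -{1}EEx e1.
  have s : comul (E x) = sw (E x) (fun a b => E a \ox b) by rewrite -{1}EEx e2.
  have lE : lin E by apply: lr.
  have := congr1 (tmap idfun (lpack lE)) s.
  rewrite comul_sw !(sw_lin (f := tmap idfun (lpack lE))); [|exact: lin_linear|exact: lin_linear].
  under eq_sw => a b do rewrite tmap_ox /=.
  by under [RHS]eq_sw => a b do rewrite tmap_ox /=.
have haar0 i : (0 < i < p)%N -> (g ^+ i) $ (haar H) = 0.
  by move=> ip; apply: gl_haar; [exact: gl_exp | apply: (gl_exp_neq1 pp)].
have dn := dim_neq0 H ch0.
have dp : (\dim {:N} * p = n)%N.
  apply: (natr_inj ch0); rewrite natrM dN.
  have -> : ltr E = n%:R * (P $ (haar H)).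
    rewrite ev_haar mulVKf //; by apply: eq_ltr => h; rewrite el.
  have lf : lin (fun f : hdual H => f $ (haar H) : k^o) by lin.
  rewrite (glavg_fun pp lf) //.
  by rewrite ev1 haar_eps // -[_ *: _]/(_ * _) mulr1 mulfVK.
exists N, iota; split=> //; first by move=> h; rewrite -iE EP.
move=> tN; have [|||gT [phi [phi_i phiM phi1 phig phis]]] := @gl_powers _ (hdual H) p g => //.
have phg x : isgl (phi x) by case: (phig x).
pose J := gextlr phiM phi1; have Jh : hopf_morphism J by apply: gextlr_hopf.
have Ji : injective J by apply: gextlr_inj.
pose D : {lrmorphism H -> hdual (group_algebra k gT)} := lrpack (dquot_linear J) (dquot_monoid Jh).
have cr h : h \in coinvr D <-> rt g h = h.
  split=> [/dquot_coinvr e|e].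
    have [x xg] := phis 1%N; have := e (gelt k x); rewrite /J gextlrE xg expr1 gl_ev1 // scale1r.
    by [].
  apply/dquot_coinvr => f; rewrite -/(rt _ _).
  elim/group_algebra_ind: f => [c f f' e1 e2|y].
    by rewrite linearP (@lin_rtf _ _ _ c (J f)) e1 e2 evP scalerDl scalerA.
  rewrite /J gextlrE; have [yg [i ->]] := phig y.
  by rewrite rt_powers // gl_ev1 ?scale1r //; apply: gl_exp.
have cl h : h \in coinvl D <-> rt g h = h.
  rewrite rt_lt_central; split=> [/dquot_coinvl e|e].
    have [x xg] := phis 1%N; have := e (gelt k x); rewrite /J gextlrE xg expr1 gl_ev1 // scale1r.
    by [].
  apply/dquot_coinvl => f; rewrite -/(lt _ _).
  elim/group_algebra_ind: f => [c f f' e1 e2|y].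
    by rewrite linearP (@lin_ltf _ _ _ c (J f)) e1 e2 evP scalerDl scalerA.
  rewrite /J gextlrE; have [yg [i ->]] := phig y; rewrite gl_ev1 ?scale1r; last exact: gl_exp.
  elim: i => [|i IH]; first by apply: (sw_cul (fun a => a)) => [a b|]; [rewrite ev1 | lin].
  by rewrite exprS -lt_lt e.
apply: (UpperSemisolvableStep (pi := D) (dquot_hopf Jh) (dquot_surj Ji)).
- by move=> h; apply/idP/idP => [/cr/cl|/cl/cr].
- exists N, iota; split=> // h; rewrite cr -iE; split; [by move/EP | by move/EP].
by apply: us_trivial; exists gT; right; apply: hopf_iso_refl.
Qed.
End CentralCharacter.

(** * Block idempotents and products of characters *)

Section BlockIdempotents.
Variables (k : closedFieldType) (A : falgType k) (w : wedd A).
Implicit Types (r s : 'I_(wN w)) (x z : A).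

Lemma we_mul r s : wc r = r -> wc s = s -> we s * we r = (s == r)%:R *: we r.
Proof.
move=> rr ss; rewrite {2 3}/we mulr_sumr scaler_sumr; apply: eq_bigr => j /eqP jr.
by rewrite we_E jr rr ss eq_sym.
Qed.

Lemma chi_we_mul r s x : wc r = r -> wc s = s -> chi r (x * we s) = (r == s)%:R * chi r x.
Proof.
move=> rr ss; rewrite -chi_mul_we -mulrA we_mul // eq_sym; case: eqVneq => [->|_].
  by rewrite scale1r mul1r chi_mul_we.
by rewrite scale0r mulr0 mul0r (lin0 (@lin_chi _ _ w r)).
Qed.

Lemma chi_central r z x : (forall y, z * y = y * z) -> chi r (z * x) = wcf r r z * chi r x.
Proof.
move=> zC; rewrite /chi mulr_sumr; apply: eq_bigr => j /eqP jr.
rewrite wcfM (bigD1 j) //= big1 ?addr0 => [|l lj]; first by rewrite (central_wE zC jr).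
case: (eqVneq (wc j) (wc l)) => cjl; last by rewrite wcf0 // mul0r.
have -> : wcf j l z = 0; last by rewrite mul0r.
by apply: wcf_uniq => //; rewrite -mulrA zC mulrA wEM // eq_sym (negPf lj) !scale0r mul0r.
Qed.

Lemma wcf_central r z z' : (forall y, z * y = y * z) -> wcf r r (z * z') = wcf r r z * wcf r r z'.
Proof.
move=> zC; rewrite wcfM (bigD1 r) //= big1 ?addr0 // => l lr.
case: (eqVneq (wc r) (wc l)) => crl; last by rewrite wcf0 // mul0r.
have -> : wcf r l z = 0; last by rewrite mul0r.
by apply: wcf_uniq => //; rewrite -mulrA zC mulrA wEM // eq_sym (negPf lr) !scale0r mul0r.
Qed.
End BlockIdempotents.

Section Twists.
Variables (k : closedFieldType) (H : hopfType k) (w : wedd H).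
Hypotheses (ch0 : [pchar k] =i pred0) (SS : forall x : H, antipode (antipode x) = x).
Local Notation S := antipode.
Local Notation E := (@wE _ _ w).
Local Notation n := (\dim {:H}).
Local Notation L := (haar H).
Implicit Types (f g : hdual H) (x y : H) (r s t u : 'I_(wN w)).

Lemma gl_tracial f : isgl f -> tracial f.
Proof. by move=> fg x y; rewrite !gl_ev // mulrC. Qed.

Lemma gl_natural f : isgl f -> natural w f.
Proof.
move=> fg; apply: naturalP => [|r]; first exact: gl_tracial.
have : f $ (E r r) * f $ (E r r) = f $ (E r r) by rewrite -gl_ev // wEid.
move/eqP; rewrite -subr_eq0 -{3}[f $ _]mulr1 -mulrBr mulf_eq0 subr_eq0.
by case/orP=> /eqP ->; [exists 0%N | exists 1%N].
Qed.

Lemma Chi_basis_ev r s : wc s = s -> Chi r $ (E s s) = (s == wc r)%:R.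
Proof. by move=> ss; rewrite ChiE chiE // eqxx ss. Qed.

Lemma Chi_root r : Chi (wc r) = Chi r.
Proof. by apply: ev_inj => x; rewrite !ChiE chi_root. Qed.

Lemma Chi_inj r s : wc r = r -> wc s = s -> Chi r = Chi s -> r = s.
Proof.
move=> rr ss /(congr1 (fun f : hdual H => f $ (E r r))); rewrite !Chi_basis_ev // rr ss eqxx.
by case: eqVneq => // _ /esym/eqP; rewrite eq_sym oner_eq0.
Qed.

Lemma haar_swap f g : (f * g) $ L = (g * f) $ L.
Proof. by rewrite !ev_haar_rho rhoC. Qed.

Lemma Chi_norm1 r : (Chi r * S (Chi r)) $ L = 1.
Proof. by rewrite Chi_orthogonal //; [rewrite ChiE chiE // !eqxx | apply: Chi_tracial]. Qed.

(** The left side is the sum of the squares of the multiplicities. *)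
Lemma norm1_irreducible f : natural w f -> (f * S f) $ L = 1 -> exists2 s : 'I_(wN w), wc s = s & f = Chi s.
Proof.
case=> m fE; have ft : tracial f by apply: (@natural_tracial _ _ w); exists m.
have fe r : wc r = r -> f $ (E r r) = (m r)%:R.
  move=> rr; rewrite fE evf_sum (bigD1 r) ?rr //= big1 ?addr0 => [|s /andP[/eqP ss sr]].
    by rewrite evfZ Chi_basis_ev // rr eqxx mulr1.
  by rewrite evfZ Chi_basis_ev // ss eq_sym (negPf sr) mulr0.
have -> : (f * S f) $ L = (\sum_(r | wc r == r) m r * m r)%:R.
  rewrite {2}fE (linear_sum antipode) mulr_sumr evf_sum natr_sum; apply: eq_bigr => r /eqP rr.
  by rewrite linearZ_LR -scalerAr evfZ Chi_orthogonal // fe // natrM.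
move=> e1; have {e1} : (\sum_(r | wc r == r) m r * m r = 1)%N by apply: (natr_inj ch0); rewrite e1.
have [s /andP[/eqP ss ms] e1|no] := pickP (fun s => (wc s == s) && (0 < m s)%N); last first.
  rewrite big1 // => r rr; have := no r; rewrite rr /= lt0n => /negbFE/eqP ->.
  by [].
exists s => //; move: e1; rewrite (bigD1 s) ?ss //= => e1.
have ms1 : m s = 1%N by case: (m s) ms e1 => [|[|a]].
rewrite ms1 mul1n in e1; have {e1} /eqP : (\sum_(r | (wc r == r) && (r != s)) m r * m r = 0)%N by case: (\sum_(r | _) _) e1.
rewrite sum_nat_eq0 => /forall_inP m0.
rewrite fE (bigD1 s) ?ss //= ms1 scale1r big1 ?addr0 // => r rs.
by have := m0 r rs; rewrite muln_eq0 orbb => /eqP ->; rewrite scale0r.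
Qed.

Lemma gl_mul_Chi f r : isgl f -> exists2 s : 'I_(wN w), wc s = s & f * Chi r = Chi s.
Proof.
move=> fg; apply: norm1_irreducible; first by apply: naturalM; [apply: gl_natural | apply: natural_Chi].
have -> : S (f * Chi r) = S (Chi r) * S f by rewrite antipodeM.
by rewrite mulrA haar_swap !mulrA gl_Smul // mul1r Chi_norm1.
Qed.

Lemma antipode_Chi r : exists2 s : 'I_(wN w), wc s = s & S (Chi r) = Chi s.
Proof.
apply: norm1_irreducible; first exact: natural_SChi.
by rewrite hdual_inv // haar_swap Chi_norm1.
Qed.

(** The character of block u cannot occur in a product of smaller degree. Its multiplicity there is
    the trace of an idempotent map on H (x) H, and a zero trace in characteristic 0 means that the
    map is 0. *)
Lemma comul_block0 r s u : (wdeg r * wdeg s < wdeg u)%N -> comul (we u) * (we r \ox we s) = 0.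
Proof.
move=> lt; have [m mE] := natural_ChiM r s.
have m0 : m (wc u) = 0%N.
  have := congr1 (fun f : hdual H => f $ 1) mE; rewrite ev_mul sw1; [|lin|lin].
  rewrite !ChiE !chi1 evf_sum -natrM (eq_bigr (fun t => (m t * wdeg t)%:R)) => [|t _]; last first.
    by rewrite evfZ ChiE chi1 natrM.
  rewrite -natr_sum => /(natr_inj ch0) e; move: lt; rewrite e (bigD1 (wc u)) ?wcc //= wdeg_root.
  by case: (m _) => // a; rewrite mulSn -addnA ltnNge leq_addr.
have z t v : wc t = wc u -> comul (E t t) * v * (E r r \ox E s s) = 0.
  move=> tu; have [fl ff] := comul_idem_ltr r s t.
  have := ltr_comul_ChiM r s (E t t); rewrite ltr_idem // mE evf_sum (bigD1 (wc u)) ?wcc //= m0 scale0r evf0 add0r.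
  rewrite big1 => [/(natr_inj ch0 (n := 0))/eqP|a /andP[/eqP aa au]].
    rewrite dimv_eq0 => /eqP d0; have := memv_img (linfun (fun u0 : tensor H H => comul (E t t) * u0 * (E r r \ox E s s))) (memvf v).
    by rewrite d0 memv0 (lin_linfun fl) => /eqP.
  by rewrite evfZ ChiE chiE // eqxx tu aa eq_sym (negPf au) mulr0.
rewrite /we (linear_sum comul) mulr_suml big1 // => t /eqP tu.
rewrite (lin_sum (f := fun x => x \ox _)); last by lin.
rewrite mulr_sumr big1 // => a /eqP ar; rewrite (lin_sum (f := fun x => _ \ox x)); last by lin.
rewrite mulr_sumr big1 // => b /eqP bs'.
have -> : E a a \ox E b b = (E a r \ox E b s) * (E r r \ox E s s) * (E r a \ox E s b).
  by rewrite !mul_ox !wEidr !wEM // !eqxx !scale1r.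
by rewrite !mulrA z // mul0r.
Qed.

Definition wepart (Q : pred nat) : H := \sum_(r | (wc r == r) && Q (wdeg (w := w) r)) we r.

(** S permutes the irreducible characters and keeps degrees, hence fixes the sum of deg(chi) chi
    over degrees in Q; [rho] turns this functional into the idempotent. *)
Lemma antipode_wepart (Q : pred nat) : S (wepart Q) = wepart Q.
Proof.
have /fin_all_exists2[sg sgr sgE] := fun r => antipode_Chi r.
have sgd r : wdeg (w := w) (sg r) = wdeg r.
  have := congr1 (fun f : hdual H => f $ 1) (sgE r).
  by rewrite ev_antipode antipode1 !ChiE !chi1 => /(natr_inj ch0).
have sgK r : wc r = r -> sg (sg r) = r.
  by move=> rr; apply: Chi_inj => //; rewrite -!sgE hdual_inv.
pose rT : hdual H := \sum_(r | (wc r == r) && Q (wdeg (w := w) r)) (wdeg (w := w) r)%:R *: Chi r.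
have rE x : rho (x * wepart Q) = rT $ x.
  rewrite /rho (ltr_mul w) evf_sum [RHS]big_mkcondr; apply: eq_bigr => r /eqP rr.
  rewrite /wepart mulr_sumr (lin_sum _ _ _ (@lin_chi _ _ w r)).
  rewrite (eq_bigr (fun s => (r == s)%:R * chi r x)) => [|s /andP[/eqP ss _]]; last by rewrite chi_we_mul.
  case: (boolP (Q _)) => Qr.
    rewrite (bigD1 r) ?rr ?eqxx //= mul1r big1 ?addr0 => [|s /andP[_ sr]]; last by rewrite eq_sym (negPf sr) mul0r.
    by rewrite evfZ ChiE mulrC.
  rewrite big1 ?mul0r // => s /andP[_ Qs]; case: eqVneq => [rs|]; last by rewrite mul0r.
  by rewrite rs Qs in Qr.
have rS : S rT = rT.
  rewrite /rT (linear_sum antipode) [RHS](reindex_onto sg sg) => [|r /andP[/eqP rr _]]; last exact: sgK.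
  rewrite [RHS](eq_bigl (fun r => (wc r == r) && Q (wdeg (w := w) r))) => [|r].
    by apply: eq_bigr => r _; rewrite linearZ_LR sgE sgd.
  rewrite sgr eqxx sgd /= andbC; congr (_ && _); apply/eqP/eqP => [<-|]; [exact: sgr | exact: sgK].
apply/eqP; rewrite -subr_eq0; apply/eqP/(rho_nondeg w ch0) => y.
rewrite mulrBl (linB _ _ (@lin_rho k H)) ![rho (_ * y)]rhoC rE; apply/eqP; rewrite subr_eq0; apply/eqP.
have rhoS x : rho (S x) = rho x by rewrite !(rho_lmn ch0) lmn_antipode.
by rewrite -{1}(SS y) -antipodeM rhoS rhoC rE -ev_antipode rS.
Qed.
End Twists.

(** * Stabilizers of irreducible characters *)

Section Stabilizers.
Variables (k : closedFieldType) (H : hopfType k) (w : wedd H).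
Hypotheses (ch0 : [pchar k] =i pred0) (SS : forall x : H, antipode (antipode x) = x).
Local Notation S := antipode.
Local Notation L := (haar H).

Lemma gl_dot (f g : hdual H) : isgl f -> isgl g -> (f * S g) $ L = (f == g)%:R.
Proof.
move=> fg gg; case: eqVneq => [->|fn]; first by rewrite gl_mulS // ev1 haar_eps.
apply: gl_haar => //; first by apply: gl_mul => //; apply: gl_antipode.
by apply: contraNneq fn => e; rewrite -[f]mulr1 -(gl_Smul gg) mulrA e mul1r.
Qed.

Lemma gl_mult (f : hdual H) (r : 'I_(wN w)) : isgl f ->
  (Chi r * S (Chi r) * S f) $ L = (f * Chi r == Chi r)%:R.
Proof.
move=> fg; have Sg : isgl (S f) by apply: gl_antipode.
rewrite haar_swap mulrA; have [s ss e] := gl_mul_Chi ch0 SS r Sg (w := w).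
rewrite e Chi_orthogonal //; last exact: Chi_tracial.
rewrite ChiE chiE // eqxx /= ss eq_sym; congr (nat_of_bool _)%:R; apply/eqP/eqP => [sr|fr].
  by rewrite -{1}(Chi_root r) -sr -e mulrA gl_mulS // mul1r.
by apply: (@Chi_inj _ _ w); rewrite ?wcc // Chi_root -e -{1}fr mulrA gl_Smul // mul1r.
Qed.

(** Expanded in group-like elements, chi S(chi) has as coefficients the indicator of the stabilizer
    of chi. Evaluation at 1 shows that deg^2 is the order of this subgroup. *)
Lemma stabilizer_dvd (K : hopfType k) (iota : {lrmorphism K -> hdual H}) (gT : finGroupType) (phi : gT -> K)
    (r : 'I_(wN w)) : hopf_morphism iota -> injective iota ->
    injective phi -> {morph phi : x y / (x * y)%g >-> x * y} -> phi 1%g = 1 ->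
    (forall x, isgl (phi x)) -> #|gT| = \dim {:K} ->
    (exists x, iota x = Chi r * S (Chi r)) ->
  (wdeg r ^ 2 %| #|gT|)%N.
Proof.
move=> ih ii pi pM p1 pg dK [x xE].
have ig y : isgl (iota (phi y)).
  case: ih => ic ie _; have [e c] := pg y; split; first by rewrite -[LHS]/(counit _) ie.
  by rewrite ic c tmap_ox.
have Ji : injective (iota \o phi) by apply: inj_comp.
have [f fE] : exists f : gT -> k, x = \sum_y f y *: phi y.
  have [F <-] := gextlr_surj pi pM p1 pg dK x.
  by exists (fun y => (F : {ffun gT -> k^o}) y).
have psiE : Chi r * S (Chi r) = \sum_y f y *: iota (phi y).
  by rewrite -xE fE linear_sum; apply: eq_bigr => y _; rewrite linearZ_LR.
have fy y : f y = (iota (phi y) * Chi r == Chi r)%:R.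
  rewrite -gl_mult // psiE mulr_suml evf_sum (bigD1 y) //= big1 ?addr0 => [|z zy].
    by rewrite -scalerAl evfZ gl_dot // eqxx mulr1.
  by rewrite -scalerAl evfZ gl_dot // (inj_eq Ji) (negPf zy) mulr0.
pose A := [set y | iota (phi y) * Chi r == Chi r].
have gA : group_set A.
  apply/group_setP; rewrite !inE p1 rmorph1 mul1r eqxx; split=> // y z; rewrite !inE => /eqP ey /eqP ez.
  by rewrite pM rmorphM -mulrA ez ey.
have cA : (wdeg r ^ 2 = #|A|)%N.
  apply: (natr_inj ch0); have := congr1 (fun u : hdual H => u $ 1) psiE.
  rewrite ev_mul sw1; [|lin|lin]; rewrite ev_antipode antipode1 ChiE chi1 -natrM mulnn => ->.
  rewrite evf_sum -sum1_card natr_sum [RHS]big_mkcond; apply: eq_bigr => y _.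
  by rewrite evfZ fy gl_ev1 // mulr1 inE; case: eqP.
by rewrite cA -cardsT; apply: (cardSg (subsetT (Group gA))).
Qed.
End Stabilizers.

(** * Spanning by group-like elements, and biduality *)

Lemma dim_hdual (k : fieldType) (H : hopfType k) : \dim {:hdual H} = \dim {:H}.
Proof. by rewrite !dimvf; apply: muln1. Qed.

(** The group algebra case of [trivial_hopf], with an explicit parametrization that can be
    transported along morphisms. *)
Definition glspan (k : fieldType) (H : hopfType k) := exists (gT : finGroupType) (phi : gT -> H),
  [/\ injective phi, {morph phi : x y / (x * y)%g >-> x * y}, phi 1%g = 1, forall x, isgl (phi x) & #|gT| = \dim {:H}].

Section Glspan.
Variable k : fieldType.

Lemma glspan_trivial (H : hopfType k) : glspan H -> trivial_hopf H.
Proof. by case=> gT [phi [pi pM p1 pg d]]; apply: (gl_span_trivial pi pM p1 pg d). Qed.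

Lemma gl_of_ev (H : hopfType k) (f : hdual H) : f $ 1 = 1 -> (forall x y, f $ (x * y) = f $ x * f $ y) -> isgl f.
Proof.
move=> f1 fM; split; first by rewrite -[LHS]/(f $ 1).
apply: evl_inj => x; apply: ev_inj => y; rewrite evl_ox evfZ.
by rewrite -[LHS]/(heval (evl (hdual_comul _) x) y) hdual_comulE -[LHS]/(f $ (x * y)) fM.
Qed.

Lemma hopf_gl (H K : hopfType k) (f : {lrmorphism H -> K}) g : hopf_morphism f -> isgl g -> isgl (f g).
Proof.
case=> fc fe _ [e c]; split; first by rewrite -[LHS]/(counit _) fe.
by rewrite fc c tmap_ox.
Qed.

Lemma glspan_image (H K : hopfType k) (f : {lrmorphism H -> K}) : hopf_morphism f -> injective f ->
  \dim {:H} = \dim {:K} -> glspan H -> glspan K.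
Proof.
move=> fh fi d [gT [phi [pi pM p1 pg dg]]]; exists gT, (f \o phi); split=> //=.
- exact: inj_comp.
- by move=> x y /=; rewrite pM rmorphM.
- by rewrite p1 rmorph1.
- by move=> x; apply: hopf_gl.
by rewrite -d.
Qed.

Lemma bidual_iso (H : hopfType k) : exists (D : {lrmorphism H -> hdual (hdual H)}) (G : {lrmorphism hdual (hdual H) -> H}),
  [/\ forall x f, D x $ f = f $ x, injective D, forall F, exists x, D x = F, hopf_morphism G & injective G].
Proof.
pose I : {lrmorphism hdual H -> hdual H} := idfun.
have Ih : hopf_morphism I.
  split=> // f; move: (comul f); apply: lin_tensor_eq => [||y z]; [exact: lin_id | exact: lin_linear |].
  by rewrite tmap_ox.
have Ii : injective I by [].
pose D : {lrmorphism H -> hdual (hdual H)} := lrpack (dquot_linear I) (dquot_monoid Ih).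
have DE x f : D x $ f = f $ x by rewrite -[LHS]/(dquot I x $ f) dquotE.
have Di : injective D by move=> x y e; apply: ev_sep => f; rewrite -!DE e.
have surj' F : exists x, D x = F by have [x <-] := dquot_surj Ii F; exists x.
have surj F : exists x, D x == F by have [x <-] := surj' F; exists x.
have Db : bijective D.
  by exists (fun F => xchoose (surj F)) => [x|F]; [apply/Di/eqP/(xchooseP (surj _)) | apply/eqP/(xchooseP (surj _))].
have [G Gh [G' GK G'K]] := hopf_iso_inv (dquot_hopf Ih) Db.
by exists D, G; split=> //; apply: can_inj GK.
Qed.

Lemma glspan_bidual (H : hopfType k) : glspan (hdual (hdual H)) -> glspan H.
Proof.
have [_ [G [_ _ _ Gh Gi]]] := bidual_iso H.
by apply: (glspan_image Gh Gi); rewrite !dim_hdual.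
Qed.
End Glspan.

(** * Central extensions all of whose degrees are 1 *)

Section Commutative.
Variables (k : closedFieldType) (H : hopfType k).
Hypotheses (ch0 : [pchar k] =i pred0) (SS : forall x : H, antipode (antipode x) = x).
Local Notation S := antipode.

Lemma deg1_gl (w : wedd H) (r : 'I_(wN w)) : wdeg r = 1%N -> isgl (Chi r).
Proof.
move=> d1; have sg j : wc j = wc r -> j = r.
  move=> jr; have := card_le1P (_ : (#|[pred j | wc j == wc r]| <= 1)%N); rewrite -/(wdeg r) d1 => /(_ isT r).
  by rewrite inE eqxx => /(_ isT j); rewrite inE jr eqxx => /esym/eqP.
have cE x : chi r x = wcf r r x.
  by rewrite /chi (bigD1 r) //= big1 ?addr0 // => j /andP[/eqP/sg -> /negP[]].
apply: gl_of_ev => [|x y]; rewrite !ChiE !cE ?wcf1 //.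
rewrite wcfM (bigD1 r) //= big1 ?addr0 // => l lr.
by rewrite wcf0 ?mul0r //; apply: contraNneq lr => /esym/sg ->.
Qed.

(** Every block is a point, so there are dim H linear characters. *)
Lemma deg1_glspan (w : wedd H) : (forall r : 'I_(wN w), wdeg r = 1%N) -> glspan (hdual H).
Proof.
move=> d1; have [|||gT [phi [pi pM p1 pg ps]]] := @gl_group _ (hdual H) (fun=> True) => //.
have pgl x : isgl (phi x) by case: (pg x).
exists gT, phi; split=> //; apply/eqP; rewrite eqn_leq (gl_card_le pi pgl) /= dim_hdual.
have -> : \dim {:H} = wN w.
  apply: (natr_inj ch0); rewrite -rho1 (rho_wcf w) (eq_bigr (fun=> 1)) => [|i _].
    by rewrite sumr_const card_ord.
  by rewrite wcf1 d1 mulr1.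
have rr (r : 'I_(wN w)) : wc r = r.
  have := card_le1P (_ : (#|[pred j | wc j == wc r]| <= 1)%N); rewrite -/(wdeg r) d1 => /(_ isT r).
  by rewrite inE eqxx => /(_ isT (wc r)); rewrite inE wcc eqxx => /esym/eqP.
have /fin_all_exists[t tE] : forall r : 'I_(wN w), exists y, phi y = Chi r.
  by move=> r; apply: ps => //; apply: deg1_gl.
rewrite -[wN w]card_ord; apply: (@leq_card _ _ t) => r s e.
by apply: (Chi_inj (rr r) (rr s)); rewrite -!tE e.
Qed.

(** z acts on the block by a scalar, which cancels between chi and S(chi). *)
Lemma Chi_sq_central (w : wedd H) (r : 'I_(wN w)) z h : isgl z -> (forall x, z * x = x * z) ->
  (Chi r * S (Chi r)) $ (z * h) = (Chi r * S (Chi r)) $ h.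
Proof.
move=> zg zC; have zS : z * S z = 1 by apply: gl_mulS.
have SzC x : S z * x = x * S z.
  by rewrite -[RHS]mul1r -(gl_Smul zg) -[S z * z * _]mulrA (mulrA z) (zC x) -(mulrA x) zS mulr1.
rewrite !ev_mul swM; [|lin|lin]; rewrite gl_sw //; [|by move=> a; apply: lin_sw => u v; lin|by move=> a; apply: lin_sw => u v; lin].
apply: (@eq_sw _ _ k^o) => a b; rewrite !ev_antipode !ChiE antipodeM -SzC !chi_central //.
rewrite mulrACA -wcf_central // zS wcf1 mul1r.
by [].
Qed.

(** Every chi S(chi) lies in K, which is spanned by group-like elements, so deg^2 divides dim K by
    [stabilizer_dvd]. *)
Lemma central_ext_glspan p z (K : hopfType k) (iota : {lrmorphism K -> hdual H}) : prime p -> isgl z -> z ^+ p = 1 ->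
    (forall x, z * x = x * z) -> hopf_morphism iota -> injective iota ->
    (forall f, (forall h, f $ (z * h) = f $ h) <-> exists x, iota x = f) -> glspan K ->
    (forall d, d ^ 2 %| \dim {:K} -> d = 1)%N ->
  glspan (hdual H).
Proof.
move=> pp zg zp zC ih ii iE [gT [phi [pi pM p1 pg dg]]] sq.
have [w _] := wedderburn (inv_semisimple ch0 SS).
apply: (@deg1_glspan w) => r; apply: sq; rewrite -dg.
apply: (stabilizer_dvd ch0 SS ih ii pi pM p1 pg dg (r := r)).
by apply/iE => h; apply: Chi_sq_central.
Qed.
End Commutative.

Lemma sw_comm2 (k : fieldType) (H K : hopfType k) (X : lmodType k) (g : H) (h : K) (F : H -> H -> K -> K -> X) :
  sw g (fun a b => sw h (fun c d => F a b c d)) = sw h (fun c d => sw g (fun a b => F a b c d)).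
Proof.
rewrite swE; under [RHS]eq_sw => c d do rewrite swE.
rewrite sw_sum; apply: eq_bigr => i _; rewrite sw_sum; apply: eq_bigr => j _.
by rewrite sw_scaler.
Qed.

Section Traces.
Variables (k : fieldType) (H : hopfType k).
Hypotheses (ch0 : [pchar k] =i pred0) (SS : forall x : H, antipode (antipode x) = x).
Local Notation S := antipode.
Local Notation n := (\dim {:H}).
Local Notation L := (haar H).

(** This gives the ranks of the projections built from a multiplication and a translation. *)
Lemma ltr_mul_rt x (f : hdual H) : ltr (fun h => x * rt f h) = n%:R * (lmn x * f $ L).
Proof.
have lr := lin_rt f; have ll := @lin_lmn k H.
rewrite (ltr_haar ch0 SS); last by lin.
congr (_ * _); rewrite (haar_cocomm (F := fun a b => lmn (b * S (x * rt f a)) : k^o)); [|lin|lin].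
transitivity (sw L (fun a t => sw t (fun u v => f $ v * lmn (a * S u * S x) : k^o))).
  apply: (@eq_sw _ _ k^o) => a t; rewrite antipodeM mulrA -mulrA /rt (sw_lin (f := fun y => lmn (a * (S y * S x)) : k^o)); last by lin.
  apply: (@eq_sw _ _ k^o) => u v.
  rewrite [LHS](linZ (f := fun y => lmn (a * (S y * S x)) : k^o)); last by lin.
  by rewrite -[LHS]/(_ * _) mulrA.
rewrite -(swA L (fun a u v => f $ v * lmn (a * S u * S x) : k^o)).
rewrite (sw_cul (fun v => f $ v * lmn (S x) : k^o)); [by rewrite lmn_antipode // mulrC | | lin].
move=> t v; rewrite (sw_antr (fun y => f $ v * lmn (y * S x) : k^o)) ?mul1r //; lin.
Qed.
End Traces.

(** * H as a module algebra over its double *)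

Section Adjoint.
Variables (k : closedFieldType) (H : hopfType k).
Hypotheses (SS : forall x : H, antipode (antipode x) = x).
Local Notation S := antipode.
Local Notation D := (dbl SS).
Implicit Types (F G : D) (x y z : H).
Let dl := @lin_dv k H SS.
Let dlf := @lin_dvf k H SS.

Definition ad x y : H := sw x (fun p q => p * y * S q).
Lemma lin_ad x : lin (ad x). Proof. by rewrite /ad; lin. Qed.
Lemma lin_adl y : lin (ad^~ y). Proof. by rewrite /ad; lin. Qed.

Lemma ad1 y : ad 1 y = y.
Proof. by rewrite /ad sw1; [rewrite antipode1 mul1r mulr1 | lin | lin]. Qed.
Lemma adM x x' y : ad (x * x') y = ad x (ad x' y).
Proof.
rewrite /ad swM; [|lin|lin]; apply: eq_sw => p q; rewrite sw_mull sw_mulr; apply: eq_sw => p' q'.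
by rewrite antipodeM !mulrA.
Qed.
Lemma ad_one x : ad x 1 = eps x *: 1.
Proof. by apply: (sw_antr (fun y => y)) => [a b|]; rewrite ?mulr1 //; lin. Qed.
Lemma ad_mul x y z : ad x (y * z) = sw x (fun a b => ad a y * ad b z).
Proof.
rewrite /ad; under [RHS]eq_sw => a b do rewrite sw_mulr.
under [RHS]eq_sw => a b do under eq_sw => p q do rewrite sw_mull.
rewrite (swA x (fun p q b => sw b (fun p' q' => p * y * S q * (p' * z * S q')))); apply: eq_sw => p t.
rewrite -(swA t (fun q p' q' => p * y * S q * (p' * z * S q'))).
apply: esym; apply: (sw_cul (fun q' => p * (y * z) * S q')) => [s q'|]; last by lin.
rewrite (sw_antl (fun u => p * y * u * z * S q')) => [|a b|]; [by rewrite mulr1 !mulrA | by rewrite !mulrA | by lin].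
Qed.
Lemma ad_comm x y : sw x (fun a b => ad a y * b) = x * y.
Proof.
rewrite /ad; under eq_sw => a b do rewrite sw_mulr.
rewrite (swA x (fun p q b => p * y * S q * b)).
apply: (sw_cur (fun p => p * y)) => [p t|]; last by lin.
by rewrite (sw_antl (fun u => p * y * u)) ?mulr1 // => [a b|]; [rewrite !mulrA | lin].
Qed.
Lemma lmn_ad x y : lmn (ad x y) = eps x * lmn y.
Proof.
have ll := @lin_lmn k H; rewrite /ad (sw_lin _ _ ll) (sw_antipoder_op SS (fun u => lmn (u * y) : k^o)) ?mul1r //; last by lin.
by move=> a b; rewrite lmnC !mulrA.
Qed.

(** H is a Yetter-Drinfeld module under the adjoint action and the coaction Delta; this is the
    resulting action of D. It restricts to [ad] on H and to [lt] on the dual. *)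
Definition dact F y : H := sw y (fun a b => ad (dv F a) b).
Let la := lin_ad. Let lal := lin_adl.
Lemma lin_dact F : lin (dact F). Proof. by rewrite /dact; lin. Qed.
Lemma lin_dactl y : lin (dact^~ y).
Proof. by rewrite /dact; apply: lin_sw => a b; apply: lin_comp (lal b) _; lin. Qed.

Lemma dact1 y : dact 1 y = y.
Proof.
apply: (sw_cul (fun b => b)) => [a b|]; last by lin.
by rewrite dv1 (linZ _ _ (lal b)) ad1.
Qed.
Lemma dact_gi x y : dact (gi SS x) y = ad x y.
Proof.
apply: (sw_cul (fun b => ad x b)) => [a b|]; last by lin.
by rewrite giE (linZ _ _ (lal b)).
Qed.
Lemma dact_gj psi y : dact (gj SS psi) y = lt psi y.
Proof. by apply: eq_sw => a b; rewrite rk1E (linZ _ _ (lal b)) ad1. Qed.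

Lemma dactM F G y : dact (F * G) y = dact F (dact G y).
Proof.
have l3 t b : lin (fun g => sw3 g (fun x u z => ad (dv F (x * t * S z)) (ad u b))).
  by apply: lin_sw3g; lin.
transitivity (sw y (fun a t => sw t (fun b1 b2 => sw3 (dv G a) (fun p q r => ad (dv F (p * b1 * S r)) (ad q b2))))).
  rewrite -(swA y (fun a b1 b2 => sw3 (dv G a) (fun p q r => ad (dv F (p * b1 * S r)) (ad q b2)))).
  apply: eq_sw => a b; rewrite dvM (sw_lin _ _ (lal b)); apply: eq_sw => a1 a2.
  by rewrite (sw3_lin _ _ (lal b)); apply: eq_sw3 => p q r; rewrite adM.
apply: esym; rewrite {2}/dact (sw_lin _ _ (lin_dact F)); apply: eq_sw => a b.
rewrite {2}/ad (sw_lin _ _ (lin_dact F)).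
transitivity (sw (dv G a) (fun p q => sw p (fun p1 p2 => sw q (fun q1 q2 => sw b (fun b1 b2 =>
   ad (dv F (p1 * b1 * S q2)) (p2 * b2 * S q1)))))).
  apply: eq_sw => p q; rewrite /dact swM; [|lin|lin]; rewrite swM; [|by move=> ?; apply: lin_sw => ? ?; lin|by move=> ?; apply: lin_sw => ? ?; lin].
  apply: eq_sw => p1 p2; rewrite [RHS]sw_comm; apply: eq_sw => b1 b2.
  by rewrite sw_antipode //; lin.
rewrite (swA (dv G a) (fun p1 p2 q => sw q (fun q1 q2 => sw b (fun b1 b2 =>
   ad (dv F (p1 * b1 * S q2)) (p2 * b2 * S q1))))).
rewrite -sw3_comm /sw3; apply: eq_sw => p1 t.
rewrite -(swA t (fun p2 q1 q2 => sw b (fun b1 b2 => ad (dv F (p1 * b1 * S q2)) (p2 * b2 * S q1)))).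
apply: eq_sw => s q2; rewrite sw_comm; apply: eq_sw => b1 b2.
exact: esym (sw_lin s (fun p2 q1 => p2 * b2 * S q1) (la _)).
Qed.

Lemma dact_mul F y z : dact F (y * z) = sw F (fun F1 F2 => dact F1 y * dact F2 z).
Proof.
rewrite /dact swM; [|lin|lin]; apply: esym.
under eq_sw => F1 F2 do rewrite sw_mulr.
under eq_sw => F1 F2 do under eq_sw => a b do rewrite sw_mull.
transitivity (sw y (fun a b => sw F (fun F1 F2 => sw z (fun a' b' => ad (dv F1 a) b * ad (dv F2 a') b')))).
  exact: sw_comm2.
apply: eq_sw => a b; transitivity (sw z (fun a' b' => sw F (fun F1 F2 => ad (dv F1 a) b * ad (dv F2 a') b'))).
  exact: sw_comm2.
apply: eq_sw => a' b'.
by rewrite (sw_dv _ _ _ (B := fun u v => ad u b * ad v b')) ?ad_mul //; lin.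
Qed.
Lemma dact_one F : dact F 1 = eps F *: 1.
Proof. by rewrite /dact sw1 ?ad_one //; lin. Qed.

Lemma lmn_dact F y : lmn (dact F y) = eps F * lmn y.
Proof.
have ll := @lin_lmn k H; rewrite /dact (sw_lin _ _ ll).
under eq_sw => a b do rewrite lmn_ad.
transitivity (eps (dv F (sw y (fun a b => lmn b *: a)))).
  rewrite (sw_lin _ _ (dl F)) eps_sw; apply: (@eq_sw _ _ k^o) => a b.
  by rewrite (linZ _ _ (dl F)) epsZ mulrC.
by rewrite lmn_l // (linZ _ _ (dl F)) epsZ mulrC.
Qed.

Lemma lmn_dactS F y z : lmn (dact F y * z) = lmn (y * dact (S F) z).
Proof.
have ll := @lin_lmn k H; have ld := lin_dact; have ldl := lin_dactl.
transitivity (sw F (fun F1 F2 => lmn (dact F1 (y * dact (S F2) z)) : k^o)); last first.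
  rewrite (sw_cul (fun F => lmn (y * dact (S F) z) : k^o)) //; last by lin.
  by move=> F1 F2; rewrite lmn_dact.
transitivity (sw F (fun F1 F2 => sw F1 (fun G1 G2 => lmn (dact G1 y * dact (G2 * S F2) z) : k^o))); last first.
  apply: (@eq_sw _ _ k^o) => F1 F2; rewrite dact_mul (sw_lin _ _ ll); apply: (@eq_sw _ _ k^o) => G1 G2.
  by rewrite dactM.
rewrite (swA F (fun G1 G2 F2 => lmn (dact G1 y * dact (G2 * S F2) z) : k^o)).
rewrite (sw_cur (fun G => lmn (dact G y * z) : k^o)) //; last by lin.
move=> G1 t; rewrite (sw_antr (fun G => lmn (dact G1 y * dact G z) : k^o)) ?dact1 //; lin.
Qed.
End Adjoint.

(* T is the sum of the isotypic components of H, as a D(H)-module, of degree in Q. *)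
Section PrimePart.
Variables (k : closedFieldType) (H : hopfType k).
Hypotheses (ch0 : [pchar k] =i pred0) (SS : forall x : H, antipode (antipode x) = x).
Local Notation S := antipode.
Local Notation D := (dbl SS).
Local Notation n := (\dim {:H}).
Local Notation L := (haar H).
Let dinv := @double_inv k H SS.
Variables (w : wedd D).
Local Notation E := (@wE _ _ w).
Implicit Types (F G : D) (x y z t : H) (r s u : 'I_(wN w)).

Lemma sum_we : \sum_(r | wc r == r) we (w := w) r = 1.
Proof.
rewrite -(wE1 w) [RHS](partition_big (@wc _ _ w) (fun r => wc r == r)) /=; last by move=> i _; rewrite wcc.
by apply: eq_bigr => r /eqP rr; apply: eq_bigl => j; rewrite rr.
Qed.

Definition mult r : nat := \dim (limg (linfun (dact (E r r)))).

Lemma ltr_mult r : ltr (dact (E r r)) = (mult r)%:R.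
Proof.
rewrite ltr_idem //; first exact: lin_dact.
by move=> x; rewrite -dactM wEid.
Qed.

Lemma ltr_we r : wc r = r -> ltr (dact (we (w := w) r)) = (wdeg r * mult r)%:R.
Proof.
move=> rr; have lF x := @lin_dactl k H SS x.
transitivity (\sum_(j | wc j == wc r) ltr (dact (E j j))).
  rewrite -ltr_bigsum; apply: eq_ltr => x; rewrite (lin_sum _ _ _ (lF x)).
  by [].
rewrite (eq_bigr (fun=> (mult r)%:R)) => [|j /eqP jr].
  by rewrite sumr_const natrM mulr_natl.
rewrite -ltr_mult (eq_ltr (g := fun x => dact (E j r) (dact (E r j) x))) => [|x].
  rewrite (ltr_comm (f := dact (E j r)) (g := dact (E r j))); [|exact: lin_dact|exact: lin_dact].
  by apply: eq_ltr => x; rewrite -dactM wEM // eqxx scale1r.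
by rewrite -dactM wEM // eqxx scale1r.
Qed.

Lemma ltr_wepart (Q : pred nat) : ltr (dact (wepart w Q)) =
  (\sum_(r | (wc r == r) && Q (wdeg r)) wdeg r * mult r)%:R.
Proof.
rewrite natr_sum; transitivity (ltr (fun x => \sum_(r | (wc r == r) && Q (wdeg r)) dact (we (w := w) r) x)).
  by apply: eq_ltr => x; rewrite (lin_sum _ _ _ (@lin_dactl k H SS x)).
by rewrite ltr_bigsum; apply: eq_bigr => r /andP[/eqP rr _]; apply: ltr_we.
Qed.

Lemma dim_mult : (n = \sum_(r | wc r == r) wdeg r * mult r)%N.
Proof.
apply: (natr_inj ch0); rewrite -ltr_id (eq_ltr (g := dact (wepart w predT))) => [|x].
  by rewrite ltr_wepart; congr (_%:R); apply: eq_bigl => r; rewrite andbT.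
rewrite (_ : wepart w predT = 1) ?dact1 // -sum_we /wepart.
by apply: eq_bigl => r; rewrite andbT.
Qed.

(** The counit is a linear character, so it lives on a block of degree 1. *)
Lemma eps_we r : eps (we (w := w) r) != 0 -> wdeg r = 1%N.
Proof.
have c2 F : F * F = F -> eps F = 0 \/ eps F = 1.
  move=> xx; have : eps F * eps F == eps F by rewrite -epsM xx.
  rewrite -subr_eq0 -{3}[eps F]mulr1 -mulrBr mulf_eq0 subr_eq0.
  by case/orP=> /eqP; [left | right].
have e : eps (we (w := w) r) = (wdeg r)%:R * eps (E r r).
  rewrite /we eps_sum (eq_bigr (fun=> eps (E r r))) ?sumr_const ?mulr_natl // => j /eqP jr.
  have -> : E j j = E j r * E r j by rewrite wEM // eqxx scale1r.
  by rewrite epsM mulrC -epsM wEM // eqxx scale1r.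
move=> nz; case: (c2 _ (@we_idem _ _ w r)) => e1; first by rewrite e1 eqxx in nz.
case: (c2 (E r r)); rewrite ?wEid // => e2; rewrite e2 in e; first by rewrite e1 mulr0 in e; move/eqP: e; rewrite oner_eq0.
by apply: (natr_inj ch0); rewrite -[LHS]mulr1 -e e1.
Qed.

Variables (Q : pred nat) (B : nat).
Hypotheses (Q1 : Q 1) (QB : forall r, Q (wdeg r) -> (wdeg r <= B)%N)
  (nQB : forall r, ~~ Q (wdeg r) -> (B * B < wdeg r)%N).
Local Notation e := (wepart w Q).
Definition tproj : H -> H := dact e.
Local Notation T := tproj.
Let lT : lin T. Proof. exact: lin_dact. Qed.

Lemma wepartC : e + wepart w (predC Q) = 1.
Proof.
rewrite -sum_we /wepart [RHS](bigID (fun r => Q (wdeg r))) /=.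
by congr (_ + _); apply: eq_bigl.
Qed.

Lemma eps_wepart : eps e = 1.
Proof.
rewrite -[RHS](@eps1 k D) -wepartC epsD [eps (wepart w (predC Q))](_ : _ = 0) ?addr0 //.
rewrite /wepart eps_sum big1 // => r /andP[_ Qr]; apply/eqP; apply: contraNT Qr => /eps_we ->.
exact: Q1.
Qed.

Lemma wepart_idem : e * e = e.
Proof.
rewrite {2 3}/wepart mulr_sumr; apply: eq_bigr => r /andP[/eqP rr Qr].
rewrite /wepart mulr_suml (bigD1 r) ?rr ?eqxx //= we_idem big1 ?addr0 // => s /andP[/andP[/eqP ss _] /negPf sr].
by rewrite we_mul // sr scale0r.
Qed.

Lemma wepart_central F : e * F = F * e.
Proof. by rewrite /wepart mulr_suml mulr_sumr; apply: eq_bigr => r _; rewrite we_central. Qed.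

Lemma tproj_idem x : T (T x) = T x.
Proof. by rewrite /T -dactM wepart_idem. Qed.
Lemma tproj1 : T 1 = 1.
Proof. by rewrite /T dact_one eps_wepart scale1r. Qed.
Lemma tproj_dact F x : T (dact F x) = dact F (T x).
Proof. by rewrite /T -!dactM wepart_central. Qed.

Definition act2 (t : tensor D D) x y : H := tlift (fun F G => dact F x * dact G y) t.
Let act2b x y : bilinear_map (fun F G : D => dact F x * dact G y).
Proof. by have ld := @lin_dactl k H SS; apply: lin2_bilinear => F; lin. Qed.
Lemma act2_mul (v : tensor D D) F G x y : act2 (v * (F \ox G)) x y = act2 v (dact F x) (dact G y).
Proof.
move: v; apply: lin_tensor_eq => [||F' G']; last by rewrite mul_ox /act2 !tlift_ox // !dactM.
  by apply: lin_comp (@lin_tlift _ _ _ _ _) _; lin.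
exact: lin_tlift.
Qed.

(** By [comul_block0] the coproduct of the complementary idempotent, whose degrees exceed B B, kills
    tensors of components of degree at most B. *)
Lemma tproj_mul x y : T (T x * T y) = T x * T y.
Proof.
have e0 : comul (wepart w (predC Q)) * (e \ox e) = 0.
  rewrite /wepart (linear_sum comul) mulr_suml big1 // => u /andP[_ Qu].
  rewrite (lin_sum (f := fun v : D => v \ox _)); last by lin.
  rewrite mulr_sumr big1 // => r /andP[_ Qr]; rewrite (lin_sum (f := fun v : D => _ \ox v)); last by lin.
  rewrite mulr_sumr big1 // => s /andP[_ Qs]; apply: comul_block0 => //.
  by apply: leq_ltn_trans (nQB Qu); rewrite leq_mul // QB.
have : dact (wepart w (predC Q)) (T x * T y) = 0.
  rewrite dact_mul -[LHS]/(act2 (comul _) (T x) (T y)) /T -act2_mul e0.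
  by rewrite /act2 linear0.
move=> z; rewrite -[RHS](dact1 SS) -wepartC (linD _ _ (@lin_dactl k H SS _)) z addr0.
by [].
Qed.

Lemma lmn_tproj x y : lmn (T x * y) = lmn (x * T y).
Proof. by rewrite /T lmn_dactS antipode_wepart. Qed.

(** T is self-adjoint for the Haar form and its image is closed under products; hence multiplication
    by the image preserves the orthogonal complement, the kernel. *)
Lemma tproj_ker t y : T t = t -> T (t * (y - T y)) = 0.
Proof.
move=> tT; have ll := @lin_lmn k H; apply: (lmn_nondeg ch0 SS) => x.
rewrite -lmn_tproj mulrA -{1}tT -tproj_mul lmn_tproj (linB _ _ lT) tproj_idem subrr mulr0.
exact: (lin0 ll).
Qed.

Lemma tproj_mull t y : T t = t -> T (t * y) = t * T y.
Proof.
move=> tT; rewrite -{1}[y](subrK (T y)) mulrDr (linD _ _ lT) tproj_ker // add0r.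
by rewrite -{1}tT tproj_mul tT.
Qed.

Definition tint : H := T L.
(** L is invariant under the adjoint action and T commutes with that action; adjoint invariants are
    central by [ad_comm]. *)
Lemma tint_central b : b * tint = tint * b.
Proof.
have adL x : ad x L = eps x *: L.
  rewrite /ad (sw_cul (fun q => L * S q)); [by rewrite haar_r // eps_antipode | | by lin].
  by move=> p q; rewrite haar_l // scalerAl.
have adT x : ad x tint = eps x *: tint.
  by rewrite /tint -(dact_gi SS) -tproj_dact dact_gi adL (linZ _ _ lT).
rewrite -(ad_comm b tint); apply: (sw_cul (fun y => tint * y)) => [u v|]; last by lin.
by rewrite adT scalerAl.
Qed.
Lemma tint_mul t : T t = t -> t * tint = eps t *: tint.
Proof. by move=> tT; rewrite /tint -[LHS](tproj_mull L tT) haar_l // (linZ (eps t) L lT). Qed.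

Definition teps : hdual H := linfun (fun y => eps (T y) : k^o).
Lemma tepsE y : teps $ y = eps (T y).
Proof. by apply: (ev_linfun (f := fun y => eps (T y) : k^o)); lin. Qed.
Lemma tproj_lt psi y : T (lt psi y) = lt psi (T y).
Proof. by rewrite -!(dact_gj SS) tproj_dact. Qed.
(** A map commuting with all left translations is the right translation by its composite with the
    counit. *)
Lemma tproj_rt y : T y = rt teps y.
Proof.
apply: ev_sep => psi; rewrite ev_rt -ev_lt tepsE tproj_lt -[RHS]ev1 ev_lt mulr1.
by [].
Qed.

Definition dimT : nat := \sum_(r | (wc r == r) && Q (wdeg r)) wdeg r * mult r.
Lemma dimT_tint : n%:R * eps tint = dimT%:R.
Proof.
rewrite /dimT -ltr_wepart (eq_ltr (g := fun h => 1 * rt teps h)) => [|x]; last by rewrite mul1r -tproj_rt.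
by rewrite ltr_mul_rt // lmn1 // mul1r tepsE.
Qed.
Lemma lmn_tint : lmn tint = n%:R^-1.
Proof.
have ll := @lin_lmn k H; rewrite /tint tproj_rt /rt (sw_lin _ _ ll).
transitivity (teps $ (sw L (fun a b => lmn a *: b))).
  by rewrite ev_sw; apply: (@eq_sw _ _ k^o) => a b; rewrite (linZ _ _ ll) evZ -[LHS]/(_ * _) mulrC.
by rewrite lmn_r // lmn_haar // evZ tepsE tproj1 eps1 mulr1.
Qed.

Lemma dimT_rank : dimT = \dim (limg (linfun T)).
Proof. by apply: (natr_inj ch0); rewrite /dimT -ltr_wepart ltr_idem //; apply: tproj_idem. Qed.

Lemma dimT_gt0 : (0 < dimT)%N.
Proof.
rewrite dimT_rank lt0n dimv_eq0; apply/eqP => d0; have := memv_img (linfun T) (memvf 1).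
by rewrite d0 memv0 (lin_linfun lT) tproj1 oner_eq0.
Qed.

(** Rescaled by n / dim T to counit 1, T(L) is a group-like projection P, with Haar value 1 / dim T;
    apply [glproj_subhopf]. *)
Lemma tproj_subhopf : exists (K : hopfType k) (iota : {lrmorphism K -> hdual H}),
  [/\ hopf_morphism iota, injective iota & (\dim {:K} * dimT = n)%N].
Proof.
have dT := dimT_gt0.
have dn := dim_neq0 H ch0; have dk : dimT%:R != 0 :> k by rewrite (proj1 (pcharf0P _) ch0) -lt0n.
have et : eps tint = dimT%:R / n%:R by rewrite -dimT_tint mulrAC mulfV // mul1r.
pose P := (n%:R / dimT%:R) *: tint.
have PT t : T t = t -> t * P = eps t *: P by move=> tT; rewrite /P -scalerAr tint_mul // !scalerA mulrC.
have PL : P = T ((n%:R / dimT%:R) *: L) by rewrite (linZ _ _ lT).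
have eP : eps P = 1 by rewrite /P epsZ et mulrA divfK // mulfV.
have PC h : h * P = P * h by rewrite /P -scalerAr -scalerAl tint_central.
have PD : sw P (fun a b => a \ox (b * P)) = P \ox P.
  have c : comul P = sw ((n%:R / dimT%:R) *: L) (fun a b => a \ox T b).
    by rewrite PL tproj_rt comul_rt; apply: eq_sw => a b; rewrite -tproj_rt.
  transitivity (comul P * (1 \ox P)).
    by rewrite comul_sw sw_mulr; apply: eq_sw => a b; rewrite mul_ox mulr1.
  rewrite c sw_mulr; transitivity (sw ((n%:R / dimT%:R) *: L) (fun a b => (teps $ b *: a) \ox P)).
    apply: eq_sw => a b; rewrite mul_ox mulr1 PT ?tproj_idem // tepsE.
    by rewrite (linZ (f := fun z => a \ox z)) ?(linZ (f := fun z => z \ox P)) //; lin.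
  by rewrite -(sw_lin (f := fun z => z \ox P)) -/(rt _ _) -?tproj_rt -?PL //; lin.
have [K [iota [ih ii _ dK]]] := glproj_subhopf SS eP PC PD ch0.
exists K, iota; split=> //; apply: (natr_inj ch0).
have ll := @lin_lmn k H.
rewrite natrM dK /P (linZ _ _ ll) lmn_tint -[_ *: _]/(_ * _).
have -> : n%:R / dimT%:R * n%:R^-1 = dimT%:R^-1 :> k by rewrite mulrAC mulfV // mul1r.
by rewrite divfK.
Qed.
End PrimePart.

(** * Linear characters of the double *)

Section DoubleGrouplikes.
Variables (k : closedFieldType) (H : hopfType k).
Hypotheses (ch0 : [pchar k] =i pred0) (SS : forall x : H, antipode (antipode x) = x).
Local Notation S := antipode.
Local Notation D := (dbl SS).
Local Notation L := (haar H).
Implicit Types (F G : D) (a b x y z t : H) (psi phi : hdual H) (f : hdual D).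
Let dl := @lin_dv k H SS.
Let dlf := @lin_dvf k H SS.

(** A linear character of D amounts to a group-like g in the dual, its restriction to H, and a
    group-like x in H, its restriction to the dual ([dgl_ev]). *)
Definition dgl f : hdual H := linfun (fun a => f $ (gi SS a) : k^o).
Definition dpt f : H := \sum_i f $ (gj SS (@dbasis k H i)) *: bs i.

Lemma dglE f a : dgl f $ a = f $ (gi SS a).
Proof. by have l := @lin_rk1 k H SS 1; apply: (ev_linfun (f := fun a => f $ (gi SS a) : k^o)); rewrite /gi; lin. Qed.

Lemma ev_dpt f psi : psi $ (dpt f) = f $ (gj SS psi).
Proof.
have l := @lin_rk1f k H SS 1; have pE : psi = \sum_i psi $ (bs i) *: dbasis i.
  apply: ev_inj => h; rewrite evf_sum {1}(bs_sum h) ev_sum.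
  by apply: eq_bigr => i _; rewrite evZ evfZ ev_dbasis mulrC.
rewrite /dpt ev_sum {2}pE /gj (lin_sum _ _ _ l) ev_sum; apply: eq_bigr => i _.
by rewrite evZ (linZ _ _ l) evZ mulrC.
Qed.

Section Grouplike.
Variable f : hdual D.
Hypothesis fg : isgl f.
Local Notation g := (dgl f).
Local Notation x := (dpt f).

Lemma dgl_ev F : f $ F = g $ (dv F x).
Proof.
rewrite {1}(dd_sum F) ev_sum {1}/dpt (lin_sum _ _ _ (dl F)) ev_sum; apply: eq_bigr => i _.
have -> : dd SS i (dv F (bs i)) = gi SS (dv F (bs i)) * gj SS (@dbasis k H i).
  by rewrite gi_gj; apply: dv_inj => h; rewrite ddE rk1E ev_dbasis.
by rewrite gl_ev // (linZ _ _ (dl F)) evZ dglE mulrC.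
Qed.

Lemma gi_one : gi SS 1 = 1.
Proof. by apply: dv_inj => h; rewrite giE dv1. Qed.
Lemma giM a b : gi SS (a * b) = gi SS a * gi SS b.
Proof. by apply: dv_inj => h; rewrite gi_mul !giE scalerAr. Qed.
Lemma gj_one : gj SS 1 = 1.
Proof. by apply: dv_inj => h; rewrite rk1E dv1 ev1. Qed.
Lemma gjM phi psi : gj SS (psi * phi) = gj SS phi * gj SS psi.
Proof.
apply: dv_inj => h; rewrite mul_gj rk1E ev_mul sw_scalel; apply: eq_sw => u v.
by rewrite rk1E scalerA.
Qed.

Lemma dgl_gl : isgl g.
Proof.
apply: gl_of_ev => [|a b]; first by rewrite dglE gi_one gl_ev1.
by rewrite !dglE giM gl_ev.
Qed.

Lemma dpt_gl : isgl x.
Proof.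
split; first by rewrite -ev1 ev_dpt gj_one gl_ev1.
apply/matrixP => i j; rewrite comul_coef ev_dpt gjM gl_ev // -!ev_dpt !ev_dbasis.
by rewrite ox.unlock mxE mulrC.
Qed.

Lemma dgl_comm a : x * lt g a = rt g a * x.
Proof.
have R1 c : sw3 c (fun u v w => g $ v *: (u * x * S w)) = g $ c *: x.
  apply: ev_sep => psi; rewrite evZ ev_dpt dglE -gl_ev // -[RHS]mul1r mul1r.
  have -> : f $ (gi SS c * gj SS psi) = f $ (gj SS psi * gi SS c) by rewrite !gl_ev // mulrC.
  rewrite dgl_ev mul_gi (sw3_lin (f := fun z => psi $ z : k^o)); last by lin.
  rewrite (sw3_lin (f := fun z => g $ z : k^o)); last by lin.
  by apply: (@eq_sw3 _ _ k^o) => u v w; rewrite rk1E -scalerAl mul1r !evZ mulrC.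
rewrite /lt sw_mull; transitivity (sw a (fun c b => sw3 c (fun u v w => g $ v *: (u * x * S w)) * b)).
  by apply: eq_sw => c b; rewrite R1 -scalerAl -scalerAr.
have e c b : sw3 c (fun u v w => g $ v *: (u * x * S w)) * b = sw3 c (fun u v w => g $ v *: (u * x * S w) * b).
  by rewrite (sw3_lin (f := fun z => z * b)) //; lin.
under eq_sw => c b do rewrite e.
rewrite /sw3 (swA a (fun u t b => sw t (fun v w => g $ v *: (u * x * S w) * b))).
rewrite /rt sw_mulr; apply: eq_sw => u t.
rewrite (swA t (fun v w b => g $ v *: (u * x * S w) * b)).
transitivity (sw t (fun v s => eps s *: (g $ v *: (u * x)))).
  apply: eq_sw => v s; rewrite (sw_antl (fun z => g $ v *: (u * x * z))) ?mulr1 //; last by lin.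
  by move=> c b; rewrite -scalerAl !mulrA.
rewrite -scalerAl; apply: (sw_cur (fun v => g $ v *: (u * x))) => //.
by lin.
Qed.

Lemma rt_dact a : rt g a = dact (gi SS x * gj SS g) a.
Proof.
have xg := dpt_gl; rewrite dactM dact_gi dact_gj /ad gl_sw //; [|lin|lin].
by rewrite dgl_comm -mulrA gl_mulS // mulr1.
Qed.

Lemma dgl_central : x = 1 -> forall phi, phi * g = g * phi.
Proof.
move=> x1 phi; apply: ev_inj => a; rewrite -ev_rt -ev_lt.
by have := dgl_comm a; rewrite x1 mul1r mulr1 => ->.
Qed.

Lemma dpt_central : g = 1 -> forall a, x * a = a * x.
Proof.
move=> g1 a; have := dgl_comm a; rewrite g1 rt1 => <-; congr (_ * _).
by apply: esym; apply: (sw_cul (fun b => b)) => [u v|]; [rewrite ev1 | lin].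
Qed.
End Grouplike.

Lemma dgl_mul f f' F : isgl f -> isgl f' -> (f * f') $ F = (dgl f * dgl f') $ (dv F (dpt f * dpt f')).
Proof.
move=> fg fg'; rewrite !ev_mul; under eq_sw => u v do rewrite !dgl_ev //.
by rewrite (sw_dv _ _ _ (B := fun u v => dgl f $ u * dgl f' $ v : k^o)) //; lin.
Qed.

Lemma dgl_ext f (g : hdual H) (x : H) : isgl g -> isgl x -> (forall F, f $ F = g $ (dv F x)) -> dgl f = g /\ dpt f = x.
Proof.
move=> gg xg e; split.
  by apply: ev_inj => a; rewrite dglE e giE (proj1 xg) scale1r.
by apply: ev_sep => psi; rewrite ev_dpt e rk1E evZ gl_ev1 // mulr1.
Qed.

Lemma dgl_exp f i : isgl f -> dgl (f ^+ i) = dgl f ^+ i /\ dpt (f ^+ i) = dpt f ^+ i.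
Proof.
move=> fg; elim: i => [|i [IH1 IH2]].
  by apply: dgl_ext; [exact: gl_one | exact: gl_one |] => F; rewrite expr0 !ev1.
have gg := dgl_gl fg; have xg := dpt_gl fg.
apply: dgl_ext; [exact: gl_exp | exact: gl_exp |] => F.
by rewrite exprS dgl_mul ?IH1 ?IH2 -?exprS //; apply: gl_exp.
Qed.

Lemma dgl1 f : isgl f -> dgl f = 1 -> dpt f = 1 -> f = 1.
Proof. by move=> fg g1 x1; apply: ev_inj => F; rewrite dgl_ev // g1 x1 !ev1. Qed.

(** Up to convention the Drinfeld element of D; S^2 = id makes it central. *)
Definition drin : D := dmk SS id.
Lemma drinE h : dv drin h = h. Proof. by apply: dv_mk; lin. Qed.

Lemma mul_drin F h : dv (F * drin) h = sw h (fun a b => dv F a * b).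
Proof.
rewrite dvM /sw3; under eq_sw => h1 h2 do rewrite drinE.
rewrite (swA h (fun a t h2 => sw t (fun b c => dv F (a * h2 * S c) * b))); apply: eq_sw => a u.
rewrite (swA u (fun b c h2 => dv F (a * h2 * S c) * b)).
apply: (sw_cur (fun b => dv F a * b)) => [b v|]; last by lin.
rewrite (sw_antipodel_op SS (fun z => dv F (a * z) * b)) ?mulr1 //; last by lin.
by move=> c h2; rewrite mulrA.
Qed.
Lemma drin_mul F h : dv (drin * F) h = sw h (fun a b => dv F a * b).
Proof.
rewrite dvM; apply: eq_sw => h1 h2; rewrite /sw3.
apply: (sw_cur (fun a => a * h2)) => [a t|]; last by lin.
rewrite (sw_antipoder_op SS (fun z => a * h2 * z)) ?mulr1 //; last by lin.
by move=> b c; rewrite drinE !mulrA.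
Qed.
Lemma drin_central F : drin * F = F * drin.
Proof. by apply: dv_inj => h; rewrite drin_mul mul_drin. Qed.
Lemma drin_unit : drin * dmk SS S = 1.
Proof.
apply: dv_inj => h; rewrite drin_mul dv1.
by apply: (sw_antl (fun z => z)) => [a b|]; [rewrite dv_mk //; lin | lin].
Qed.

Lemma drin_wcf (w : wedd D) (r : 'I_(wN w)) : wcf r r drin != 0.
Proof.
apply/eqP => w0; have := wcf1 r; rewrite -drin_unit wcf_central ?w0 ?mul0r; last exact: drin_central.
by move/esym/eqP; rewrite oner_eq0.
Qed.
End DoubleGrouplikes.

(** * Finding a central group-like element of the dual *)

Section Dagger.
Variables (k : closedFieldType) (H : hopfType k).
Hypotheses (ch0 : [pchar k] =i pred0) (SS : forall x : H, antipode (antipode x) = x).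
Local Notation S := antipode.
Local Notation D := (dbl SS).
Local Notation n := (\dim {:H}).
Local Notation L := (haar H).
Let dinv := @double_inv k H SS.
Variables (w : wedd D) (Q : pred nat) (B : nat).
Local Notation E := (@wE _ _ w).
Implicit Types (F G : D) (a b x y z t : H) (psi phi : hdual H) (f : hdual D) (r s u : 'I_(wN w)).
Hypotheses (Q1 : Q 1) (QB : forall r, Q (wdeg r) -> (wdeg r <= B)%N)
  (nQB : forall r, ~~ Q (wdeg r) -> (B * B < wdeg r)%N).
Local Notation T := (tproj w Q).
Let dl := @lin_dv k H SS.
Let dlf := @lin_dvf k H SS.

(* The stabilizer of an irreducible character, counted through chi * S chi. *)
Lemma stab_count r (gT : finGroupType) (phi : gT -> hdual D) : injective phi ->
    (forall c, isgl (phi c) /\ phi c * Chi r = Chi r) ->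
    (forall f, isgl f -> f * Chi r = Chi r -> exists c, phi c = f) ->
  exists m : 'I_(wN w) -> nat, (wdeg r ^ 2 = #|gT| + \sum_(s | (wc s == s) && (wdeg s != 1)) m s * wdeg s)%N /\
    forall s, m s != 0 -> (wdeg s <= wdeg r ^ 2)%N.
Proof.
move=> pi pg ps; have [m mE] := naturalM (natural_Chi (w := w) r) (natural_SChi (w := w) r).
have e1 : (wdeg r ^ 2 = \sum_(s | wc s == s) m s * wdeg s)%N.
  apply: (natr_inj ch0); have := congr1 (fun f : hdual D => f $ 1) mE.
  rewrite ev_mul sw1; [|lin|lin]; rewrite ev_antipode antipode1 ChiE chi1 -natrM mulnn => ->.
  by rewrite evf_sum natr_sum; apply: eq_bigr => s _; rewrite evfZ ChiE chi1 natrM.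
pose m' s := if wc s == s then m s else 0%N.
exists m'; split; last first.
  move=> s; rewrite /m'; case: (eqVneq (wc s) s) => // ss ms; rewrite e1 (bigD1 s) ?ss //=.
  by case: (m s) ms => // c _; rewrite mulSn -addnA leq_addr.
have me s : wc s = s -> (Chi r * S (Chi r)) $ (E s s) = (m s)%:R.
  move=> ss; rewrite mE evf_sum (bigD1 s) ?ss //= big1 ?addr0 => [|u /andP[/eqP uu us]].
    by rewrite evfZ Chi_basis_ev // ss eqxx mulr1.
  by rewrite evfZ Chi_basis_ev // uu eq_sym (negPf us) mulr0.
have ct : tracial (Chi r * S (Chi r)) by apply: tracialM; [|apply: tracial_antipode]; apply: Chi_tracial.
have m1 s : wc s = s -> wdeg s = 1%N -> m s = (Chi s * Chi r == Chi r).
  move=> ss s1; apply: (natr_inj ch0); rewrite -me // -Chi_orthogonal // gl_mult //.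
  exact: deg1_gl.
rewrite e1 (bigID (fun s => wdeg s == 1%N)) /=; congr addn; last first.
  by apply: eq_bigr => s /andP[ss _]; rewrite /m' ss.
pose A := [set s : 'I_(wN w) | [&& wc s == s, wdeg s == 1%N & Chi s * Chi r == Chi r]].
have -> : (\sum_(s | (wc s == s) && (wdeg s == 1%N)) m s * wdeg s = #|A|)%N.
  rewrite -sum1_card (big_mkcond (fun s => s \in A)) [LHS]big_mkcond; apply: eq_bigr => s _.
  rewrite inE; case: eqP => //= ss; case: eqP => //= s1.
  by rewrite m1 // s1 muln1; case: eqP.
have /fin_all_exists2[t tr tE] : forall c : gT, exists2 s : 'I_(wN w), wc s = s & phi c = Chi s.
  move=> c; have [xg _] := pg c; apply: norm1_irreducible => //; first exact: gl_natural.
  by rewrite gl_mulS // ev1 haar_eps.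
have -> : A = [set t c | c in [set: gT]].
  apply/setP => s; rewrite inE; apply/and3P/imsetP => [[/eqP ss /eqP s1 /eqP sr]|[x _ ->]].
    have [x xE] := ps _ (deg1_gl s1) sr; exists x => //.
    by apply: (Chi_inj ss (tr x)); rewrite -tE.
  have [xg xr] := pg x; rewrite tr eqxx -tE xr eqxx; split=> //.
  have := gl_ev1 xg; rewrite tE ChiE chi1 -[1 in RHS]/(1%:R) => /(natr_inj ch0) ->.
  by [].
rewrite card_imset ?cardsT // => x y e; apply: pi.
by rewrite !tE e.
Qed.

Lemma tproj_gl_eps f : isgl f -> (forall t, dgl f $ (T t) = eps (T t)) -> forall t, rt (dgl f) (T t) = T t.
Proof.
move=> fg fT t; rewrite [in RHS]tproj_rt // {1}tproj_rt // rt_rt.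
have -> : dgl f * teps w Q = teps w Q; last by [].
by apply: ev_inj => a; rewrite -ev_rt -tproj_rt // fT tepsE.
Qed.

(** Evaluate f chi = chi at the Drinfeld element u. Translating u by f gives g(x) F0, and F0 acts on
    T as u does because g translates T trivially. As chi occurs in T, chi(F0) = chi(u), which is
    nonzero since u is central and invertible. *)
Lemma eps_twist_trivial r f : isgl f -> f * Chi r = Chi r -> wc r = r -> Q (wdeg r) -> mult r != 0%N ->
  (forall t, dgl f $ (T t) = eps (T t)) -> dgl f $ (dpt f) = 1.
Proof.
move=> fg fr rr Qr mr fT; set g := dgl f; set x := dpt f.
have gg : isgl g by apply: dgl_gl. have xg : isgl x by apply: dpt_gl.
pose u := drin SS; pose F0 : D := dmk SS (fun h => x * lt g h).
have ll := lin_lt g; have la := @lin_ad k H; have lal := @lin_adl k H; have ld := @lin_dact k H SS.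
have ldl := @lin_dactl k H SS.
have F0E h : dv F0 h = x * lt g h by rewrite dv_mk //; lin.
have lu : lt f u = (g $ x) *: F0.
  apply: dv_inj => h; rewrite (linZ _ _ (dlf h)) F0E /lt (sw_lin _ _ (dlf h)).
  under eq_sw => F1 F2 do rewrite (linZ _ _ (dlf h)) dgl_ev //.
  rewrite -/x -/g (sw_dv _ _ _ (B := fun a b => g $ a *: b)); [|lin|lin].
  rewrite drinE swM; [|lin|lin]; rewrite gl_sw //; [|by move=> a; apply: lin_sw => c d; lin|by move=> a; apply: lin_sw => c d; lin].
  rewrite sw_mull sw_scaler; apply: eq_sw => a b.
  by rewrite gl_ev // -scalerAr scalerA.
have actF0 y : dact F0 (T y) = dact u (T y).
  have -> : F0 = u * (gi SS x * gj SS g).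
    rewrite mulrA drin_central -mulrA; apply: dv_inj => h; rewrite gi_mul mul_gj F0E; congr (_ * _).
    by apply: eq_sw => a b; rewrite drinE.
  by rewrite dactM -rt_dact // tproj_gl_eps.
have k0 y : dact (F0 - u) (T y) = 0.
  by rewrite (linB _ _ (ldl _)) actF0 subrr.
have [y0 y00] : exists y0, dact (E r r) y0 != 0.
  apply: Classical_Prop.NNPP => no; case/negP: mr; rewrite /mult dimv_eq0 -subv0; apply/subvP => v.
  case/(lin_limg _ (ld _)) => y ->; rewrite memv0; apply/negP => yn; apply: no.
  by exists y; apply/negP.
have eE j : wc j = r -> wepart w Q * E j r = E j r.
  move=> jr; rewrite /wepart mulr_suml (bigD1 r) ?rr ?eqxx //= big1 ?addr0 => [|s /andP[/andP[/eqP ss _] sr]].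
    by rewrite we_E jr rr eqxx scale1r.
  by rewrite we_E jr ss eq_sym (negPf sr) scale0r.
have w0 j : wc j = r -> wcf j j (F0 - u) = 0.
  move=> jr; have crj : wc r = wc j by rewrite rr jr.
  have : dact (E j j * (F0 - u) * E j j) (dact (E j r) y0) = 0.
    have e2 : dact (E j j) (dact (E j r) y0) = dact (E j r) y0 by rewrite -dactM wEid // jr.
    rewrite !dactM e2 [dact (E j r) y0](_ : _ = T (dact (E j r) y0)); last by rewrite /T -dactM eE.
    by rewrite k0 (lin0 (ld _)).
  rewrite wcfP (linZ _ _ (ldl _)) -dactM wEid ?rr // => /eqP; rewrite scaler_eq0 => /orP[/eqP //|/eqP e].
  have : dact (E r j) (dact (E j r) y0) = 0 by rewrite e (lin0 (ld _)).
  by rewrite -dactM wEM // eqxx scale1r => e0; rewrite e0 eqxx in y00.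
have cF : chi r F0 = chi r u.
  apply/eqP; rewrite -subr_eq0 -(linB _ _ (@lin_chi _ _ w r)); apply/eqP.
  by rewrite /chi big1 // => j /eqP jr; apply: w0; rewrite jr.
have cu : chi r u != 0.
  rewrite -[u]mulr1 chi_central ?chi1; last by move=> F; apply: drin_central.
  by rewrite mulf_neq0 ?drin_wcf ?wdeg_neq0.
have := congr1 (fun h : hdual D => h $ u) fr; rewrite -ev_lt lu evZ !ChiE cF => e.
by apply: (mulIf cu); rewrite mul1r.
Qed.

Lemma rank_div (M : H -> H) c : lin M -> (forall x, M (M x) = M x) -> (0 < c)%N -> ltr M * c%:R = n%:R -> (c %| n)%N.
Proof.
move=> Ml MM c0; rewrite ltr_idem // -natrM => /(natr_inj ch0) <-.
exact: dvdn_mull.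
Qed.

Lemma glavg_ev p g (v : H) : prime p -> isgl g -> g ^+ p = 1 -> g != 1 -> (forall i, (0 < i < p)%N -> (g ^+ i) $ v = 0) ->
  glavg p g $ v = p%:R^-1 * eps v.
Proof.
move=> pp gg gp g1 g0; have lf : lin (fun f : hdual H => f $ v : k^o) by lin.
by have := glavg_fun pp lf g0; rewrite ev1.
Qed.

(** The stabilizer of chi contains some f of order p, giving a pair (g, x). If g = 1 then x is
    central, hence 1, which is excluded; if x = 1 then g is central, as wanted. Two rank arguments
    exclude the remaining case, according to whether g(x) = 1. *)
Lemma central_character_ex p m r : prime p -> n = (p * m)%N -> ~~ (p %| m)%N -> ~~ (p %| dimT w Q)%N ->
    (forall z, isgl z -> (forall a, z * a = a * z) -> z = 1) ->
    (forall s, (wdeg s <= p ^ 2)%N -> wdeg s = 1%N \/ wdeg s = p) ->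
    wc r = r -> wdeg r = p -> Q p -> mult r != 0%N ->
  exists g : hdual H, [/\ isgl g, g ^+ p = 1, g != 1 & forall phi, phi * g = g * phi].
Proof.
move=> pp nE pm pT nc ds rr rp Qp mr.
have p0 := prime_gt0 pp; have pk : p%:R != 0 :> k by rewrite (proj1 (pcharf0P _) ch0) -lt0n.
have [|g h gr hr|g gg gr|gT [phi [pi pM p1 pg ps]]] := @gl_group _ (hdual D) (fun f => f * Chi r = Chi r).
- by rewrite mul1r.
- by rewrite -mulrA hr gr.
- by rewrite -{1}gr mulrA gl_Smul // mul1r.
(* In chi S(chi), of degree p^2, the constituents not of degree 1 have degree p, so p divides the
   number of linear ones, which is the order of the stabilizer. *)
have pG : (p %| #|gT|)%N.
  have [mm [e mb]] := stab_count pi pg ps.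
  have : (p %| #|gT| + \sum_(s | (wc s == s) && (wdeg s != 1%N)) mm s * wdeg s)%N by rewrite -e rp expnS dvdn_mulr.
  rewrite dvdn_addl // dvdn_sum // => s /andP[_ s1]; case: (eqVneq (mm s) 0%N) => [->|ms]; first by rewrite mul0n.
  have := mb s ms; rewrite rp => /ds[s1'|->]; last exact: dvdn_mull.
  by rewrite s1' in s1.
have [c [fp f1]] := gl_cauchy pp pi pM p1 pG.
have [fg fr] := pg c; set f := phi c in fp f1 fg fr.
set g := dgl f; set x := dpt f; have gg : isgl g by apply: dgl_gl. have xg : isgl x by apply: dpt_gl.
have [gp xp] : g ^+ p = 1 /\ x ^+ p = 1.
  have [<- <-] := dgl_exp p fg; rewrite fp; apply: dgl_ext; [exact: gl_one | exact: gl_one |].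
  by move=> F; rewrite !ev1.
case: (eqVneq g 1) => [g1|g1].
  have x1 : x = 1 by apply: nc => //; apply: dpt_central.
  by case/negP: f1; apply/eqP/dgl1.
case: (eqVneq x 1) => [x1|x1]; first by exists g; split=> //; apply: dgl_central.
case: (eqVneq (g $ x) 1) => [gx|gx].
  have rx i : rt g (x ^+ i) = x ^+ i.
    elim: i => [|i IH]; first exact: rt_1.
    by rewrite exprS rtM // IH; congr (_ * _); rewrite /rt gl_sw ?gx ?scale1r //; lin.
  have lr := @lin_rt k H; have rX : rt g (glavg p x) = glavg p x.
    by rewrite /glavg (linZ _ _ (lr g)) (lin_sum _ _ _ (lr g)); congr (_ *: _); apply: eq_bigr => i _.
  have rXi i y : rt (g ^+ i) (glavg p x * y) = glavg p x * rt (g ^+ i) y.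
    have gi_ : isgl (g ^+ i) by apply: gl_exp.
    rewrite rtM //; congr (_ * _); elim: (i) => [|j IH]; first by rewrite rt1.
    by rewrite exprS -rt_rt IH rX.
  pose M h := glavg p x * rt (glavg p g) h.
  have rG y : rt (glavg p g) (glavg p x * y) = glavg p x * rt (glavg p g) y.
    have lf h := @lin_rtf k H h.
    rewrite /glavg -/(glavg p x) !(linZ _ _ (lf _)) !(lin_sum _ _ _ (lf _)) -scalerAr mulr_sumr; congr (_ *: _).
    by apply: eq_bigr => i _; apply: rXi.
  have Ml : lin M by have l := lr (glavg p g); rewrite /M; lin.
  have MM y : M (M y) = M y by rewrite /M rG rt_rt !mulrA !glavg_idem.
  (* When g(x) = 1 the averages over x and over g commute, and M is a projection of trace n /
     p^2. *)
  have : (p * p %| n)%N.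
    apply: (rank_div Ml MM); first by rewrite muln_gt0 p0.
    have hX : lmn (glavg p x) = p%:R^-1 by apply: lmn_glavg.
    have g0L i : (0 < i < p)%N -> (g ^+ i) $ L = 0.
      by move=> ip; apply: gl_haar => //; [exact: gl_exp | apply: (gl_exp_neq1 pp)].
    have hG : glavg p g $ L = p%:R^-1 by rewrite (glavg_ev pp gg gp g1 g0L) haar_eps // mulr1.
    rewrite /M ltr_mul_rt // hX hG natrM mulrA -!mulrA.
    by rewrite (mulrA p%:R^-1 p%:R) mulVf // mul1r mulVf // mulr1.
  by rewrite nE dvdn_pmul2l // (negPf pm).
(* If every such g^i vanished at T(L), averaging T over g would leave rank dim T / p. A nonzero
   value forces g^i to be the counit on T, since t T(L) = eps(t) T(L). *)
have [i ip gi0] : exists2 i, (0 < i < p)%N & (g ^+ i) $ (tint w Q) != 0.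
  apply: Classical_Prop.NNPP => no; case/negP: pT.
  pose M h := T (rt (glavg p g) h).
  have lT : lin T by apply: lin_dact.
  have Tr y (l : nat) : T (rt (g ^+ l) y) = rt (g ^+ l) (T y).
    elim: l y => [|l IH] y; first by rewrite !rt1.
    by rewrite exprS -!rt_rt -IH /g !rt_dact // tproj_dact.
  have TG y : T (rt (glavg p g) y) = rt (glavg p g) (T y).
    have lf h := @lin_rtf k H h.
    rewrite /glavg !(linZ _ _ (lf _)) !(lin_sum _ _ _ (lf _)) (linZ _ _ lT) (lin_sum _ _ _ lT); congr (_ *: _).
    by apply: eq_bigr => u _; apply: Tr.
  have Ml : lin M by have l := @lin_rt k H (glavg p g); rewrite /M; lin.
  have MM y : M (M y) = M y by rewrite /M -TG tproj_idem rt_rt glavg_idem.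
  have : ltr M * p%:R = (dimT w Q)%:R.
    rewrite (eq_ltr (g := fun h => 1 * rt (glavg p g * teps w Q) h)) => [|h]; last first.
      by rewrite mul1r -rt_rt -tproj_rt // /M TG.
    have g0T (u : nat) : (0 < u < p)%N -> (g ^+ u) $ (tint w Q) = 0.
      by move=> up; apply/eqP/negPn/negP => gu; apply: no; exists u.
    rewrite ltr_mul_rt // lmn1 // mul1r -ev_rt -tproj_rt // -/(tint w Q) (glavg_ev pp gg gp g1 g0T).
    by rewrite mulrCA mulrAC mulVf // mul1r dimT_tint.
  by rewrite ltr_idem // -natrM => /(natr_inj ch0) <-; apply: dvdn_mull.
have fig : isgl (f ^+ i) by apply: gl_exp.
have [gE xE] := dgl_exp i fg.
have fir : f ^+ i * Chi r = Chi r by elim: (i) => [|j IH]; rewrite ?mul1r // exprS -mulrA IH.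
have giT t : dgl (f ^+ i) $ (T t) = eps (T t).
  rewrite gE -/g; apply: (mulIf gi0); rewrite -gl_ev; last exact: gl_exp.
  by rewrite (@tint_mul _ _ ch0 SS w Q B QB nQB) ?tproj_idem // evZ.
have := eps_twist_trivial fig fir rr _ mr giT; rewrite rp gE xE -/g -/x => /(_ Qp) e.
have zE j : (g ^+ j) $ (x ^+ i) = (g $ x) ^+ (j * i).
  elim: j => [|j IH]; first by rewrite ev1 (proj1 (gl_exp i xg)).
  rewrite exprS ev_mul gl_sw; [|exact: gl_exp|lin|lin]; rewrite IH mulSn exprD; congr (_ * _).
  by elim: (i) => [|l IHl]; rewrite ?gl_ev1 // exprS gl_ev // IHl exprS.
rewrite zE in e.
have zp : (g $ x) ^+ p = 1.
  have := zE p; rewrite gp; have := gl_ev1 gg; rewrite -xp.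
  have gxj j : g $ (x ^+ j) = (g $ x) ^+ j by elim: j => [|j IH]; rewrite ?gl_ev1 // exprS gl_ev // IH exprS.
  by rewrite gxj.
case/negP: gx; apply/eqP.
(* g(x) has p-th power 1 and also (i i)-th power 1, by [eps_twist_trivial] for f^i; so g(x) = 1. *)
have cop : coprime p (i * i).
  rewrite prime_coprime // Euclid_dvdM // orbb; case/andP: ip => i0 ip.
  by apply/negP => /dvdn_leq -/(_ i0); rewrite leqNgt ip.
have [a _] := Bezoutl (i * i) p0; rewrite (eqP cop) => /dvdnP[b eb].
have eb' : (1 + a * (i * i) = b * p)%N by [].
have : (g $ x) ^+ (b * p) = 1 by rewrite mulnC exprM zp expr1n.
by rewrite -eb' exprD expr1 mulnC exprM e expr1n mulr1.
Qed.
End Dagger.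

(** * Central group-like elements as one-dimensional submodules *)

Section CentralGrouplikes.
Variables (k : closedFieldType) (H : hopfType k).
Hypotheses (ch0 : [pchar k] =i pred0) (SS : forall x : H, antipode (antipode x) = x).
Local Notation S := antipode.
Local Notation D := (dbl SS).
Local Notation n := (\dim {:H}).
Let dinv := @double_inv k H SS.
Variable (w : wedd D).
Local Notation E := (@wE _ _ w).
Implicit Types (F G : D) (a b x y z t : H) (r s u : 'I_(wN w)).

Lemma central_dact z F : isgl z -> (forall a, z * a = a * z) -> dact F z = eps (dv F z) *: z.
Proof.
move=> zg zC; have la := @lin_ad k H; have lal := @lin_adl k H.
rewrite /dact gl_sw //; [|by move=> ?; first [apply: la | apply: lin_comp (lal _) (@lin_dv k H SS F)]..].
rewrite /ad (sw_antr (fun y => y * z)) ?mul1r //; last by lin.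
by move=> p q; rewrite -mulrA zC mulrA.
Qed.

(* A one-dimensional D(H)-submodule of H is spanned by a central group-like element. *)
Lemma weight_central y (om : D -> k) : y != 0 -> (forall F, dact F y = om F *: y) ->
  exists z, [/\ isgl z, forall a, z * a = a * z & y = eps y *: z].
Proof.
move=> y0 yE.
have lty psi : lt psi y = om (gj SS psi) *: y by rewrite -(dact_gj SS) yE.
have yy psi : psi $ y = om (gj SS psi) * eps y by have := eps_rt; rewrite -epsZ -lty -ev1 ev_lt mulr1.
have ey : eps y != 0.
  by apply: contraNneq y0 => e0; apply/eqP/ev_sep => psi; rewrite yy e0 mulr0 -(scale0r (0 : H)) evZ mul0r.
pose z := (eps y)^-1 *: y.
have yz : y = eps y *: z by rewrite /z scalerA mulfV // scale1r.
have ez : eps z = 1 by rewrite /z epsZ mulVf.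
have zE psi : psi $ z = om (gj SS psi) by rewrite /z evZ yy mulrC mulfK.
have ltz psi : lt psi z = psi $ z *: z.
  by rewrite zE /z (linZ _ _ (lin_lt psi)) lty !scalerA mulrC.
have zg : isgl z.
  split=> //; apply/matrixP => i j; rewrite comul_coef -ev_lt ltz evZ !ev_dbasis.
  by rewrite ox.unlock mxE.
exists z; split=> // a.
have adz c : ad c z = eps c *: z.
  have e1 : ad c z = om (gi SS c) *: z by rewrite /z (linZ _ _ (lin_ad c)) -(dact_gi SS) yE !scalerA mulrC.
  have e2 : eps (ad c z) = eps c.
    rewrite /ad eps_sw; apply: (sw_cul (fun q => eps q : k^o)) => [p q|]; last by lin.
    by rewrite !epsM ez mulr1 eps_antipode.
  by rewrite e1; congr (_ *: _); rewrite -e2 e1 epsZ ez mulr1.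
rewrite -(ad_comm a z); apply: esym; apply: (sw_cul (fun b => z * b)) => [u v|]; last by lin.
by rewrite adz scalerAl.
Qed.

Lemma deg1_dact r y F : wdeg r = 1%N -> dact (E r r) y = y -> dact F y = chi r F *: y.
Proof.
move=> r1 yE; have sg j : wc j = wc r -> j = r.
  move=> jr; have := card_le1P (_ : (#|[pred j | wc j == wc r]| <= 1)%N); rewrite -/(wdeg r) r1 => /(_ isT r).
  by rewrite inE eqxx => /(_ isT j); rewrite inE jr eqxx => /esym/eqP.
have wr : we r = E r r by rewrite /we (bigD1 r) //= big1 ?addr0 // => j /andP[/eqP/sg -> /negP[]].
have cE : chi r F = wcf r r F by rewrite /chi (bigD1 r) //= big1 ?addr0 // => j /andP[/eqP/sg -> /negP[]].
rewrite -{1}yE -dactM -{1}(wEid (i := r) (j := r)) // -{1}wr mulrA -we_central wr wcfP -cE.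
by rewrite (linZ _ _ (@lin_dactl k H SS _)) yE.
Qed.

Lemma deg1_point r z psi : wdeg r = 1%N -> dact (E r r) z = z -> isgl z -> (forall a, z * a = a * z) ->
  psi $ z = chi r (gj SS psi).
Proof.
move=> r1 ze zg zC; have := congr1 (@eps k H) (deg1_dact (gj SS psi) r1 ze).
by rewrite central_dact // !epsZ (proj1 zg) !mulr1 rk1E epsZ eps1 mulr1.
Qed.

Lemma mult_le1 r : wdeg r = 1%N -> (mult r <= 1)%N /\ (mult r != 0%N ->
  exists z, [/\ isgl z, forall a, z * a = a * z & dact (E r r) z = z]).
Proof.
move=> r1; have ldl := @lin_dactl k H SS; have ld := @lin_dact k H SS.
have om y F : dact (E r r) y = y -> dact F y = chi r F *: y by apply: deg1_dact.
have fixed v : v \in limg (linfun (dact (E r r))) -> dact (E r r) v = v.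
  by case/(lin_limg _ (ld _)) => x ->; rewrite -dactM wEid.
have wt v : v \in limg (linfun (dact (E r r))) -> v != 0 ->
    exists z, [/\ isgl z, forall a, z * a = a * z & v = eps v *: z].
  by move=> vV v0; apply: (weight_central (om := chi r)) => // F; apply: om; apply: fixed.
case: (eqVneq (mult r) 0%N) => [->|m0]; first by split.
have [v vV v0] : exists2 v, v \in limg (linfun (dact (E r r))) & v != 0.
  exists (vpick (limg (linfun (dact (E r r))))); first exact: memv_pick.
  by rewrite vpick0 -dimv_eq0.
have [z [zg zC vz]] := wt v vV v0.
have ev0 : eps v != 0 by apply: contraNneq v0 => e0; rewrite vz e0 scale0r.
have zV : z \in limg (linfun (dact (E r r))).
  have -> : z = (eps v)^-1 *: v by rewrite {2}vz scalerA mulVf // scale1r.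
  exact: memvZ.
split; last by move=> _; exists z; split=> //; apply: fixed.
rewrite /mult -(_ : \dim <[z]> = 1%N); last first.
  by rewrite dim_vline; case: eqP => // z0; have := proj1 zg; rewrite z0 (lin0 (f := eps : H -> k^o)) => [/esym/eqP|]; [rewrite oner_eq0 | lin].
apply: dimvS; apply/subvP => u uV; case: (eqVneq u 0) => [->|u0]; first exact: mem0v.
have [z' [zg' zC' uz]] := wt u uV u0.
suff -> : z = z' by rewrite uz memvZ // memv_line.
have eu0 : eps u != 0 by apply: contraNneq u0 => e0; rewrite uz e0 scale0r.
have zV' : z' \in limg (linfun (dact (E r r))).
  have -> : z' = (eps u)^-1 *: u by rewrite {2}uz scalerA mulVf // scale1r.
  exact: memvZ.
by apply: ev_sep => psi; rewrite !(deg1_point psi r1) //; apply: fixed.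
Qed.

(** A central z spans a submodule on which D acts by F |-> eps (F z), a linear character determining
    z. By [mult_le1] each linear character occurs at most once in H. *)
Lemma central_count : exists (gT : finGroupType) (phi : gT -> H), [/\ injective phi,
  {morph phi : x y / (x * y)%g >-> x * y}, phi 1%g = 1, forall c, isgl (phi c) /\ (forall a, phi c * a = a * phi c)
  & (forall z, isgl z -> (forall a, z * a = a * z) -> exists c, phi c = z) /\ #|gT| = (\sum_(r < wN w | (wc r == r) && (wdeg r == 1%N)) mult r)%N].
Proof.
have [|g h gr hr a|g gg gr a|gT [phi [pi pM p1 pg ps]]] := @gl_group _ H (fun z => forall a, z * a = a * z).
- by move=> a; rewrite mul1r mulr1.
- by rewrite -mulrA hr mulrA gr mulrA.
- by rewrite -[RHS]mul1r -(gl_Smul gg) -[S g * g * _]mulrA (mulrA g) (gr a) -(mulrA a) gl_mulS // mulr1.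
exists gT, phi; split=> //; split=> //.
have ldl := @lin_dactl k H SS.
pose A := [set r : 'I_(wN w) | [&& wc r == r, wdeg r == 1%N & mult r != 0%N]].
have -> : (\sum_(r < wN w | (wc r == r) && (wdeg r == 1%N)) mult r = #|A|)%N.
  rewrite -sum1_card (big_mkcond (fun s => s \in A)) [LHS]big_mkcond; apply: eq_bigr => r _.
  rewrite inE; case: eqP => //= rr; case: eqP => //= r1; have [m1 _] := mult_le1 r1.
  by case: (mult r) m1 => [|[|m]].
have ex c : exists r : 'I_(wN w), [/\ wc r = r, wdeg r = 1%N & dact (E r r) (phi c) = phi c].
  have [cg cC] := pg c.
  have ef F G : eps (dv (F * G) (phi c)) = eps (dv F (phi c)) * eps (dv G (phi c)).
    have := dactM F G (phi c); rewrite (central_dact G cg cC) (linZ _ _ (lin_dact F)) !(central_dact _ cg cC).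
    by move/(congr1 (@eps k H)); rewrite !epsZ (proj1 cg) !mulr1 mulrC.
  have lf : lin (fun F : D => eps (dv F (phi c)) : k^o) by have l := @lin_dvf k H SS (phi c); lin.
  pose f : hdual D := linfun (fun F : D => eps (dv F (phi c)) : k^o).
  have fE F : f $ F = eps (dv F (phi c)) by apply: (ev_linfun (f := fun F : D => eps (dv F (phi c)) : k^o)).
  have fg : isgl f.
    by apply: gl_of_ev => [|F G]; rewrite !fE ?ef // dv1 epsZ eps1 mulr1 (proj1 cg).
  have [|r rr fr] := @norm1_irreducible _ _ w ch0 dinv f (gl_natural w fg).
    by rewrite gl_mulS // ev1 haar_eps.
  exists r; split=> //.
    by have := gl_ev1 fg; rewrite fr ChiE chi1 -[1 in RHS]/(1%:R) => /(natr_inj ch0).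
  by rewrite central_dact // -fE fr Chi_basis_ev // rr eqxx scale1r.
have /fin_all_exists[t tP] := ex.
have -> : A = [set t c | c in [set: gT]].
  apply/setP => r; rewrite inE; apply/and3P/imsetP => [[/eqP rr /eqP r1 mr]|[c _ ->]].
    have [_ /(_ mr)[z [zg zC ze]]] := mult_le1 r1.
    have [c cE] := ps z zg zC; exists c => //; have [tr t1 te] := tP c.
    apply/eqP; apply: contraT => rt_; have := ze; rewrite -cE -te -dactM.
    case: (eqVneq (wc r) (wc (t c))) => [e|e]; first by rewrite -rr -tr e eqxx in rt_.
    have -> : E r r * E (t c) (t c) = 0 by rewrite wEM // (negPf rt_) scale0r.
    rewrite (lin0 (ldl _)) => /esym z0; have := proj1 (pg c) => -[]; rewrite te in z0; rewrite -te te z0.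
    by rewrite (lin0 (f := eps : H -> k^o)) => [/esym/eqP|]; [rewrite oner_eq0 | lin].
  have [tr t1 te] := tP c; rewrite tr t1 !eqxx; split=> //; rewrite /mult dimv_eq0; apply/eqP => l0.
  have := memv_img (linfun (dact (E (t c) (t c)))) (memvf (phi c)); rewrite l0 memv0 (lin_linfun (lin_dact _)) te.
  by move/eqP => z0; have := proj1 (proj1 (pg c)); rewrite z0 (lin0 (f := eps : H -> k^o)) => [/esym/eqP|]; [rewrite oner_eq0 | lin].
rewrite card_imset ?cardsT // => c c' e; apply/pi/ev_sep => psi.
have [tr t1 tc] := tP c; have [_ t1' tc'] := tP c'; have [cg cC] := pg c; have [cg' cC'] := pg c'.
by rewrite (deg1_point psi t1 tc cg cC) (deg1_point psi t1' tc' cg' cC') e.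
Qed.
End CentralGrouplikes.

(** * Dimensions 1, l and l^2 *)

Definition hinv (k : fieldType) (H : hopfType k) := forall x : H, antipode (antipode x) = x.

Lemma sq_dvd_prime d p : prime p -> (d ^ 2 %| p)%N -> d = 1%N.
Proof.
move=> pp dp; have dp' : (d %| p)%N by apply: dvdn_trans dp; rewrite expnS dvdn_mulr.
case/primeP: (pp) => _ /(_ d dp') /orP[/eqP //|/eqP dE].
have : (p ^ 2 %| p ^ 1)%N by rewrite expn1 -{1}dE.
by rewrite dvdn_Pexp2l // prime_gt1.
Qed.

Section SmallDimensions.
Variables (k : closedFieldType).
Hypotheses (ch0 : [pchar k] =i pred0).

Lemma central_prime (H : hopfType k) (SS : hinv H) (gT : finGroupType) (phi : gT -> H) l : prime l -> injective phi ->
    {morph phi : x y / (x * y)%g >-> x * y} -> phi 1%g = 1 ->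
    (forall c, isgl (phi c) /\ (forall a, phi c * a = a * phi c)) -> (l %| #|gT|)%N ->
  exists z : H, [/\ isgl z, z ^+ l = 1, z != 1 & forall a, z * a = a * z].
Proof.
move=> ll pi pM p1 pg ld; have [c [cl c1]] := gl_cauchy ll pi pM p1 ld.
by exists (phi c); have [] := pg c.
Qed.

Lemma double_wedd (H : hopfType k) (SS : hinv H) : exists w : wedd (dbl SS), True.
Proof. exact: wedderburn (inv_semisimple ch0 (@double_inv k H SS)). Qed.

(** Class equation: the degrees other than 1 are multiples of l, so l divides the number of central
    group-like elements. *)
Lemma central_prime_power (H : hopfType k) (SS : hinv H) l a : prime l -> \dim {:H} = (l ^ a.+1)%N ->
  exists z : H, [/\ isgl z, z ^+ l = 1, z != 1 & forall b, z * b = b * z].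
Proof.
move=> ll dH; have [w _] := double_wedd SS.
have [gT [phi [pi pM p1 pg [_ gE]]]] := central_count ch0 w.
apply: (central_prime SS ll pi pM p1 pg).
have : (l %| \dim {:H})%N by rewrite dH expnS dvdn_mulr.
rewrite (dim_mult ch0 w) (bigID (fun r => wdeg r == 1%N)) /= (eq_bigr (fun r => mult r)) => [|r /andP[_ /eqP ->]]; last by rewrite mul1n.
rewrite -gE dvdn_addl // dvdn_sum // => r /andP[_ r1].
have := double_wdeg_dvd ch0 r; rewrite dH => /(dvdn_pfactor _ _ ll)[[|e] _ e1]; first by rewrite e1 in r1.
by rewrite e1 expnS -mulnA dvdn_mulr.
Qed.

Lemma glspan_card (H : hopfType k) (gT : finGroupType) (phi : gT -> H) : injective phi -> {morph phi : x y / (x * y)%g >-> x * y} ->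
  phi 1%g = 1 -> (forall x, isgl (phi x)) -> (\dim {:H} <= #|gT|)%N -> glspan H.
Proof. by move=> pi pM p1 pg d; exists gT, phi; split=> //; apply/eqP; rewrite eqn_leq d (gl_card_le pi pg). Qed.

Lemma glspan_powers (H : hopfType k) l (z : H) : prime l -> \dim {:H} = l -> isgl z -> z ^+ l = 1 -> z != 1 -> glspan H.
Proof.
move=> ll dH zg zl z1; have [|||gT [phi [pi pM p1 pg ps]]] := @gl_powers _ H l z => //.
have phg x : isgl (phi x) by case: (pg x).
apply: (glspan_card pi pM p1 phg); rewrite dH.
have /fin_all_exists[t tE] : forall i : 'I_l, exists x, phi x = z ^+ i by move=> i; apply: ps.
rewrite -[l]card_ord; apply: (@leq_card _ _ t) => i j e; apply: (gl_exp_inj ll zg zl z1).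
by rewrite -!tE e.
Qed.

Lemma glspan_prime (H : hopfType k) l : hinv H -> prime l -> \dim {:H} = l -> glspan H.
Proof.
move=> SS ll dH; have [|z [zg zl z1 _]] := @central_prime_power H SS l 0 ll; first by rewrite expn1.
exact: (glspan_powers ll dH zg zl z1).
Qed.

Lemma glspan_central_ext (H : hopfType k) p (z : H) m : hinv H -> prime p -> \dim {:H} = (p * m)%N -> isgl z -> z ^+ p = 1 -> z != 1 ->
    (forall a, z * a = a * z) -> (forall d, d ^ 2 %| m -> d = 1)%N ->
    (forall K : hopfType k, hinv K -> \dim {:K} = m -> (exists iota : {lrmorphism K -> hdual H}, hopf_morphism iota /\ injective iota /\
       (forall f, (forall h, f $ (z * h) = f $ h) <-> exists x, iota x = f)) -> glspan K) ->
  glspan (hdual H).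
Proof.
move=> SS pp dH zg zp z1 zC sq gK; have [K [iota [ih ii iE dK _]]] := central_quotient ch0 SS pp zg zp z1 zC.
have dm : \dim {:K} = m.
  by apply/eqP; rewrite -(eqn_pmul2r (prime_gt0 pp)) dK dH mulnC.
have KS : hinv K by apply: (hopf_inj_inv ih ii (hdual_inv SS)).
apply: (central_ext_glspan ch0 SS pp zg zp zC ih ii iE); last by rewrite dm.
by apply: gK => //; exists iota.
Qed.

(** The dual has a central group-like element of order l whose quotient has prime dimension; a
    degree whose square divides l is 1. *)
Lemma glspan_prime_sq (H : hopfType k) l : hinv H -> prime l -> \dim {:H} = (l ^ 2)%N -> glspan H.
Proof.
move=> SS ll dH; apply: glspan_bidual.
have [|z [zg zl z1 zC]] := @central_prime_power (hdual H) (hdual_inv SS) l 1 ll; first by rewrite dim_hdual.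
apply: (glspan_central_ext (hdual_inv SS) ll _ zg zl z1 zC (m := l)).
- by rewrite dim_hdual dH mulnn.
- by move=> d; apply: sq_dvd_prime.
by move=> K KS dK _; apply: (glspan_prime KS ll dK).
Qed.

Lemma glspan_one (H : hopfType k) : \dim {:H} = 1%N -> glspan H.
Proof.
move=> d1; have [|||gT [phi [pi pM p1 pg ps]]] := @gl_group _ H (fun=> True) => //.
have phg x : isgl (phi x) by case: (pg x).
by apply: (glspan_card pi pM p1 phg); rewrite d1; apply/card_gt0P; exists 1%g.
Qed.
End SmallDimensions.

(** * Dimensions built from p and q *)

Section TwoPrimes.
Variables (k : closedFieldType) (p q : nat).
Hypotheses (ch0 : [pchar k] =i pred0) (pp : prime p) (qp : prime q) (pq : (p ^ 4 < q)%N).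

Lemma p_lt_q : (p < q)%N.
Proof. by apply: leq_ltn_trans pq; rewrite -{1}[p]expn1 leq_exp2l ?prime_gt1. Qed.
Lemma coprime_pq : coprime p q.
Proof. by rewrite prime_coprime // dvdn_prime2 // neq_ltn p_lt_q. Qed.

Definition Qq : pred nat := fun d => ~~ (q %| d)%N.

Section Degrees.
Variables (H : hopfType k) (SS : hinv H) (w : wedd (dbl SS)) (a b : nat).
Hypotheses (dH : \dim {:H} = (p ^ a * q ^ b)%N) (a2 : (a <= 2)%N).
Implicit Types (r : 'I_(wN w)).

Lemma Qq_dvd r : Qq (wdeg r) -> (wdeg r %| p ^ a)%N.
Proof.
move=> Qr; have := double_wdeg_dvd ch0 r; rewrite dH Gauss_dvdl // coprimeXr //.
by rewrite coprime_sym prime_coprime.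
Qed.
Lemma Qq_one : Qq 1.
Proof. by rewrite /Qq dvdn1 neq_ltn prime_gt1 // orbT. Qed.
Lemma Qq_le r : Qq (wdeg r) -> (wdeg r <= p ^ 2)%N.
Proof.
move=> /Qq_dvd/dvdn_leq; rewrite expn_gt0 prime_gt0 // => /(_ isT)/leq_trans; apply.
by rewrite leq_exp2l ?prime_gt1.
Qed.
Lemma Qq_gt r : ~~ Qq (wdeg r) -> (p ^ 2 * p ^ 2 < wdeg r)%N.
Proof.
rewrite negbK => /dvdn_leq; rewrite wdeg_gt0 -expnD => /(_ isT); apply: leq_trans.
exact: pq.
Qed.
Lemma Qq_small r : (wdeg r <= p ^ 2)%N -> Qq (wdeg r).
Proof.
move=> lp; apply/negP => /dvdn_leq; rewrite wdeg_gt0 => /(_ isT) /leq_trans/(_ lp).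
rewrite leqNgt => /negP; apply; apply: leq_ltn_trans pq.
by rewrite leq_exp2l // (prime_gt1 pp).
Qed.

Lemma dimT_dvd : (0 < b)%N -> (q %| dimT w Qq)%N.
Proof.
move=> b0; have : (q %| \dim {:H})%N by rewrite dH dvdn_mull // dvdn_exp.
rewrite (dim_mult ch0 w) (bigID (fun r => Qq (wdeg r))) /= dvdn_addl // dvdn_sum // => r /andP[_].
by rewrite negbK => qr; apply: dvdn_mulr.
Qed.

(** Degrees prime to q and different from 1 are multiples of p, so modulo p only the linear part of
    T counts. *)
Lemma dimT_central (gT : finGroupType) : #|gT| = (\sum_(r < wN w | (wc r == r) && (wdeg r == 1%N)) mult r)%N ->
  (p %| dimT w Qq)%N = (p %| #|gT|)%N /\ (#|gT| = dimT w Qq \/ exists r, [/\ wc r = r, wdeg r != 1%N, Qq (wdeg r) & mult r != 0%N]).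
Proof.
move=> ->; rewrite /dimT (bigID (fun r => wdeg r == 1%N)) /=.
have e : (\sum_(r < wN w | (wc r == r) && Qq (wdeg r) && (wdeg r == 1%N)) wdeg r * mult r =
    \sum_(r < wN w | (wc r == r) && (wdeg r == 1%N)) mult r)%N.
  apply: eq_big => [r|r /andP[_ /eqP ->]]; last by rewrite mul1n.
  by rewrite -andbA; congr (_ && _); case: eqP => [->|]; rewrite ?Qq_one ?andbF.
rewrite e; split.
  rewrite dvdn_addl // dvdn_sum // => r /andP[/andP[_ Qr] r1].
  have := Qq_dvd Qr => /(dvdn_pfactor _ _ pp)[[|c] _ e1]; first by rewrite e1 in r1.
  by rewrite e1 expnS -mulnA dvdn_mulr.
have [r /andP[/andP[/andP[/eqP rr Qr] r1] mr]|no] := pickP (fun r => (wc r == r) && Qq (wdeg r) && (wdeg r != 1%N) && (mult r != 0%N)).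
  by right; exists r.
left; rewrite [X in (_ + X)%N]big1 ?addn0 // => r re.
by have := no r; rewrite re /= => /negbFE/eqP ->; rewrite muln0.
Qed.

(** If p does not divide dim T, then dim T = q^e with e > 0, and c is b - e. *)
Lemma prime_part_cases : (0 < b)%N ->
  (exists z : H, [/\ isgl z, z ^+ p = 1, z != 1 & forall x, z * x = x * z]) \/
  (exists (K : hopfType k) (iota : {lrmorphism K -> hdual H}) (c : nat),
     [/\ hopf_morphism iota, injective iota, (c < b)%N & \dim {:K} = (p ^ a * q ^ c)%N]).
Proof.
move=> b0; have [gT [phi [pi pM p1 pg [_ gE]]]] := central_count ch0 w.
have [pE _] := dimT_central gE; case: (boolP (p %| dimT w Qq)%N) => pT.
  by left; apply: (central_prime SS pp pi pM p1 pg); rewrite -pE.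
right; have [K [iota [ih ii dK]]] := tproj_subhopf ch0 Qq_one Qq_le Qq_gt.
have : (dimT w Qq %| p ^ a * q ^ b)%N by rewrite -dH -dK dvdn_mull.
rewrite Gauss_dvdr ?coprimeXr //; last by rewrite coprime_sym prime_coprime.
case/(dvdn_pfactor _ _ qp) => e eb dT.
have e0 : (0 < e)%N.
  by have := dimT_dvd b0; rewrite dT; case: (e) => //; rewrite expn0 dvdn1 => /eqP q1; have := prime_gt1 qp; rewrite q1.
exists K, iota, (b - e)%N; split=> //; first by rewrite ltn_subrL b0 e0.
apply/eqP; rewrite -(eqn_pmul2r (_ : 0 < q ^ e)%N) ?expn_gt0 ?prime_gt0 // -{1}dT dK dH -mulnA -expnD subnK //.
Qed.
End Degrees.

Lemma us_prime_part b (H : hopfType k) : hinv H -> (b <= 2)%N -> \dim {:H} = (q ^ b)%N -> upper_semisolvable H.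
Proof.
move=> SS b2 dH; apply/us_trivial/glspan_trivial; case: b b2 dH => [|[|[|b]]] // _ dH.
- exact: glspan_one.
- exact: (glspan_prime ch0 SS qp).
- exact: (glspan_prime_sq ch0 SS qp).
Qed.

(** If 1 is the only central group-like element, the linear part of T has dimension 1 while q
    divides dim T. So T has a component of degree p, the input of [central_character_ex]. *)
Lemma central_or_character (H : hopfType k) (SS : hinv H) b : (0 < b)%N -> \dim {:H} = (p * q ^ b)%N ->
  (exists l (z : H), [/\ prime l, isgl z, z ^+ l = 1, z != 1 & forall x, z * x = x * z]) \/
  (exists g : hdual H, [/\ isgl g, g ^+ p = 1, g != 1 & forall phi, phi * g = g * phi]).
Proof.
move=> b0 dH; have [w _] := double_wedd ch0 SS; have dH' : \dim {:H} = (p ^ 1 * q ^ b)%N by rewrite expn1.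
have [gT [phi [pi pM p1 pg [ps gE]]]] := central_count ch0 w.
case: (eqVneq #|gT| 1%N) => [g1|g1].
  right; have [pE [dE|[r [rr r1 Qr mr]]]] := dimT_central dH' gE.
    have := dimT_dvd w dH' b0; rewrite -dE g1 dvdn1 => /eqP q1.
    by move: qp; rewrite q1.
  have rp : wdeg r = p.
    have := Qq_dvd dH' Qr; rewrite expn1; case/primeP: pp => _ prp /prp.
    by rewrite (negPf r1) => /eqP.
  have le12 : (1 <= 2)%N by [].
  apply: (@central_character_ex _ _ ch0 SS w Qq (p ^ 2)%N (Qq_le dH' le12) (@Qq_gt H SS w) p (q ^ b) r pp dH _ _ _ _ rr rp _ mr).
  - by rewrite -prime_coprime // coprimeXr // coprime_pq.
  - by rewrite pE g1 dvdn1 neq_ltn prime_gt1 // orbT.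
  - move=> z zg zC; have [c <-] := ps z zg zC; rewrite -p1; congr phi.
    have /card_le1P c1 : (#|gT| <= 1)%N by rewrite g1.
    by apply/eqP; have := c1 (1%g : gT) isT c; rewrite inE /= => /esym.
  - move=> s sl; have := Qq_dvd dH' (Qq_small sl); rewrite expn1; case/primeP: pp => _ prp /prp.
    by case/orP=> /eqP; [left | right].
  by rewrite -rp.
left; have g2 : (1 < #|gT|)%N.
  by rewrite ltn_neqAle eq_sym g1; apply/card_gt0P; exists 1%g.
have [z zP] := central_prime SS (pdiv_prime g2) pi pM p1 pg (pdiv_dvd _).
by exists (pdiv #|gT|), z; case: zP => *; split=> //; apply: pdiv_prime.
Qed.

(** Induction on b. A central z of prime order leads to a quotient of dimension q^b or p q^(b-1); a
    central character of order p has coinvariants of dimension q^b, a group algebra because b is at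
    most 2. *)
Lemma us_p_qb b (H : hopfType k) : hinv H -> (b <= 2)%N -> \dim {:H} = (p * q ^ b)%N -> upper_semisolvable H.
Proof.
elim: b H => [|b IH] H SS b2 dH.
  by apply/us_trivial/glspan_trivial; apply: (glspan_prime ch0 SS pp); rewrite dH expn0 muln1.
have [[l [z [ll zg zl z1 zC]]]|[g [gg gp g1 gC]]] := central_or_character SS (ltn0Sn b) dH.
  have [K [iota [ih ii _ dK us]]] := central_quotient ch0 SS ll zg zl z1 zC.
  have KS : hinv K by apply: (hopf_inj_inv ih ii (hdual_inv SS)).
  apply: us; have lpq : (l %| p * q ^ b.+1)%N by rewrite -dH -dK dvdn_mull.
  have KdS : hinv (hdual K) by apply: hdual_inv.
  have l0 := prime_gt0 ll.
  case: (eqVneq l p) => [lp|lp].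
    apply: (us_prime_part KdS b2); rewrite dim_hdual; apply/eqP.
    by rewrite -(eqn_pmul2r l0) dK dH lp mulnC.
  have lq : l = q.
    move: lpq; rewrite Gauss_dvdr; last by rewrite prime_coprime // dvdn_prime2.
    by rewrite Euclid_dvdX // dvdn_prime2 // => /andP[/eqP].
  apply: (IH _ KdS (ltnW b2)); rewrite dim_hdual; apply/eqP.
  by rewrite -(eqn_pmul2r l0) dK dH lq -mulnA -expnSr.
have [N [iota [ih ii _ dN us]]] := central_character ch0 SS pp gg gp g1 gC.
have NS : hinv N by apply: (hopf_inj_inv ih ii SS).
apply: us; apply: glspan_trivial; have dN' : \dim {:N} = (q ^ b.+1)%N.
  by apply/eqP; rewrite -(eqn_pmul2r (prime_gt0 pp)) dN dH mulnC.
case: b b2 dN' {IH dH} => [|[|b]] // _ dN'; first exact: (glspan_prime ch0 NS qp).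
exact: (glspan_prime_sq ch0 NS qp).
Qed.
End TwoPrimes.

(** * An automorphism of prime order with scalar fixed points *)

Section CyclicAutomorphism.
Variables (k : closedFieldType) (A : falgType k) (q : nat) (al : A -> A) (e : A) (lam : A -> k^o).
Hypotheses (ch0 : [pchar k] =i pred0) (qp : prime q).
Hypotheses (al_lin : lin al) (al_M : forall a b, al (a * b) = al a * al b) (al_q : forall a, iter q al a = a).
Hypotheses (ee : e * e = e) (eC : forall a, e * a = a * e) (al_1 : al 1 = 1) (ale : al e = e).
Hypotheses (lam_lin : lin lam) (lam_al : forall a, lam (al a) = lam a).
Hypothesis lam_nd : forall a, (forall b, lam (b * a) = 0) -> a = 0.
Hypothesis fixed : forall y, y * e = y -> al y = y -> exists c, y = c *: e.
Hypothesis central : forall y, y * e = y -> (forall a, y * a = a * y) -> exists c, y = c *: e.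

(** Unnormalized projection onto the eigenvalue 1/w of [al]; [sum_proj] accounts for the missing
    factor q. *)
Let proj (w : k) m := \sum_(l < q) w ^+ l *: iter l al m.

Let iter_M l a b : iter l al (a * b) = iter l al a * iter l al b.
Proof. by elim: l => //= l ->. Qed.
Let iter_e l : iter l al e = e.
Proof. by elim: l => //= l ->. Qed.
Let iter_lam l a : lam (iter l al a) = lam a.
Proof. by elim: l => //= l IH; rewrite lam_al. Qed.

Let al_proj w m : w ^+ q = 1 -> w *: al (proj w m) = proj w m.
Proof.
move=> wq; pose F l := w ^+ l *: iter l al m.
have -> : w *: al (proj w m) = \sum_(l < q) F l.+1.
  rewrite /proj (lin_sum _ _ _ al_lin) scaler_sumr; apply: eq_bigr => l _.
  by rewrite (linZ _ _ al_lin) scalerA -exprS.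
have e1 : \sum_(0 <= l < q.+1) F l = F 0%N + \sum_(0 <= l < q) F l.+1 by rewrite big_nat_recl.
have e2 : \sum_(0 <= l < q.+1) F l = \sum_(0 <= l < q) F l + F q by rewrite big_nat_recr.
have Fq : F q = F 0%N by rewrite /F wq al_q expr0.
rewrite -(big_mkord xpredT (fun l => F l.+1)) /proj -(big_mkord xpredT F).
by apply: (addrI (F 0%N)); rewrite -e1 e2 Fq addrC.
Qed.

Let proj_e w m : m * e = m -> proj w m * e = proj w m.
Proof.
move=> me; rewrite /proj mulr_suml; apply: eq_bigr => l _.
by rewrite -scalerAl -{2}me iter_M iter_e.
Qed.

Let sum_proj w m : w != 1 -> w ^+ q = 1 -> \sum_(j < q) proj (w ^+ j) m = q%:R *: m.
Proof.
move=> w1 wq; rewrite exchange_big /=; have q0 := prime_gt0 qp.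
rewrite (bigD1 (Ordinal q0)) //= [X in _ + X]big1 ?addr0 => [|l l0].
  by rewrite (eq_bigr (fun=> m)) => [|j _]; rewrite ?expr0 ?scale1r // sumr_const card_ord scaler_nat.
rewrite -scaler_suml (eq_bigr (fun j : 'I_q => (w ^+ l) ^+ j)) => [|j _]; last by rewrite exprAC.
have [d dw dq] := prim_order_exists q0 wq.
have wl : w ^+ l != 1.
  have dE : d = q.
    case/primeP: qp => _ /(_ _ dq) /orP[|] /eqP // d1.
    by move: w1; rewrite -(prim_expr_order dw) d1 expr1 eqxx.
  rewrite -(prim_order_dvd dw) dE; apply/negP => /dvdn_leq.
  move=> h; case: (posnP l) => [l1|l1]; last by have := h l1; rewrite leqNgt ltn_ord.
  by case/negP: l0; apply/eqP/val_inj.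
have := subrX1 (w ^+ l) q; rewrite exprAC wq expr1n subrr => /esym/eqP.
by rewrite mulf_eq0 subr_eq0 (negPf wl) /= => /eqP ->; rewrite scale0r.
Qed.

(* A nonzero eigenvector y is invertible in the corner of e and generates all eigenspaces, so it is central, hence fixed. *)
Let eigen_zero w y : w != 1 -> w ^+ q = 1 -> y * e = y -> al y = w *: y -> y = 0.
Proof.
move=> w1 wq ye ay; have ey : e * y = y by rewrite eC.
apply: lam_nd => t; case: (eqVneq (lam (t * y)) 0) => // ty.
have y0 : y != 0 by apply: contraNneq ty => ->; rewrite mulr0 (lin0 lam_lin).
have it_y l : iter l al y = w ^+ l *: y.
  by elim: l => [|l IH]; rewrite ?expr0 ?scale1r //= IH (linZ _ _ al_lin) ay scalerA -exprSr.
pose u := proj w t * e; have ue : u * e = u by rewrite -mulrA ee.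
have au : w *: al u = u by rewrite al_M ale scalerAl al_proj.
have uyE : u * y = \sum_(l < q) iter l al (t * y).
  rewrite -mulrA ey mulr_suml; apply: eq_bigr => l _.
  by rewrite iter_M it_y -scalerAr -scalerAl.
have [||c uy] := @fixed (u * y).
- by rewrite -mulrA ye.
- by rewrite al_M ay -scalerAr scalerAl au.
have c0 : c != 0.
  apply: contraNneq ty => c0; have : lam (u * y) = q%:R * lam (t * y).
    rewrite uyE (lin_sum _ _ _ lam_lin) (eq_bigr (fun=> lam (t * y))) => [|l _]; last exact: iter_lam.
    by rewrite sumr_const card_ord mulr_natl.
  rewrite uy c0 scale0r (lin0 lam_lin) => /esym/eqP; rewrite mulf_eq0 => /orP[|//].
  by rewrite (proj1 (pcharf0P _) ch0) => /eqP q0; move: (prime_gt0 qp); rewrite q0.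
have [||c' yu] := @fixed (y * u).
- by rewrite -mulrA ue.
- by rewrite al_M ay -scalerAl scalerAr au.
have cc : c' = c.
  have : c' *: y = c *: y by rewrite -{1}ey scalerAl -yu -mulrA uy -scalerAr ye.
  by move/eqP; rewrite -subr_eq0 -scalerBl scaler_eq0 (negPf y0) orbF subr_eq0 => /eqP.
have yuy : y * u = u * y by rewrite yu uy cc.
have pow l : y ^+ l * u ^+ l * e = c ^+ l *: e.
  elim: l => [|l IH]; first by rewrite !expr0 scale1r !mul1r.
  rewrite exprSr exprS mulrA -(mulrA (y ^+ l)) yu cc -scalerAr -scalerAl -mulrA -scalerAl.
  rewrite -[_ * _ * e]mulrA -[e * _ * e]mulrA [e * (_ * e)]eC -[_ * e * e]mulrA ee mulrA.
  by rewrite IH scalerA -exprS.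
have comm m l : m * e = m -> y * proj (w ^+ l) m = proj (w ^+ l) m * y.
  move=> me; set M := proj _ _; have Me : M * e = M by apply: proj_e.
  have aM : w ^+ l *: al M = M by apply: al_proj; rewrite exprAC wq expr1n.
  have [||d My] := @fixed (M * y ^+ l * e).
  - by rewrite -(mulrA _ e e) ee.
  - rewrite !al_M ale; congr (_ * _); rewrite -{2}aM -scalerAl scalerAr; congr (_ * _).
    elim: (l) => [|l' IH]; last by rewrite exprS al_M IH ay (exprS w) -scalerAl -scalerAr scalerA.
    by rewrite !expr0 scale1r al_1.
  have : M * y ^+ l * e * u ^+ l = c ^+ l *: M.
    by rewrite -mulrA eC -!mulrA [y ^+ l * _]mulrA pow -scalerAr Me.
  rewrite My -scalerAl => /esym ME.
  have cl : c ^+ l != 0 by apply: expf_neq0.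
  have -> : M = (c ^+ l)^-1 *: (d *: (e * u ^+ l)) by rewrite -ME scalerA mulVf // scale1r.
  rewrite -!scalerAr -!scalerAl; congr (_ *: (_ *: _)).
  rewrite mulrA -eC -!mulrA; congr (_ * _).
  by apply: commrX; rewrite /GRing.comm.
have yC a : y * a = a * y.
  have ae : (a * e) * e = a * e by rewrite -mulrA ee.
  suff h : y * (a * e) = (a * e) * y by rewrite -{1}ye -mulrA eC h -mulrA ey.
  have q0 : q%:R != 0 :> k by rewrite (proj1 (pcharf0P _) ch0) -lt0n prime_gt0.
  apply: (scalerI q0); rewrite [LHS]scalerAr [RHS]scalerAl -(sum_proj (a * e) w1 wq) mulr_sumr mulr_suml.
  by apply: eq_bigr => j _; apply: comm.
have [d yd] := central ye yC.
have : w *: y = y by rewrite -ay yd (linZ _ _ al_lin) ale.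
move/eqP; rewrite -{2}(scale1r y) -subr_eq0 -scalerBl scaler_eq0 (negPf y0) orbF subr_eq0 (negPf w1).
by [].
Qed.

(** Split y into eigencomponents: [eigen_zero] kills the nontrivial ones, and the fixed one is
    scalar by hypothesis. *)
Lemma cyclic_automorphism_scalar y : y * e = y -> exists c, y = c *: e.
Proof.
move=> ye; have [w pw] := closed_prim_root ch0 (prime_gt0 qp); have wq := prim_expr_order pw.
have w1 : w != 1.
  by apply: contraTneq qp => w1; move: (prim_order_dvd pw 1); rewrite expr1 w1 eqxx dvdn1 => /eqP ->.
have q0 : q%:R != 0 :> k by rewrite (proj1 (pcharf0P _) ch0) -lt0n prime_gt0.
have pe j : proj (w ^+ j) y * e = proj (w ^+ j) y by apply: proj_e.
have aj j : w ^+ j *: al (proj (w ^+ j) y) = proj (w ^+ j) y by apply: al_proj; rewrite exprAC wq expr1n.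
have [|c pc] := fixed (pe 0%N); first by rewrite -{2}(aj 0%N) expr0 scale1r.
exists (q%:R^-1 * c); apply: (scalerI q0); rewrite scalerA mulrA mulfV // mul1r.
rewrite -(sum_proj y w1 wq) (bigD1 (Ordinal (prime_gt0 qp))) //= pc big1 ?addr0 // => j j0.
have w0 : w != 0.
  by apply: contraTneq (oner_neq0 k) => w0; rewrite negbK -wq w0 expr0n eqn0Ngt prime_gt0.
have wj0 : w ^+ j != 0 by apply: expf_neq0.
have wj : w ^+ j != 1.
  rewrite -(prim_order_dvd pw); apply: contra j0 => /dvdnP[[|d] jd]; first by apply/eqP/val_inj.
  by have := ltn_ord j; rewrite jd mulSn ltnNge leq_addr.
apply: (eigen_zero (w := (w ^+ j)^-1)) => //; first by rewrite invr_eq1.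
  by rewrite exprVn exprAC wq expr1n invr1.
by rewrite -{2}(aj j) scalerA mulVf // scale1r.
Qed.
End CyclicAutomorphism.

(** * The adjoint action on a block *)

Section BlockStabilizer.
Variables (k : closedFieldType) (H : hopfType k).
Hypotheses (ch0 : [pchar k] =i pred0) (SS : forall x : H, antipode (antipode x) = x).
Local Notation S := antipode.
Local Notation L := (haar H).

Lemma ltM (f : hdual H) x y : isgl f -> lt f (x * y) = lt f x * lt f y.
Proof.
move=> fg; rewrite /lt swM; [|lin|lin]; rewrite sw_mulr; apply: eq_sw => a b.
rewrite sw_mull; apply: eq_sw => c d.
by rewrite gl_ev // -scalerAl -scalerAr scalerA mulrC.
Qed.
Lemma lt_1 (h : H) : lt 1 h = h.
Proof. by rewrite /lt; apply: (sw_cul (fun x => x)) => // a b; rewrite ev1. Qed.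

(** [rt u] is multiplicative, so b can be moved under it as rt (S u) b, where L absorbs it. *)
Lemma ad_rt_haar (u : hdual H) y b : isgl u -> ad b (ad (rt u L) y) = (S u $ b) *: ad (rt u L) y.
Proof.
move=> ug; have e c : ad (rt u c) (ad (rt u L) y) = eps c *: ad (rt u L) y.
  by rewrite -adM -rtM // (haar_l SS c) (linZ _ _ (lin_rt u)) (linZ _ _ (lin_adl y)).
by have := e (rt (S u) b); rewrite rt_rt eps_rt (gl_mulS ug) rt1.
Qed.

Lemma ad_eigen_comm (v : hdual H) y b : (forall a, ad a y = v $ a *: y) -> b * y = y * lt v b.
Proof.
move=> vy; rewrite -ad_comm /lt sw_mull; apply: eq_sw => a c.
by rewrite vy -scalerAl -scalerAr.
Qed.

Variable w : wedd H.
Implicit Types (r : 'I_(wN w)).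

Lemma central_we r z : (forall a, z * a = a * z) -> z * we r = wcf r r z *: we r.
Proof.
move=> zC; rewrite /we mulr_sumr scaler_sumr; apply: eq_bigr => j /eqP jr.
by rewrite -(central_wE zC jr) -wcfP -zC -mulrA wEid.
Qed.

(** From b y = y lt_v(b) with b the block idempotent E, the central idempotent lt_v(E) acts on y as
    1, hence contains E. The same for S v gives the reverse inclusion. *)
Lemma ad_eigen_block (v : hdual H) r y : isgl v -> (forall b, ad b y = v $ b *: y) -> y * we r = y -> y != 0 ->
  lt v (we r) = we r.
Proof.
move=> vg vy yE y0; set E := we r; have com b := ad_eigen_comm b vy.
have EC b : E * b = b * E by apply: we_central.
have Ey : E * y = y by rewrite EC.
have ltK b : lt v (lt (S v) b) = b by rewrite lt_lt (gl_Smul vg) lt_1.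
have ltK' b : lt (S v) (lt v b) = b by rewrite lt_lt (gl_mulS vg) lt_1.
have Svg : isgl (S v) by apply: gl_antipode.
have scal z t : t *: y = z -> z = y -> t = 1.
  move=> <- /eqP; rewrite -{2}(scale1r y) -subr_eq0 -scalerBl scaler_eq0 (negPf y0) orbF subr_eq0.
  by move/eqP.
have c1C a : lt v E * a = a * lt v E by rewrite -(ltK a) -!ltM // EC.
have c2C a : lt (S v) E * a = a * lt (S v) E by rewrite -(ltK' a) -!ltM // EC.
have e1 : lt v E * E = E.
  rewrite (central_we r c1C); suff -> : wcf r r (lt v E) = 1 by rewrite scale1r.
  apply: (scal (lt v E * y)); last by rewrite c1C -com.
  by rewrite -{2}Ey mulrA (central_we r c1C) -scalerAl Ey.
have e2 : lt (S v) E * E = E.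
  rewrite (central_we r c2C); suff -> : wcf r r (lt (S v) E) = 1 by rewrite scale1r.
  apply: (scal (lt (S v) E * y)); last by rewrite com ltK -EC.
  by rewrite -{2}Ey mulrA (central_we r c2C) -scalerAl Ey.
by rewrite -{2}e1 -{1}e2 ltM // ltK EC.
Qed.

Lemma rho_we r : wc r = r -> rho (we r) = (wdeg r ^ 2)%:R.
Proof.
move=> rr; rewrite /rho (@ltr_mul _ _ w) (bigD1 r) ?rr //= chi_we eqxx -natrM mulnn big1 ?addr0 // => s /andP[/eqP ss sr].
by rewrite chi_we ss rr (negPf sr) mul0r.
Qed.

(** Left multiplication by e commutes with translation by the average of the powers of u; the
    product is idempotent of trace rho(e) / p. *)
Lemma rt_fixed_dvd p (u : hdual H) e m : prime p -> isgl u -> u ^+ p = 1 -> u != 1 -> e * e = e -> rt u e = e ->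
  rho e = m%:R -> (p %| m)%N.
Proof.
move=> pp ug up u1 ee ue em; have p0 : p%:R != 0 :> k by rewrite (proj1 (pcharf0P _) ch0) -lt0n prime_gt0.
set P := glavg p u; have lf h := @lin_rtf k H h; have lr f := @lin_rt k H f.
have ui i : rt (u ^+ i) e = e by elim: i => [|i IH]; rewrite ?expr0 ?rt1 // exprS -rt_rt IH.
have rP h : rt P h = p%:R^-1 *: \sum_(i < p) rt (u ^+ i) h by rewrite /P /glavg (linZ _ _ (lf h)) (lin_sum _ _ _ (lf h)).
have Pe h : rt P (e * h) = e * rt P h.
  rewrite !rP -scalerAr mulr_sumr; congr (_ *: _); apply: eq_bigr => i _.
  by rewrite rtM ?ui //; apply: gl_exp.
have := ltr_mul_rt ch0 SS e P; rewrite mulrA -rho_lmn // em.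
rewrite (@glavg_fun _ _ _ _ pp k^o (fun f : hdual H => f $ L : k^o)) ?ev1 ?haar_eps //; last first.
- by move=> i i0; apply: (gl_haar SS); [apply: gl_exp | apply: (gl_exp_neq1 pp)].
- by lin.
rewrite ltr_idem; last first.
- by move=> h; rewrite Pe mulrA ee rt_rt (glavg_idem ch0 pp up).
- by lin.
set t := \dim _ => te; apply/dvdnP; exists t; apply: (natr_inj ch0).
by rewrite natrM te -mulrA -[_ *: _]/(_ * _) mulr1 mulVf // mulr1.
Qed.

Lemma lt_fixed_dvd p (u : hdual H) r : prime p -> isgl u -> u ^+ p = 1 -> u != 1 -> wc r = r ->
  lt (S u) (we r) = we r -> (p %| wdeg r)%N.
Proof.
move=> pp ug up u1 rr ur; suff : (p %| wdeg r ^ 2)%N by rewrite Euclid_dvdX // => /andP[].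
apply: (@rt_fixed_dvd p u (S (we r))) => //.
- by rewrite -antipodeM we_idem.
- have ls : lin (S : H -> H) by apply: (lin_antipode (@lin_id k H)).
  rewrite -{2}ur /rt sw_antipode; [|lin|lin]; rewrite /lt (sw_lin _ _ ls); apply: eq_sw => a b.
  by rewrite (linZ _ _ ls) ev_antipode.
by rewrite rho_lmn // lmn_antipode // -rho_lmn // rho_we.
Qed.

(** Expand the average in powers of u. For i prime to p the term at u^i is an adjoint eigenvector in
    the block, hence 0 as p would otherwise divide the degree; the term at 1 is central, hence
    scalar on the block. *)
Lemma block_fixed_scalar p (u : hdual H) r y c : prime p -> isgl u -> u ^+ p = 1 -> u != 1 -> wc r = r ->
    ~~ (p %| wdeg r)%N -> y * we r = y -> c != 0 -> ad (rt (glavg p u) L) y = c *: y ->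
  exists d, y = d *: we r.
Proof.
move=> pp ug up u1 rr pr yE c0 yc.
have p0 : p%:R != 0 :> k by rewrite (proj1 (pcharf0P _) ch0) -lt0n prime_gt0.
have adE x : ad x y * we r = ad x y.
  rewrite /ad sw_mulr; apply: eq_sw => a b.
  have -> : a * y * S b * we r = a * (y * we r) * S b by rewrite -!mulrA we_central.
  by rewrite yE.
have lf : lin (fun f : hdual H => ad (rt f L) y).
  move=> t f g; have -> : rt (t *: f + g) L = t *: rt f L + rt g L by apply: (@lin_rtf k H L).
  exact: (@lin_adl k H y).
move: yc; rewrite (glavg_fun pp lf) => [|i ip]; last first.
  have uig : isgl (u ^+ i) by apply: gl_exp.
  apply/eqP; apply: contraNT pr => w0; apply: (@lt_fixed_dvd p (u ^+ i)) => //.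
  - by rewrite exprAC up expr1n.
  - exact: (gl_exp_neq1 pp).
  - by apply: (ad_eigen_block _ _ (adE (rt (u ^+ i) L))) => //; [apply: gl_antipode | move=> b; apply: ad_rt_haar].
set v := ad _ _ => vy; have vC b : v * b = b * v.
  have g1 := @gl_one k (hdual H).
  have hv a : ad a v = S 1 $ a *: v by apply: ad_rt_haar.
  by rewrite (ad_eigen_comm b hv) antipode1 lt_1.
have := central_we r vC; rewrite /v adE -/v => vE.
exists (c^-1 * (p%:R^-1 * wcf r r v)).
by rewrite -!scalerA -vE vy scalerA mulVf // scale1r.
Qed.
End BlockStabilizer.

(** * Blocks of a central extension *)

Section CentralBlock.
Variables (k : closedFieldType) (H : hopfType k).
Hypotheses (ch0 : [pchar k] =i pred0) (SS : forall x : H, antipode (antipode x) = x).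
Variables (z : H) (K : hopfType k) (iota : {lrmorphism K -> hdual H}).
Hypotheses (zg : isgl z) (zC : forall a, z * a = a * z) (ih : hopf_morphism iota) (ii : injective iota).
Hypothesis iE : forall f, (forall h, f $ (z * h) = f $ h) <-> exists x, iota x = f.
Local Notation S := antipode.
Local Notation L := (haar H).

Let pi : {lrmorphism H -> hdual K} := lrpack (dquot_linear iota) (dquot_monoid ih).
Let piE a x : pi a $ x = iota x $ a.
Proof. exact: dquotE. Qed.
Let pil : lin pi. Proof. exact: lin_linear. Qed.
Let sec (b : hdual K) : H := ((linfun pi)^-1)%VF b.
Let secK b : pi (sec b) = b.
Proof.
rewrite -(lin_linfun pil) /sec limg_lfunVK //; have [a <-] := dquot_surj ii b.
by rewrite -[dquot _ _]/(pi a) -(lin_linfun pil) memv_img ?memvf.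
Qed.
Let sec_lin : lin sec. Proof. by move=> c a b; rewrite /sec linearP. Qed.

Let ad_central a y : ad (z * a) y = ad a y.
Proof.
by rewrite adM {1}/ad gl_sw //; [rewrite zC -mulrA gl_mulS // mulr1 | lin | lin].
Qed.

(* Conjugation by a central element is trivial, so the adjoint action factors through the quotient by z. *)
Let ad_pi a a' y : pi a = pi a' -> ad a y = ad a' y.
Proof.
move=> e; apply: ev_sep => F; have ladl := @lin_adl k H y.
have lF : lin (fun a => F $ (ad a y) : k^o) by apply: lin_ev.
have fE b : linfun (fun a => F $ (ad a y) : k^o) $ b = F $ (ad b y) by apply: ev_linfun.
have [x xE] : exists x, iota x = linfun (fun a => F $ (ad a y) : k^o).
  by apply/iE => h; rewrite !fE ad_central.
by rewrite -!fE -xE -!piE e.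
Qed.

Let act b y := ad (sec b) y.
Let act_pi a y : act (pi a) y = ad a y.
Proof. by apply: ad_pi; rewrite secK. Qed.
Let act_linl y : lin (act^~ y).
Proof. by move=> c a b; rewrite /act sec_lin; apply: (@lin_adl k H y). Qed.
Let act_lin b : lin (act b).
Proof. exact: lin_ad. Qed.
Let act_M b c y : act (b * c) y = act b (act c y).
Proof. by rewrite -{1}(secK b) -{1}(secK c) -rmorphM act_pi adM. Qed.
Let act_one y : act 1 y = y.
Proof. by rewrite -(rmorph1 pi) act_pi ad1. Qed.
Let eps_pi a : eps (pi a) = eps a.
Proof. by have [_ pe _] := dquot_hopf ih; rewrite -[LHS]/(counit _) -[pi _]/(dquot iota _) pe. Qed.
Let eps_sec b : eps (sec b) = eps b.
Proof. by rewrite -eps_pi secK. Qed.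
Let sw_pi (X : lmodType k) (F : hdual K -> hdual K -> X) a :
    (forall u, lin (fun v => F u v)) -> (forall v, lin (fun u => F u v)) ->
  sw (pi a) F = sw a (fun u v => F (pi u) (pi v)).
Proof.
have [pc _ _] := dquot_hopf ih; move=> F1 F2; rewrite /sw -[pi a]/(dquot iota a) pc.
exact: (tlift_tmap pi pi _ (lin2_bilinear F1 F2)).
Qed.
Let act_gl x y y' : isgl x -> act x (y * y') = act x y * act x y'.
Proof.
move=> xg; rewrite /act ad_mul; have l1 := act_linl y; have l2 := act_linl y'.
have F1 u : lin (fun v => act u y * act v y').
  by move=> t a b; rewrite l2 mulrDr -scalerAr.
have F2 v : lin (fun u => act u y * act v y').
  by move=> t a b; rewrite l1 mulrDl -scalerAl.
rewrite -[RHS](gl_sw (F := fun u v => act u y * act v y')) // -{2}(secK x) (sw_pi _ F1 F2).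
by apply: eq_sw => a b; rewrite !act_pi.
Qed.

Variables (p q : nat) (x : hdual K) (kap : K).
Local Notation u := (iota kap).
Hypotheses (pp : prime p) (qp : prime q) (xg : isgl x) (xq : x ^+ q = 1).
Hypotheses (ug : isgl u) (up : u ^+ p = 1) (u1 : u != 1).
Hypothesis span : forall b : hdual K, (forall y, b $ (y * kap) = b $ y) ->
  exists c : 'I_q -> k, b = \sum_i c i *: x ^+ i.

(** By [span], the integral translated by the average of u maps to a combination of powers of x. It
    therefore acts on y by its counit, 1/p, and [block_fixed_scalar] applies. *)
Let act_fixed (w : wedd H) (r : 'I_(wN w)) y : wc r = r -> ~~ (p %| wdeg r)%N -> y * we r = y -> act x y = y ->
  exists d, y = d *: we r.
Proof.
move=> rr pr yE xy; have p0 : p%:R != 0 :> k by rewrite (proj1 (pcharf0P _) ch0) -lt0n prime_gt0.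
apply: (block_fixed_scalar ch0 SS (p := p) (u := u) (c := p%:R^-1) pp ug up u1 rr pr yE); first by rewrite invr_eq0.
set T := rt _ L; have uT : rt u T = T by rewrite /T rt_rt (glavg_l pp up).
have [c cE] : exists c : 'I_q -> k, pi T = \sum_i c i *: x ^+ i.
  apply: span => y0; rewrite !piE rmorphM -ev_rt uT //.
have xi i : act (x ^+ i) y = y by elim: i => [|i IH]; rewrite ?expr0 ?act_one // exprS act_M IH.
rewrite -act_pi cE (lin_sum _ _ _ (act_linl y)).
rewrite (eq_bigr (fun i => c i *: y)) => [|i _]; last by rewrite (linZ _ _ (act_linl y)) xi.
rewrite -scaler_suml; congr (_ *: _).
have <- : eps (pi T) = \sum_i c i.
  rewrite cE eps_sum; apply: eq_bigr => i _.
  by rewrite epsZ (proj1 (gl_exp i xg)) mulr1.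
rewrite eps_pi.
rewrite /T eps_rt (@glavg_fun _ _ _ _ pp k^o (fun f : hdual H => f $ L : k^o)) ?ev1 ?haar_eps //.
- by rewrite -[_ *: _]/(_ * _) mulr1.
- by lin.
by move=> i i0; apply: (gl_haar SS); [apply: gl_exp | apply: (gl_exp_neq1 pp)].
Qed.

(** The whole corner of [we r] is scalar by [cyclic_automorphism_scalar]. So the primitive
    idempotent E r r is a multiple of the block idempotent, hence equal to it. *)
Lemma central_block_deg1 (w : wedd H) (r : 'I_(wN w)) : wc r = r -> ~~ (p %| wdeg r)%N -> wdeg r = 1%N.
Proof.
move=> rr pr; have EC a : we r * a = a * we r by apply: we_central.
have aE : act x (we r) = we r.
  rewrite /act /ad (eq_sw _ (G := fun a b => we r * (a * 1 * S b))) => [|a b]; last by rewrite mulr1 mulrA EC.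
  by rewrite -sw_mull -[sw _ _]/(ad (sec x) 1) ad_one eps_sec (proj1 xg) scale1r mulr1.
have [c cE] : exists c, wE r r = c *: we r.
  apply: (@cyclic_automorphism_scalar k H q (act x) (we r) (@lmn k H : H -> k^o)) => //.
  - by move=> a b; apply: act_gl.
  - move=> a; suff e l : iter l (act x) a = act (x ^+ l) a by rewrite e xq act_one.
    by elim: l => [|l IH]; rewrite ?expr0 ?act_one //= IH -act_M exprS.
  - exact: we_idem.
  - by rewrite /act ad_one eps_sec (proj1 xg) scale1r.
  - exact: lin_lmn.
  - by move=> a; rewrite /act lmn_ad // eps_sec (proj1 xg) mul1r.
  - by move=> a; apply: (lmn_nondeg ch0 SS).
  - by move=> y yE xy; apply: (act_fixed rr pr yE xy).
  - by move=> y yE yC; exists (wcf r r y); rewrite -(central_we r yC).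
  by rewrite E_we eqxx scale1r.
have cc : c * c = c.
  have : wE r r * wE r r = wE r r by rewrite wEM // eqxx scale1r.
  rewrite cE -scalerAl -scalerAr we_idem scalerA.
  move/eqP; rewrite -subr_eq0 -scalerBl scaler_eq0 subr_eq0 => /orP[/eqP //|/eqP we0].
  by have := wEn0 r; rewrite cE we0 scaler0 eqxx.
have c1 : c = 1.
  have c0 : c != 0 by apply: contraNneq (wEn0 r) => c0; rewrite cE c0 scale0r.
  by apply: (mulfI c0); rewrite mulr1.
apply: (natr_inj ch0); have := Chi_basis_ev r rr; rewrite rr eqxx cE c1 scale1r ChiE chi_we eqxx.
by [].
Qed.
End CentralBlock.

(** * Divisors of the number of group-like elements *)

Section GroupOrder.
Variable k : fieldType.

(** Asking only for divisibility lets a subgroup of unknown order serve; [glsub_dvd] passes to the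
    full group. *)
Definition glsub (H : hopfType k) m := exists (gT : finGroupType) (phi : gT -> H),
  [/\ injective phi, {morph phi : x y / (x * y)%g >-> x * y}, phi 1%g = 1, forall x, isgl (phi x) & (m %| #|gT|)%N].

Lemma glsub_glspan (H : hopfType k) : glspan H -> glsub H (\dim {:H}).
Proof. by case=> gT [phi [pi pM p1 pg dg]]; exists gT, phi; split=> //; rewrite dg. Qed.

Lemma glsub_image (H K : hopfType k) (f : {lrmorphism K -> H}) m : hopf_morphism f -> injective f -> glsub K m -> glsub H m.
Proof.
move=> fh fi [gT [phi [pi pM p1 pg dg]]]; exists gT, (f \o phi); split=> //=.
- exact: inj_comp.
- by move=> x y /=; rewrite pM rmorphM.
- by rewrite p1 rmorph1.
by move=> x; apply: hopf_gl.
Qed.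

Lemma glsub_dvd (H : hopfType k) m n : card_grouplikes H n -> glsub H m -> (m %| n)%N.
Proof.
move=> cn [gT [phi [pi pM p1 pg dg]]].
have [|||hT [psi [qi qM q1 qg qs]]] := @gl_group _ H (fun=> True) => //.
have qgl x : isgl (psi x) by case: (qg x).
have <- : #|hT| = n by apply: (card_gl_group qi qgl _ cn) => g gg; apply: qs.
have /fin_all_exists[t tE] : forall x : gT, exists y, psi y = phi x by move=> x; apply: qs.
apply: (dvdn_trans dg); apply: (@dvdn_inj_morph _ _ t) => [x y e|x y]; first by apply/pi; rewrite -!tE e.
by apply: qi; rewrite tE pM qM !tE.
Qed.

(** Evaluation at z is a linear character of the group. Its kernel contains u of order p, and f has
    order p in the quotient since f^p is trivial on z. *)
Lemma gl_kernel_dvd (H : hopfType k) p (z : H) (u f : hdual H) : prime p -> isgl z -> z ^+ p = 1 ->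
  isgl u -> u ^+ p = 1 -> u != 1 -> u $ z = 1 -> isgl f -> f $ z != 1 -> glsub (hdual H) (p ^ 2).
Proof.
move=> pp zg zp ug up u1 uz fg fz.
have [|||gT [phi [pi pM p1 pg ps]]] := @gl_group _ (hdual H) (fun=> True) => //.
have phg x : isgl (phi x) by case: (pg x).
exists gT, phi; split=> //; pose c x := phi x $ z.
have cM x y : c (x * y)%g = c x * c y by rewrite /c pM ev_mul gl_sw //; lin.
have c1 : c 1%g = 1 by rewrite /c p1 ev1 (proj1 zg).
have cV x : c x^-1%g * c x = 1 by rewrite -cM mulVg.
have gD : group_set [set x | c x == 1].
  apply/group_setP; split=> [|x y]; first by rewrite inE c1.
  by rewrite !inE cM => /eqP -> /eqP ->; rewrite mulr1.
pose D := Group gD; have inD x : (x \in D) = (c x == 1) by rewrite inE.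
have ND x : x \in 'N(D)%g.
  rewrite inE; apply/subsetP => y /imsetP[v]; rewrite inD => /eqP vD ->.
  by rewrite inD conjgE !cM vD mul1r cV.
have ordp (hT : finGroupType) (h : hT) : (h ^+ p = 1 -> h != 1 -> #[h] = p)%g.
  move=> hp h1; have : (#[h]%g %| p)%N by rewrite order_dvdn hp.
  by case/primeP: pp => _ pr /pr; rewrite order_eq1 (negPf h1) => /eqP.
have [a aE] := ps u ug I; have [t tE] := ps f fg I.
have aD : a \in D by rewrite inD /c aE uz.
have pD : (p %| #|D|)%N.
  rewrite -(ordp _ a) ?order_dvdG //; first by apply: pi; rewrite (gl_expr_morph pM p1) aE up p1.
  by apply: contraNneq u1 => a1; rewrite -aE a1 p1.
have tD : t \notin D by rewrite inD /c tE.
have tpD : (t ^+ p)%g \in D.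
  rewrite inD /c (gl_expr_morph pM p1) tE; suff -> : (f ^+ p) $ z = f $ (z ^+ p) by rewrite zp (gl_ev1 fg).
  elim: (p) => [|m IH]; first by rewrite !expr0 ev1 (proj1 zg) (gl_ev1 fg).
  by rewrite !exprS ev_mul gl_sw ?IH ?gl_ev //; lin.
have pQ : (p %| #|[set: gT] : D|%g)%N.
  rewrite -card_quotient; last by apply/subsetP => x _; apply: ND.
  rewrite -(ordp _ (coset D t)) ?order_dvdG ?mem_quotient ?inE //.
    by rewrite -(morphX (coset D)) ?ND //= coset_id.
  by apply: contra tD => /eqP t1; apply: coset_idr => //; apply: ND.
by rewrite -cardsT -(Lagrange (subsetT D)) expnS expn1 dvdn_mul.
Qed.

Lemma span_powers (H : hopfType k) l (z : H) : prime l -> \dim {:H} = l -> isgl z -> z ^+ l = 1 -> z != 1 ->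
  forall h, exists c : 'I_l -> k, h = \sum_i c i *: z ^+ i.
Proof.
move=> ll dH zg zl z1 h; pose X := [tuple z ^+ i | i < l].
have XE (i : 'I_l) : X`_i = z ^+ i by rewrite -tnth_nth tnth_mktuple.
have XU : uniq X by rewrite map_inj_uniq ?enum_uniq // => i j; apply: (gl_exp_inj ll zg zl z1).
have Xf : free X by apply: gl_free => // g /mapP[i _ ->]; apply: gl_exp.
have Xb : basis_of fullv X by rewrite basisEfree Xf subvf size_tuple dH leqnn.
exists (fun i => coord X i h); rewrite {1}(coord_basis Xb (memvf h)).
by apply: eq_bigr => i _; rewrite XE.
Qed.
End GroupOrder.

Lemma glavg_central (k : fieldType) (H : hopfType k) p (z : H) : (forall a, z * a = a * z) ->
  forall a, glavg p z * a = a * glavg p z.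
Proof.
move=> zC a; rewrite /glavg -scalerAl -scalerAr mulr_suml mulr_sumr; congr (_ *: _).
apply: eq_bigr => i _; elim: (i : nat) => [|j IH]; first by rewrite mul1r mulr1.
by rewrite exprS -[LHS]mulrA IH [LHS]mulrA (zC a) -[LHS]mulrA.
Qed.

Lemma rho_central (k : closedFieldType) (H : hopfType k) (w : wedd H) x : (forall a, x * a = a * x) ->
  rho x = \sum_(r < wN w | wc r == r) wcf r r x * (wdeg r ^ 2)%:R.
Proof.
move=> xC; rewrite /rho (@ltr_mul _ _ w); apply: eq_bigr => r _.
by rewrite -[x]mulr1 chi_central // mulr1 chi1 -mulrA -natrM mulnn.
Qed.

(* A block on which z acts nontrivially: these blocks have total dimension n - n / p. *)
Lemma nontrivial_block (k : closedFieldType) (H : hopfType k) (w : wedd H) p m (z : H) : [pchar k] =i pred0 -> hinv H ->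
    prime p -> \dim {:H} = (p ^ 2 * m)%N -> ~~ (p %| m)%N -> isgl z -> z ^+ p = 1 -> z != 1 -> (forall a, z * a = a * z) ->
  exists r : 'I_(wN w), [/\ wc r = r, ~~ (p %| wdeg r)%N & wcf r r (glavg p z) = 0].
Proof.
move=> ch0 SS pp dH pm zg zp z1 zC; set P := glavg p z.
have p0 : p%:R != 0 :> k by rewrite (proj1 (pcharf0P _) ch0) -lt0n prime_gt0.
have PC := glavg_central p zC.
have t01 r : wcf (w := w) r r P = 0 \/ wcf r r P = 1.
  have /eqP : wcf (w := w) r r P * wcf r r P = wcf r r P.
    by rewrite -wcf_central // (glavg_idem ch0 pp zp).
  rewrite -subr_eq0 -{3}(mulr1 (wcf r r P)) -mulrBr mulf_eq0 subr_eq0.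
  by case/orP=> /eqP; [left | right].
have [r /andP[/andP[/eqP rr pr] /eqP t0]|no] :=
    pickP (fun r : 'I_(wN w) => (wc r == r) && ~~ (p %| wdeg r)%N && (wcf r r P == 0)).
  by exists r.
have eA : (\sum_(r < wN w | wc r == r) wdeg r ^ 2)%N = (p ^ 2 * m)%N.
  apply: (natr_inj ch0); rewrite -dH -rho1 natr_sum (@rho_central k H w 1) => [|a]; last by rewrite mul1r mulr1.
  by apply: eq_bigr => r _; rewrite wcf1 mul1r.
have eB : (\sum_(r < wN w | (wc r == r) && (wcf r r P != 0%R)) wdeg r ^ 2)%N = (p * m)%N.
  apply: (natr_inj ch0); transitivity (rho P).
    rewrite natr_sum (rho_central w PC) [RHS](bigID (fun r : 'I_(wN w) => wcf r r P == 0)) /=.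
    rewrite [X in _ = X + _]big1 ?add0r => [|r /andP[_ /eqP ->]]; last by rewrite mul0r.
    by apply: eq_bigr => r /andP[_]; case: (t01 r) => ->; rewrite ?eqxx ?mul1r.
  rewrite rho_lmn // (lmn_glavg ch0 SS pp zg zp z1) dH expnS expn1 -mulnA [(p * (p * m))%N]mulnC natrM -mulrA mulfV // mulr1.
  by [].
(* Otherwise p divides the degree of every block killed by P; p^2 then divides the total dimension p
   m of the others. *)
have : (p ^ 2 %| p * m)%N.
  have : (p ^ 2 %| p ^ 2 * m)%N by apply: dvdn_mulr.
  rewrite -eA (bigID (fun r : 'I_(wN w) => wcf r r P != 0)) /= eB dvdn_addl // dvdn_sum // => r /andP[/eqP rr].
  rewrite negbK => t0; rewrite dvdn_exp2r //.
  by have := no r; rewrite rr eqxx t0 andbT /= => /negbFE.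
by rewrite expnS expn1 dvdn_pmul2l ?prime_gt0 // (negPf pm).
Qed.

(** * Dimension p^2 q *)

Section TwoPrimesGrouplikes.
Variables (k : closedFieldType) (p q : nat).
Hypotheses (ch0 : [pchar k] =i pred0) (pp : prime p) (qp : prime q) (pq : (p ^ 4 < q)%N).

Let pNq : ~~ (p %| q)%N.
Proof. by rewrite dvdn_prime2 // neq_ltn (p_lt_q pp pq). Qed.

Lemma prime_dvd_pq l : prime l -> (l %| p * q)%N -> l = p \/ l = q.
Proof. by move=> ll; rewrite Euclid_dvdM // !dvdn_prime2 // => /orP[] /eqP; [left | right]. Qed.

Lemma sq_dvd_pq d : (d ^ 2 %| p * q)%N -> d = 1%N.
Proof.
move=> dpq; apply/eqP; rewrite eqn_leq; have d0 : (0 < d)%N.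
  by case: d dpq => //; rewrite exp0n // dvd0n muln_eq0 !eqn0Ngt (prime_gt0 pp) (prime_gt0 qp).
rewrite d0 andbT leqNgt; apply/negP => d1; have ll := pdiv_prime d1.
have l2 : (pdiv d ^ 2 %| p * q)%N by apply: dvdn_trans dpq; rewrite dvdn_exp2r // pdiv_dvd.
have l1 : (pdiv d %| p * q)%N by apply: dvdn_trans l2; rewrite expnS dvdn_mulr.
case: (prime_dvd_pq ll l1) => lE; move: l2; rewrite lE expnS expn1.
  by rewrite dvdn_pmul2l ?prime_gt0 // (negPf pNq).
by rewrite dvdn_pmul2r ?prime_gt0 // dvdn_prime2 // => /eqP qE; have := p_lt_q pp pq; rewrite qE ltnn.
Qed.

Lemma glspan_pq (K : hopfType k) l (z : hdual K) : hinv K -> \dim {:K} = (p * q)%N -> prime l -> isgl z -> z ^+ l = 1 ->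
  z != 1 -> (forall a, z * a = a * z) -> glspan K.
Proof.
move=> SS dK ll zg zl z1 zC; apply: glspan_bidual.
have dK' : \dim {:hdual K} = (p * q)%N by rewrite dim_hdual.
have lpq : (l %| p * q)%N.
  have [K1 [? [_ _ _ dK1 _]]] := central_quotient ch0 (hdual_inv SS) ll zg zl z1 zC.
  by rewrite -dK' -dK1 dvdn_mull.
have [m mp dm] : exists2 m, prime m & \dim {:hdual K} = (l * m)%N.
  by case: (prime_dvd_pq ll lpq) => ->; [exists q | exists p]; rewrite // dK' mulnC.
apply: (glspan_central_ext ch0 (hdual_inv SS) ll dm zg zl z1 zC) => [d|K1 K1S dK1 _].
  exact: sq_dvd_prime.
exact: (glspan_prime ch0 K1S mp dK1).
Qed.

(** With z central of order p, K is the dual of H/(z - 1), of dimension p q. Either K is a group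
    algebra, and then so is the dual of H, or K has a central group-like kap of order p: then iota
    kap is a character of H trivial on z, to be completed by one that is not. *)
Lemma glsub_sq (H : hopfType k) : hinv H -> \dim {:H} = (p ^ 2 * q)%N -> glsub (hdual H) (p ^ 2).
Proof.
move=> SS dH; have [w0 _] := double_wedd ch0 SS.
have dH' : \dim {:H} = (p ^ 2 * q ^ 1)%N by rewrite expn1.
have [[z [zg zp z1 zC]]|[K [iota [c [ih ii c1 dK]]]]] := prime_part_cases ch0 pp qp pq w0 dH' (leqnn 2) isT; last first.
  have KS : hinv K by apply: (hopf_inj_inv ih ii (hdual_inv SS)).
  move: dK; have -> : c = 0%N by case: (c) c1.
  rewrite expn0 muln1 => dK; apply: (glsub_image ih ii); rewrite -dK; apply: glsub_glspan.
  exact: (glspan_prime_sq ch0 KS pp dK).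
have [K [iota [ih ii iE dK _]]] := central_quotient ch0 SS pp zg zp z1 zC.
have KS : hinv K by apply: (hopf_inj_inv ih ii (hdual_inv SS)).
have dK' : \dim {:K} = (p * q)%N.
  by apply/eqP; rewrite -(eqn_pmul2r (prime_gt0 pp)) dK dH expnS expn1 mulnAC.
have gsK : glspan K -> glsub (hdual H) (p ^ 2).
  move=> gK; have := central_ext_glspan ch0 SS pp zg zp zC ih ii iE gK; rewrite dK' => /(_ sq_dvd_pq).
  case/glsub_glspan=> gT [phi [pi pM p1 pg dg]]; exists gT, phi; split=> //.
  by apply: dvdn_trans dg; rewrite dim_hdual dH dvdn_mulr.
have dKd : \dim {:hdual K} = (p * q ^ 1)%N by rewrite dim_hdual expn1.
have [[l [z' [ll zg' zl' z1' zC']]]|[g [gg gp g1 gC]]] := central_or_character ch0 pp qp pq (hdual_inv KS) (ltn0Sn 0) dKd.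
  exact: (gsK (glspan_pq KS dK' ll zg' zl' z1' zC')).
have [N [jota [jh ji jE dN _]]] := central_character ch0 (hdual_inv KS) pp gg gp g1 gC.
have NS : hinv N by apply: (hopf_inj_inv jh ji (hdual_inv KS)).
have dN' : \dim {:N} = q by apply/eqP; rewrite -(eqn_pmul2r (prime_gt0 pp)) dN dim_hdual dK' mulnC.
have [|x0 [xg xq x1 _]] := @central_prime_power k ch0 N NS q 0 qp; first by rewrite expn1.
(* g lives in the bidual of K; kap is the same element in K itself. *)
have [D [_ [DE Di Ds _ _]]] := bidual_iso K; have [kap kapE] := Ds g.
have gE b : g $ b = b $ kap by rewrite -kapE DE.
have kE a : iota kap $ a = g $ (dquot iota a) by rewrite gE dquotE.
have [pM p1] : {morph dquot iota : a b / a * b} * (dquot iota 1 = 1) by have [p1 pM] := dquot_monoid ih.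
have ug : isgl (iota kap) by apply: gl_of_ev => [|a b]; rewrite !kE ?p1 ?pM ?(gl_ev1 gg) // gl_ev.
have up : iota kap ^+ p = 1.
  have kp : kap ^+ p = 1 by apply: Di; transitivity (D kap ^+ p); [exact: rmorphXn | rewrite kapE gp rmorph1].
  by rewrite -rmorphXn kp rmorph1.
have u1 : iota kap != 1.
  by apply: contraNneq g1; rewrite -(rmorph1 iota) => /ii k1; rewrite -kapE k1 rmorph1.
have uz : iota kap $ z = 1.
  have /iE e : exists y, iota y = iota kap by exists kap.
  by rewrite -[z]mulr1 e (gl_ev1 ug).
(* The fixed points of translation by g form N, of prime dimension q, spanned by the powers of
   x0. *)
have span (b : hdual K) : (forall y, b $ (y * kap) = b $ y) -> exists c : 'I_q -> k, b = \sum_i c i *: jota x0 ^+ i.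
  move=> bk; have /jE[n <-] : rt g b = b.
    apply: ev_inj => y; rewrite -[RHS]bk -sw_hdual /rt.
    rewrite (sw_lin (f := fun f : hdual K => f $ y : k^o)); last by apply: lin_evf; apply: lin_id.
    by apply: (@eq_sw _ _ k^o) => a c; rewrite evfZ gE mulrC.
  have [c ->] := span_powers qp dN' xg xq x1 n; exists c.
  by rewrite linear_sum; apply: eq_bigr => i _; rewrite linearZ /= rmorphXn.
have [w _] := wedderburn (inv_semisimple ch0 SS).
have [r [rr pr r0]] := nontrivial_block w ch0 SS pp dH pNq zg zp z1 zC.
have jq : jota x0 ^+ q = 1 by rewrite -rmorphXn xq rmorph1.
have d1 := central_block_deg1 ch0 SS zg zC ih ii iE pp qp (hopf_gl jh xg) jq ug up u1 span rr pr.
have fg : isgl (Chi r) := deg1_gl d1.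
(* Were Chi r trivial on z, it would be 1 at the average of the powers of z, which acts as 0 on
   block r. *)
apply: (gl_kernel_dvd pp zg zp ug up u1 uz fg); apply/negP => /eqP fz.
have fzi i : Chi r $ (z ^+ i) = 1 by elim: i => [|i IH]; rewrite ?(gl_ev1 fg) // exprS gl_ev // fz IH mulr1.
have : Chi r $ (glavg p z) = 1.
  rewrite /glavg evZ ev_sum (eq_bigr (fun=> 1)) => [|i _]; last exact: fzi.
  by rewrite sumr_const card_ord mulVf // (proj1 (pcharf0P _) ch0) -lt0n prime_gt0.
have PC := glavg_central p zC.
by rewrite ChiE -[glavg p z]mulr1 chi_central // r0 mul0r => /esym/eqP; rewrite oner_eq0.
Qed.
End TwoPrimesGrouplikes.

Theorem lemma3p2 (k : closedFieldType) (char0 : [pchar k] =i pred0)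
    (p q : nat) (p_prime : prime p) (q_prime : prime q) (p4_lt_q : (p ^ 4 < q)%N)
    (H : hopfType k) (H_semisimple : semisimple H)
    (dimH : \dim {:H} = (p ^ 2 * q ^ 2)%N) :
  card_grouplikes (hdual H) p \/ card_grouplikes (hdual H) (p * q)%N ->
  upper_semisolvable H.
Proof.
move=> cG; have SS : hinv H := antipode_involutive char0 H_semisimple.
have noP2 : ~ glsub (hdual H) (p ^ 2).
  move=> gs; have : (p ^ 2 %| p * q)%N.
    by case: cG => /glsub_dvd/(_ gs) // d; apply: dvdn_trans d _; apply: dvdn_mulr.
  rewrite expnS expn1 dvdn_pmul2l ?prime_gt0 // dvdn_prime2 // => /eqP pq.
  by have := p_lt_q p_prime p4_lt_q; rewrite pq ltnn.
have [w _] := double_wedd char0 SS.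
have [[z [zg zp z1 zC]]|[K [iota [c [ih ii c2 dK]]]]] :=
    prime_part_cases char0 p_prime q_prime p4_lt_q w dimH (leqnn 2) isT.
  have [K [iota [ih ii _ dK us]]] := central_quotient char0 SS p_prime zg zp z1 zC.
  have KS : hinv K by apply: (hopf_inj_inv ih ii (hdual_inv SS)).
  apply/us/(us_p_qb char0 p_prime q_prime p4_lt_q (b := 2)) => //; first exact: hdual_inv.
  apply/eqP; rewrite dim_hdual -(eqn_pmul2r (prime_gt0 p_prime)) dK dimH expnS expn1.
  by rewrite mulnAC.
have KS : hinv K by apply: (hopf_inj_inv ih ii (hdual_inv SS)).
(* The bound c < 2 leaves K of dimension p^2 or p^2 q. *)
case: noP2; apply: (glsub_image ih ii); case: c c2 dK => [|[|c]] // _ dK.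
  rewrite expn0 muln1 in dK; rewrite -dK; apply: glsub_glspan.
  exact: (glspan_prime_sq char0 KS p_prime dK).
(* [glsub_sq] speaks of the dual of its argument; applied to the dual of K, its answer is carried
   back from the bidual. *)
rewrite expn1 in dK; have [_ [G [_ _ _ Gh Gi]]] := bidual_iso K.
apply: (glsub_image Gh Gi); apply: (glsub_sq char0 p_prime q_prime p4_lt_q (hdual_inv KS)).
by rewrite dim_hdual.
Qed.
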